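(* Let $L\to M$ be a line bundle over a manifold $M$ with $n=\dim M$ odd, set $k=(n+1)/2$, and let $\widetilde L=L^*\setminus\{0\}$. The assignment $S\mapsto\omega$ described in the context defines a one-to-one correspondence between $\alpha$-homogeneous $\mathrm{Sp}_k$-structures $S$ on $\widetilde L$, with $\alpha=1$ (the trivial homomorphism $\mathbb R^\times\to N(\mathrm{Sp}_k)/\mathrm{Sp}_k$), and non-degenerate $2$-forms $\omega:\wedge^2DL\to\mathbb R_M$ on the Atiyah algebroid $DL$ with values in the trivial line bundle $\mathbb R_M=M\times\mathbb R$. Furthermore, for such an $S$ with corresponding $\omega$, the following conditions are equivalent: (1) $S$ is homogeneous integrable; (2) $S$ is integrable; (3) $\omega$ is a cocycle in the de Rham complex of the Lie algebroid $DL$ (with trivial coefficients).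
   Context: Everything is smooth. **Setting.** $L\to M$ is a real line bundle, $n=\dim M$, $\widetilde L:=L^*\setminus\{0\}$ is the complement of the zero section in $L^*$, $p:\widetilde L\to M$ is the projection, and $\mathbb R^\times=\mathbb R\setminus\{0\}$ acts on $\widetilde L$ by $h_r(\epsilon)=r\epsilon$. For $U\subset M$ open, $\widetilde L_U:=p^{-1}(U)$ is called a saturated open subset. $\mathrm{Fr}(\widetilde L)$ is the bundle of linear isomorphisms $\psi:\mathbb R^{n+1}\to T_\epsilon\widetilde L$, with right $\mathrm{GL}_{n+1}(\mathbb R)$-action by composition. A $G$-structure on $\widetilde L$, for a Lie subgroup $G\subset\mathrm{GL}_{n+1}(\mathbb R)$, is a reduction $S\subset\mathrm{Fr}(\widetilde L)$ of the frame bundle to $G$. **Homogeneous frames.** For a frame $\sigma$ (a section of the frame bundle) of $\widetilde L$ or of a saturated open subset, let $A_\sigma(r,\epsilon)\in\mathrm{GL}_{n+1}(\mathbb R)$ be determined by $\sigma(r\epsilon)=(h_r)_*\circ\sigma(\epsilon)\circ A_\sigma(r,\epsilon)^{-1}$. The frame $\sigma$ is homogeneous if $A_\sigma(r,\epsilon)=A_\sigma(r)$ is independent of $\epsilon$; then $A_\sigma:\mathbb R^\times\to\mathrm{GL}_{n+1}(\mathbb R)$ is a Lie group homomorphism. A semi-local homogeneous frame (section) around $\epsilon$ is a homogeneous frame (section) defined on a saturated open neighborhood of $\epsilon$. **Homogeneous $G$-structures.** A $G$-structure $S$ on $\widetilde L$ is homogeneous if for any $\epsilon\in\widetilde L$ there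 is a semi-local homogeneous section $\sigma$ of $S$ around $\epsilon$, with domain $\widetilde L_U$, such that for all $r\in\mathbb R^\times$ the map $\psi\mapsto(h_r)_*\circ\psi\circ A_\sigma(r)^{-1}$ preserves $S|_{\widetilde L_U}$. Then $A_\sigma$ takes values in the normalizer $N(G)$ of $G$ in $\mathrm{GL}_{n+1}(\mathbb R)$, and $r\mapsto A_\sigma(r)G\in N(G)/G$ does not depend on the choice of such sections over a connected component of $M$. If it is the same map $\alpha:\mathbb R^\times\to N(G)/G$ for all connected components, $\alpha$ is called the degree of $S$ and $S$ is called $\alpha$-homogeneous. **Integrability.** $S$ is integrable if around every point there is a coordinate chart $(V,\chi)$ whose coordinate frame $\sigma_\chi=(\partial/\partial\chi^1,\dots,\partial/\partial\chi^{n+1})$ takes values in $S$. A chart $(V,\chi)$ of $\widetilde L$ is homogeneous if, locally around every point of $V$, $\sigma_\chi$ is the restriction of a semi-local homogeneous frame of $\widetilde L$. A homogeneous $G$-structure $S$ is homogeneous integrable if around every point of $\widetilde L$ there is a homogeneous coordinate chart such that $\sigma_\chi$ takes values in $S$. **The group.** $J=\begin{pmatrix}0&\mathbb I_k\\-\mathbb I_k&0\end{pmatrix}$ and $\mathrm{Sp}_k=\{A\in\mathrm{GL}_{2k}(\mathbb R): A^tJA=J\}$. **Atiyah algebroid.** $DL\to M$ is the Lie algebroid whose sections are the derivations of $\Gamma(L)$, i.e. linear maps $\Delta:\Gamma(L)\to\Gamma(L)$ with $\Delta(f\lambda)=f\Delta(\lambda)+X_\Delta(f)\lambda$ for a (unique)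 vector field $X_\Delta$ on $M$, the symbol of $\Delta$. The bracket is the commutator and the anchor is $\Delta\mapsto X_\Delta$. To $\lambda\in\Gamma(L)$ corresponds the function $\widetilde\lambda(\epsilon)=\epsilon(\lambda(p(\epsilon)))$ on $\widetilde L$, and to $\Delta\in\Gamma(DL)$ the vector field $\widetilde\Delta$ on $\widetilde L$ with $\widetilde\Delta(\widetilde\lambda)=\widetilde{\Delta(\lambda)}$; the latter are exactly the vector fields $X$ with $(h_r)_*X=X$ for all $r$. The de Rham complex of $DL$ with trivial coefficients is $\Gamma(\Lambda^\bullet(DL)^* )$ with the Lie algebroid differential, $\Gamma(DL)$ acting on $C^\infty(M)$ by $f\mapsto X_\Delta(f)$. **The assignment $S\mapsto\omega$.** Let $S$ be an $\alpha$-homogeneous $\mathrm{Sp}_k$-structure with $\alpha=1$. Around any point of $\widetilde L$ there is a homogeneous section $\sigma=(X_1,\dots,X_k,Y^1,\dots,Y^k)$ of $S$ on a saturated open set $\widetilde L_U$ with $A_\sigma=1$, i.e. all $X_i,Y^i$ are $\mathbb R^\times$-invariant. With $\xi^1,\dots,\xi^k,\eta_1,\dots,\eta_k$ the dual coframe, $\widetilde\omega|_{\widetilde L_U}=\sum_i\xi^i\wedge\eta_i$ defines a global non-degenerate $2$-form $\widetilde\omega$ on $\widetilde L$ with $h_r^*\widetilde\omega=\widetilde\omega$ for all $r\in\mathbb R^\times$. Then $\omega$ is defined by $\widetilde\omega(\widetilde\Delta,\widetilde\Delta')=p^*(\omega(\Delta,\Delta'))$ for all $\Delta,\Delta'\in\Gamma(DL)$.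 *)

(* Defs.v *)
From HB Require Import structures.
From mathcomp Require Import all_boot all_order all_algebra.
From mathcomp Require Import all_classical all_reals all_analysis.

Set Implicit Arguments.
Unset Strict Implicit.
Unset Printing Implicit Defensive.

Import Order.TTheory GRing.Theory Num.Theory.
Import numFieldNormedType.Exports.
Local Open Scope classical_set_scope.
Local Open Scope ring_scope.

(* Conventions.  Points of R^m are column vectors.  An object that lives on a
   subset (a local frame, a chart, ...) is a total function whose values outside
   that subset are never used.  Tangent vectors, and elements of the fibres of
   DL, are functions on all maps X -> R, resp. on all set-theoretic sections of
   L, normalised to vanish on the non-smooth ones, so that two of them are equal
   as soon as they agree on smooth arguments. *)

(** * Smooth functions on open subsets of R^m *)

Section Euclidean.
Variables (R : realType) (m : nat).

Fixpoint Ck (k : nat) (U : set 'cV[R]_m) (f : 'cV[R]_m -> R) : Prop :=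
  (forall x, U x -> {for x, continuous f}) /\
  if k is k'.+1 then
    forall i : 'I_m, (forall x, U x -> derivable f x (delta_mx i 0)) /\
                     Ck k' U (fun x => 'D_(delta_mx i 0) f x)
  else True.

Definition Cinf (U : set 'cV[R]_m) (f : 'cV[R]_m -> R) : Prop :=
  forall k, Ck k U f.

End Euclidean.

(** * Charts and manifolds *)

Section Charts.
Variables (R : realType) (m : nat) (X : topologicalType).

Record chart := Chart { dom : set X ; coord :> X -> 'cV[R]_m }.

Implicit Types (c : chart) (A : set chart) (f g : X -> R).

(* f \o c^-1 on the image of c, and 0 elsewhere *)
Definition in_coords c f (y : 'cV[R]_m) : R :=
  xget 0 (f @` (dom c `&` c @^-1` [set y])).

(* homeomorphism from an open set onto an open subset of R^m *)
Definition chart_ok c : Prop :=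
  [/\ open (dom c), set_inj (dom c) c,
      forall x, dom c x -> {for x, continuous c} &
      forall U, open U -> U `<=` dom c -> open (c @` U)].

Definition smooth_transition c c' : Prop :=
  forall i : 'I_m,
    Cinf (c @` (dom c `&` dom c')) (in_coords c (fun x => c' x i 0)).

Definition is_atlas A : Prop :=
  [/\ forall c, A c -> chart_ok c,
      forall x, exists2 c, A c & dom c x &
      forall c c', A c -> A c' -> smooth_transition c c'].

(* c belongs to the maximal atlas generated by A *)
Definition is_chart A c : Prop :=
  chart_ok c /\
  forall c', A c' -> smooth_transition c c' /\ smooth_transition c' c.

Definition smooth_on A (U : set X) f : Prop :=
  forall c, A c -> Cinf (c @` (dom c `&` U)) (in_coords c f).

Definition smooth A f : Prop := smooth_on A setT f.

(* tangent vectors as derivations at a point of the algebra of smooth functions *)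
Definition tangent A (x : X) (v : (X -> R) -> R) : Prop :=
  [/\ forall (a : R) f g, smooth A f -> smooth A g ->
        v (fun y => a * f y + g y) = a * v f + v g,
      forall f g, smooth A f -> smooth A g ->
        v (fun y => f y * g y) = f x * v g + g x * v f &
      forall f, ~ smooth A f -> v f = 0].

Definition vector_field A (Z : X -> (X -> R) -> R) : Prop :=
  (forall x, tangent A x (Z x)) /\
  (forall f, smooth A f -> smooth A (fun x => Z x f)).

(** * Frames and G-structures *)

Definition preframe := 'cV[R]_m -> (X -> R) -> R.

Definition frame_comp (psi : preframe) (B : 'M[R]_m) : preframe :=
  fun w => psi (B *m w).

(* psi is a linear isomorphism from R^m to the tangent space at x *)
Definition is_frame A (x : X) (psi : preframe) : Prop :=
  [/\ forall (a : R) w w' f,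
        psi (a *: w + w') f = a * psi w f + psi w' f,
      forall w, tangent A x (psi w),
      injective psi &
      forall v, tangent A x v -> exists w, psi w = v].

Definition local_frame A (V : set X) (sigma : X -> preframe) : Prop :=
  [/\ open V,
      forall x, V x -> is_frame A x (sigma x) &
      forall w f, smooth A f -> smooth_on A V (fun x => sigma x w f)].

Definition coord_frame A c (x : X) : preframe :=
  fun w f => if `[< smooth A f >] then 'D_w (in_coords c f) (c x) else 0.

Definition dual_coframe (psi : preframe) (theta : ((X -> R) -> R) -> 'cV[R]_m) :
  Prop := forall w, theta (psi w) = w.

(* reduction of the frame bundle to G: a subset of the frame bundle whose fibres
   are G-orbits and which has smooth local sections *)
Definition G_structure A (G : set 'M[R]_m) (S : X -> set preframe) : Prop :=
  [/\ forall x psi, S x psi -> is_frame A x psi,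
      forall x psi, S x psi -> forall psi',
        S x psi' <-> exists2 B, G B & psi' = frame_comp psi B &
      forall x, exists V sigma,
        [/\ V x, local_frame A V sigma & forall y, V y -> S y (sigma y)]].

Definition G_integrable A (S : X -> set preframe) : Prop :=
  forall x, exists c,
    [/\ is_chart A c, dom c x & forall y, dom c y -> S y (coord_frame A c y)].

End Charts.

Record manifold (R : realType) (n : nat) := Manifold {
  pts :> topologicalType ;
  atlas : set (chart R n pts) ;
  atlasP : is_atlas atlas ;
  manifold_hausdorff : hausdorff_space pts ;
  manifold_second_countable : @second_countable pts
}.

Arguments atlas {R n} m.

(** * Line bundles and the slit dual *)

Record local_triv (R : realType) (X : topologicalType) (F : X -> lmodType R) :=
  LocalTriv { tdom : set X ; tmap : forall x, F x -> R }.

Record line_bundle (R : realType) (n : nat) (M : manifold R n) := LineBundle {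
  fib : M -> lmodType R ;
  trivs : set (local_triv fib) ;
  trivs_open : forall t, trivs t -> open (tdom t) ;
  trivs_cover : forall x, exists2 t, trivs t & tdom t x ;
  trivs_linear : forall t x, trivs t -> tdom t x ->
    forall (a : R) (u v : fib x),
      tmap t (a *: u + v) = a * tmap t u + tmap t v ;
  trivs_bij : forall t x, trivs t -> tdom t x -> bijective (@tmap _ _ _ t x) ;
  trivs_smooth : forall t t', trivs t -> trivs t' -> exists2 g : M -> R,
    smooth_on (atlas M) (tdom t `&` tdom t') g &
    forall x, tdom t x -> tdom t' x ->
      forall v : fib x, tmap t' v = g x * tmap t v
}.

Arguments trivs {R n M} l.

Section SlitDual.
Variables (R : realType) (n : nat) (M : manifold R n) (L : line_bundle M).

Record slit_dual := SlitDual {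
  proj : M ;
  cov : fib L proj -> R ;
  cov_linear : forall (a : R) (u v : fib L proj),
    cov (a *: u + v) = a * cov u + cov v ;
  cov_neq0 : exists v, cov v != 0
}.

HB.instance Definition _ := gen_eqMixin slit_dual.
HB.instance Definition _ := gen_choiceMixin slit_dual.

Definition slit_dual_dom (c : chart R n M) (t : local_triv (fib L)) :
  set slit_dual := proj @^-1` (dom c `&` tdom t).

(* in a local frame u of L, with tmap t u = 1, the coordinates of e are
   e(u) followed by the coordinates of its base point *)
Definition slit_dual_coord (c : chart R n M) (t : local_triv (fib L))
  (e : slit_dual) : 'cV[R]_n.+1 :=
  col_mx (const_mx (cov (xget 0 [set u : fib L (proj e) | tmap t u = 1])) : 'cV_1)
         (c (proj e)).

Definition slit_dual_subbase : set (set slit_dual) :=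
  [set B | exists c t, exists2 O,
     [/\ atlas M c, trivs L t & open O] &
     B = slit_dual_dom c t `&` slit_dual_coord c t @^-1` O].

HB.instance Definition _ :=
  isSubBaseTopological.Build slit_dual slit_dual_subbase id.

Definition slit_dual_atlas : set (chart R n.+1 slit_dual) :=
  [set C | exists c t, [/\ atlas M c, trivs L t &
     C = Chart (slit_dual_dom c t) (slit_dual_coord c t)]].

Lemma scale_linear (r : R) (e : slit_dual) (a : R) (u v : fib L (proj e)) :
  r * cov (a *: u + v) = a * (r * cov u) + r * cov v.
Proof. by rewrite cov_linear mulrDr mulrCA. Qed.

Lemma scale_neq0 (r : R) (e : slit_dual) :
  r != 0 -> exists v : fib L (proj e), r * cov v != 0.
Proof.
by move=> r0; have [v v0] := cov_neq0 e; exists v; rewrite mulf_neq0.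
Qed.

(* the action h_r of r != 0 *)
Definition scale (r : R) (r0 : r != 0) (e : slit_dual) : slit_dual :=
  SlitDual (@scale_linear r e) (scale_neq0 e r0).

Local Notation frame := (preframe R n.+1 slit_dual).

Definition push (r : R) (r0 : r != 0) (psi : frame) : frame :=
  fun w f => psi w (f \o scale r0).

(** * Homogeneous frames and homogeneous G-structures *)

(* sigma is a homogeneous frame on the saturated open set over U and a is
   A_sigma (the value of a at 0 is irrelevant) *)
Definition homogeneous_frame (U : set M) (sigma : slit_dual -> frame)
  (a : R -> 'M[R]_n.+1) : Prop :=
  [/\ open U, local_frame slit_dual_atlas (proj @^-1` U) sigma,
      forall r, r != 0 -> a r \in unitmx &
      forall r (r0 : r != 0) e, U (proj e) ->
        sigma (scale r0 e) = frame_comp (push r0 (sigma e)) (invmx (a r))].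

Implicit Type S : slit_dual -> set frame.

Definition homogeneous_section S (U : set M) (sigma : slit_dual -> frame)
  (a : R -> 'M[R]_n.+1) : Prop :=
  homogeneous_frame U sigma a /\ forall e, U (proj e) -> S e (sigma e).

Definition adapted_section S (U : set M) (sigma : slit_dual -> frame)
  (a : R -> 'M[R]_n.+1) : Prop :=
  homogeneous_section S U sigma a /\
  forall r (r0 : r != 0) e psi, U (proj e) -> S e psi ->
    S (scale r0 e) (frame_comp (push r0 psi) (invmx (a r))).

Definition homogeneous S : Prop :=
  forall e, exists U sigma a, U (proj e) /\ adapted_section S U sigma a.

(* alpha r is the coset A_sigma(r) G, for every choice of sigma *)
Definition has_degree (G : set 'M[R]_n.+1) S (alpha : R -> set 'M[R]_n.+1) :
  Prop :=
  forall U sigma a, U !=set0 -> adapted_section S U sigma a ->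
    forall r, r != 0 -> [set a r *m B | B in G] = alpha r.

Definition homogeneous_G_structure (G : set 'M[R]_n.+1)
  (alpha : R -> set 'M[R]_n.+1) S : Prop :=
  [/\ G_structure slit_dual_atlas G S, homogeneous S & has_degree G S alpha].

(* the trivial homomorphism to N(G)/G *)
Definition trivial_degree (G : set 'M[R]_n.+1) : R -> set 'M[R]_n.+1 :=
  fun=> G.

Definition homogeneous_chart (c : chart R n.+1 slit_dual) : Prop :=
  is_chart slit_dual_atlas c /\
  forall e, dom c e -> exists V U sigma a,
    [/\ open V, V e, homogeneous_frame U sigma a &
        forall e', V e' -> dom c e' ->
          U (proj e') /\ coord_frame slit_dual_atlas c e' = sigma e'].

Definition homogeneous_integrable S : Prop :=
  forall e, exists c, [/\ homogeneous_chart c, dom c e &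
    forall e', dom c e' -> S e' (coord_frame slit_dual_atlas c e')].

(** * The Atiyah algebroid *)

Definition presection := forall x : M, fib L x.

Definition smooth_section (lam : presection) : Prop :=
  forall t, trivs L t -> smooth_on (atlas M) (tdom t) (fun x => tmap t (lam x)).

(* Delta is a section of DL, i.e. a derivation of the smooth sections of L,
   with symbol X *)
Definition derivation (Delta : presection -> presection)
  (X : M -> (M -> R) -> R) : Prop :=
  [/\ forall lam, smooth_section lam -> smooth_section (Delta lam),
      forall (a : R) lam mu, smooth_section lam -> smooth_section mu ->
        Delta (fun x => a *: lam x + mu x) =
        (fun x => a *: Delta lam x + Delta mu x),
      vector_field (atlas M) X,
      forall f lam, smooth (atlas M) f -> smooth_section lam ->
        Delta (fun x => f x *: lam x) =
        (fun x => f x *: Delta lam x + X x f *: lam x) &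
      forall lam, ~ smooth_section lam -> Delta lam = (fun x => 0)].

Definition at_point (Delta : presection -> presection) (x : M) :
  presection -> fib L x := fun lam => Delta lam x.

(* the fibre of DL at x *)
Definition DL_fibre (x : M) : set (presection -> fib L x) :=
  [set delta | exists Delta X, derivation Delta X /\ delta = at_point Delta x].

Definition bracket (Delta Delta' : presection -> presection) :
  presection -> presection :=
  fun lam x => Delta (Delta' lam) x - Delta' (Delta lam) x.

Definition DL_preform :=
  forall x : M, (presection -> fib L x) -> (presection -> fib L x) -> R.

Implicit Type omega : DL_preform.

(* smooth 2-form on DL with values in the trivial line bundle; the last clause
   fixes the values outside the fibres of DL, so that forms are equal as soon as
   they agree on these fibres *)
Definition DL_form omega : Prop :=
  [/\ forall x (a : R) d1 d2 d,
        DL_fibre d1 -> DL_fibre d2 -> DL_fibre d ->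
        omega x (fun lam => a *: d1 lam + d2 lam) d =
        a * omega x d1 d + omega x d2 d,
      forall x d d', DL_fibre d -> DL_fibre d' -> omega x d d' = - omega x d' d,
      forall Delta X Delta' X', derivation Delta X -> derivation Delta' X' ->
        smooth (atlas M) (fun x =>
          omega x (at_point Delta x) (at_point Delta' x)) &
      forall x d d', ~ (DL_fibre d /\ DL_fibre d') -> omega x d d' = 0].

Definition DL_nondegenerate omega : Prop :=
  forall x d, DL_fibre d -> (forall d', DL_fibre d' -> omega x d d' = 0) ->
    d = (fun lam => 0).

Definition pairing omega (Delta Delta' : presection -> presection) : M -> R :=
  fun x => omega x (at_point Delta x) (at_point Delta' x).

(* the Lie algebroid differential (d omega)(D1, D2, D3), where Xi is the symbol
   of Di *)
Definition DL_differential omega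
  (D1 : presection -> presection) (X1 : M -> (M -> R) -> R)
  (D2 : presection -> presection) (X2 : M -> (M -> R) -> R)
  (D3 : presection -> presection) (X3 : M -> (M -> R) -> R) : M -> R :=
  fun x => X1 x (pairing omega D2 D3) - X2 x (pairing omega D1 D3)
           + X3 x (pairing omega D1 D2)
           - pairing omega (bracket D1 D2) D3 x
           + pairing omega (bracket D1 D3) D2 x
           - pairing omega (bracket D2 D3) D1 x.

Definition cocycle omega : Prop :=
  forall D1 X1 D2 X2 D3 X3,
    derivation D1 X1 -> derivation D2 X2 -> derivation D3 X3 ->
    forall x, DL_differential omega D1 X1 D2 X2 D3 X3 x = 0.

(** * The correspondence *)

Definition fun_of_section (lam : presection) : slit_dual -> R :=
  fun e => cov (lam (proj e)).

(* Z is the vector field on the slit dual determined by Delta *)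
Definition lifts (Delta : presection -> presection)
  (Z : slit_dual -> (slit_dual -> R) -> R) : Prop :=
  vector_field slit_dual_atlas Z /\
  forall lam, smooth_section lam -> forall e,
    Z e (fun_of_section lam) = fun_of_section (Delta lam) e.

(* W is, on tangent vectors, sum_i xi^i /\ eta_i, for every homogeneous section
   (X_1, .., X_k, Y^1, .., Y^k) of S with A_sigma = 1, with dual coframe
   (xi^1, .., xi^k, eta_1, .., eta_k), where k = (n + 1) / 2; the convention is
   (xi /\ eta)(v, v') = xi(v) eta(v') - eta(v) xi(v') *)
Definition assoc_form S
  (W : slit_dual -> ((slit_dual -> R) -> R) -> ((slit_dual -> R) -> R) -> R) :
  Prop :=
  forall U sigma, homogeneous_section S U sigma (fun=> 1%:M) ->
  forall e, U (proj e) -> forall theta, dual_coframe (sigma e) theta ->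
  forall v v', tangent slit_dual_atlas e v -> tangent slit_dual_atlas e v' ->
    W e v v' =
    \sum_(i < (n.+1)./2)
      (theta v (inord i) 0 * theta v' (inord ((n.+1)./2 + i)) 0
       - theta v (inord ((n.+1)./2 + i)) 0 * theta v' (inord i) 0).

Definition corresponds S omega : Prop :=
  exists2 W, assoc_form S W &
  forall Delta X Delta' X' Z Z',
    derivation Delta X -> derivation Delta' X' ->
    lifts Delta Z -> lifts Delta' Z' ->
    forall e, W e (Z e) (Z' e) = pairing omega Delta Delta' (proj e).

End SlitDual.

(** * The symplectic group *)

Definition symplectic_J (R : realType) (k m : nat) : 'M[R]_m :=
  \matrix_(i, j) (if j == (k + i)%N :> nat then 1
                  else if i == (k + j)%N :> nat then -1 else 0).

(* Sp_k inside GL_m, meaningful for m = 2k *)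
Definition Sp (R : realType) (k m : nat) : set 'M[R]_m :=
  [set B | B \in unitmx /\ B^T *m symplectic_J R k m *m B = symplectic_J R k m].

Arguments Sp R k m : clear implicits.
Arguments slit_dual_atlas {R n M} L m.
Arguments corresponds {R n M L} S omega.
Arguments DL_nondegenerate {R n M L} omega.
Arguments DL_form {R n M L} omega.
Arguments cocycle {R n M L} omega.
Arguments homogeneous_integrable {R n M L} S.

(* Main.v *)
(* A section of L is a function of degree 1 on the slit dual, and an element of
   the fibre of DL at x is a tangent vector at any point over x.  In a
   trivialisation, with coordinates (s, x) on the slit dual, the invariant frames
   are (s d/ds, d/dx_1, .., d/dx_n) P(x).  An adapted section of S, taken on the
   slice s = 1 and moved by the action, becomes an invariant section; hence S
   consists of the frames in which a non-degenerate form omega on DL has Gram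
   matrix J.  Conversely, Gram-Schmidt with parameters turns omega into invariant
   sections of such an S.

   In a chart with coordinate frame in S the form has constant coefficients, and
   the Leibniz rule gives d omega = 0.  If d omega = 0, the Gram matrix of omega
   in (s d/ds, d/dx_1, .., d/dx_n) is a closed 2-form in the coordinates (ln s, x)
   whose coefficients do not depend on ln s.  The homotopy operator in the
   direction of x yields a primitive with the same property, so Moser's isotopy
   commutes with the translations of ln s, and the resulting Darboux chart is
   homogeneous. *)

From HB Require Import structures.
From mathcomp Require Import all_boot all_order all_algebra.
From mathcomp Require Import all_classical all_reals all_analysis.
From mathcomp Require Import perm ring lra zify.
Require Import Defs.

Set Implicit Arguments.
Unset Strict Implicit.
Unset Printing Implicit Defensive.

Import Order.TTheory GRing.Theory Num.Theory.
Import numFieldNormedType.Exports.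
Local Open Scope classical_set_scope.
Local Open Scope ring_scope.

(** * Calculus in R^m *)

(** Triviality of the degree makes the slice argument work: the coset of A_sigma(r) is Sp_k itself,
    so A_sigma(r) is absorbed in the orbit and push-forward by h_r preserves S. Conversely, a frame
    whose matrix in (s d/ds, d/dx_1, .., d/dx_n) depends on the base point alone is homogeneous with
    A = 1; this is why the constructions are arranged so that only x enters.

    The main obstacle is analytic: Moser's argument needs a globally defined flow that is smooth in
    all variables and has a smooth inverse. The generator is therefore cut off to a bounded field
    and made autonomous by adding time as a coordinate. Picard iterates are treated as smooth
    functions of (t, x); their x-derivatives are again Picard iterates, of the tangent lift (x, v)
    -> (X x, dX v), and repeating the lift gives smoothness of every order.

    Tangent vectors are derivations of globally smooth functions, so local data have to be extended
    by bump functions; on the slit dual these are pulled back from M, which keeps invariance. *)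

Notation e_ i := (delta_mx i 0).

Section DirectionalDerivatives.
Variables (R : realType) (V : normedModType R).
Implicit Types (f g : V -> R) (x v : V).

Lemma is_derive_line f x v (s : R) :
  derivable f (x + s *: v) v ->
  is_derive s 1 (fun s => f (x + s *: v)) ('D_v f (x + s *: v)).
Proof.
have E : (fun h : R => h^-1 *: (f (x + (h%:A + s) *: v) - f (x + s *: v))) =
    (fun h => h^-1 *: (f (h *: v + (x + s *: v)) - f (x + s *: v))).
  by apply/funext => h; rewrite [h%:A]mulr1 scalerDl addrCA.
move=> df; apply: DeriveDef.
  by rewrite /derivable /= E.
by rewrite /derive /= E.
Qed.

Lemma derivable_line_continuous f x v :
  derivable f x v -> (fun t : R => f (t *: v + x)) t @[t --> 0] --> f x.
Proof.
move=> /derivable1P/derivable1_diffP/differentiable_continuous H.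
have {H} : (fun t : R => f (t *: v + x)) t @[t --> 0] --> f (0 *: v + x) by exact: H.
by rewrite scale0r add0r.
Qed.

(** Bounding [s] by absolute values covers both signs of [t] at once; the statement does not place
    [s] between 0 and [t]. *)
Lemma line_MVT f x v (t : R) :
  (forall s : R, `|s| <= `|t| -> derivable f (x + s *: v) v) ->
  exists2 s : R, `|s| <= `|t| & f (x + t *: v) - f x = t * 'D_v f (x + s *: v).
Proof.
move=> df.
have D (s : R) : `|s| <= `|t| ->
    is_derive s 1 (fun s => f (x + s *: v)) ('D_v f (x + s *: v)).
  by move=> /df; exact: is_derive_line.
have C (a b : R) : (forall s, s \in `[a, b] -> `|s| <= `|t|) ->
    {within `[a, b], continuous (fun s => f (x + s *: v))}.
  by move=> H; apply: derivable_within_continuous => s /H/D [].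
have fx0 : f x = f (x + 0 *: v) by rewrite scale0r addr0.
have [t0|t0|->] := ltgtP t 0; last first.
- by exists 0 => //; rewrite scale0r addr0 subrr mul0r.
- have H s : s \in `[0, t] -> `|s| <= `|t|.
    by rewrite in_itv /= => /andP[s0 st]; rewrite !ger0_norm // ltW.
  have [s s01 E] := MVT t0 (fun s si => D s (H s (subset_itv_oo_cc si))) (C _ _ H).
  exists s; first exact/H/subset_itv_oo_cc.
  by rewrite fx0 E subr0 mulrC.
- have H s : s \in `[t, 0] -> `|s| <= `|t|.
    rewrite in_itv /= => /andP[st s0].
    by rewrite !ler0_norm ?lerN2 // ltW.
  have [s s01 E] := MVT t0 (fun s si => D s (H s (subset_itv_oo_cc si))) (C _ _ H).
  exists s; first exact/H/subset_itv_oo_cc.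
  by rewrite fx0 -opprB E sub0r mulrN opprK mulrC.
Qed.

End DirectionalDerivatives.

(** * Column vectors with the sup norm *)

Section MatrixNorm.
Variables (R : realType) (m : nat).
Implicit Types x y : 'cV[R]_m.

Lemma cV_norm_le x (e : R) : 0 <= e -> (forall i, `|x i 0| <= e) -> `|x| <= e.
Proof.
move=> e0 H; rewrite /Num.Def.normr /= mx_normrE (bigmax_le _ e0) //= => -[i j] _ /=.
by rewrite ord1.
Qed.

Lemma cV_norm_ge x i : `|x i 0| <= `|x|.
Proof.
rewrite [leRHS]/Num.Def.normr /= mx_normrE.
exact: (@le_bigmax _ _ _ _ (fun ij : 'I_m * 'I_1 => `|x ij.1 ij.2|) (i, 0)).
Qed.

Lemma cV_cvg (T : Type) (F : set_system T) (FF : Filter F) (g : T -> 'cV[R]_m) (l : 'cV[R]_m) :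
  (forall i, (fun t => g t i 0) @ F --> l i 0) -> g @ F --> l.
Proof.
move=> H; apply/cvgrPdist_le => e e0; near=> t.
apply: (cV_norm_le (ltW e0)) => i; rewrite !mxE.
move: i; near: t; apply: filter_forall => i.
by move/cvgrPdist_le: (H i); exact.
Unshelve. all: by end_near. Qed.

Lemma cV_continuous (T : topologicalType) (g : T -> 'cV[R]_m) (t : T) :
  (forall i, {for t, continuous (fun t => g t i 0)}) -> {for t, continuous g}.
Proof. by move=> H; exact: (@cV_cvg _ (nbhs t) _ g (g t) H). Qed.

Lemma cV_nbhsP (x : 'cV[R]_m) (P : set 'cV[R]_m) :
  nbhs x P <-> exists2 d : R, 0 < d & forall y, `|y - x| < d -> P y.
Proof.
rewrite -nbhs_ballE; split=> [[d /= d0 H]|[d d0 H]]; exists d => // y.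
  by move=> yx; apply: H; rewrite -ball_normE /= distrC.
by rewrite -ball_normE /= distrC; exact: H.
Qed.

Lemma cV_continuousP (g : 'cV[R]_m -> R) (x : 'cV[R]_m) :
  {for x, continuous g} <-> forall e : R, 0 < e ->
    exists2 d : R, 0 < d & forall y, `|y - x| < d -> `|g y - g x| <= e.
Proof.
split=> [/(@cvgrPdist_le _ _ _ (nbhs x)) H e /H /cV_nbhsP[d d0 Hd]|H].
  by exists d => // y /Hd; rewrite distrC.
apply/(@cvgrPdist_le _ _ _ (nbhs x)) => e /H[d d0 Hd].
by apply/cV_nbhsP; exists d => // y /Hd; rewrite distrC.
Qed.

Lemma cV_openP (A : set 'cV[R]_m) :
  open A <-> forall x, A x -> exists2 d : R, 0 < d & forall y, `|y - x| < d -> A y.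
Proof.
split=> [oA x Ax|H]; first by apply/cV_nbhsP; exact: open_nbhs_nbhs.
by rewrite openE => x /H/cV_nbhsP.
Qed.

Lemma open_near (x0 : 'cV[R]_m) (r : R) : open [set x : 'cV[R]_m | `|x - x0| < r].
Proof.
apply/cV_openP => x /= xr; exists (r - `|x - x0|); first by rewrite subr_gt0.
move=> y yx; rewrite -(subrK x y) -addrA (le_lt_trans (ler_normD _ _)) //.
by rewrite -ltrBrDr.
Qed.

Lemma open_far (x0 : 'cV[R]_m) (r : R) : open [set x : 'cV[R]_m | r < `|x - x0|].
Proof.
apply/cV_openP => x /= xr; exists (`|x - x0| - r); first by rewrite subr_gt0.
move=> y yx; have : `|x - x0| <= `|y - x| + `|y - x0|.
  by rewrite [`|y - x|]distrC -{1}(subrK y x) -addrA ler_normD.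
move=> H; lra.
Qed.

Lemma cV_sum_delta x : x = \sum_i x i 0 *: e_ i.
Proof.
apply/colP => i; rewrite summxE (bigD1 i) //= big1 => [|j ji].
  by rewrite !mxE !eqxx mulr1 addr0.
by rewrite !mxE eq_sym (negbTE ji) mulr0.
Qed.

Lemma cV_openT : open [set: 'cV[R]_m].
Proof. exact: openT. Qed.

End MatrixNorm.

#[global] Hint Extern 0 (open [set: 'cV__]) => exact: cV_openT : core.

Lemma cvg_sumr (R : realType) (I T : Type) (F : set_system T) (FF : Filter F)
    (r : seq I) (P : pred I) (f : I -> T -> R) (l : I -> R) :
  (forall i, P i -> f i @ F --> l i) ->
  (fun t => \sum_(i <- r | P i) f i t) @ F --> \sum_(i <- r | P i) l i.
Proof.
move=> H; elim: r => [|i r IH].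
  rewrite big_nil (_ : (fun _ => _) = cst 0); first exact: cvg_cst.
  by apply/funext => t; rewrite big_nil.
rewrite big_cons (_ : (fun _ => _) = if P i
  then (fun t => f i t + \sum_(i <- r | P i) f i t)
  else (fun t => \sum_(i <- r | P i) f i t)).
  by case: ifP => // Pi; apply: cvgD => //; exact: H.
by apply/funext => t; rewrite big_cons; case: ifP.
Qed.

(** * Differentiability from continuous partial derivatives *)

Section Partial.
Variables (R : realType) (m : nat).
Implicit Types (f g : 'cV[R]_m -> R) (U V : set 'cV[R]_m) (x h : 'cV[R]_m).

Definition partial (i : 'I_m) f : 'cV[R]_m -> R := fun x => 'D_(e_ i) f x.

(** These truncations form a staircase from 0 to [h] that moves one coordinate at a time, so an
    increment of [f] telescopes into increments along the axes. *)
Definition head_coords (k : nat) h : 'cV[R]_m :=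
  \col_j (if (j < k)%N then h j 0 else 0).

Lemma head_coordsS (i : 'I_m) h :
  head_coords i.+1 h = head_coords i h + h i 0 *: e_ i.
Proof.
apply/colP => j; rewrite !mxE ltnS leq_eqVlt /= andbT.
case: (eqVneq j i) => [->|ji]; first by rewrite eqxx ltnn mulr1 add0r.
by rewrite -val_eqE /= in ji; rewrite (negbTE ji) /= mulr0 addr0.
Qed.

Lemma head_coords0 h : head_coords 0 h = 0.
Proof. by apply/colP => j; rewrite !mxE. Qed.

Lemma head_coords_full h : head_coords m h = h.
Proof. by apply/colP => j; rewrite !mxE ltn_ord. Qed.

Lemma head_coords_near (i : 'I_m) h (s : R) : `|s| <= `|h i 0| ->
  `|head_coords i h + s *: e_ i| <= `|h|.
Proof.
move=> sh; apply: cV_norm_le => // j; rewrite !mxE /= andbT.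
case: (eqVneq j i) => [->|ji].
  by rewrite ltnn add0r mulr1 (le_trans sh) // cV_norm_ge.
rewrite mulr0 addr0; case: ifP => _; first exact: cV_norm_ge.
by rewrite normr0.
Qed.

(* Caratheodory's form of differentiability: the increment is a combination of
   the coordinate increments with coefficients continuous at the point *)
Lemma C1_caratheodory U f x : open U -> U x ->
  (forall y i, U y -> derivable f y (e_ i)) ->
  (forall i, {for x, continuous (partial i f)}) ->
  exists q : 'I_m -> 'cV[R]_m -> R,
    [/\ forall h, f (x + h) - f x = \sum_i h i 0 * q i h,
        forall i, {for 0, continuous (q i)} &
        forall i, q i 0 = partial i f x].
Proof.
move=> oU Ux df cf.
(* The coefficient is the difference quotient along the i-th leg of the staircase; a leg of length 0
   gets the partial derivative at [x], which is also the limit. *)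
pose q i h := if h i 0 == 0 then partial i f x
   else (f (x + head_coords i.+1 h) - f (x + head_coords i h)) / h i 0.
have q0 i : q i 0 = partial i f x by rewrite /q mxE eqxx.
exists q; split=> // [h|i].
- transitivity (\sum_(i < m) (f (x + head_coords i.+1 h) - f (x + head_coords i h))).
    rewrite -(big_mkord xpredT
      (fun k => f (x + head_coords k.+1 h) - f (x + head_coords k h))).
    by rewrite telescope_sumr // head_coords_full head_coords0 addr0.
  apply: eq_bigr => i _; rewrite /q; case: eqVneq => [h0|h0].
    by rewrite head_coordsS h0 scale0r addr0 subrr mul0r.
  by rewrite mulrC divfK.
- apply/(@cvgrPdist_le _ _ _ (nbhs (0 : 'cV[R]_m))) => e e0; rewrite q0.
  have /cvgrPdist_le/(_ _ e0) := cf i; move=> /nbhs_ballP[d /= d0 Hd].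
  have /nbhs_ballP[d' /= d'0 Hd'] : nbhs x U by exact: open_nbhs_nbhs.
  apply/cV_nbhsP; exists (Num.min d d') => /=; first by rewrite lt_min d0.
  move=> h; rewrite subr0 => hd; rewrite /q.
  case: eqVneq => [_|h0]; first by rewrite subrr normr0 ltW.
  have B (s : R) : `|s| <= `|h i 0| ->
      `|x - (x + head_coords i h + s *: e_ i)| < Num.min d d'.
    move=> sh; rewrite -addrA opprD addrA subrr sub0r normrN.
    by rewrite (le_lt_trans (head_coords_near sh)).
  (* The quotient equals the partial derivative at some point within distance [|h|] of [x], and
     continuity of that derivative at [x] finishes. *)
  have [s sh|s sh E] := @line_MVT R _ f (x + head_coords i h) (e_ i) (h i 0).
    apply/df/Hd'; rewrite -ball_normE /=.
    by have := B _ sh; rewrite lt_min => /andP[].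
  rewrite head_coordsS addrA E mulrAC mulfV // mul1r; apply: Hd.
  by rewrite -ball_normE /=; have := B _ sh; rewrite lt_min => /andP[].
Unshelve. all: by end_near. Qed.

End Partial.

Section ChainRule.
Variables (R : realType) (m : nat).

(** The Caratheodory coefficients of [f] are composed with the increment of [g] along the line
    through [y], and converge because they are continuous at 0. Hence [g] has to be derivable only
    in the direction [v]; both curves and maps of several variables are covered. *)
Lemma is_derive_chain (W : normedModType R) (U : set 'cV[R]_m)
    (f : 'cV[R]_m -> R) (g : W -> 'cV[R]_m) (y v : W) :
  open U -> U (g y) ->
  (forall z i, U z -> derivable f z (e_ i)) ->
  (forall i, {for g y, continuous (partial i f)}) ->
  (forall i, derivable (fun z => g z i 0) y v) ->
  is_derive y v (f \o g)
    (\sum_i partial i f (g y) * 'D_v (fun z => g z i 0) y).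
Proof.
move=> oU Ugy df cf dg.
have [q [fq cq q0]] := C1_caratheodory oU Ugy df cf.
pose D t := g (t *: v + y) - g y.
have cD : D t @[t --> (0 : R)] --> (0 : 'cV[R]_m).
  apply: cV_cvg => i.
  have -> : (0 : 'cV[R]_m) i 0 = g y i 0 - g y i 0 by rewrite mxE subrr.
  rewrite (_ : (fun t => _) = (fun t : R => g (t *: v + y) i 0 - g y i 0)).
    by apply: cvgB; [exact: derivable_line_continuous (dg i)|exact: cvg_cst].
  by apply/funext => t; rewrite !mxE.
have L : (fun t : R => t^-1 *: ((f \o g) (t *: v + y) - (f \o g) y)) t
     @[t --> 0^'] -->
    \sum_i partial i f (g y) * 'D_v (fun z => g z i 0) y.
  rewrite (_ : (fun t => _) = (fun t : R => \sum_i
      q i (D t) * (t^-1 *: (g (t *: v + y) i 0 - g y i 0)))); last first.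
    apply/funext => t /=; rewrite -[in f (g (_ + _))](subrK (g y) (g _)).
    rewrite [X in f X - _]addrC fq scaler_sumr; apply: eq_bigr => i _.
    by rewrite !mxE /D [RHS]mulrC /GRing.scale /= mulrA.
  apply: cvg_sumr => i _; apply: cvgM; last exact: dg.
  rewrite -q0.
  apply: (@cvg_comp _ _ _ D (q i) (0^') (nbhs (0 : 'cV[R]_m))); last exact: cq.
  by move=> A /cD; exact: nbhs_dnbhs.
apply: DeriveDef; first by apply/cvg_ex; eexists; exact: L.
exact: cvg_lim L.
Qed.

End ChainRule.

Lemma is_derive_of_line (R : realType) (V : normedModType R) (f : V -> R) x v (d : R) :
  is_derive (0 : R) 1 (fun s => f (x + s *: v)) d -> is_derive x v f d.
Proof.
have E : (fun h : R => h^-1 *: (f (x + (h%:A + 0) *: v) - f (x + 0 *: v))) =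
    (fun h => h^-1 *: (f (h *: v + x) - f x)).
  by apply/funext => h; rewrite [h%:A]mulr1 addr0 scale0r addr0 [x + _]addrC.
move=> [H1 H2]; rewrite /derivable /derive /= E in H1 H2.
by apply: DeriveDef; [exact: H1|exact: H2].
Qed.

Lemma is_derive_comp1 (R : realType) (V : normedModType R) (f : V -> R)
    (h : R -> R) x v (dh : R) :
  derivable f x v -> is_derive (f x) 1 h dh ->
  is_derive x v (h \o f) (dh * 'D_v f x).
Proof.
move=> df [dh1 <-]; apply: is_derive_of_line.
have := @is_derive_line _ _ f x v 0; rewrite scale0r addr0 => /(_ df)[d1 <-].
have dh' : derivable h (f (x + 0 *: v)) 1 by rewrite scale0r addr0.
apply: DeriveDef.
  apply/derivable1_diffP; apply: (@differentiable_comp _ _ _ _ (fun s : R => f (x + s *: v)) h).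
    exact/derivable1_diffP.
  exact/derivable1_diffP.
by rewrite -!derive1E (@derive1_comp _ (fun s : R => f (x + s *: v)) h) // scale0r addr0.
Qed.

Section PointwiseOperations.
Variables (R : realType) (V : normedModType R).
Implicit Types (f g : V -> R) (x v : V).

Lemma continuous_add_fun (T : topologicalType) (f g : T -> R) (t : T) :
  {for t, continuous f} -> {for t, continuous g} ->
  {for t, continuous (fun t => f t + g t)}.
Proof. by move=> cf cg; exact: (@cvgD _ _ _ _ _ f g _ _ cf cg). Qed.

Lemma continuous_opp_fun (T : topologicalType) (f : T -> R) (t : T) :
  {for t, continuous f} -> {for t, continuous (fun t => - f t)}.
Proof. by move=> cf; exact: (@cvgN _ _ _ _ _ f _ cf). Qed.

Lemma continuous_mul_fun (T : topologicalType) (f g : T -> R) (t : T) :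
  {for t, continuous f} -> {for t, continuous g} ->
  {for t, continuous (fun t => f t * g t)}.
Proof. by move=> cf cg; exact: (@cvgM _ _ _ _ f g _ _ cf cg). Qed.

Lemma is_derive_add_fun f g x v : derivable f x v -> derivable g x v ->
  is_derive x v (fun x => f x + g x) ('D_v f x + 'D_v g x).
Proof.
move=> df dg; apply: DeriveDef; first exact: (@derivableD _ _ _ f g).
exact: (@deriveD _ _ _ f g).
Qed.

Lemma is_derive_mul_fun f g x v : derivable f x v -> derivable g x v ->
  is_derive x v (fun x => f x * g x) (f x * 'D_v g x + g x * 'D_v f x).
Proof.
move=> df dg; apply: DeriveDef; first exact: (@derivableM _ _ f g).
exact: (@deriveM _ _ f g).
Qed.

End PointwiseOperations.

(** * Algebra and composition of smooth functions *)

Section CkTheory.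
Variables (R : realType) (m : nat).
Implicit Types (f g : 'cV[R]_m -> R) (U V : set 'cV[R]_m) (k : nat).

Lemma Ck_continuous k U f x : Ck k U f -> U x -> {for x, continuous f}.
Proof. by case: k => [|k] [H _]; exact: H. Qed.

Lemma Ck_derivable k U f i x : Ck k.+1 U f -> U x -> derivable f x (e_ i).
Proof. by move=> [_ /(_ i)[H _]]; exact: H. Qed.

Lemma Ck_partial k U f i : Ck k.+1 U f -> Ck k U (partial i f).
Proof. by move=> [_ /(_ i)[_]]. Qed.

Lemma Ck_sub k U V f : V `<=` U -> Ck k U f -> Ck k V f.
Proof.
elim: k f => [|k IH] f VU [c H]; (split; first by move=> x /VU; exact: c) => // i.
have [d p] := H i; split; first by move=> x /VU; exact: d.
exact: IH.
Qed.

Lemma CkW k U f : Ck k.+1 U f -> Ck k U f.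
Proof.
elim: k f => [|k IH] f [c H]; split=> // i.
by have [d p] := H i; split=> //; exact: IH.
Qed.

(** Openness makes every derivative at a point of [U] depend on the values on [U] alone. *)
Lemma Ck_ext k U f g : open U -> (forall x, U x -> f x = g x) ->
  Ck k U f -> Ck k U g.
Proof.
move=> oU; elim: k f g => [|k IH] f g fg [c H].
all: have N x : U x -> \forall y \near x, f y = g y
  by move=> Ux; near=> y; apply: fg; near: y; exact: open_nbhs_nbhs.
all: have C : forall x, U x -> {for x, continuous g}.
1,3: move=> x Ux; rewrite /prop_for /continuous_at -(fg _ Ux);
  by apply: cvg_trans (c _ Ux); exact: near_eq_cvg (N _ Ux).
  by [].
split=> // i; have [d p] := H i; split.
  by move=> x Ux; exact: near_eq_derivable (N _ Ux) (d _ Ux).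
by apply: IH p => x Ux; exact: near_eq_derive (N _ Ux).
Unshelve. all: by end_near. Qed.

Lemma Ck_local k U f :
  (forall x, U x -> exists V, [/\ open V, V x & Ck k V f]) -> Ck k U f.
Proof.
elim: k f => [|k IH] f H.
  by split=> // x /H[V [_ Vx cV]]; exact: Ck_continuous cV Vx.
split=> [x /H[V [_ Vx cV]]|i]; first exact: Ck_continuous cV Vx.
split=> [x /H[V [_ Vx cV]]|]; first exact: Ck_derivable cV Vx.
by apply: IH => x /H[V [oV Vx cV]]; exists V; split=> //; exact: Ck_partial i cV.
Qed.

Lemma Ck_cst k U (a : R) : Ck k U (fun=> a).
Proof.
elim: k a => [|k IH] a; first by split=> // x _; exact: cst_continuous.
split=> [x _|i]; first exact: cst_continuous.
split=> [x _|]; first exact: derivable_cst.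
have -> : (fun x : 'cV[R]_m => 'D_(e_ i) (fun=> a) x) = fun=> 0.
  by apply/funext => x; exact: derive_cst.
exact: IH.
Qed.

Lemma Ck_coord k U (j : 'I_m) : Ck k U (fun x => x j 0).
Proof.
have D (i : 'I_m) x :
    is_derive x (e_ i : 'cV[R]_m) (fun x : 'cV[R]_m => x j 0) ((e_ i : 'cV[R]_m) j 0).
  have L (h : R) : h != 0 ->
      h^-1 *: ((h *: (e_ i : 'cV[R]_m) + x) j 0 - x j 0) = (e_ i : 'cV[R]_m) j 0.
    by move=> h0; rewrite !mxE addrK /GRing.scale /= mulKf.
  have C : h^-1 *: ((h *: (e_ i : 'cV[R]_m) + x) j 0 - x j 0) @[h --> 0^'] -->
      (e_ i : 'cV[R]_m) j 0.
    apply: (@cvg_trans _ ((fun=> (e_ i : 'cV[R]_m) j 0) @ (0 : R)^')); last exact: cvg_cst.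
    by apply: near_eq_cvg; near=> h; rewrite L //; near: h; exact: nbhs_dnbhs_neq.
  by apply: DeriveDef; [apply/cvg_ex; eexists; exact: C|exact: cvg_lim C].
have C x : {for x, continuous (fun x : 'cV[R]_m => x j 0)} by exact: coord_continuous.
case: k => [|k]; split=> // i; split=> [x _|].
  by have [] := D i x.
have -> : (fun x : 'cV[R]_m => 'D_(e_ i) (fun x : 'cV[R]_m => x j 0) x) =
    fun=> (e_ i : 'cV[R]_m) j 0.
  by apply/funext => x; have [_] := D i x.
exact: Ck_cst.
Unshelve. all: by end_near. Qed.

Lemma Ck_add k U f g : open U -> Ck k U f -> Ck k U g ->
  Ck k U (fun x => f x + g x).
Proof.
move=> oU; elim: k f g => [|k IH] f g [cf Hf] [cg Hg].
  by split=> // x Ux; exact: continuous_add_fun (cf _ Ux) (cg _ Ux).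
split=> [x Ux|i]; first exact: continuous_add_fun (cf _ Ux) (cg _ Ux).
have [[df pf] [dg pg]] := (Hf i, Hg i).
have E x Ux := is_derive_add_fun (df x Ux) (dg x Ux).
split=> [x Ux|]; first by have [] := E x Ux.
by apply: Ck_ext (IH _ _ pf pg) => // x Ux; have [_ ->] := E x Ux.
Qed.

Lemma Ck_mul k U f g : open U -> Ck k U f -> Ck k U g ->
  Ck k U (fun x => f x * g x).
Proof.
move=> oU; elim: k f g => [|k IH] f g Cf Cg; have [[cf Hf] [cg Hg]] := (Cf, Cg).
  by split=> // x Ux; exact: continuous_mul_fun (cf _ Ux) (cg _ Ux).
split=> [x Ux|i]; first exact: continuous_mul_fun (cf _ Ux) (cg _ Ux).
have [[df pf] [dg pg]] := (Hf i, Hg i).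
have E x Ux := is_derive_mul_fun (df x Ux) (dg x Ux).
split=> [x Ux|]; first by have [] := E x Ux.
have := Ck_add oU (IH _ _ (CkW Cf) pg) (IH _ _ (CkW Cg) pf).
by apply: Ck_ext => // x Ux; have [_ ->] := E x Ux.
Qed.

Lemma Ck_opp k U f : open U -> Ck k U f -> Ck k U (fun x => - f x).
Proof.
move=> oU Cf; have := Ck_mul oU (Ck_cst k U (-1)) Cf.
by apply: Ck_ext => // x _; rewrite mulN1r.
Qed.

Lemma Ck_sub_fun k U f g : open U -> Ck k U f -> Ck k U g ->
  Ck k U (fun x => f x - g x).
Proof. by move=> oU Cf Cg; apply: Ck_add => //; exact: Ck_opp. Qed.

Lemma Ck_sum k U (I : Type) (r : seq I) (P : pred I) (F : I -> 'cV[R]_m -> R) :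
  open U -> (forall i, P i -> Ck k U (F i)) ->
  Ck k U (fun x => \sum_(i <- r | P i) F i x).
Proof.
move=> oU H; elim: r => [|i r IH].
  by apply: Ck_ext (Ck_cst _ _ 0) => // x _; rewrite big_nil.
case Pi: (P i).
  by apply: Ck_ext (Ck_add oU (H _ Pi) IH) => // x _; rewrite big_cons Pi.
by apply: Ck_ext IH => // x _; rewrite big_cons Pi.
Qed.

Lemma Ck_prod k U (I : Type) (r : seq I) (P : pred I) (F : I -> 'cV[R]_m -> R) :
  open U -> (forall i, P i -> Ck k U (F i)) ->
  Ck k U (fun x => \prod_(i <- r | P i) F i x).
Proof.
move=> oU H; elim: r => [|i r IH].
  by apply: Ck_ext (Ck_cst _ _ 1) => // x _; rewrite big_nil.
case Pi: (P i).
  by apply: Ck_ext (Ck_mul oU (H _ Pi) IH) => // x _; rewrite big_cons Pi.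
by apply: Ck_ext IH => // x _; rewrite big_cons Pi.
Qed.

Lemma Ck_inv k U f : open U -> (forall x, U x -> f x != 0) ->
  Ck k U f -> Ck k U (fun x => (f x)^-1).
Proof.
move=> oU f0; elim: k => [|k IH] Cf; have [cf Hf] := Cf.
  by split=> // x Ux; exact: (@cvgV _ _ _ _ f _ (f0 _ Ux) (cf _ Ux)).
split=> [x Ux|i]; first exact: (@cvgV _ _ _ _ f _ (f0 _ Ux) (cf _ Ux)).
have [df pf] := Hf i.
split=> [x Ux|]; first by apply: derivableV; [exact: f0|exact: df].
have I := IH (CkW Cf).
apply: Ck_ext (Ck_opp oU (Ck_mul oU (Ck_mul oU I I) pf)) => // x Ux.
rewrite deriveV; [|exact: f0|exact: df].
by rewrite /GRing.scale /= -exprVn expr2 !mulNr.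
Qed.

(* the derivatives of the h's are combinations of the h's, hence induction on k *)
Lemma Ck_comp1 k U (I : Type) (h : I -> R -> R) (dh : I -> seq (R * I)) (D : set R) f :
  (forall i t, D t -> is_derive t 1 (h i) (\sum_(aj <- dh i) aj.1 * h aj.2 t)) ->
  open U -> (forall x, U x -> D (f x)) -> Ck k U f ->
  forall i, Ck k U (fun x => h i (f x)).
Proof.
move=> Hh oU fD; elim: k => [|k IH] Cf i.
all: have C x : U x -> {for x, continuous (fun x => h i (f x))}.
1,3: move=> Ux; apply: (@continuous_comp _ _ _ f (h i));
  [exact: Ck_continuous Cf Ux|apply: differentiable_continuous; 
   apply/derivable1_diffP; by have [] := Hh i _ (fD _ Ux)].
  by [].
have E x j : U x -> is_derive x (e_ j : 'cV[R]_m) (fun x => h i (f x))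
    ((\sum_(al <- dh i) al.1 * h al.2 (f x)) * partial j f x).
  move=> Ux; apply: (@is_derive_comp1 _ _ f (h i)); first exact: Ck_derivable Cf Ux.
  exact: Hh (fD _ Ux).
split=> // j; split=> [x Ux|]; first by have [] := E x j Ux.
have := Ck_mul oU (Ck_sum (dh i) (P := xpredT) oU (fun al _ =>
  Ck_mul oU (Ck_cst k U al.1) (IH (CkW Cf) al.2))) (Ck_partial j Cf).
by apply: Ck_ext => // x Ux; have [_ ->] := E x j Ux.
Qed.

End CkTheory.

Section Composition.
Variables (R : realType) (m p : nat).

Lemma Ck_comp k (U : set 'cV[R]_m) (W : set 'cV[R]_p) (f : 'cV[R]_p -> R)
    (g : 'cV[R]_m -> 'cV[R]_p) :
  open U -> open W -> (forall x, U x -> W (g x)) ->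
  (forall i, Ck k U (fun x => g x i 0)) -> Ck k W f -> Ck k U (f \o g).
Proof.
move=> oU oW gW; elim: k f => [|k IH] f Cg Cf.
all: have C x : U x -> {for x, continuous (f \o g)}.
1,3: move=> Ux; apply: continuous_comp; last exact: Ck_continuous Cf (gW _ Ux).
1,2: by apply: cV_continuous => i; exact: Ck_continuous (Cg i) Ux.
  by [].
have E x j : U x -> is_derive x (e_ j : 'cV[R]_m) (f \o g)
    (\sum_i partial i f (g x) * partial j (fun z => g z i 0) x).
  move=> Ux; apply: (is_derive_chain oW (gW _ Ux)).
  - by move=> z i Wz; exact: Ck_derivable Cf Wz.
  - by move=> i; exact: Ck_continuous (Ck_partial i Cf) (gW _ Ux).
  - by move=> i; exact: Ck_derivable (Cg i) Ux.
split=> // j; split=> [x Ux|]; first by have [] := E x j Ux.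
have := Ck_sum (index_enum 'I_p) (P := xpredT) oU (fun i _ =>
  Ck_mul oU (IH _ (fun l => CkW (Cg l)) (Ck_partial i Cf)) (Ck_partial j (Cg i))).
by apply: Ck_ext => // x Ux; have [_ ->] := E x j Ux.
Qed.

Lemma is_derive_comp (W : set 'cV[R]_p) (f : 'cV[R]_p -> R)
    (g : 'cV[R]_m -> 'cV[R]_p) x v :
  open W -> W (g x) -> Ck 1 W f -> (forall i, derivable (fun z => g z i 0) x v) ->
  is_derive x v (f \o g)
    (\sum_i partial i f (g x) * 'D_v (fun z => g z i 0) x).
Proof.
move=> oW Wx Cf dg; apply: (is_derive_chain oW Wx) => //.
- by move=> z i Wz; exact: Ck_derivable Cf Wz.
- by move=> i; exact: Ck_continuous (Ck_partial i Cf) Wx.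
Qed.

End Composition.

Section CinfTheory.
Variables (R : realType) (m : nat).
Implicit Types (f g : 'cV[R]_m -> R) (U V : set 'cV[R]_m).

Lemma Cinf_sub U V f : V `<=` U -> Cinf U f -> Cinf V f.
Proof. by move=> VU Cf k; exact: Ck_sub VU (Cf k). Qed.

Lemma Cinf_ext U f g : open U -> (forall x, U x -> f x = g x) ->
  Cinf U f -> Cinf U g.
Proof. by move=> oU fg Cf k; exact: Ck_ext oU fg (Cf k). Qed.

Lemma Cinf_local U f :
  (forall x, U x -> exists V, [/\ open V, V x & Cinf V f]) -> Cinf U f.
Proof.
by move=> H k; apply: Ck_local => x /H[V [oV Vx Cf]]; exists V; split.
Qed.

Lemma Cinf_cst U (a : R) : Cinf U (fun=> a).
Proof. by move=> k; exact: Ck_cst. Qed.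

Lemma Cinf_coord U (j : 'I_m) : Cinf U (fun x => x j 0).
Proof. by move=> k; exact: Ck_coord. Qed.

Lemma Cinf_add U f g : open U -> Cinf U f -> Cinf U g ->
  Cinf U (fun x => f x + g x).
Proof. by move=> oU Cf Cg k; exact: Ck_add. Qed.

Lemma Cinf_mul U f g : open U -> Cinf U f -> Cinf U g ->
  Cinf U (fun x => f x * g x).
Proof. by move=> oU Cf Cg k; exact: Ck_mul. Qed.

Lemma Cinf_opp U f : open U -> Cinf U f -> Cinf U (fun x => - f x).
Proof. by move=> oU Cf k; exact: Ck_opp. Qed.

Lemma Cinf_subr U f g : open U -> Cinf U f -> Cinf U g ->
  Cinf U (fun x => f x - g x).
Proof. by move=> oU Cf Cg k; exact: Ck_sub_fun. Qed.

Lemma Cinf_sum U (I : Type) (r : seq I) (P : pred I) (F : I -> 'cV[R]_m -> R) :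
  open U -> (forall i, P i -> Cinf U (F i)) ->
  Cinf U (fun x => \sum_(i <- r | P i) F i x).
Proof. by move=> oU H k; apply: Ck_sum => // i /H; exact. Qed.

Lemma Cinf_prod U (I : Type) (r : seq I) (P : pred I) (F : I -> 'cV[R]_m -> R) :
  open U -> (forall i, P i -> Cinf U (F i)) ->
  Cinf U (fun x => \prod_(i <- r | P i) F i x).
Proof. by move=> oU H k; apply: Ck_prod => // i /H; exact. Qed.

Lemma Cinf_inv U f : open U -> (forall x, U x -> f x != 0) ->
  Cinf U f -> Cinf U (fun x => (f x)^-1).
Proof. by move=> oU f0 Cf k; exact: Ck_inv. Qed.

Lemma Cinf_partial U f i : Cinf U f -> Cinf U (partial i f).
Proof. by move=> Cf k; exact: Ck_partial (Cf k.+1). Qed.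

Lemma Cinf_continuous U f x : Cinf U f -> U x -> {for x, continuous f}.
Proof. by move=> Cf; exact: Ck_continuous (Cf 0). Qed.

Lemma Cinf_derivable U f i x : Cinf U f -> U x -> derivable f x (e_ i).
Proof. by move=> Cf; exact: Ck_derivable (Cf 1). Qed.

Lemma Cinf_comp p (U : set 'cV[R]_m) (W : set 'cV[R]_p) (f : 'cV[R]_p -> R)
    (g : 'cV[R]_m -> 'cV[R]_p) :
  open U -> open W -> (forall x, U x -> W (g x)) ->
  (forall i, Cinf U (fun x => g x i 0)) -> Cinf W f -> Cinf U (fun x => f (g x)).
Proof. by move=> oU oW gW Cg Cf k; apply: (Ck_comp oU oW) => // i; exact: Cg. Qed.

Lemma Cinf_det U p (A : 'cV[R]_m -> 'M[R]_p) : open U ->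
  (forall i j, Cinf U (fun x => A x i j)) -> Cinf U (fun x => \det (A x)).
Proof.
move=> oU CA; apply: Cinf_sum => // s _; apply: Cinf_mul => //.
  exact: Cinf_cst.
exact: Cinf_prod.
Qed.

Lemma Cinf_mulmx U p q r (A : 'cV[R]_m -> 'M[R]_(p, q)) (B : 'cV[R]_m -> 'M[R]_(q, r)) :
  open U -> (forall i j, Cinf U (fun x => A x i j)) ->
  (forall i j, Cinf U (fun x => B x i j)) ->
  forall i j, Cinf U (fun x => (A x *m B x) i j).
Proof.
move=> oU CA CB i j; apply: (@Cinf_ext _ (fun x => \sum_k A x i k * B x k j)) => //.
  by move=> x _; rewrite mxE.
by apply: Cinf_sum => // k _; exact: Cinf_mul.
Qed.

(** Cramer's rule writes the entries of the inverse as polynomials in the entries of [A] divided by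
    the determinant. *)
Lemma Cinf_invmx U p (A : 'cV[R]_m -> 'M[R]_p) : open U ->
  (forall x, U x -> A x \in unitmx) ->
  (forall i j, Cinf U (fun x => A x i j)) ->
  forall i j, Cinf U (fun x => invmx (A x) i j).
Proof.
move=> oU uA CA i j.
apply: (@Cinf_ext _ (fun x => (\det (A x))^-1 *
   ((-1) ^+ (j + i) * \det (row' j (col' i (A x)))))) => //.
  by move=> x Ux; rewrite /invmx uA // !mxE.
apply: Cinf_mul => //.
  apply: Cinf_inv => //; last exact: Cinf_det.
  by move=> x /uA; rewrite unitmxE unitfE.
apply: Cinf_mul => //; first exact: Cinf_cst.
apply: Cinf_det => // k l.
by apply: (@Cinf_ext _ (fun x => A x (lift j k) (lift i l))) => // x _; rewrite !mxE.
Qed.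

Lemma is_derive_coord (x v : 'cV[R]_m) (j : 'I_m) :
  is_derive x v (fun x : 'cV[R]_m => x j 0) (v j 0).
Proof.
have C : (fun h : R => h^-1 *: ((h *: v + x) j 0 - x j 0)) h @[h --> 0^'] --> v j 0.
  apply: (@cvg_trans _ ((fun=> v j 0) @ (0 : R)^')); last exact: cvg_cst.
  apply: near_eq_cvg; near=> h.
  have h0 : h != 0 by near: h; exact: nbhs_dnbhs_neq.
  by rewrite !mxE addrK /GRing.scale /= mulKf.
by apply: DeriveDef; [apply/cvg_ex; eexists; exact: C|exact: cvg_lim C].
Unshelve. all: by end_near. Qed.

Lemma is_derive_partials U f (x v : 'cV[R]_m) : open U -> U x -> Ck 1 U f ->
  is_derive x v f (\sum_i partial i f x * v i 0).
Proof.
move=> oU Ux Cf.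
have := @is_derive_comp R m m U f id x v oU Ux Cf.
have E i := is_derive_coord x v i.
have -> : \sum_i partial i f (id x) * 'D_v (fun z : 'cV[R]_m => id z i 0) x =
   \sum_i partial i f x * v i 0.
  by apply: eq_bigr => i _; have [_ ->] := E i.
by apply => i; have [] := E i.
Qed.

Lemma Ck_expR k U f : open U -> Ck k U f -> Ck k U (fun x => expR (f x)).
Proof.
move=> oU Cf.
apply: (@Ck_comp1 _ _ k U unit (fun=> expR) (fun=> [:: (1, tt)]) setT f _ oU _ Cf tt) => //.
move=> _ t _; rewrite big_seq1 mul1r; exact: is_derive_expR.
Qed.

Lemma Ck_ln k U f : open U -> (forall x, U x -> 0 < f x) -> Ck k U f ->
  Ck k U (fun x => ln (f x)).
Proof.
move=> oU f0 Cf.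
have C x : U x -> {for x, continuous (fun x => ln (f x))}.
  move=> Ux; apply: (@continuous_comp _ _ _ f (@ln R)); first exact: Ck_continuous Cf Ux.
  exact/continuous_ln/f0.
case: k Cf => [|k] Cf; split=> // i.
have E x : U x -> is_derive x (e_ i : 'cV[R]_m) (fun x => ln (f x))
    ((f x)^-1 * partial i f x).
  move=> Ux; apply: (@is_derive_comp1 _ _ f (@ln R)); first exact: Ck_derivable Cf Ux.
  exact/is_derive1_ln/f0.
split=> [x Ux|]; first by have [] := E x Ux.
have f0' x : U x -> f x != 0 by move=> /f0/lt0r_neq0.
apply: Ck_ext (Ck_mul oU (Ck_inv oU f0' (CkW Cf)) (Ck_partial i Cf)) => // x Ux.
by have [_ ->] := E x Ux.
Qed.

Lemma Cinf_expR U f : open U -> Cinf U f -> Cinf U (fun x => expR (f x)).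
Proof. by move=> oU Cf k; exact: Ck_expR. Qed.

Lemma Cinf_ln U f : open U -> (forall x, U x -> 0 < f x) -> Cinf U f ->
  Cinf U (fun x => ln (f x)).
Proof. by move=> oU f0 Cf k; exact: Ck_ln. Qed.

End CinfTheory.

(** * Smooth cutoff functions *)

Section Bump.
Variable R : realType.

(** The powers of 1/t make the family stable under differentiation: the derivative of [flat n] is a
    combination of [flat n.+1] and [flat n.+2], the shape that [Ck_comp1] requires. *)
Definition flat (n : nat) (t : R) : R :=
  if 0 < t then t^-1 ^+ n * expR (- t^-1) else 0.

(** The inequality exp u >= 1 + u at u = y / (n + 1), raised to the power n + 1. *)
Lemma expRN_mul_bound (n : nat) (y : R) : 0 < y ->
  y ^+ n * expR (- y) <= n.+1%:R ^+ n.+1 / y.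
Proof.
move=> y0; rewrite ler_pdivlMr // mulrAC -exprSr expRN.
rewrite ler_pdivrMr ?expR_gt0 //.
have -> : expR y = expR (y / n.+1%:R) ^+ n.+1.
  by rewrite -expRM_natl mulrC divfK // pnatr_eq0.
rewrite -exprMn lerXn2r // ?nnegrE ?mulr_ge0 ?ler0n ?expR_ge0 ?(ltW y0) //.
rewrite mulrC -ler_pdivrMr ?ltr0n //.
by apply: le_trans (expR_ge1Dx _); rewrite lerDr.
Qed.

Lemma flat_ge0 n t : 0 <= flat n t.
Proof.
by rewrite /flat; case: ifP => // t0; rewrite mulr_ge0 ?exprn_ge0 ?invr_ge0 ?expR_ge0 ?ltW.
Qed.

Lemma flat_gt0 t : 0 < t -> 0 < flat 0 t.
Proof. by rewrite /flat => ->; rewrite mul1r expR_gt0. Qed.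

Lemma is_derive_flat n (t : R) :
  is_derive t 1 (flat n) (- n%:R * flat n.+1 t + flat n.+2 t).
Proof.
have [t0|t0|->] := ltgtP t 0.
- rewrite /flat !(ltNge 0 t) (ltW t0) /= mulr0 addr0.
  apply: (@near_eq_is_derive _ _ _ (cst 0)).
  by near=> s; rewrite ltNge (_ : s <= 0) //=; apply: ltW; near: s; exact: lt_nbhsl.
- have N : \near t, t^-1 ^+ n * expR (- t^-1) = flat n t.
    by near=> s; rewrite /flat (_ : 0 < s) //; near: s; exact: lt_nbhsr.
  have tn0 : t != 0 by rewrite gt_eqF.
  have dV : is_derive t 1 (fun s : R => s^-1) (- t^-1 ^+ 2).
    have := @is_deriveV R id t 1 1 tn0 (is_derive_id _ _).
    by rewrite /= /GRing.scale /= mulr1 exprVn.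
  have dE : is_derive t 1 (fun s : R => expR (- s^-1)) (expR (- t^-1) * t^-1 ^+ 2).
    have dN : is_derive t 1 (fun s : R => - s^-1) (t^-1 ^+ 2).
      by have := is_deriveN dV; rewrite opprK.
    exact: is_derive1_comp (is_derive_expR _) dN.
  have dX : is_derive t 1 (fun s : R => s^-1 ^+ n) (- n%:R * t^-1 ^+ n.+1).
    case: n N => [|n] _.
      by rewrite oppr0 mul0r; exact: is_derive_cst.
    have H : is_derive t^-1 1 (fun u : R => u ^+ n.+1) (n.+1%:R * t^-1 ^+ n).
      apply: DeriveDef; first exact: exprn_derivable.
      by rewrite exp_derive /GRing.scale /= mulr1.
    have := is_derive1_comp (f := fun u : R => u ^+ n.+1) H dV.
    by rewrite mulrN -mulrA -exprD addn2 mulNr.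
  have dX' : derivable (fun s : R => s^-1 ^+ n) t 1 by have [] := dX.
  have dE' : derivable (fun s : R => expR (- s^-1)) t 1 by have [] := dE.
  have := is_derive_mul_fun (V := R^o) dX' dE'.
  have [_ ->] := dX; have [_ ->] := dE => H.
  apply: (near_eq_is_derive N); apply: is_derive_eq H _.
  rewrite /flat t0 -[n.+2]addn2 exprD; ring.
- rewrite /flat ltxx mulr0 addr0.
  (* At 0 the right-hand quotient is h^-(n+1) exp(-1/h); [expRN_mul_bound] with y = 1/h and exponent
     n + 1 bounds it by (n+2)^(n+2) h. *)
  have L : h^-1 *: (flat n (h *: 1 + 0) - flat n 0) @[h --> (0 : R)^'] --> (0 : R).
    apply/cvgrPdist_le => e e0; near=> h.
    have h0 : h != 0 by near: h; exact: nbhs_dnbhs_neq.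
    rewrite sub0r normrN addr0 [h *: 1]mulr1 {2}/flat ltxx subr0.
    rewrite /flat; case: ltP => hp; last by rewrite scaler0 normr0 ltW.
    have -> : h^-1 *: (h^-1 ^+ n * expR (- h^-1)) = h^-1 ^+ n.+1 * expR (- h^-1).
      by rewrite /GRing.scale /= mulrA exprS.
    rewrite ger0_norm ?mulr_ge0 ?exprn_ge0 ?invr_ge0 ?expR_ge0 ?(ltW hp) //.
    apply: le_trans (@expRN_mul_bound n.+1 h^-1 _) _; rewrite ?invr_gt0 // invrK.
    have : `|h| <= e / n.+2%:R ^+ n.+2.
      near: h; apply: dnbhs0_le; rewrite divr_gt0 // exprn_gt0 //.
    by rewrite gtr0_norm // ler_pdivlMr ?exprn_gt0 // mulrC.
  by apply: DeriveDef; [apply/cvg_ex; exists 0|exact: cvg_lim L].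
Unshelve. all: by end_near. Qed.

End Bump.

Section SmoothCutoff.
Variables (R : realType).

Lemma Cinf_flat m (U : set 'cV[R]_m) f n : open U -> Cinf U f ->
  Cinf U (fun x => flat n (f x)).
Proof.
move=> oU Cf k.
apply: (@Ck_comp1 _ _ k U nat (@flat R)
  (fun n => [:: (- n%:R, n.+1); (1, n.+2)]) setT f _ oU _ (Cf k) n) => // i t _.
by rewrite !big_cons big_nil /= addr0 mul1r; exact: is_derive_flat.
Qed.

(** A smooth switch from 1 on t <= 1 to 0 on t >= 2. The denominator never vanishes because 2 - t or
    t - 1 is positive. *)
Definition step (t : R) : R := flat 0 (2 - t) / (flat 0 (2 - t) + flat 0 (t - 1)).

Lemma step_den_gt0 (t : R) : 0 < flat 0 (2 - t) + flat 0 (t - 1).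
Proof.
case: (ltP t 2) => t2.
  by rewrite ltr_wpDr ?flat_ge0 // flat_gt0 // subr_gt0.
by rewrite ltr_wpDl ?flat_ge0 // flat_gt0 // subr_gt0 (lt_le_trans _ t2) // ltr1n.
Qed.

Lemma step_eq1 (t : R) : t <= 1 -> step t = 1.
Proof.
move=> t1; have E : flat 0 (t - 1) = 0 :> R by rewrite /flat subr_gt0 ltNge t1.
rewrite /step E addr0 divff //.
by rewrite gt_eqF // flat_gt0 // subr_gt0 (le_lt_trans t1) // ltr1n.
Qed.

Lemma step_eq0 (t : R) : 2 <= t -> step t = 0.
Proof.
move=> t2; have E : flat 0 (2 - t) = 0 :> R by rewrite /flat subr_gt0 ltNge t2.
by rewrite /step E mul0r. Qed.

(** A product over the coordinates matches the sup norm, and the square replaces the absolute value,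
    which is not smooth. Beyond distance 2d some square exceeds 4, which is more than the 2 that
    [step] needs in order to vanish. *)
Definition bump m (x0 : 'cV[R]_m) (d : R) (x : 'cV[R]_m) : R :=
  \prod_i step (((x i 0 - x0 i 0) / d) ^+ 2).

Lemma Cinf_bump m (U : set 'cV[R]_m) x0 d : open U -> Cinf U (@bump m x0 d).
Proof.
move=> oU; apply: Cinf_prod => // i _.
have C : Cinf U (fun x : 'cV[R]_m => ((x i 0 - x0 i 0) / d) ^+ 2).
  have C1 : Cinf U (fun x : 'cV[R]_m => (x i 0 - x0 i 0) / d).
    apply: Cinf_mul => //; last exact: Cinf_cst.
    by apply: Cinf_subr => //; [exact: Cinf_coord|exact: Cinf_cst].
  by apply: Cinf_ext (Cinf_mul oU C1 C1) => // x _; rewrite expr2.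
apply: Cinf_mul => //; first apply: Cinf_flat => //.
  by apply: Cinf_subr => //; exact: Cinf_cst.
apply: Cinf_inv => //; first by move=> x _; rewrite gt_eqF // step_den_gt0.
apply: Cinf_add => //; apply: Cinf_flat => //; apply: Cinf_subr => //; exact: Cinf_cst.
Qed.

Lemma bump_eq1 m (x0 : 'cV[R]_m) d x : 0 < d -> `|x - x0| <= d -> bump x0 d x = 1.
Proof.
move=> d0 xd; rewrite /bump big1 // => i _; apply: step_eq1.
rewrite -real_normK ?num_real // exprn_ile1 // normrM normfV (gtr0_norm d0).
rewrite ler_pdivrMr // mul1r; apply: le_trans xd.
by have := cV_norm_ge (x - x0) i; rewrite !mxE.
Qed.

Lemma bump_eq0 m (x0 : 'cV[R]_m) d x : 0 < d -> 2 * d < `|x - x0| -> bump x0 d x = 0.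
Proof.
move=> d0 xd; apply/eqP; rewrite /bump prodf_seq_eq0; apply/hasP.
apply: contrapT => H; move: xd; apply/negP; rewrite -leNgt.
apply: cV_norm_le => [|i]; first by rewrite mulr_ge0 ?ltW.
rewrite !mxE leNgt; apply/negP => xi; apply: H.
exists i; first by rewrite mem_index_enum.
apply/eqP/step_eq0; rewrite -real_normK ?num_real // normrM normfV (gtr0_norm d0).
have : 2 < `|x i 0 - x0 i 0| / d by rewrite ltr_pdivlMr.
move=> H2; nra.
Qed.

(** The ball of radius 3d, where [f] is smooth, and the exterior of radius 2d, where the bump
    vanishes, are open and cover the space. *)
Lemma Cinf_cutoff m (U : set 'cV[R]_m) f x0 d : 0 < d ->
  (forall x, `|x - x0| < 3 * d -> U x) -> Cinf U f ->
  Cinf setT (fun x => bump x0 d x * f x).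
Proof.
move=> d0 HU Cf; apply: Cinf_local => x _.
case: (ltP `|x - x0| (3 * d)) => xd.
  exists [set y | `|y - x0| < 3 * d]; split=> //; first exact: open_near.
  apply: Cinf_mul; [exact: open_near|apply: Cinf_bump; exact: open_near|].
  exact: Cinf_sub HU Cf.
exists [set y | 2 * d < `|y - x0|]; split; first exact: open_far.
  by rewrite /= (lt_le_trans _ xd) // ltr_pM2r // ltr_nat.
apply: Cinf_ext (Cinf_cst _ 0) => [|y yd]; first exact: open_far.
by rewrite bump_eq0 // mul0r.
Qed.

Lemma Cinf_extend m (U : set 'cV[R]_m) f x0 : open U -> U x0 -> Cinf U f ->
  exists g, exists2 d : R, 0 < d & Cinf setT g /\
    forall x, `|x - x0| <= d -> U x /\ g x = f x.
Proof.
move=> oU Ux0 Cf.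
have /cV_nbhsP[d d0 H] : nbhs x0 U by exact: open_nbhs_nbhs.
have d3 : 0 < d / 3 by rewrite divr_gt0.
(* [Cinf_cutoff] asks for [f] on a ball of three times the bump radius, hence a third of the
   available radius. *)
exists (fun x => bump x0 (d / 3) x * f x), (d / 3) => //; split.
  by apply: Cinf_cutoff Cf => // x; rewrite mulrC divfK //; exact: H.
move=> x xd; rewrite bump_eq1 // mul1r; split=> //; apply: H.
by rewrite (le_lt_trans xd) // ltr_pdivrMr // ltr_pMr // ltr1n.
Qed.

End SmoothCutoff.

(** * Parametric integrals *)

Section UnitIntegral.
Variable R : realType.
Implicit Types (g h : R -> R).

Definition I01 g : R := \int[@lebesgue_measure R]_(s in `[0, 1]) g s.

Let continuous_integrable g : continuous g ->
  (@lebesgue_measure R).-integrable `[0, 1] (EFin \o g).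
Proof.
move=> cg; apply: continuous_compact_integrable; first exact: segment_compact.
by apply: continuous_subspaceT.
Qed.

Lemma I01_cst (c : R) : I01 (fun=> c) = c.
Proof.
rewrite /I01 Rintegral_cst //= lebesgue_measure_itv /= lte_fin ltr01.
by rewrite oppr0 addr0 mulr1.
Qed.

Lemma I01_close g h (e : R) : continuous g -> continuous h ->
  (forall s, 0 <= s <= 1 -> `|g s - h s| <= e) -> `|I01 g - I01 h| <= e.
Proof.
move=> cg ch H; rewrite /I01 -RintegralB //; try exact: continuous_integrable.
have cgh : continuous (fun s => g s - h s).
  by move=> s; apply: (@cvgB _ _ _ (nbhs s) _ g h); [exact: cg|exact: ch].
apply: (le_trans (le_normr_Rintegral _ _)) => //; first exact: continuous_integrable.
rewrite -[leRHS]I01_cst; apply: le_Rintegral => //.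
- apply: continuous_integrable => s.
  by apply: (@continuous_comp _ _ _ (fun s => g s - h s) Num.norm); [exact: cgh|exact: norm_continuous].
- by apply: continuous_integrable; exact: cst_continuous.
Qed.

Lemma I01_add g h : continuous g -> continuous h ->
  I01 (fun s => g s + h s) = I01 g + I01 h.
Proof. by move=> cg ch; rewrite /I01 RintegralD //; exact: continuous_integrable. Qed.

Lemma I01_scale (c : R) g : continuous g -> I01 (fun s => c * g s) = c * I01 g.
Proof. by move=> cg; rewrite /I01 RintegralZl //; exact: continuous_integrable. Qed.

Lemma I01_sum (I : Type) (r : seq I) (F : I -> R -> R) :
  (forall i, continuous (F i)) ->
  I01 (fun s => \sum_(i <- r) F i s) = \sum_(i <- r) I01 (F i).
Proof.
move=> cF; elim: r => [|i r IH].
  by rewrite big_nil -[RHS](I01_cst 0); congr I01; apply/funext => s; rewrite big_nil.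
rewrite big_cons -IH -I01_add //.
  by congr I01; apply/funext => s; rewrite big_cons.
by move=> s; apply: cvg_sumr => j _; exact: cF.
Qed.

Lemma I01_derive (G g : R -> R) : continuous g ->
  (forall s : R, is_derive s 1 G (g s)) -> I01 g = G 1 - G 0.
Proof.
move=> cg dG; have dG' (s : R) : derivable G s 1 by have [] := dG s.
have cG (s : R) : {for s, continuous G}.
  by apply: differentiable_continuous; apply/derivable1_diffP.
rewrite /I01 /Rintegral (@continuous_FTC2 R g G 0 1) //.
- exact: continuous_subspaceT.
- split; [by move=> s _|exact: cvg_at_right_filter (cG 0)|].
  exact: cvg_at_left_filter (cG 1).
- by move=> s _; rewrite derive1E; have [_ ->] := dG s.
Qed.

Lemma I01_ext g h : (forall s, 0 <= s <= 1 -> g s = h s) -> I01 g = I01 h.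
Proof.
move=> gh; apply: eq_Rintegral => s; rewrite inE /= in_itv /=; exact: gh.
Qed.

End UnitIntegral.

(** * Differentiation under the integral sign *)

Section ParametricIntegral.
Variables (R : realType) (m : nat).
Implicit Types (f : 'cV[R]_m.+1 -> R) (x v : 'cV[R]_m).

(** A distinguished real variable becomes coordinate 0: the integration variable, the time of a
    flow, or the fibre coordinate. The block form is that of [slit_dual_coord], so the two agree by
    computation. *)
Definition vcons (s : R) x : 'cV[R]_m.+1 := col_mx (const_mx s : 'cV_1) x.

Definition vtail (z : 'cV[R]_m.+1) : 'cV[R]_m := \col_i z (lift ord0 i) 0.

Lemma vcons0 s x : vcons s x ord0 0 = s.
Proof.
have -> : (ord0 : 'I_m.+1) = lshift m (0 : 'I_1) by exact: val_inj.
by rewrite (@col_mxEu _ 1 m 1) mxE.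
Qed.

Lemma vconsS s x i : vcons s x (lift ord0 i) 0 = x i 0.
Proof.
have -> : lift ord0 i = rshift 1 i by exact: val_inj.
by rewrite (@col_mxEd _ 1 m 1).
Qed.

Lemma vtail_cons s x : vtail (vcons s x) = x.
Proof. by apply/colP => i; rewrite mxE vconsS. Qed.

Lemma vcons_tail (z : 'cV[R]_m.+1) : vcons (z ord0 0) (vtail z) = z.
Proof.
apply/colP => i; case: (unliftP ord0 i) => [j|] ->; last by rewrite vcons0.
by rewrite vconsS mxE.
Qed.

Lemma vcons_add s t x y : vcons s x + vcons t y = vcons (s + t) (x + y).
Proof.
apply/colP => i; case: (unliftP ord0 i) => [j|] ->; rewrite mxE.
  by rewrite !vconsS mxE.
by rewrite !vcons0.
Qed.

Lemma vcons_scale a s x : a *: vcons s x = vcons (a * s) (a *: x).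
Proof.
apply/colP => i; case: (unliftP ord0 i) => [j|] ->; rewrite mxE.
  by rewrite !vconsS mxE.
by rewrite !vcons0.
Qed.

Lemma vcons_delta0 : vcons 1 0 = e_ ord0.
Proof.
apply/colP => i; case: (unliftP ord0 i) => [j|] ->.
  by rewrite vconsS !mxE.
by rewrite vcons0 mxE !eqxx.
Qed.

Lemma vcons_deltaS i : vcons 0 (e_ i) = e_ (lift ord0 i).
Proof.
apply/colP => k; case: (unliftP ord0 k) => [j|] ->.
  by rewrite vconsS !mxE (inj_eq (@lift_inj _ ord0)).
by rewrite vcons0 mxE.
Qed.

Lemma vcons_pair_continuous (p : R * 'cV[R]_m) :
  {for p, continuous (fun p : R * 'cV[R]_m => vcons p.1 p.2)}.
Proof.
apply: cV_continuous => i; case: (unliftP ord0 i) => [j|] ->.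
  rewrite (_ : (fun _ => _) = (fun x : 'cV[R]_m => x j 0) \o snd).
    by apply: continuous_comp; [exact: cvg_snd|exact: coord_continuous].
  by apply/funext => y; rewrite vconsS.
rewrite (_ : (fun _ => _) = fst); first exact: cvg_fst.
by apply/funext => y; rewrite vcons0.
Qed.

Lemma vcons_continuousl s x : {for s, continuous (vcons ^~ x)}.
Proof.
apply: cV_continuous => i; case: (unliftP ord0 i) => [j|] ->.
  rewrite (_ : (fun _ => _) = fun=> x j 0); first exact: cst_continuous.
  by apply/funext => y; rewrite vconsS.
rewrite (_ : (fun _ => _) = id); first exact: cvg_id.
by apply/funext => y; rewrite vcons0.
Qed.

Definition J f x : R := I01 (fun s => f (vcons s x)).

Lemma continuous_slice f x : continuous f -> continuous (fun s => f (vcons s x)).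
Proof.
move=> cf s; apply: (@continuous_comp _ _ _ (vcons ^~ x) f); last exact: cf.
exact: vcons_continuousl.
Qed.

(** Compactness of the segment [0, 1] makes continuity in the remaining variables uniform in [s]. *)
Lemma near_slice f x (e : R) : continuous f -> 0 < e ->
  \forall y \near x, forall s, 0 <= s <= 1 -> `|f (vcons s y) - f (vcons s x)| <= e.
Proof.
move=> cf e0.
have /compact_near_coveringP/(_ 'cV[R]_m (nbhs x)
  (fun y s => `|f (vcons s y) - f (vcons s x)| <= e) _) := @segment_compact R 0 1.
move=> H; have {H} := H _ => H.
suff /H : forall s : R, `[0, 1]%classic s -> \forall s' \near s & y \near x,
    `|f (vcons s' y) - f (vcons s' x)| <= e.
  by apply: filterS => y Hy s s01; apply: Hy; rewrite /= in_itv.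
move=> s _.
have c1 : {for (s, x), continuous (fun p : R * 'cV[R]_m => f (vcons p.1 p.2))}.
  apply: (@continuous_comp _ _ _ (fun p => vcons p.1 p.2) f); last exact: cf.
  exact: vcons_pair_continuous.
have e2 : 0 < e / 2 by rewrite divr_gt0.
have /cvgrPdist_le/(_ _ e2) [/= [A B] [nA nB] AB] := c1.
exists (A `&` A, B) => /=; first by split=> //; rewrite setIid.
move=> [s' y] /= [[As' _] By].
have := AB (s', y) (conj As' By); have := AB (s', x) (conj As' (nbhs_singleton nB)).
rewrite /= distrC => H1; rewrite distrC => H2.
rewrite -(subrKA (f (vcons s x))) (le_trans (ler_normD _ _)) // (splitr e).
by rewrite lerD // distrC.
Qed.

Lemma J_continuous f : continuous f -> continuous (J f).
Proof.
move=> cf x; apply/cV_continuousP => e e0.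
have /cV_nbhsP[d d0 H] := near_slice x cf e0; exists d => // y /H Hy; apply: I01_close => //; exact: continuous_slice.
Qed.

(** The difference quotient of the integrand is, by the mean value theorem, a value of the partial
    derivative at a nearby point; [near_slice] makes its convergence uniform in [s], so it passes
    through the integral. *)
Lemma is_derive_J f x i :
  continuous f -> (forall z, derivable f z (e_ (lift ord0 i))) ->
  continuous (partial (lift ord0 i) f) ->
  is_derive x (e_ i : 'cV[R]_m) (J f) (J (partial (lift ord0 i) f) x).
Proof.
move=> cf df cp.
have L : (fun h : R => h^-1 *: (J f (h *: e_ i + x) - J f x)) h @[h --> 0^'] -->
    J (partial (lift ord0 i) f) x.
  apply/cvgrPdist_le => e e0.
  have /cV_nbhsP[d d0 Hd] := near_slice x cp e0.
  near=> h.
  have h0 : h != 0 by near: h; exact: nbhs_dnbhs_neq.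
  have hd : `|h| < d by near: h; exact: dnbhs0_lt.
  have cB : continuous (fun s => f (vcons s (h *: e_ i + x)) - f (vcons s x)).
    move=> s; apply: (continuous_add_fun (f := fun s => f (vcons s _))).
      exact: continuous_slice.
    by apply: (continuous_opp_fun (f := fun s => f (vcons s _))); exact: continuous_slice.
  have ch : continuous (fun s => h^-1 * (f (vcons s (h *: e_ i + x)) - f (vcons s x))).
    move=> s; have := continuous_mul_fun (f := fun=> h^-1) (t := s) _ (cB s).
    by apply; exact: cst_continuous.
  have -> : h^-1 *: (J f (h *: e_ i + x) - J f x) =
      I01 (fun s => h^-1 * (f (vcons s (h *: e_ i + x)) - f (vcons s x))).
    rewrite I01_scale //; congr (_ * _).
    rewrite I01_add; [|exact: continuous_slice|]; last first.
      move=> s; apply: (continuous_opp_fun (f := fun s => f (vcons s _))).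
      exact: continuous_slice.
    congr (_ + _).
    rewrite -mulN1r -I01_scale; last exact: continuous_slice.
    by congr I01; apply/funext => s; rewrite mulN1r.
  apply: I01_close => // [|s s01]; first exact: continuous_slice.
  have [//|s' s'h E] := @line_MVT R _ f (vcons s x) (e_ (lift ord0 i)) h.
  have -> : f (vcons s (h *: e_ i + x)) = f (vcons s x + h *: e_ (lift ord0 i)).
    by rewrite -vcons_deltaS vcons_scale vcons_add mulr0 addr0 [x + _]addrC.
  rewrite E mulKf // distrC.
  have -> : vcons s x + s' *: e_ (lift ord0 i) = vcons s (x + s' *: e_ i).
    by rewrite -vcons_deltaS vcons_scale vcons_add mulr0 addr0.
  apply: Hd => //; rewrite addrAC subrr add0r.
  apply: le_lt_trans hd; apply: cV_norm_le => // j; rewrite !mxE /= andbT.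
  by case: (j == i); rewrite ?mulr1 ?mulr0 ?normr0.
by apply: DeriveDef; [apply/cvg_ex; eexists; exact: L|exact: cvg_lim L].
Unshelve. all: by end_near. Qed.

Lemma Ck_J k f : Ck k setT f -> Ck k setT (J f).
Proof.
elim: k f => [|k IH] f Cf.
all: have C : forall x, setT x -> {for x, continuous (J f)}
 by move=> x _; apply: J_continuous => z; exact: Ck_continuous Cf _.
  by [].
split=> // i.
have E x : is_derive x (e_ i : 'cV[R]_m) (J f) (J (partial (lift ord0 i) f) x).
  apply: is_derive_J => z; [exact: Ck_continuous Cf _|exact: Ck_derivable Cf _|].
  exact: Ck_continuous (Ck_partial _ Cf) _.
split=> [x _|]; first by have [] := E x.
apply: Ck_ext (IH _ (Ck_partial (lift ord0 i) Cf)) => [//|x _].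
by have [_ ->] := E x.
Qed.

Lemma Cinf_J f : Cinf setT f -> Cinf setT (J f).
Proof. by move=> Cf k; exact: Ck_J. Qed.

Lemma partial_J f i x : Cinf setT f -> partial i (J f) x = J (partial (lift ord0 i) f) x.
Proof.
move=> Cf; have [|||_ E] := @is_derive_J f x i; last exact: E.
- by move=> z; exact: Cinf_continuous Cf _.
- by move=> z; exact: Cinf_derivable Cf _.
- by move=> z; exact: Cinf_continuous (Cinf_partial _ Cf) _.
Qed.

End ParametricIntegral.

(** * Primitives in the first coordinate *)

Section Primitive.
Variables (R : realType) (m : nat).
Implicit Types (g : 'cV[R]_m.+1 -> R) (z : 'cV[R]_m.+1).

(** The integral of [g] over the first coordinate from 0 to t, rescaled to [0, 1]: one formula for
    both signs of t, and an instance of the parametric integral [J], with t among the parameters. *)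
Definition prim g z : R :=
  z ord0 0 * I01 (fun s => g (vcons (s * z ord0 0) (vtail z))).

Let prim_fun g (w : 'cV[R]_m.+2) : R :=
  g (vcons (w ord0 0 * w (lift ord0 ord0) 0) (vtail (vtail w))).

Let prim_J g z : prim g z = z ord0 0 * J (prim_fun g) z.
Proof.
rewrite /prim /J; congr (_ * I01 _); apply/funext => s.
by rewrite /prim_fun vtail_cons vcons0 vconsS.
Qed.

Let Cinf_prim_fun g : Cinf setT g -> Cinf setT (prim_fun g).
Proof.
apply: Cinf_comp => // i.
case: (unliftP ord0 i) => [j|] ->.
  apply: (@Cinf_ext _ _ _ (fun w => w (lift ord0 (lift ord0 j)) 0)) => //.
    by move=> x _; rewrite vconsS !mxE.
  exact: Cinf_coord.
apply: (@Cinf_ext _ _ _ (fun w => w ord0 0 * w (lift ord0 ord0) 0)) => //.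
  by move=> x _; rewrite vcons0.
by apply: Cinf_mul => //; exact: Cinf_coord.
Qed.

Lemma Cinf_prim g : Cinf setT g -> Cinf setT (prim g).
Proof.
move=> Cg; rewrite (funext (prim_J g)).
apply: Cinf_mul => //; first exact: Cinf_coord.
exact/Cinf_J/Cinf_prim_fun.
Qed.

Lemma prim_at0 g x : prim g (vcons 0 x) = 0.
Proof. by rewrite /prim vcons0 mul0r. Qed.

Lemma prim_cons g t x : prim g (vcons t x) = t * I01 (fun s => g (vcons (s * t) x)).
Proof. by rewrite /prim vcons0 vtail_cons. Qed.

Lemma prim_sum (I : Type) (r : seq I) (F : I -> 'cV[R]_m.+1 -> R) z :
  (forall i, Cinf setT (F i)) ->
  prim (fun z => \sum_(i <- r) F i z) z = \sum_(i <- r) prim (F i) z.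
Proof.
move=> CF; rewrite /prim I01_sum ?mulr_sumr // => i s.
have cs : continuous (fun s => F i (vcons s (vtail z))).
  by apply: continuous_slice => y; exact: Cinf_continuous (CF i) _.
have cm : {for s, continuous (fun s : R => s * z ord0 0)} by exact: mulrr_continuous.
exact: (continuous_comp cm (cs _)).
Qed.

Lemma Cinf_slice_derive g x (t : R) : Cinf setT g ->
  is_derive t 1 (fun t => g (vcons t x)) (partial ord0 g (vcons t x)).
Proof.
move=> Cg.
have E (s : R) : g (vcons s x) = g (vcons 0 x + s *: e_ ord0).
  by rewrite -vcons_delta0 vcons_scale vcons_add add0r mulr1 scaler0 addr0.
rewrite (funext E) /partial.
have -> : vcons t x = vcons 0 x + t *: e_ ord0.
  by rewrite -vcons_delta0 vcons_scale vcons_add add0r mulr1 scaler0 addr0.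
by apply: is_derive_line; exact: Cinf_derivable Cg _.
Qed.

(** Differentiating t times the integral of g(s t, x) produces the integrand g(s t, x) + s t g'(s t,
    x), which is the s-derivative of s g(s t, x); the fundamental theorem leaves g(t, x). *)
Lemma partial_prim0 g z : Cinf setT g -> partial ord0 (prim g) z = g z.
Proof.
move=> Cg; have CJ := Cinf_J (Cinf_prim_fun Cg).
have E : is_derive z (e_ ord0 : 'cV[R]_m.+1) (prim g)
   (z ord0 0 * partial ord0 (J (prim_fun g)) z + J (prim_fun g) z * 1).
  rewrite (funext (prim_J g)).
  have D1 := is_derive_coord z (e_ ord0) (ord0 : 'I_m.+1).
  have d1 : derivable (fun x : 'cV[R]_m.+1 => x ord0 0) z (e_ ord0) by have [] := D1.
  have := is_derive_mul_fun d1 (Cinf_derivable (i := ord0) (x := z) CJ I).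
  by have [_ ->] := D1; rewrite !mxE eqxx.
have [_ E'] := E; rewrite /partial E' {E E'} partial_J; last exact: Cinf_prim_fun.
have cont f : Cinf setT f -> continuous (fun s => f (vcons s z)).
  by move=> Cf; apply: continuous_slice => y; exact: Cinf_continuous Cf _.
rewrite mulr1 /J -I01_scale; last exact/cont/Cinf_partial/Cinf_prim_fun.
have cF := cont _ (Cinf_prim_fun Cg).
have cP := cont _ (Cinf_partial (lift ord0 ord0) (Cinf_prim_fun Cg)).
have cM : continuous (fun s => z ord0 0 * partial (lift ord0 ord0) (prim_fun g) (vcons s z)).
  move=> s; have := continuous_mul_fun (f := fun=> z ord0 0) (t := s) _ (cP s).
  by apply; exact: cst_continuous.
rewrite -I01_add //.
have Ep s : partial (lift ord0 ord0) (prim_fun g) (vcons s z) =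
    s * partial ord0 g (vcons (s * z ord0 0) (vtail z)).
  have H : is_derive (vcons s z) (e_ (lift ord0 ord0) : 'cV[R]_m.+2) (prim_fun g)
     (s * partial ord0 g (vcons (s * z ord0 0) (vtail z))).
    apply: is_derive_of_line.
    have F (u : R) : prim_fun g (vcons s z + u *: e_ (lift ord0 ord0)) =
        g (vcons (s * z ord0 0 + s * u) (vtail z)).
      rewrite -vcons_deltaS vcons_scale vcons_add mulr0 addr0 /prim_fun.
      rewrite vcons0 vconsS vtail_cons; congr (g (vcons _ _)).
        by rewrite !mxE !eqxx mulr1 mulrDr.
      by apply/colP => j; rewrite !mxE /= mulr0 addr0.
    rewrite (funext F).
    have H1 := Cinf_slice_derive (vtail z) (s * z ord0 0 + s * 0) Cg.
    have H2 : is_derive (0 : R) 1 (fun u : R => s * z ord0 0 + s * u) s.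
      have := @is_derive_add_fun R R^o (fun=> s * z ord0 0) (fun u => s * u) 0 1 
        (derivable_cst _ _ _).
      have H3 : is_derive (0 : R) 1 (fun u : R => s * u) s.
        have := @is_derive_mul_fun R R^o (fun=> s) id 0 1 (derivable_cst _ _ _) 
          (@derivable_id _ _ _ _).
        by rewrite derive_id derive_cst mulr0 addr0 mulr1.
      have H3' : derivable (fun u : R => s * u) 0 1 by have [] := H3.
      by move=> /(_ H3'); rewrite derive_cst add0r; have [_ ->] := H3.
    have := is_derive1_comp (f := fun t => g (vcons t (vtail z)))
      (g := fun u : R => s * z ord0 0 + s * u) H1 H2.
    by rewrite mulr0 addr0 [_ * s]mulrC => H'; exact: H'.
  have [_ E] := H. exact: E.
have -> : (fun s => z ord0 0 * partial (lift ord0 ord0) (prim_fun g) (vcons s z) +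
    prim_fun g (vcons s z)) =
  (fun s => s * (z ord0 0 * partial ord0 g (vcons (s * z ord0 0) (vtail z))) +
    g (vcons (s * z ord0 0) (vtail z))).
  apply/funext => s; rewrite Ep mulrCA; congr (_ + _).
  by rewrite /prim_fun vcons0 vconsS vtail_cons.
apply: etrans (@I01_derive R (fun s => s * g (vcons (s * z ord0 0) (vtail z))) _ _ _) _;
  last first.
- by rewrite mul1r mul0r subr0 mul1r vcons_tail.
- move=> s.
  have H1 := Cinf_slice_derive (vtail z) (s * z ord0 0) Cg.
  have H2 : is_derive s 1 (fun u : R => u * z ord0 0) (z ord0 0).
    have := @is_derive_mul_fun R R^o id (fun=> z ord0 0) s 1 
       (@derivable_id _ _ _ _) (derivable_cst _ _ _).
    by rewrite derive_id derive_cst mulr0 add0r mulr1.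
  have H3 := is_derive1_comp (f := fun t => g (vcons t (vtail z)))
    (g := fun u : R => u * z ord0 0) H1 H2.
  have d3 : derivable (fun s : R => g (vcons (s * z ord0 0) (vtail z))) s 1.
    by have [] := H3.
  have := @is_derive_mul_fun R R^o id _ s 1 (@derivable_id _ _ _ _) d3.
  rewrite derive_id mulr1; have [_ E3] := H3.
  rewrite [X in _ * X](_ : _ = partial ord0 g (vcons (s * z ord0 0) (vtail z)) * z ord0 0).
    by rewrite [_ * z ord0 0]mulrC.
  exact: E3.
- have -> : (fun s => s * (z ord0 0 * partial ord0 g (vcons (s * z ord0 0) (vtail z))) +
    g (vcons (s * z ord0 0) (vtail z))) = (fun s => 
    z ord0 0 * partial (lift ord0 ord0) (prim_fun g) (vcons s z) + prim_fun g (vcons s z)).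
    apply/funext => s; rewrite Ep mulrCA; congr (_ + _).
    by rewrite /prim_fun vcons0 vconsS vtail_cons.
  by move=> s; exact: continuous_add_fun (cM s) (cF s).
Qed.

Lemma partial_primS g i z : Cinf setT g ->
  partial (lift ord0 i) (prim g) z = prim (partial (lift ord0 i) g) z.
Proof.
move=> Cg; have CJ := Cinf_J (Cinf_prim_fun Cg).
have E : is_derive z (e_ (lift ord0 i) : 'cV[R]_m.+1) (prim g)
   (z ord0 0 * partial (lift ord0 i) (J (prim_fun g)) z).
  rewrite (funext (prim_J g)).
  have D1 := is_derive_coord z (e_ (lift ord0 i)) (ord0 : 'I_m.+1).
  have d1 : derivable (fun x : 'cV[R]_m.+1 => x ord0 0) z (e_ (lift ord0 i)).
    by have [] := D1.
  have := is_derive_mul_fun d1 (Cinf_derivable (i := lift ord0 i) (x := z) CJ I).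
  by have [_ ->] := D1; rewrite !mxE /= mulr0 addr0.
have [_ E'] := E; rewrite /partial E' {E E'} partial_J; last exact: Cinf_prim_fun.
rewrite /prim /J; congr (_ * I01 _); apply/funext => s.
have F (h : R) : prim_fun g (vcons s z + h *: e_ (lift ord0 (lift ord0 i))) =
    g (vcons (s * z ord0 0) (vtail z) + h *: e_ (lift ord0 i)).
  rewrite -[in LHS]vcons_deltaS vcons_scale vcons_add mulr0 addr0 /prim_fun vcons0 vconsS.
  rewrite vtail_cons -[in RHS]vcons_deltaS [in RHS]vcons_scale [in RHS]vcons_add.
  rewrite mulr0 addr0; congr (g (vcons (s * _) _)).
    by rewrite !mxE /= mulr0 addr0.
  by apply/colP => j; rewrite !mxE (inj_eq (@lift_inj _ ord0)).
have H : is_derive (vcons s z) (e_ (lift ord0 (lift ord0 i)) : 'cV[R]_m.+2) (prim_fun g)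
     (partial (lift ord0 i) g (vcons (s * z ord0 0) (vtail z))).
  apply: is_derive_of_line; rewrite (funext F).
  have := @is_derive_line _ _ g (vcons (s * z ord0 0) (vtail z)) (e_ (lift ord0 i)) 0.
  rewrite scale0r addr0 => H; apply: H; exact: Cinf_derivable Cg _.
by have [_] := H.
Qed.

End Primitive.

(** * Flows of vector fields *)

Section Geometric.
Variable R : realType.
Implicit Types (u : nat -> R).

Lemma half_pow_cvg0 (C : R) : (fun j => C / 2 ^+ j) @ \oo --> (0 : R).
Proof.
rewrite -(mulr0 C) (_ : (fun j => _) = (fun j => C * (2^-1) ^+ j)).
  apply: cvgM; first exact: cvg_cst.
  by apply: cvg_expr; rewrite normfV ger0_norm ?invf_lt1 ?ltr1n.
by apply/funext => j; rewrite exprVn.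
Qed.

Lemma half_pow_small (C e : R) : 0 < e -> exists N, forall j, (N <= j)%N -> `|C| / 2 ^+ j <= e.
Proof.
move=> e0; have /cvgrPdist_le/(_ _ e0) [N _ HN] := half_pow_cvg0 `|C|.
by exists N => j /HN; rewrite /= sub0r normrN ger0_norm.
Qed.

Lemma half_pow_le (a b C : R) N : (forall j, (N <= j)%N -> a <= b + C / 2 ^+ j) ->
  a <= b.
Proof.
move=> H; apply/ler_addgt0Pr => e e0.
have [N' HN'] := half_pow_small C e0.
apply: le_trans (H (maxn N N') (leq_maxl _ _)) _; rewrite lerD2l.
apply: le_trans (HN' (maxn N N') (leq_maxr _ _)).
by rewrite ler_pM2r ?ler_norm // invr_gt0 exprn_gt0.
Qed.

(** The factor 2 is the sum of the geometric tail. Subtracting the tail from [u] gives a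
    nondecreasing sequence and adding it a nonincreasing one, and the supremum of the first is the
    limit. *)
Lemma geometric_limit u (C : R) : (forall j, `|u j.+1 - u j| <= C / 2 ^+ j) ->
  forall j, `|lim (u @ \oo) - u j| <= 2 * C / 2 ^+ j.
Proof.
move=> H.
have E j : C / 2 ^+ j = 2 * (C / 2 ^+ j.+1).
  by rewrite exprS invfM mulrCA [2 * _]mulrA divff ?mul1r // pnatr_eq0.
have C0 : 0 <= C by have := H 0%N; rewrite expr0 divr1; exact: le_trans.
have p0 j : 0 <= C / 2 ^+ j by rewrite mulr_ge0 // invr_ge0 exprn_ge0.
have ndv : nondecreasing_seq (fun j => u j - 2 * (C / 2 ^+ j)).
  apply/nondecreasing_seqP => j; have := H j; rewrite ler_norml => /andP[H1 H2].
  have := E j; lra.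
have niw : nonincreasing_seq (fun j => u j + 2 * (C / 2 ^+ j)).
  apply/nonincreasing_seqP => j; have := H j; rewrite ler_norml => /andP[H1 H2].
  have := E j; lra.
have vw i j : u i - 2 * (C / 2 ^+ i) <= u j + 2 * (C / 2 ^+ j).
  apply: le_trans (ndv _ _ (leq_maxl i j)) _; apply: le_trans (niw _ _ (leq_maxr i j)).
  have := p0 (maxn i j); lra.
have Hs : has_sup (range (fun j => u j - 2 * (C / 2 ^+ j))).
  split; first by exists (u 0%N - 2 * (C / 2 ^+ 0)); exists 0%N.
  by exists (u 0%N + 2 * (C / 2 ^+ 0)) => _ [i _ <-].
set l := sup (range (fun j => u j - 2 * (C / 2 ^+ j))).
have Hl j : `|l - u j| <= 2 * (C / 2 ^+ j).
  rewrite ler_norml; apply/andP; split.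
    rewrite lerBrDl; apply: (sup_upper_bound Hs); by exists j.
  rewrite lerBlDl; apply: ge_sup; first by case: Hs.
  by move=> _ [i _ <-].
have -> : lim (u @ \oo) = l.
  apply: cvg_lim => //; apply/cvgrPdist_le => e e0.
  have [N HN] := half_pow_small (2 * C) e0.
  exists N => // j Nj /=; apply: le_trans (Hl j) _; apply: le_trans (HN j Nj).
  by rewrite mulrA ler_pM2r ?ler_norm // invr_gt0 exprn_gt0.
by move=> j; rewrite -mulrA.
Qed.

Lemma geometric_limit_continuous m (f : nat -> 'cV[R]_m -> R) x (C : R) (N : set 'cV[R]_m) :
  nbhs x N -> (forall j y, N y -> `|f j.+1 y - f j y| <= C / 2 ^+ j) ->
  (forall j, {for x, continuous (f j)}) ->
  {for x, continuous (fun y => lim ((fun j => f j y) @ \oo))}.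
Proof.
move=> /cV_nbhsP[d d0 Hd] H cf; apply/cV_continuousP => e e0.
have e3 : 0 < e / 3 by rewrite divr_gt0.
have [j0 Hj] := half_pow_small (2 * C) e3; have {}Hj := Hj j0 (leqnn _).
have /cV_continuousP/(_ _ e3)[d' d'0 Hd'] := cf j0.
exists (Num.min d d'); first by rewrite lt_min d0.
move=> y; rewrite lt_min => /andP[yd yd'].
have L y' : N y' -> `|lim ((fun j => f j y') @ \oo) - f j0 y'| <= e / 3.
  move=> Ny; apply: le_trans (geometric_limit (C := C) _ j0) _; first by move=> j; exact: H.
  by apply: le_trans Hj; rewrite ler_pM2r ?ler_norm // invr_gt0 exprn_gt0.
have := L _ (Hd _ yd); have := L x; have := Hd' _ yd'.
have Nx : N x by apply: Hd; rewrite subrr normr0.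
move=> H1 /(_ Nx); move: H1; rewrite !ler_norml.
by move=> /andP[? ?] /andP[? ?] /andP[? ?]; apply/andP; split; lra.
Qed.

(** Uniform convergence of the derivatives on a neighbourhood. The mean value theorem bounds the
    increments of [f j - f n] by a small multiple of [h], uniformly in [j]; letting [j] grow gives
    the same bound for the limit minus [f n], and [f n] is differentiable. *)
Lemma geometric_limit_derive (V : normedModType R) (f df : nat -> V -> R) (x v : V) (C : R)
    (N : set V) :
  nbhs x N -> (forall j y, N y -> is_derive y v (f j) (df j y)) ->
  (forall j y, N y -> `|f j.+1 y - f j y| <= C / 2 ^+ j) ->
  (forall j y, N y -> `|df j.+1 y - df j y| <= C / 2 ^+ j) ->
  is_derive x v (fun y => lim ((fun j => f j y) @ \oo))
    (lim ((fun j => df j x) @ \oo)).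
Proof.
move=> nN Df Hf Hdf.
set F := fun y => lim ((fun j => f j y) @ \oo).
set G := fun y => lim ((fun j => df j y) @ \oo).
have LF y j : N y -> `|F y - f j y| <= 2 * C / 2 ^+ j.
  by move=> Ny; apply: geometric_limit => i; exact: Hf.
have LG y j : N y -> `|G y - df j y| <= 2 * C / 2 ^+ j.
  by move=> Ny; apply: geometric_limit => i; exact: Hdf.
have Nx : N x by exact: nbhs_singleton.
have L : (fun h : R => h^-1 *: (F (h *: v + x) - F x)) h @[h --> 0^'] --> G x.
  apply/cvgrPdist_le => e e0.
  have e8 : 0 < e / 8 by rewrite divr_gt0.
  have [n Hn] := half_pow_small (2 * C) e8.
  have Hn' j : (n <= j)%N -> 2 * C / 2 ^+ j <= e / 8.
    move=> /Hn; apply: le_trans.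
    by rewrite ler_pM2r ?ler_norm // invr_gt0 exprn_gt0.
  have [dn En] := Df n x Nx.
  have : (fun h : R => h^-1 *: (f n (h *: v + x) - f n x)) h @[h --> 0^'] --> df n x.
    by rewrite -En; exact: dn.
  move=> /cvgrPdist_le/(_ _ e8) Hd.
  have NL : \forall h \near (0 : R), forall s : R, `|s| <= `|h| -> N (x + s *: v).
    have : {for (0 : R), continuous (fun s : R => x + s *: v)}.
      have cs : {for (0 : R), continuous (fun s : R => s *: v)} by exact: scalel_continuous.
      by apply: (@cvgD _ _ _ (nbhs (0 : R)) _ (fun=> x)) => //; exact: cvg_cst.
    rewrite /prop_for /continuous_at scale0r addr0 => /(_ _ nN).
    move=> /nbhs_ballP[r /= r0 Hr]; near=> h => s sh; apply: Hr.
    rewrite /ball /= sub0r normrN; apply: le_lt_trans sh _.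
    near: h; apply/nbhs_ballP; exists r => // y.
    by rewrite /ball /= sub0r normrN.
  near=> h.
  have h0 : h != 0 by near: h; exact: nbhs_dnbhs_neq.
  have NL' : forall s : R, `|s| <= `|h| -> N (x + s *: v).
    by near: h; exact: nbhs_dnbhs NL.
  have Hd' : `|df n x - h^-1 *: (f n (h *: v + x) - f n x)| <= e / 8.
    by near: h.
  have Nh : N (x + h *: v) by exact: NL'.
  have K : `|(F (x + h *: v) - f n (x + h *: v)) - (F x - f n x)| <= e / 4 * `|h|.
    apply: (@half_pow_le _ _ (4 * C) n) => j nj.
    have [s sh|s sh E] := @line_MVT R V (fun y => f j y - f n y) x v h.
      have [d1 _] := Df j _ (NL' _ sh); have [d2 _] := Df n _ (NL' _ sh).
      exact: (@derivableB _ _ _ (f j) (f n)).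
    have Ns := NL' _ sh.
    have E' : 'D_v (fun y => f j y - f n y) (x + s *: v) = df j (x + s *: v) - df n (x + s *: v).
      have [d1 <-] := Df j _ Ns; have [d2 <-] := Df n _ Ns.
      exact: (@deriveB _ _ _ (f j) (f n)).
    rewrite {}E' in E.
    have B : `|df j (x + s *: v) - df n (x + s *: v)| <= e / 4.
      have := LG _ j Ns; have := LG _ n Ns; have := Hn' _ nj; have := Hn' _ (leqnn n).
      rewrite !ler_norml => ? ? /andP[? ?] /andP[? ?]; apply/andP; split; lra.
    have := LF _ j Nh; have := LF _ j Nx; move: E; rewrite -![2 * C / _]mulrA -![4 * C / _]mulrA.
    move=> E; have : `|h * (df j (x + s *: v) - df n (x + s *: v))| <= e / 4 * `|h|.
      by rewrite normrM mulrC ler_wpM2r.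
    rewrite -E !ler_norml => /andP[? ?] /andP[? ?] /andP[? ?]; apply/andP; split; lra.
  have -> : h^-1 *: (F (h *: v + x) - F x) = h^-1 *: (f n (h *: v + x) - f n x) +
      h^-1 * ((F (x + h *: v) - f n (x + h *: v)) - (F x - f n x)).
    by rewrite [h *: v + x]addrC /GRing.scale /= -mulrDr; congr (_ * _); ring.
  have K2 : `|h^-1 * ((F (x + h *: v) - f n (x + h *: v)) - (F x - f n x))| <= e / 4.
    by rewrite normrM normfV mulrC ler_pdivrMr ?normr_gt0.
  have := LG _ n Nx; have := Hn' _ (leqnn n); move: Hd' K2.
  rewrite !ler_norml => /andP[? ?] /andP[? ?] ? /andP[? ?]; apply/andP; split; lra.
by apply: DeriveDef; [apply/cvg_ex; eexists; exact: L|exact: cvg_lim L].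
Unshelve. all: by end_near. Qed.

(** Integrating an exponential of rate [l] divides it by [l]. In a norm weighted by such an
    exponential, a large [l] turns Picard's operator into a contraction on any time interval, not
    only on short ones. *)
Lemma exponential_growth (F F' : R -> R) (a l T : R) :
  0 <= a -> 0 < l -> (forall t : R, is_derive t 1 F (F' t)) -> F 0 = 0 ->
  (forall t, `|t| <= T -> `|F' t| <= a * expR (l * `|t|)) ->
  forall t, `|t| <= T -> `|F t| <= a / l * expR (l * `|t|).
Proof.
move=> a0 l0 dF F0 HF.
(* The upper bound for positive times suffices: it is applied to [F], to [- F], and to both with
   time reversed. *)
have pos (H H' : R -> R) t : (forall t : R, is_derive t 1 H (H' t)) -> H 0 = 0 ->
    (forall t, 0 <= t <= T -> H' t <= a * expR (l * t)) ->
    0 <= t <= T -> H t <= a / l * expR (l * t).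
  move=> dH H0 HH /andP[t0 tT].
  pose G s := a / l * expR (l * s) - H s.
  have dG (s : R) : is_derive s 1 G (a * expR (l * s) - H' s).
    have dl : is_derive s 1 (fun s : R => l * s) l.
      have := @is_derive_mul_fun R R^o (fun=> l) id s 1 (derivable_cst _ _ _) 
        (@derivable_id _ _ _ _).
      by rewrite derive_id derive_cst mulr0 addr0 mulr1.
    have dE := is_derive1_comp (is_derive_expR (l * s)) dl.
    have d1 : derivable (fun s : R => expR (l * s)) s 1 by have [] := dE.
    have d2 : derivable (fun s => - H s) s 1 by have [d _] := dH s; exact: derivableN.
    have := @is_derive_mul_fun R R^o (fun=> a / l) _ s 1 (derivable_cst _ _ _) d1.
    rewrite derive_cst mulr0 addr0; have [_ E] := dE => dM.
    have d3 : derivable (fun s : R => a / l * expR (l * s)) s 1 by have [] := dM.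
    have := @is_derive_add_fun R R^o _ _ s 1 d3 d2; have [_ ->] := dM.
    have -> : 'D_1 (fun s => - H s) s = - H' s.
      by have [d <-] := dH s; exact: deriveN.
    rewrite (_ : 'D_1 (fun s : R => expR (l * s)) s = expR (l * s) * l).
      have -> : a / l * (expR (l * s) * l) = a * expR (l * s).
        by field; rewrite gt_eqF.
      exact.
    exact: E.
  have [|c] := @MVT_segment R G (fun s => a * expR (l * s) - H' s) 0 t t0 (fun s _ => dG s).
    by apply: derivable_within_continuous => s _; have [] := dG s.
  rewrite in_itv /= => /andP[c0 ct] E.
  have P : 0 <= (a * expR (l * c) - H' c) * t.
    by rewrite mulr_ge0 // subr_ge0 HH // c0 (le_trans ct).
  have G0 : 0 <= G 0.
    by rewrite /G mulr0 expR0 mulr1 H0 subr0 divr_ge0 // ltW.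
  by move: E; rewrite subr0 {1}/G => E; rewrite -subr_ge0; lra.
have dN (H H' : R -> R) : (forall t : R, is_derive t 1 H (H' t)) ->
    forall t : R, is_derive t 1 (fun t => - H t) (- H' t).
  by move=> dH t; have := dH t; exact: is_deriveN.
have dV (H H' : R -> R) : (forall t : R, is_derive t 1 H (H' t)) ->
    forall t : R, is_derive t 1 (fun t => H (- t)) (- H' (- t)).
  move=> dH t; have := is_derive1_comp (dH (- t)) (is_deriveNid t 1).
  by rewrite mulrN1.
move=> t; case: (leP 0 t) => t0 tT; rewrite ler_norml.
- rewrite ger0_norm // in tT *; rewrite lerNl.
  have tI : 0 <= t <= T by rewrite t0.
  rewrite (pos _ _ _ (dN _ _ dF)) ?F0 ?oppr0 //= ?(pos _ _ _ dF) //.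
    move=> s /andP[s0 sT]; have := HF s; rewrite ger0_norm // => /(_ sT).
    by rewrite ler_norml => /andP[_].
  move=> s /andP[s0 sT]; have := HF s; rewrite ger0_norm // => /(_ sT).
  by rewrite ler_norml lerNl => /andP[].
- rewrite ltr0_norm // in tT *; rewrite lerNl.
  have tI : 0 <= - t <= T by rewrite tT oppr_ge0 ltW.
  have := pos _ _ _ (dN _ _ (dV _ _ dF)) _ _ tI; have := pos _ _ _ (dV _ _ dF) _ _ tI.
  rewrite !opprK !oppr0 !F0 ?oppr0 => H1 H2; rewrite H1 ?H2 //.
    move=> s /andP[s0 sT]; have := HF (- s); rewrite normrN ger0_norm // => /(_ sT).
    by rewrite opprK ler_norml => /andP[].
  move=> s /andP[s0 sT]; have := HF (- s); rewrite normrN ger0_norm // => /(_ sT).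
  by rewrite ler_norml lerNl => /andP[].
Qed.

End Geometric.

(** * Compact balls and Lipschitz bounds *)

Section Compactness.
Variables (R : realType) (m : nat).

(** A ball of the sup norm is a product of segments. *)
Lemma compact_closed_ball (x0 : 'cV[R]_m) (K : R) :
  compact [set x : 'cV[R]_m | `|x - x0| <= K].
Proof.
have [K0|K0] := ltP K 0.
  rewrite (_ : mkset _ = set0); first exact: compact0.
  by apply/seteqP; split=> // x /= xK; have := le_lt_trans xK K0; rewrite normr_lt0.
pose A i : set R := `[x0 i 0 - K, x0 i 0 + K]%classic.
have cA : compact [set v : 'rV[R]_m | forall i, A i (v ord0 i)].
  by apply: rV_compact => i; exact: segment_compact.
pose tr (v : 'rV[R]_m) : 'cV[R]_m := v^T.
have ctr : continuous tr.
  move=> v; apply: cV_continuous => i.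
  have -> : (fun t : 'rV[R]_m => tr t i 0) = (fun t => t 0 i).
    by apply/funext => t; rewrite mxE.
  exact: coord_continuous.
have -> : [set x : 'cV[R]_m | `|x - x0| <= K] = tr @` [set v : 'rV[R]_m | forall i, A i (v ord0 i)].
  apply/seteqP; split=> [x /= xK|_ [v Hv <-]] /=.
    exists x^T; last by rewrite /tr trmxK.
    move=> i; rewrite /A /= in_itv /= mxE -ler_distl.
    by apply: le_trans xK; have := cV_norm_ge (x - x0) i; rewrite !mxE.
  apply: cV_norm_le => // i; rewrite !mxE ler_distl.
  by have := Hv i; rewrite /A /= in_itv.
by apply: continuous_compact => //; exact: continuous_subspaceT.
Qed.

Lemma continuous_bounded (g : 'cV[R]_m -> R) (K : R) : continuous g ->
  exists2 B : R, 0 <= B & forall x, `|x| <= K -> `|g x| <= B.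
Proof.
move=> cg; have cK := @compact_closed_ball (0 : 'cV[R]_m) K.
have : compact (g @` [set x : 'cV[R]_m | `|x - 0| <= K]).
  by apply: continuous_compact => //; exact: continuous_subspaceT.
move=> /compact_bounded [B [_ HB]].
exists (`|B| + 1); first by rewrite addr_ge0.
move=> x xK; apply: HB; last by exists x => //=; rewrite subr0.
by rewrite (le_lt_trans (ler_norm B)) // ltrDl.
Qed.

Lemma finite_upper_bound (I : finType) (P : I -> R -> Prop) :
  (forall i (a b : R), P i a -> a <= b -> P i b) ->
  (forall i, exists a, P i a) -> exists2 a, 0 <= a & forall i, P i a.
Proof.
move=> mono H; have /choice[f Hf] := H.
exists (\sum_i `|f i|); first exact: sumr_ge0.
move=> i; apply: mono (Hf i) _; rewrite (bigD1 i) //=.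
by rewrite (le_trans (ler_norm _)) // lerDl sumr_ge0.
Qed.

Lemma Cinf_lipschitz (g : 'cV[R]_m -> R) (K : R) : Cinf setT g ->
  exists2 L : R, 0 <= L & forall x y, `|x| <= K -> `|y| <= K ->
    `|g x - g y| <= L * `|x - y|.
Proof.
move=> Cg.
(* The intermediate point of [line_MVT] is y + s (x - y) with |s| <= 1 and [s] of unknown sign, so
   its norm is bounded by K + 2K. *)
have [B B0 HB] : exists2 B, 0 <= B & forall i x, `|x| <= 3 * K -> `|partial i g x| <= B.
  apply: (@finite_upper_bound _ (fun i B => forall x, `|x| <= 3 * K -> `|partial i g x| <= B)).
    by move=> i a b Ha ab x /Ha; move/le_trans; exact.
  move=> i; have [|B _ HB] := @continuous_bounded (partial i g) (3 * K); last by exists B.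
  by move=> x; exact: Cinf_continuous (Cinf_partial i Cg) _.
exists (\sum_(i < m) B); first by apply: sumr_ge0.
move=> x y xK yK.
have D z : is_derive z (x - y) g (\sum_i partial i g z * (x - y) i 0).
  by apply: (@is_derive_partials _ _ setT) => //; exact: Cg.
have [s _|s] := @line_MVT R _ g y (x - y) 1; first by have [] := D (y + s *: (x - y)).
rewrite normr1 => s1; rewrite scale1r [y + _]addrC subrK mul1r => ->.
have [_ ->] := D (y + s *: (x - y)).
apply: le_trans (ler_norm_sum _ _ _) _; rewrite mulr_suml; apply: ler_sum => i _.
rewrite normrM ler_pM ?cV_norm_ge //; apply: HB.
apply: le_trans (ler_normD _ _) _; rewrite normrZ.
have : `|x - y| <= 2 * K by apply: le_trans (ler_normB _ _) _; lra.
move=> H; have : `|s| * `|x - y| <= 1 * (2 * K) by apply: ler_pM.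
lra.
Qed.

End Compactness.

Definition smooth_map (R : realType) m p (g : 'cV[R]_m -> 'cV[R]_p) : Prop :=
  forall i, Cinf setT (fun x => g x i 0).

Section SmoothMaps.
Variables (R : realType).

Lemma smooth_map_comp m p q (f : 'cV[R]_p -> 'cV[R]_q) (g : 'cV[R]_m -> 'cV[R]_p) :
  smooth_map f -> smooth_map g -> smooth_map (f \o g).
Proof. by move=> Cf Cg i; exact: Cinf_comp (Cg) (Cf i). Qed.

Lemma smooth_map_continuous m p (g : 'cV[R]_m -> 'cV[R]_p) : smooth_map g -> continuous g.
Proof. by move=> Cg x; apply: cV_continuous => i; exact: Cinf_continuous (Cg i) _. Qed.

Lemma smooth_map_lipschitz m p (g : 'cV[R]_m -> 'cV[R]_p) (K : R) : smooth_map g ->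
  exists2 L : R, 0 <= L & forall x y, `|x| <= K -> `|y| <= K ->
    `|g x - g y| <= L * `|x - y|.
Proof.
move=> Cg.
have [L L0 HL] : exists2 L, 0 <= L & forall i x y, `|x| <= K -> `|y| <= K ->
    `|g x i 0 - g y i 0| <= L * `|x - y|.
  apply: (@finite_upper_bound _ _ (fun i L => forall x y, `|x| <= K -> `|y| <= K ->
    `|g x i 0 - g y i 0| <= L * `|x - y|)).
    by move=> i a b Ha ab x y xK yK; apply: le_trans (Ha _ _ xK yK) _; rewrite ler_wpM2r.
  by move=> i; have [L _ HL] := Cinf_lipschitz K (Cg i); exists L.
exists L => // x y xK yK; apply: cV_norm_le => [|i]; first by rewrite mulr_ge0.
by rewrite !mxE; exact: HL.
Qed.

End SmoothMaps.

(** * Picard iteration *)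

Section Picard.
Variables (R : realType).

Section Iterates.
Variables (m : nat) (X : 'cV[R]_m -> 'cV[R]_m).

(** The iterates are functions of (t, x) jointly, so each inherits smoothness in all variables from
    the previous one through [prim]. *)
Fixpoint picard (j : nat) (z : 'cV[R]_m.+1) : 'cV[R]_m :=
  if j is j'.+1 then
    vtail z + \col_i prim (fun z => X (picard j' z) i 0) z
  else vtail z.

Definition flow (z : 'cV[R]_m.+1) : 'cV[R]_m :=
  \col_i lim ((fun j => picard j z i 0) @ \oo).

(** A local bound on all iterates at once, used in place of boundedness of the field. The tangent
    lift of a bounded field is linear in v and hence in general unbounded, but this weaker property
    passes to it. *)
Definition picard_bounded : Prop :=
  forall x0 (T : R), exists d K : R, 0 < d /\
    forall j t x, `|x - x0| < d -> `|t| <= T -> `|picard j (vcons t x)| <= K.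

Hypothesis CX : smooth_map X.

Lemma smooth_picard j : smooth_map (picard j).
Proof.
have Ct i : Cinf setT (fun z : 'cV[R]_m.+1 => vtail z i 0).
  apply: (@Cinf_ext _ _ _ (fun z => z (lift ord0 i) 0)) => [//|z _|].
    by rewrite mxE.
  exact: Cinf_coord.
elim: j => [|j IH] i //=.
apply: (@Cinf_ext _ _ _ (fun z => vtail z i 0 + prim (fun z => X (picard j z) i 0) z)) => //.
  by move=> z _; rewrite !mxE.
by apply: Cinf_add => //; apply: Cinf_prim; exact: smooth_map_comp.
Qed.

Lemma picard_at0 j x : picard j (vcons 0 x) = x.
Proof.
case: j => [|j] /=; first by rewrite vtail_cons.
by rewrite vtail_cons; apply/colP => i; rewrite mxE [X in _ + X]mxE prim_at0 addr0.
Qed.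

Lemma is_derive_picard j i x (t : R) :
  is_derive t 1 (fun t => picard j.+1 (vcons t x) i 0) (X (picard j (vcons t x)) i 0).
Proof.
have -> : (fun t => picard j.+1 (vcons t x) i 0) =
   (fun t => x i 0 + prim (fun z => X (picard j z) i 0) (vcons t x)).
  by apply/funext => s; rewrite /= vtail_cons mxE [X in _ + X]mxE.
have Cg : Cinf setT (fun z => X (picard j z) i 0).
  by apply: smooth_map_comp => //; exact: smooth_picard.
have := Cinf_slice_derive x t (Cinf_prim Cg); rewrite partial_prim0 // => H.
have d : derivable (fun t => prim (fun z => X (picard j z) i 0) (vcons t x)) t 1.
  by have [] := H.
have := @is_derive_add_fun R R^o (fun=> x i 0) _ t 1 (derivable_cst _ _ _) d.
by rewrite derive_cst add0r; have [_ ->] := H.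
Qed.

Lemma bounded_picard : (exists B : R, forall x, `|X x| <= B) -> picard_bounded.
Proof.
move=> [B HB] x0 T; exists 1, (`|x0| + 1 + B * `|T|); split=> // j t x xd tT.
have B0 : 0 <= B by exact: le_trans (HB 0).
have xx0 : `|x| <= `|x0| + 1.
  by rewrite -(subrK x0 x) (le_trans (ler_normD _ _)) // addrC lerD2l ltW.
case: j => [|j]; first by rewrite /= vtail_cons (le_trans xx0) // lerDl mulr_ge0.
rewrite -(subrK x (picard _ _)) (le_trans (ler_normD _ _)) // addrC lerD //.
apply: cV_norm_le => [|i]; first by rewrite mulr_ge0.
have E (s : R) : picard j.+1 (vcons s x) i 0 =
   (fun u => picard j.+1 (vcons u x) i 0) (0 + s *: 1).
  by rewrite add0r [s *: 1]mulr1.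
have [s _|s _] := @line_MVT R R^o (fun u => picard j.+1 (vcons u x) i 0) 0 1 t.
  by have [] := is_derive_picard j i x (0 + s *: 1).
rewrite -E -[picard j.+1 (vcons 0 x)]/(picard j.+1 (vcons 0 x)) picard_at0 !mxE => ->.
have [_ ->] := is_derive_picard j i x (0 + s *: 1).
rewrite normrM mulrC ler_pM //; first exact: le_trans (cV_norm_ge _ _) (HB _).
by rewrite (le_trans tT) // ler_norm.
Qed.

(** All iterates stay in a ball on which [X] is Lipschitz. The differences of successive iterates
    are measured against exp(l |t|), and each iteration multiplies the bound by L / l. *)
Lemma picard_geometric : picard_bounded -> forall x0 (T : R), exists d C : R,
  0 < d /\ forall j t x, `|x - x0| < d -> `|t| <= T ->
    `|picard j.+1 (vcons t x) - picard j (vcons t x)| <= C / 2 ^+ j.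
Proof.
move=> BX x0 T; have [d [K [d0 HK]]] := BX x0 T.
have [L L0 HL] := smooth_map_lipschitz K CX.
(* This rate gives L / l <= 1/2; adding 1 keeps [l] positive when L = 0. *)
pose l := 2 * L + 1; have l0 : 0 < l by rewrite /l; lra.
exists d, (2 * K * expR (l * T)); split=> // j t x xd tT.
have K0 : 0 <= K by apply: le_trans (HK 0%N t x xd tT).
suff H : `|picard j.+1 (vcons t x) - picard j (vcons t x)| <=
    2 * K / 2 ^+ j * expR (l * `|t|).
  apply: le_trans H _; rewrite [leRHS]mulrAC ler_wpM2l ?mulr_ge0 ?invr_ge0 ?exprn_ge0 //.
  by rewrite ler_expR ler_pM2l.
elim: j t tT => [|j IH] t tT.
  apply: le_trans (ler_normB _ _) _; apply: (@le_trans _ _ (2 * K)).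
    by have := HK 1%N t x xd tT; have := HK 0%N t x xd tT; lra.
  rewrite expr0 divr1 ler_peMr ?mulr_ge0 // -expR0 ler_expR.
  by rewrite mulr_ge0 // ltW.
apply: cV_norm_le => [|i]; first by rewrite !mulr_ge0 ?expR_ge0 ?invr_ge0 ?exprn_ge0.
rewrite !mxE.
have a0 : 0 <= L * (2 * K / 2 ^+ j) by rewrite !mulr_ge0 // invr_ge0 exprn_ge0.
pose F s := picard j.+2 (vcons s x) i 0 - picard j.+1 (vcons s x) i 0.
pose F' s := X (picard j.+1 (vcons s x)) i 0 - X (picard j (vcons s x)) i 0.
have dF (s : R) : is_derive s 1 F (F' s).
  have D1 := is_derive_picard j.+1 i x s; have D2 := is_derive_picard j i x s.
  exact: (is_deriveB D1 D2).
have F0 : F 0 = 0 by rewrite /F !picard_at0 subrr.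
have HF s : `|s| <= T -> `|F' s| <= L * (2 * K / 2 ^+ j) * expR (l * `|s|).
  move=> sT; rewrite -mulrA.
  apply: (@le_trans _ _ (L * `|picard j.+1 (vcons s x) - picard j (vcons s x)|)).
    apply: le_trans (HL _ _ (HK _ _ _ xd sT) (HK _ _ _ xd sT)).
    by have := cV_norm_ge (X (picard j.+1 (vcons s x)) - X (picard j (vcons s x))) i;
      rewrite mxE [X in _ + X]mxE.
  by rewrite ler_wpM2l // IH.
have := exponential_growth a0 l0 dF F0 HF tT; rewrite /F /= !mxE => H.
apply: le_trans H _; rewrite ler_wpM2r ?expR_ge0 //.
rewrite ler_pdivrMr // exprS invfM.
set u := 2 ^+ j; have u0 : 0 <= u^-1 by rewrite invr_ge0 exprn_ge0.
have -> : 2 * K * (2^-1 / u) * l = K / u * l by field; rewrite /u expf_neq0.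
have -> : L * (2 * K / u) = K / u * (2 * L) by ring.
by rewrite ler_wpM2l ?mulr_ge0 // /l; lra.
Qed.

End Iterates.
End Picard.

(** * The tangent lift of a vector field *)

Section TangentLift.
Variables (R : realType) (m : nat) (X : 'cV[R]_m -> 'cV[R]_m).

Definition dmap p (g : 'cV[R]_m -> 'cV[R]_p) (x v : 'cV[R]_m) : 'cV[R]_p :=
  \col_i \sum_k partial k (fun y => g y i 0) x * v k 0.

(** The complete lift of [X] to the tangent bundle, (x, v) -> (X x, dX_x v). Its flow is the
    differential of the flow of [X]. *)
Definition tlift (w : 'cV[R]_(m + m)) : 'cV[R]_(m + m) :=
  col_mx (X (usubmx w)) (dmap X (usubmx w) (dsubmx w)).

Hypothesis CX : smooth_map X.

Lemma smooth_tlift : smooth_map tlift.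
Proof.
have Cu : smooth_map (@usubmx R m m 1).
  by move=> i; apply: Cinf_ext (Cinf_coord _ (lshift m i)) => // x _; rewrite mxE.
move=> i; case: (split_ordP i) => k ->.
  apply: (@Cinf_ext _ _ _ (fun x => X (usubmx x) k 0)) => [//|x _|].
    by rewrite col_mxEu.
  exact: Cinf_comp (Cu) (CX k).
apply: (@Cinf_ext _ _ _ (fun x => \sum_l partial l (fun y => X y k 0) (usubmx x) *
    x (rshift m l) 0)) => [//|x _|].
  by rewrite col_mxEd mxE; apply: eq_bigr => l _; rewrite mxE.
apply: Cinf_sum => // l _; apply: Cinf_mul => //; last exact: Cinf_coord.
exact: Cinf_comp (Cu) (Cinf_partial l (CX k)).
Qed.

(** Differentiation in x commutes with Picard iteration, so the space derivatives of the iterates of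
    [X] converge as soon as the iterates of the lift do. *)
Lemma picard_tlift j t x v :
  picard tlift j (vcons t (col_mx x v)) =
  col_mx (picard X j (vcons t x))
    (\col_i \sum_k partial (lift ord0 k) (fun z => picard X j z i 0) (vcons t x) * v k 0).
Proof.
elim: j t => [|j IH] t /=; rewrite !vtail_cons.
  congr col_mx; apply/colP => i; rewrite mxE (bigD1 i) //= big1 => [|k ki].
    have -> : (fun z : 'cV[R]_m.+1 => vtail z i 0) = (fun z => z (lift ord0 i) 0).
      by apply/funext => z; rewrite mxE.
    have [_ E] := is_derive_coord (vcons t x) (e_ (lift ord0 i)) (lift ord0 i).
    by rewrite /partial E !mxE !eqxx mul1r addr0.
  have -> : (fun z : 'cV[R]_m.+1 => vtail z i 0) = (fun z => z (lift ord0 i) 0).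
    by apply/funext => z; rewrite mxE.
  have [_ E] := is_derive_coord (vcons t x) (e_ (lift ord0 k)) (lift ord0 i).
  by rewrite /partial E !mxE (inj_eq (@lift_inj _ ord0)) eq_sym (negbTE ki) mul0r.
have CP l : Cinf setT (fun z => picard X j z l 0) by exact: smooth_picard.
have Cg i : Cinf setT (fun z => X (picard X j z) i 0).
  by apply: smooth_map_comp => //; exact: smooth_picard.
have prim_ext (g g' : 'cV[R]_(m + m).+1 -> R) (h : 'cV[R]_m.+1 -> R) :
    (forall s, g (vcons s (col_mx x v)) = h (vcons s x)) ->
    prim g (vcons t (col_mx x v)) = prim h (vcons t x).
  by move=> gh; rewrite !prim_cons; congr (_ * I01 _); apply/funext => s.
apply/colP => i; case: (split_ordP i) => k -> {i}; rewrite mxE.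
  rewrite !col_mxEu !mxE; congr (_ + _).
  by apply: prim_ext => [//|s]; rewrite IH /tlift col_mxKu col_mxEu.
rewrite !col_mxEd !mxE.
under [RHS]eq_bigr => i _.
  have -> : partial (lift ord0 i) (fun z => (vtail z + 
      \col_i0 prim (fun z0 => X (picard X j z0) i0 0) z) k 0) (vcons t x) =
    (i == k)%:R + prim (fun z => \sum_l partial l (fun y => X y k 0) (picard X j z) *
      partial (lift ord0 i) (fun z => picard X j z l 0) z) (vcons t x).
    have -> : (fun z => (vtail z + \col_i0 prim (fun z0 => X (picard X j z0) i0 0) z) k 0) =
      (fun z => z (lift ord0 k) 0 + prim (fun z0 => X (picard X j z0) k 0) z).
      by apply/funext => z; rewrite !mxE.
    have D1 := is_derive_coord (vcons t x) (e_ (lift ord0 i)) (lift ord0 k).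
    have d1 : derivable (fun z : 'cV[R]_m.+1 => z (lift ord0 k) 0) (vcons t x) (e_ (lift ord0 i)).
      by have [] := D1.
    have [_] := is_derive_add_fun d1
      (Cinf_derivable (i := lift ord0 i) (x := vcons t x) (Cinf_prim (Cg k)) I).
    rewrite /partial => ->; have [_ ->] := D1; congr (_ + _).
      by rewrite !mxE (inj_eq (@lift_inj _ ord0)) andbT eq_sym.
    rewrite -/(partial _ _ _) partial_primS //; congr (prim _ _); apply/funext => z.
    have dP l : derivable (fun z => picard X j z l 0) z (e_ (lift ord0 i)).
      exact: Cinf_derivable (CP l) _.
    have [_ E] := @is_derive_comp R _ _ setT (fun y => X y k 0) (picard X j) z
      (e_ (lift ord0 i)) (@cV_openT _ _) I (CX k 1%N) dP.
    exact: E.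
  rewrite mulrDl; over.
rewrite big_split /= (bigD1 k) //= big1 => [|i ik]; last by rewrite (negbTE ik) mul0r.
rewrite eqxx mul1r addr0; congr (_ + _).
have Cs i : Cinf setT (fun z => \sum_l partial l (fun y => X y k 0) (picard X j z) *
      partial (lift ord0 i) (fun z => picard X j z l 0) z).
  apply: Cinf_sum => // l _; apply: Cinf_mul => //; last exact: Cinf_partial.
  by apply: Cinf_comp (Cinf_partial l (CX k)) => //; exact: smooth_picard.
transitivity (prim (fun z => \sum_i (\sum_l partial l (fun y => X y k 0) (picard X j z) *
      partial (lift ord0 i) (fun z => picard X j z l 0) z) * v i 0) (vcons t x)).
  apply: prim_ext => [//|s]; rewrite IH /tlift col_mxKu col_mxKd col_mxEd mxE.
  under eq_bigr => l _ do rewrite mxE mulr_sumr.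
  rewrite exchange_big /=; apply: eq_bigr => i _; rewrite mulr_suml.
  by apply: eq_bigr => l _; rewrite mulrA.
rewrite prim_sum => [|i]; last by apply: Cinf_mul => //; exact: Cinf_cst.
apply: eq_bigr => i _; rewrite !prim_cons -[RHS]mulrA; congr (_ * _).
rewrite [RHS]mulrC -I01_scale => [|s]; first by congr I01; apply/funext => s; rewrite mulrC.
have cm : {for s, continuous (fun s : R => s * t)} by exact: mulrr_continuous.
have cs : continuous (fun s => \sum_l partial l (fun y => X y k 0) (picard X j (vcons s x)) *
      partial (lift ord0 i) (fun z => picard X j z l 0) (vcons s x)).
  by apply: (continuous_slice (f := fun z => \sum_l partial l (fun y => X y k 0) (picard X j z) *
      partial (lift ord0 i) (fun z => picard X j z l 0) z)) => y; 
    exact: Cinf_continuous (Cs i) _.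
exact: (continuous_comp cm (cs _)).
Qed.

(** The base part of a lifted iterate is an iterate of [X] and stays in a ball of radius K, on which
    the entries of dX are bounded by B. The fibre part then solves a linear recursion and grows at
    most exponentially, uniformly in [j]. *)
Lemma picard_bounded_tlift : picard_bounded X -> picard_bounded tlift.
Proof.
move=> BX w0 T; have [d [K [d0 HK]]] := BX (usubmx w0) T.
have [B B0 HB] : exists2 B : R, 0 <= B & forall p : 'I_m * 'I_m, forall x, `|x| <= K ->
    `|partial p.2 (fun y => X y p.1 0) x| <= B.
  apply: (@finite_upper_bound R _ (fun (p : 'I_m * 'I_m) B => forall x, `|x| <= K ->
    `|partial p.2 (fun y => X y p.1 0) x| <= B)).
    by move=> p a b Ha ab x /Ha; move/le_trans; exact.
  move=> p; have [|B _ HB] := @continuous_bounded R m (partial p.2 (fun y => X y p.1 0)) K.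
    by move=> x; exact: Cinf_continuous (Cinf_partial _ (CX p.1)) _.
  by exists B.
(* A row of dX has [m] entries bounded by B, so m B plays the role of the Lipschitz constant and one
   iteration adds at most half of the bound 2 V exp(l |t|). *)
pose l := 2 * (m%:R * B) + 1.
have mB : 0 <= m%:R * B by rewrite mulr_ge0.
have l0 : 0 < l by rewrite /l; lra.
pose V := `|w0| + 1; have V1 : 1 <= V by rewrite /V lerDr.
have [T0|T0] := ltP T 0.
  exists 1, 0; split=> // j t x _ tT.
  by have := le_lt_trans tT T0; rewrite normr_lt0.
exists (Num.min d 1), (`|K| + 2 * V * expR (l * T)); split; first by rewrite lt_min d0 ltr01.
move=> j t w; rewrite lt_min => /andP[wd w1] tT.
have xd : `|usubmx w - usubmx w0| < d.
  apply: le_lt_trans wd; apply: cV_norm_le => // i.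
  by have := cV_norm_ge (w - w0) (lshift m i); rewrite !mxE.
have wV : `|w| <= V.
  by rewrite -(subrK w0 w) (le_trans (ler_normD _ _)) // addrC lerD2l ltW.
have E0 j' s : usubmx (picard tlift j' (vcons s w)) = picard X j' (vcons s (usubmx w)).
  by rewrite -[w in LHS]vsubmxK picard_tlift col_mxKu.
have V0 : 0 <= V by lra.
suff H i : `|dsubmx (picard tlift j (vcons t w)) i 0| <= 2 * V * expR (l * `|t|).
  apply: cV_norm_le => [|i]; first by rewrite addr_ge0 // !mulr_ge0 ?expR_ge0.
  case: (split_ordP i) => k -> {i}.
    apply: (@le_trans _ _ `|K|); last by rewrite lerDl !mulr_ge0 ?expR_ge0.
    apply: le_trans (ler_norm K); apply: le_trans (HK j t _ xd tT); rewrite -E0.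
    by have := cV_norm_ge (usubmx (picard tlift j (vcons t w))) k; rewrite mxE.
  have := H k; rewrite mxE => /le_trans; apply.
  rewrite (@le_trans _ _ (2 * V * expR (l * T))) ?lerDr //.
  by rewrite ler_wpM2l ?mulr_ge0 // ler_expR ler_pM2l.
elim: j t tT i => [|j IH] t tT i.
  rewrite /= vtail_cons mxE; apply: le_trans (cV_norm_ge _ _) _.
  apply: le_trans wV _; apply: (@le_trans _ _ (2 * V)); first lra.
  rewrite ler_peMr ?mulr_ge0 // -expR0 ler_expR.
  by rewrite mulr_ge0 // ltW.
pose F s := picard tlift j.+1 (vcons s w) (rshift m i) 0 - w (rshift m i) 0.
pose F' s := tlift (picard tlift j (vcons s w)) (rshift m i) 0.
have dF (s : R) : is_derive s 1 F (F' s).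
  have D1 := is_derive_picard smooth_tlift j (rshift m i) w s.
  have := is_deriveB D1 (is_derive_cst (w (rshift m i) 0) s 1).
  by rewrite subr0.
have F0 : F 0 = 0 by rewrite /F picard_at0 subrr.
have a0 : 0 <= m%:R * B * (2 * V) by rewrite !mulr_ge0.
have HF s : `|s| <= T -> `|F' s| <= m%:R * B * (2 * V) * expR (l * `|s|).
  move=> sT; rewrite /F' /tlift col_mxEd mxE E0.
  apply: le_trans (ler_norm_sum _ _ _) _.
  apply: (@le_trans _ _ (\sum_(i < m) B * (2 * V * expR (l * `|s|)))).
    apply: ler_sum => k _; rewrite normrM ler_pM ?IH //.
    exact: (HB (i, k)) (HK _ _ _ xd sT).
  by rewrite sumr_const card_ord -[_ *+ m]mulr_natl !mulrA.
have := exponential_growth a0 l0 dF F0 HF tT; rewrite /F => H.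
rewrite mxE; set p := picard _ _ _ _ _ in H *.
have {}H : `|p| <= `|w (rshift m i) 0| + m%:R * B * (2 * V) / l * expR (l * `|t|).
  rewrite -(subrK (w (rshift m i) 0) p) (le_trans (ler_normD _ _)) //.
  by rewrite addrC lerD2l.
apply: le_trans H _.
have e1 : 1 <= expR (l * `|t|) by rewrite -expR0 ler_expR mulr_ge0 // ltW.
have q : m%:R * B * (2 * V) / l <= V.
  rewrite ler_pdivrMr // mulrA [leRHS]mulrC ler_wpM2r // /l; lra.
have := le_trans (cV_norm_ge w (rshift m i)) wV.
move=> H1; have : V <= V * expR (l * `|t|) by rewrite ler_peMr.
have : m%:R * B * (2 * V) / l * expR (l * `|t|) <= V * expR (l * `|t|).
  by rewrite ler_wpM2r ?expR_ge0.
lra.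
Qed.

End TangentLift.

(** * Smoothness and group law of the flow *)

Section SmoothFlow.
Variable R : realType.

Lemma geometric_cvg (u : nat -> R) (C : R) : (forall j, `|u j.+1 - u j| <= C / 2 ^+ j) ->
  u @ \oo --> lim (u @ \oo).
Proof.
move=> H; apply/cvgrPdist_le => e e0.
have [N HN] := half_pow_small (2 * C) e0; exists N => // j Nj /=.
apply: le_trans (geometric_limit H j) _; apply: le_trans (HN j Nj).
by rewrite ler_pM2r ?ler_norm // invr_gt0 exprn_gt0.
Qed.

Section OneField.
Variables (m : nat) (X : 'cV[R]_m -> 'cV[R]_m).
Hypotheses (CX : smooth_map X) (BX : picard_bounded X).

Lemma picard_near (z0 : 'cV[R]_m.+1) : exists d C K : R,
  [/\ 0 < d, 0 <= C,
      forall j z, `|z - z0| < d -> `|picard X j.+1 z - picard X j z| <= C / 2 ^+ j &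
      forall j z, `|z - z0| < d -> `|picard X j z| <= K].
Proof.
have [d1 [C [d10 HC]]] := picard_geometric CX BX (vtail z0) (`|z0| + 1).
have [d2 [K [d20 HK]]] := BX (vtail z0) (`|z0| + 1).
have P z : `|z - z0| < Num.min (Num.min d1 d2) 1 ->
    [/\ `|vtail z - vtail z0| < d1, `|vtail z - vtail z0| < d2 & `|z ord0 0| <= `|z0| + 1].
  rewrite !lt_min => /andP[/andP[zd1 zd2] z1].
  have H : `|vtail z - vtail z0| <= `|z - z0|.
    by apply: cV_norm_le => // i; have := cV_norm_ge (z - z0) (lift ord0 i); rewrite !mxE.
  split; try exact: le_lt_trans H _.
  apply: le_trans (cV_norm_ge z ord0) _.
  by rewrite -(subrK z0 z) (le_trans (ler_normD _ _)) // addrC lerD2l ltW.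
exists (Num.min (Num.min d1 d2) 1), C, K; split.
- by rewrite !lt_min d10 d20 ltr01.
- have := HC 0%N 0 (vtail z0); rewrite subrr !normr0 expr0 divr1.
  by move=> /(_ d10 (addr_ge0 (normr_ge0 _) ler01)); exact: le_trans.
- by move=> j z /P[zd _ zT]; have := HC j _ _ zd zT; rewrite vcons_tail.
- by move=> j z /P[_ zd zT]; have := HK j _ _ zd zT; rewrite vcons_tail.
Qed.

Lemma picard_step_coord j z i (e : R) : `|picard X j.+1 z - picard X j z| <= e ->
  `|picard X j.+1 z i 0 - picard X j z i 0| <= e.
Proof.
apply: le_trans.
by have := cV_norm_ge (picard X j.+1 z - picard X j z) i; rewrite mxE [X in _ + X]mxE.
Qed.

Lemma picard_cvg z i : (fun j => picard X j z i 0) @ \oo --> flow X z i 0.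
Proof.
have [d [C [K [d0 C0 HC _]]]] := picard_near z.
rewrite mxE; apply: (@geometric_cvg _ C) => j; apply: picard_step_coord; apply: HC.
by rewrite subrr normr0.
Qed.

Lemma flow_continuous i : continuous (fun z => flow X z i 0).
Proof.
move=> z; have [d [C [K [d0 C0 HC _]]]] := picard_near z.
have -> : (fun z => flow X z i 0) = (fun z => lim ((fun j => picard X j z i 0) @ \oo)).
  by apply/funext => y; rewrite mxE.
apply: (@geometric_limit_continuous _ _ _ _ C [set y | `|y - z| < d]).
- by apply/cV_nbhsP; exists d.
- by move=> j y yd; apply: picard_step_coord; exact: HC.
- by move=> j; exact: Cinf_continuous (smooth_picard CX j i) _.
Qed.

Lemma flow_at0 x : flow X (vcons 0 x) = x.
Proof.
apply/colP => i; have := @picard_cvg (vcons 0 x) i.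
rewrite (_ : (fun j => _) = fun=> x i 0); last by apply/funext => j; rewrite picard_at0.
by move=> /(cvg_lim (@Rhausdorff R)) <-; rewrite lim_cst.
Qed.

Lemma is_derive_flow_time z i :
  is_derive z (e_ ord0 : 'cV[R]_m.+1) (fun z => flow X z i 0) (X (flow X z) i 0).
Proof.
have [d [C [K [d0 C0 HC HK]]]] := picard_near z.
have [L L0 HL] := smooth_map_lipschitz K CX.
have C' j : C / 2 ^+ j <= (C + L * C) / 2 ^+ j.
  by rewrite ler_pM2r ?invr_gt0 ?exprn_gt0 // lerDl mulr_ge0.
have nN : nbhs z [set y | `|y - z| < d] by apply/cV_nbhsP; exists d.
(* The iterates are shifted by one because the time derivative of iterate j + 1 is [X] at iterate j.
   The constant C + L C serves both the iterates and, through the Lipschitz bound, their time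
   derivatives. *)
have := @geometric_limit_derive R _ (fun j z => picard X j.+1 z i 0)
  (fun j z => X (picard X j z) i 0) z (e_ ord0) (C + L * C) _ nN.
have -> : (fun y => lim ((fun j => picard X j.+1 y i 0) @ \oo)) = (fun z => flow X z i 0).
  apply/funext => y; apply: cvg_lim; first exact: Rhausdorff.
  have := @picard_cvg y i.
  by rewrite -(cvg_shiftS (fun j => picard X j y i 0)).
have -> : lim ((fun j => X (picard X j z) i 0) @ \oo) = X (flow X z) i 0.
  apply: cvg_lim; first exact: Rhausdorff.
  have H : (fun j => picard X j z) @ \oo --> flow X z.
    by apply: cV_cvg => l; exact: picard_cvg.
  have cX : {for flow X z, continuous (fun x => X x i 0)} by exact: Cinf_continuous (CX i) _.
  exact: (cvg_comp _ _ H cX).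
apply.
- move=> j y _.
  have CP := smooth_picard CX j.+1 i; have := Cinf_derivable (i := ord0) (x := y) CP I.
  move=> dP; apply: DeriveDef => //.
  have [_ E1] := Cinf_slice_derive (vtail y) (y ord0 0) CP.
  have [_ E2] := is_derive_picard CX j i (vtail y) (y ord0 0).
  by rewrite -[y]vcons_tail; exact: etrans (esym E1) E2.
- move=> j y yd; apply: le_trans (C' j); apply: (@le_trans _ _ (C / 2 ^+ j.+1)).
    by apply: picard_step_coord; exact: HC.
  rewrite exprS invfM mulrCA ler_piMl ?mulr_ge0 ?invr_ge0 ?exprn_ge0 //.
  by rewrite invf_le1 // ler1n.
- move=> j y yd; apply: (@le_trans _ _ (L * C / 2 ^+ j)).
    apply: (@le_trans _ _ (L * `|picard X j.+1 y - picard X j y|)).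
      apply: le_trans (HL _ _ (HK _ _ yd) (HK _ _ yd)).
      by have := cV_norm_ge (X (picard X j.+1 y) - X (picard X j y)) i;
        rewrite mxE [X in _ + X]mxE.
    by rewrite -mulrA ler_wpM2l // HC.
  by rewrite ler_pM2r ?invr_gt0 ?exprn_gt0 // lerDr.
Qed.

End OneField.

(** The k-th space derivative of an iterate is the fibre part of the lifted iterate started at (x,
    e_k); both sequences converge geometrically, so the derivative of the limit is the limit of the
    derivatives. *)
Lemma is_derive_flow_space m (X : 'cV[R]_m -> 'cV[R]_m) z i k :
  smooth_map X -> picard_bounded X ->
  is_derive z (e_ (lift ord0 k) : 'cV[R]_m.+1) (fun z => flow X z i 0)
    (flow (tlift X) (vcons (z ord0 0) (col_mx (vtail z) (e_ k))) (rshift m i) 0).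
Proof.
move=> CX BX.
have CT := smooth_tlift CX; have BT := picard_bounded_tlift CX BX.
have [d [C [K [d0 C0 HC _]]]] := picard_near CX BX z.
pose lf (z : 'cV[R]_m.+1) := vcons (z ord0 0) (col_mx (vtail z) (e_ k : 'cV[R]_m)).
have [d' [C' [K' [d'0 C'0 HC' _]]]] := picard_near CT BT (lf z).
have nN : nbhs z [set y | `|y - z| < Num.min d d'].
  by apply/cV_nbhsP; exists (Num.min d d'); rewrite ?lt_min ?d0.
have P j y : partial (lift ord0 k) (fun z => picard X j z i 0) y =
    picard (tlift X) j (lf y) (rshift m i) 0.
  rewrite /lf picard_tlift // col_mxEd mxE vcons_tail (bigD1 k) //= big1 => [|l lk].
    by rewrite !mxE !eqxx mulr1 addr0.
  by rewrite !mxE (negbTE lk) mulr0.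
have lfd y : `|lf y - lf z| <= `|y - z|.
  apply: cV_norm_le => // l; case: (unliftP ord0 l) => [l'|] ->; rewrite mxE [X in _ + X]mxE.
    rewrite !vconsS; case: (split_ordP l') => l'' ->; rewrite ?col_mxEu ?col_mxEd.
      by have := cV_norm_ge (y - z) (lift ord0 l''); rewrite !mxE.
    by rewrite subrr normr0.
  by rewrite !vcons0; have := cV_norm_ge (y - z) ord0; rewrite !mxE.
have := @geometric_limit_derive R _ (fun j z => picard X j z i 0)
  (fun j z => picard (tlift X) j (lf z) (rshift m i) 0) z (e_ (lift ord0 k)) (C + C') _ nN.
have -> : (fun y => lim ((fun j => picard X j y i 0) @ \oo)) = (fun z => flow X z i 0).
  by apply/funext => y; rewrite mxE.
have -> : lim ((fun j => picard (tlift X) j (lf z) (rshift m i) 0) @ \oo) =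
  flow (tlift X) (lf z) (rshift m i) 0 by rewrite mxE.
apply.
- move=> j y _; apply: DeriveDef; last exact: P.
  exact: Cinf_derivable (smooth_picard CX j i) _.
- move=> j y /=; rewrite lt_min => /andP[yd _]; apply: (@le_trans _ _ (C / 2 ^+ j)).
    by apply: picard_step_coord; exact: HC.
  by rewrite ler_pM2r ?invr_gt0 ?exprn_gt0 // lerDl.
- move=> j y /=; rewrite lt_min => /andP[_ yd]; apply: (@le_trans _ _ (C' / 2 ^+ j)).
    by apply: picard_step_coord; apply: HC'; exact: le_lt_trans (lfd y) yd.
  by rewrite ler_pM2r ?invr_gt0 ?exprn_gt0 // lerDr.
Qed.

(** The induction on [k] runs over all dimensions and fields: a space derivative of the flow is a
    component of the flow of the lift in dimension 2m, and the time derivative is [X] composed with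
    the flow. *)
Lemma Ck_flow k m (X : 'cV[R]_m -> 'cV[R]_m) : smooth_map X -> picard_bounded X ->
  forall i, Ck k setT (fun z => flow X z i 0).
Proof.
elim: k m X => [|k IH] m X CX BX i.
  by split=> // z _; exact: flow_continuous.
split=> [z _|l]; first exact: flow_continuous.
case: (unliftP ord0 l) => [l'|] ->.
- have D z := is_derive_flow_space z i l' CX BX.
  split=> [z _|]; first by have [] := D z.
  apply: (@Ck_ext _ _ _ _ (fun z => flow (tlift X) 
    (vcons (z ord0 0) (col_mx (vtail z) (e_ l'))) (rshift m i) 0)) => //.
    by move=> z _; have [_ <-] := D z.
  have CT := smooth_tlift CX; have BT := picard_bounded_tlift CX BX.
  apply: (@Ck_comp R _ _ k setT setT (fun z => flow (tlift X) z (rshift m i) 0)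
    (fun z => vcons (z ord0 0) (col_mx (vtail z) (e_ l')))) => //; last exact: IH.
  move=> j; case: (unliftP ord0 j) => [j'|] ->; last first.
    by apply: Ck_ext (Ck_coord _ _ ord0) => // z _; rewrite vcons0.
  case: (split_ordP j') => j'' ->.
    apply: Ck_ext (Ck_coord _ _ (lift ord0 j'')) => // z _.
    by rewrite vconsS col_mxEu mxE.
  apply: Ck_ext (Ck_cst _ _ ((e_ l' : 'cV[R]_m) j'' 0)) => // z _.
  by rewrite vconsS col_mxEd.
- have D z := is_derive_flow_time CX BX z i.
  split=> [z _|]; first by have [] := D z.
  apply: (@Ck_ext _ _ _ _ (fun z => X (flow X z) i 0)) => //.
    by move=> z _; have [_ <-] := D z.
  by apply: (@Ck_comp R _ _ k setT setT (fun y => X y i 0) (flow X)) => //; [move=> j; exact: IH|exact: CX].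
Qed.

Theorem smooth_flow m (X : 'cV[R]_m -> 'cV[R]_m) : smooth_map X -> picard_bounded X ->
  smooth_map (flow X).
Proof. by move=> CX BX i k; exact: Ck_flow. Qed.

Definition integral_curve m (X : 'cV[R]_m -> 'cV[R]_m) (c : R -> 'cV[R]_m) : Prop :=
  forall i (t : R), is_derive t 1 (fun t => c t i 0) (X (c t) i 0).

Lemma flow_integral_curve m (X : 'cV[R]_m -> 'cV[R]_m) x : smooth_map X -> picard_bounded X ->
  integral_curve X (fun t => flow X (vcons t x)).
Proof.
move=> CX BX i t; have CF := smooth_flow CX BX.
have := Cinf_slice_derive x t (CF i); rewrite /partial.
by have [_ ->] := is_derive_flow_time CX BX (vcons t x) i.
Qed.

Lemma integral_curve_bounded m (X : 'cV[R]_m -> 'cV[R]_m) c (B : R) :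
  (forall x, `|X x| <= B) -> integral_curve X c ->
  forall t, `|c t| <= `|c 0| + B * `|t|.
Proof.
move=> HB Hc t; rewrite -(subrK (c 0) (c t)) (le_trans (ler_normD _ _)) // addrC lerD2l.
have B0 : 0 <= B by exact: le_trans (HB 0).
apply: cV_norm_le => [|i]; first by rewrite mulr_ge0.
have E (s : R) : c s i 0 = (fun u => c u i 0) (0 + s *: 1) by rewrite add0r [s *: 1]mulr1.
have [s _|s _] := @line_MVT R R^o (fun u => c u i 0) 0 1 t.
  by have [] := Hc i (0 + s *: 1).
rewrite -E !mxE => ->; have [_ ->] := Hc i (0 + s *: 1).
rewrite normrM mulrC; apply: ler_pM => //; exact: le_trans (cV_norm_ge _ _) (HB _).
Qed.

(** The weighted estimate of Picard's iteration, applied to c - c', halves its own bound; repeated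
    indefinitely it forces equality. *)
Lemma integral_curve_unique m (X : 'cV[R]_m -> 'cV[R]_m) c c' (B : R) :
  smooth_map X -> (forall x, `|X x| <= B) -> integral_curve X c ->
  integral_curve X c' -> c 0 = c' 0 -> forall t, c t = c' t.
Proof.
move=> CX HB Hc Hc' c0 t.
have B0 : 0 <= B by exact: le_trans (HB 0).
pose T := `|t|; pose K := `|c 0| + B * T.
have cK s : `|s| <= T -> `|c s| <= K /\ `|c' s| <= K.
  move=> sT; split; rewrite /K; [|rewrite c0];
  apply: le_trans (integral_curve_bounded HB _ s) _ => //; by rewrite lerD2l ler_wpM2l.
have [L L0 HL] := smooth_map_lipschitz K CX.
pose l := 2 * L + 1; have l0 : 0 < l by rewrite /l; lra.
have K0 : 0 <= K by rewrite /K /T addr_ge0 // mulr_ge0.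
have H j : forall s, `|s| <= T -> `|c s - c' s| <= 2 * K / 2 ^+ j * expR (l * `|s|).
  elim: j => [|j IH] s sT.
    have [h1 h2] := cK s sT; rewrite expr0 divr1.
    apply: le_trans (ler_normB _ _) _; apply: (@le_trans _ _ (2 * K)); first lra.
    rewrite ler_peMr ?mulr_ge0 // -expR0 ler_expR.
    by rewrite mulr_ge0 // ltW.
  apply: cV_norm_le => [|i]; first by rewrite !mulr_ge0 ?expR_ge0 ?invr_ge0 ?exprn_ge0.
  rewrite !mxE.
  have a0 : 0 <= L * (2 * K / 2 ^+ j) by rewrite !mulr_ge0 // invr_ge0 exprn_ge0.
  pose F s := c s i 0 - c' s i 0.
  pose F' s := X (c s) i 0 - X (c' s) i 0.
  have dF (r : R) : is_derive r 1 F (F' r) by exact: (is_deriveB (Hc i r) (Hc' i r)).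
  have F0 : F 0 = 0 by rewrite /F c0 subrr.
  have HF r : `|r| <= T -> `|F' r| <= L * (2 * K / 2 ^+ j) * expR (l * `|r|).
    move=> s'T; rewrite -mulrA; have [h1 h2] := cK _ s'T.
    apply: (@le_trans _ _ (L * `|c r - c' r|)).
      apply: le_trans (HL _ _ h1 h2).
      by have := cV_norm_ge (X (c r) - X (c' r)) i; rewrite mxE [X in _ + X]mxE.
    by rewrite ler_wpM2l // IH.
  have := exponential_growth a0 l0 dF F0 HF sT; rewrite /F => H.
  apply: le_trans H _; rewrite ler_wpM2r ?expR_ge0 //.
  rewrite ler_pdivrMr // exprS invfM.
  set u := 2 ^+ j; have u0 : 0 <= u^-1 by rewrite invr_ge0 exprn_ge0.
  have -> : 2 * K * (2^-1 / u) * l = K / u * l by field; rewrite /u expf_neq0.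
  have -> : L * (2 * K / u) = K / u * (2 * L) by ring.
  by rewrite ler_wpM2l ?mulr_ge0 // /l; lra.
apply/eqP; rewrite -subr_eq0 -normr_le0.
apply: (@half_pow_le _ _ _ (2 * K * expR (l * T)) 0) => j _; rewrite add0r.
by apply: le_trans (H j t _) _ => //; rewrite mulrAC.
Qed.

Lemma flow_add m (X : 'cV[R]_m -> 'cV[R]_m) (B : R) (s t : R) x :
  smooth_map X -> (forall x, `|X x| <= B) ->
  flow X (vcons s (flow X (vcons t x))) = flow X (vcons (s + t) x).
Proof.
move=> CX HB; have BX : picard_bounded X by apply: bounded_picard => //; exists B.
have H1 := flow_integral_curve (flow X (vcons t x)) CX BX.
have H2 : integral_curve X (fun s => flow X (vcons (s + t) x)).
  move=> i u; have D := flow_integral_curve x CX BX i (u + t).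
  have D2 : is_derive u 1 (fun s : R => s + t) 1.
    have := @is_derive_add_fun R R^o id (fun=> t) u 1 (@derivable_id _ _ _ _) (derivable_cst _ _ _).
    by rewrite derive_id derive_cst addr0.
  have := is_derive1_comp (f := fun t => flow X (vcons t x) i 0) (g := fun s : R => s + t) D D2.
  by rewrite mulr1.
by apply: (integral_curve_unique CX HB H1 H2); rewrite flow_at0 ?add0r.
Qed.

End SmoothFlow.

(** * An equivariant Darboux theorem *)

Section DerivativeRules.
Variable R : realType.

Lemma is_derive_mulf (V : normedModType R) (f g : V -> R) (x v : V) (df dg : R) :
  is_derive x v f df -> is_derive x v g dg ->
  is_derive x v (fun x => f x * g x) (df * g x + f x * dg).
Proof.
move=> [d1 <-] [d2 <-]; have := is_derive_mul_fun d1 d2.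
by rewrite addrC [g x * _]mulrC.
Qed.

Lemma is_derive_addf (V : normedModType R) (f g : V -> R) (x v : V) (df dg : R) :
  is_derive x v f df -> is_derive x v g dg ->
  is_derive x v (fun x => f x + g x) (df + dg).
Proof. by move=> [d1 <-] [d2 <-]; exact: is_derive_add_fun. Qed.

Lemma is_derive_sumf (V : normedModType R) (I : Type) (r : seq I) (f : I -> V -> R)
    (x v : V) (df : I -> R) :
  (forall i, is_derive x v (f i) (df i)) ->
  is_derive x v (fun x => \sum_(i <- r) f i x) (\sum_(i <- r) df i).
Proof.
move=> H; elim: r => [|i r IH].
  rewrite big_nil (_ : (fun _ => _) = cst 0); first exact: is_derive_cst.
  by apply/funext => y; rewrite big_nil.
rewrite big_cons (_ : (fun _ => _) = (fun x => f i x + \sum_(i <- r) f i x)).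
  exact: is_derive_addf.
by apply/funext => y; rewrite big_cons.
Qed.

Lemma constant_derive0 (F : R -> R) (a b : R) : a <= b ->
  (forall t : R, a <= t <= b -> is_derive t 1 F 0) -> F b = F a.
Proof.
move=> ab dF.
have D (t : R) : t \in `]a, b[ -> is_derive t 1 F 0.
  by rewrite in_itv /= => /andP[/ltW h1 /ltW h2]; apply: dF; rewrite h1.
have [|c _] := @MVT_segment R F (fun=> 0) a b ab D.
  by apply: derivable_within_continuous => t; rewrite in_itv => /dF[].
by rewrite mul0r => /subr0_eq.
Qed.

Lemma partial_opp m (f : 'cV[R]_m -> R) i x : Cinf setT f ->
  partial i (fun y => - f y) x = - partial i f x.
Proof.
move=> Cf; have d := derivableP (Cinf_derivable (i := i) (x := x) Cf I).
have [_ E] := is_deriveN d; exact: E.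
Qed.

Lemma mulmx_entry m p q (A : 'M[R]_(m, p)) (B : 'M[R]_(p, q)) i j :
  (A *m B) i j = \sum_k A i k * B k j.
Proof. by rewrite mxE. Qed.

Lemma addscale_entry m p (A B : 'M[R]_(m, p)) (t : R) i j :
  (A + t *: B) i j = A i j + t * B i j.
Proof. by rewrite !mxE. Qed.

Definition mx_derive m p (A : R -> 'M[R]_(m, p)) (t : R) (dA : 'M[R]_(m, p)) : Prop :=
  forall i j, is_derive t 1 (fun t => A t i j) (dA i j).

Lemma mx_derive_mul m p q (A : R -> 'M[R]_(m, p)) (B : R -> 'M[R]_(p, q)) t dA dB :
  mx_derive A t dA -> mx_derive B t dB ->
  mx_derive (fun t => A t *m B t) t (dA *m B t + A t *m dB).
Proof.
move=> HA HB i j.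
have -> : (fun t => (A t *m B t) i j) = (fun t => \sum_k A t i k * B t k j).
  by apply/funext => s; rewrite mxE.
rewrite !mxE -big_split /=; apply: is_derive_sumf => k.
exact: is_derive_mulf (HA i k) (HB k j).
Qed.

Lemma mx_derive_tr m p (A : R -> 'M[R]_(m, p)) t dA :
  mx_derive A t dA -> mx_derive (fun t => (A t)^T) t dA^T.
Proof.
move=> HA i j; rewrite mxE (_ : (fun t => _) = (fun t => A t j i)); first exact: HA.
by apply/funext => s; rewrite mxE.
Qed.

End DerivativeRules.

(** * Jacobians and the variational equation *)

Section Jacobian.
Variables (R : realType).

Definition jac m p (g : 'cV[R]_m -> 'cV[R]_p) (x : 'cV[R]_m) : 'M[R]_(p, m) :=
  \matrix_(i, j) partial j (fun y => g y i 0) x.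

Lemma jac_id m (x : 'cV[R]_m) : jac id x = 1%:M.
Proof.
apply/matrixP => i j; rewrite !mxE.
by have [_] := is_derive_coord x (e_ j) i; rewrite /partial => ->; rewrite mxE andbT.
Qed.

Lemma jac_comp m p q (U : set 'cV[R]_p) (V : set 'cV[R]_m) (f : 'cV[R]_p -> 'cV[R]_q)
    (g : 'cV[R]_m -> 'cV[R]_p) x :
  open U -> U (g x) -> (forall i, Cinf U (fun y => f y i 0)) ->
  V x -> (forall i, Cinf V (fun y => g y i 0)) ->
  jac (f \o g) x = jac f (g x) *m jac g x.
Proof.
move=> oU Ux Cf Vx Cg; apply/matrixP => i j; rewrite !mxE /partial.
have dg k : derivable (fun z => g z k 0) x (e_ j) by exact: Cinf_derivable (Cg k) Vx.
have [_ E] := is_derive_comp oU Ux (Cf i 1%N) dg.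
by rewrite [LHS]E; apply: eq_bigr => k _; rewrite !mxE.
Qed.

(** This is the fibre part of the flow equation of the tangent lift, started at (x, e_k); the base
    part of that flow is the flow of [X]. *)
Lemma variational_equation m (X : 'cV[R]_m -> 'cV[R]_m) x (t : R) i k :
  smooth_map X -> picard_bounded X ->
  is_derive t 1 (fun t => partial (lift ord0 k) (fun z => flow X z i 0) (vcons t x))
    (\sum_l partial l (fun y => X y i 0) (flow X (vcons t x)) *
       partial (lift ord0 k) (fun z => flow X z l 0) (vcons t x)).
Proof.
move=> CX BX; have CT := smooth_tlift CX; have BT := picard_bounded_tlift CX BX.
have E l s : partial (lift ord0 k) (fun z => flow X z l 0) (vcons s x) =
    flow (tlift X) (vcons s (col_mx x (e_ k))) (rshift m l) 0.
  have [_] := is_derive_flow_space (vcons s x) l k CX BX.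
  by rewrite /partial vcons0 vtail_cons.
rewrite (funext (E i)).
have D := flow_integral_curve (col_mx x (e_ k)) CT BT (rshift m i) t.
have := D; rewrite {2}/tlift col_mxEd mxE.
have -> : usubmx (flow (tlift X) (vcons t (col_mx x (e_ k)))) = flow X (vcons t x).
  apply/colP => l; rewrite !mxE.
  have -> // : (fun j => picard (tlift X) j (vcons t (col_mx x (e_ k))) (lshift m l) 0) =
    (fun j => picard X j (vcons t x) l 0).
  by apply/funext => j; rewrite picard_tlift // col_mxEu.
congr is_derive; apply: eq_bigr => l _; congr (_ * _).
by rewrite E mxE.
Qed.

End Jacobian.

(** * A Poincare lemma for translation-invariant forms *)

Section Poincare.
Variables (R : realType) (m : nat).
Implicit Types (x : 'cV[R]_m) (a b : 'I_m.+1).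

(* functions of the last m coordinates of R^(m+1) *)
Definition pd a (f : 'cV[R]_m -> R) (x : 'cV[R]_m) : R :=
  if unlift ord0 a is Some k then partial k f x else 0.

Lemma pd0 f x : pd ord0 f x = 0.
Proof. by rewrite /pd unlift_none. Qed.

Lemma pdS k f x : pd (lift ord0 k) f x = partial k f x.
Proof. by rewrite /pd liftK. Qed.

Definition closed_form_at (W : 'cV[R]_m -> 'M[R]_m.+1) x : Prop :=
  forall a b c, pd a (fun y => W y b c) x + pd b (fun y => W y c a) x +
    pd c (fun y => W y a b) x = 0.

(** The retraction fixes coordinate 0 and scales the others by s, so pulling back gives a factor s
    for each dx_a and none for the differential of coordinate 0. *)
Definition weight a : nat := (a != ord0).

Variables (W : 'cV[R]_m -> 'M[R]_m.+1).
Hypothesis CW : forall a b, Cinf setT (fun x => W x a b).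
Hypothesis WT : forall x a b, W x a b = - W x b a.

Let integrand b (w : 'cV[R]_m.+1) : R :=
  w ord0 0 ^+ weight b * \sum_k w (lift ord0 k) 0 * W (w ord0 0 *: vtail w) (lift ord0 k) b.

(* the homotopy operator of the retraction (u, x) -> (u, s x) *)
Definition potential b : 'cV[R]_m -> R := J (integrand b).

Let Cscaled a b : Cinf setT (fun w : 'cV[R]_m.+1 => W (w ord0 0 *: vtail w) a b).
Proof.
apply: (Cinf_comp _ _ _ _ (CW a b)) => // i.
apply: (@Cinf_ext _ _ _ (fun w : 'cV[R]_m.+1 => w ord0 0 * w (lift ord0 i) 0)) => //.
  by move=> w _; rewrite !mxE.
by apply: Cinf_mul => //; exact: Cinf_coord.
Qed.

Let Cweight b : Cinf setT (fun w : 'cV[R]_m.+1 => w ord0 0 ^+ weight b).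
Proof.
rewrite /weight; case: (b != ord0) => /=; last exact: Cinf_cst.
exact: Cinf_coord.
Qed.

Let Cintegrand b : Cinf setT (integrand b).
Proof.
apply: Cinf_mul => //; apply: Cinf_sum => // k _.
by apply: Cinf_mul => //; exact: Cinf_coord.
Qed.

Lemma Cinf_potential b : Cinf setT (potential b).
Proof. exact: Cinf_J. Qed.

Lemma potential_at0 b : potential b 0 = 0.
Proof.
rewrite -[RHS](I01_cst 0) /potential /J; congr I01; apply/funext => s.
rewrite /integrand big1 ?mulr0 // => k _.
by rewrite vconsS mxE mul0r.
Qed.

Let pd_scaled k a b s x :
  is_derive (vcons s x) (e_ (lift ord0 k) : 'cV[R]_m.+1)
    (fun w : 'cV[R]_m.+1 => W (w ord0 0 *: vtail w) a b)
    (s * partial k (fun y => W y a b) (s *: x)).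
Proof.
apply: is_derive_of_line.
have F (h : R) : W ((vcons s x + h *: e_ (lift ord0 k)) ord0 0 *:
     vtail (vcons s x + h *: e_ (lift ord0 k))) a b = W (s *: x + (s * h) *: e_ k) a b.
  rewrite -vcons_deltaS vcons_scale vcons_add mulr0 addr0 vcons0 vtail_cons.
  by rewrite scalerDr scalerA.
rewrite (funext F).
have d : derivable (fun y => W y a b) (s *: x + (s * 0) *: e_ k) (e_ k).
  exact: Cinf_derivable (CW a b) _.
have H1 := is_derive_line d.
have H2 : is_derive (0 : R) 1 (fun h : R => s * h) s.
  have := is_derive_mulf (is_derive_cst s (0 : R) 1) (is_derive_id (0 : R) 1).
  by rewrite mul0r add0r mulr1.
have := is_derive1_comp (f := fun t => W (s *: x + t *: e_ k) a b) (g := fun h : R => s * h) H1 H2.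
by rewrite mulr0 scale0r addr0 mulrC.
Qed.

Let radial a b (s : R) x : is_derive s 1 (fun s : R => W (s *: x) a b)
    (\sum_k x k 0 * partial k (fun y => W y a b) (s *: x)).
Proof.
have := @is_derive_partials R m setT (fun y => W y a b) (s *: x) x (@cV_openT _ _) I (CW a b 1%N).
move=> [d E].
have d' : derivable (fun y => W y a b) (0 + s *: x) x by rewrite add0r.
have := is_derive_line d'; rewrite add0r E.
have -> : (fun s => W (0 + s *: x) a b) = (fun s => W (s *: x) a b).
  by apply/funext => u; rewrite add0r.
by congr is_derive; apply: eq_bigr => k _; rewrite mulrC.
Qed.

Let pd_potential k b x : partial k (potential b) x =
  I01 (fun s => s ^+ weight b * (W (s *: x) (lift ord0 k) b +
    s * \sum_l x l 0 * partial k (fun y => W y (lift ord0 l) b) (s *: x))).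
Proof.
rewrite partial_J //; congr I01; apply/funext => s.
have D0 : is_derive (vcons s x) (e_ (lift ord0 k)) (fun w : 'cV[R]_m.+1 => w ord0 0 ^+ weight b) 0.
  rewrite /weight; case: (b != ord0) => /=; last exact: is_derive_cst.
  by have := is_derive_coord (vcons s x) (e_ (lift ord0 k)) ord0; rewrite mxE.
have D l := is_derive_mulf (is_derive_coord (vcons s x) (e_ (lift ord0 k)) (lift ord0 l))
  (pd_scaled k (lift ord0 l) b s x).
have [_ E] := is_derive_mulf D0 (is_derive_sumf (index_enum 'I_m) D).
rewrite /partial [LHS]E vcons0 vtail_cons mul0r add0r; congr (_ * _).
rewrite big_split /= mulr_sumr; congr (_ + _).
  rewrite (bigD1 k) //= big1 => [|l lk]; first by rewrite !mxE !eqxx mul1r addr0.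
  by rewrite !mxE (inj_eq (@lift_inj _ ord0)) (negbTE lk) mul0r.
by apply: eq_bigr => l _; rewrite vconsS mulrCA.
Qed.

Let scont (f : 'cV[R]_m -> R) x : Cinf setT f -> continuous (fun s : R => f (s *: x)).
Proof.
move=> Cf s; have cs : {for s, continuous (fun s : R => s *: x)} by exact: scalel_continuous.
by apply: (continuous_comp cs); exact: Cinf_continuous Cf _.
Qed.

Let contX k : continuous (fun s : R => s ^+ k).
Proof. by move=> s; exact: exprn_continuous. Qed.

Let cont_add (f g : R -> R) : continuous f -> continuous g -> continuous (fun s => f s + g s).
Proof. by move=> cf cg s; exact: continuous_add_fun (cf s) (cg s). Qed.

Let cont_mul (f g : R -> R) : continuous f -> continuous g -> continuous (fun s => f s * g s).
Proof. by move=> cf cg s; exact: continuous_mul_fun (cf s) (cg s). Qed.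

Let cont_sum (f : 'I_m -> R -> R) : (forall i, continuous (f i)) ->
  continuous (fun s => \sum_i f i s).
Proof. by move=> cf s; apply: cvg_sumr => i _; exact: cf. Qed.

(** Closedness turns the antisymmetrised derivative of the integrand into the s-derivative of s^2
    W(s x) when both indices belong to x, and of s W(s x) when one of them is 0; the fundamental
    theorem yields W x. Only points s x with s in [0, 1] occur, so closedness on a ball is
    enough. *)
Lemma potential_primitive (d : R) x : 0 <= d -> `|x| <= d ->
  (forall y, `|y| <= d -> closed_form_at W y) ->
  forall a b, pd a (potential b) x - pd b (potential a) x = W x a b.
Proof.
move=> d0 xd HW a b.
have cid : continuous (fun s : R => s) by move=> s; exact: cvg_id.
have ccst (c : R) : continuous (fun _ : R => c) by move=> s; exact: cst_continuous.
have cF k c : continuous (fun s : R => s ^+ weight c * (W (s *: x) (lift ord0 k) c +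
    s * \sum_l x l 0 * partial k (fun y => W y (lift ord0 l) c) (s *: x))).
  apply: cont_mul; first exact: contX.
  apply: cont_add; first exact: scont (CW _ _).
  apply: cont_mul => //; apply: cont_sum => l; apply: cont_mul => //.
  by apply: scont; exact: Cinf_partial (CW _ _).
have cl s : 0 <= s <= 1 -> closed_form_at W (s *: x).
  move=> /andP[s0 s1]; apply: HW; rewrite normrZ ger0_norm //.
  by apply: le_trans xd; rewrite ler_piMl.
case: (unliftP ord0 a) => [i|] ->; case: (unliftP ord0 b) => [j|] ->; rewrite ?pd0 ?pdS.
- rewrite !pd_potential -mulN1r -I01_scale // -I01_add //; last exact: cont_mul.
  have := @I01_derive R (fun s => s ^+ 2 * W (s *: x) (lift ord0 i) (lift ord0 j))
    (fun s => 2 * s * W (s *: x) (lift ord0 i) (lift ord0 j) + s ^+ 2 *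
     \sum_k x k 0 * partial k (fun y => W y (lift ord0 i) (lift ord0 j)) (s *: x)).
  rewrite expr1n mul1r expr0n /= mul0r subr0 scale1r => E; apply: etrans _ (E _ _).
  + apply: I01_ext => s s01; rewrite /weight /= expr1.
    have A l : partial i (fun y => W y (lift ord0 l) (lift ord0 j)) (s *: x) -
        partial j (fun y => W y (lift ord0 l) (lift ord0 i)) (s *: x) =
        partial l (fun y => W y (lift ord0 i) (lift ord0 j)) (s *: x).
      have := cl s s01 (lift ord0 i) (lift ord0 j) (lift ord0 l); rewrite !pdS.
      have -> : (fun y => W y (lift ord0 l) (lift ord0 j)) =
         (fun y => - W y (lift ord0 j) (lift ord0 l)) by apply/funext => y; rewrite WT.
      by rewrite partial_opp // => H; lra.
    have -> : \sum_k x k 0 * partial k (fun y => W y (lift ord0 i) (lift ord0 j)) (s *: x) =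
      \sum_l x l 0 * partial i (fun y => W y (lift ord0 l) (lift ord0 j)) (s *: x) -
      \sum_l x l 0 * partial j (fun y => W y (lift ord0 l) (lift ord0 i)) (s *: x).
      by rewrite -sumrB; apply: eq_bigr => l _; rewrite -A mulrBr.
    rewrite [W _ (lift ord0 j) (lift ord0 i)]WT; ring.
  + apply: cont_add; apply: cont_mul.
    * by apply: cont_mul.
    * exact: scont (CW _ _).
    * exact: contX.
    * apply: cont_sum => l; apply: cont_mul => //.
      by apply: scont; exact: Cinf_partial (CW _ _).
  + move=> s; apply: is_derive_mulf; last exact: radial.
    have := is_derive_mulf (is_derive_id s 1) (is_derive_id s 1).
    have -> : (fun x : R => id x * id x) = (fun s => s ^+ 2) by apply/funext => u; rewrite expr2.
    by rewrite mul1r mulr1 -mulr2n mulr_natl.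
- rewrite subr0 pd_potential.
  have := @I01_derive R (fun s => s * W (s *: x) (lift ord0 i) ord0)
    (fun s => 1 * W (s *: x) (lift ord0 i) ord0 + s *
     \sum_k x k 0 * partial k (fun y => W y (lift ord0 i) ord0) (s *: x)).
  rewrite mul1r mul0r subr0 scale1r => E; apply: etrans _ (E _ _).
  + apply: I01_ext => s s01; rewrite /weight /= expr0 !mul1r; congr (_ + _ * _).
    apply: eq_bigr => l _; congr (_ * _).
    have := cl s s01 (lift ord0 i) (lift ord0 l) ord0; rewrite !pdS pd0.
    have -> : (fun y => W y (lift ord0 i) ord0) = (fun y => - W y ord0 (lift ord0 i)).
      by apply/funext => y; rewrite WT.
    by rewrite partial_opp // => H; lra.
  + apply: cont_add; apply: cont_mul => //; first exact: scont (CW _ _).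
    apply: cont_sum => l; apply: cont_mul => //.
    by apply: scont; exact: Cinf_partial (CW _ _).
  + move=> s; apply: is_derive_mulf; exact: radial.
- rewrite sub0r pd_potential WT; congr (- _).
  have := @I01_derive R (fun s => s * W (s *: x) (lift ord0 j) ord0)
    (fun s => 1 * W (s *: x) (lift ord0 j) ord0 + s *
     \sum_k x k 0 * partial k (fun y => W y (lift ord0 j) ord0) (s *: x)).
  rewrite mul1r mul0r subr0 scale1r => E; apply: etrans _ (E _ _).
  + apply: I01_ext => s s01; rewrite /weight /= expr0 !mul1r; congr (_ + _ * _).
    apply: eq_bigr => l _; congr (_ * _).
    have := cl s s01 (lift ord0 j) (lift ord0 l) ord0; rewrite !pdS pd0.
    have -> : (fun y => W y (lift ord0 j) ord0) = (fun y => - W y ord0 (lift ord0 j)).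
      by apply/funext => y; rewrite WT.
    by rewrite partial_opp // => H; lra.
  + apply: cont_add; apply: cont_mul => //; first exact: scont (CW _ _).
    apply: cont_sum => l; apply: cont_mul => //.
    by apply: scont; exact: Cinf_partial (CW _ _).
  + move=> s; apply: is_derive_mulf; exact: radial.
- by rewrite subrr; have := WT x ord0 ord0; lra.
Qed.

End Poincare.

Section Slices.
Variables (R : realType) (m : nat).

Lemma is_derive_slice (g : 'cV[R]_m.+1 -> R) (s : R) z b : Cinf setT g ->
  is_derive z (e_ b : 'cV[R]_m) (fun z => g (vcons s z)) (partial (lift ord0 b) g (vcons s z)).
Proof.
move=> Cg; apply: is_derive_of_line.
have F (h : R) : g (vcons s (z + h *: e_ b)) = g (vcons s z + h *: e_ (lift ord0 b)).
  by rewrite -vcons_deltaS vcons_scale vcons_add mulr0 addr0.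
rewrite (funext F).
have d : derivable g (vcons s z + 0 *: e_ (lift ord0 b)) (e_ (lift ord0 b)).
  exact: Cinf_derivable Cg _.
have := is_derive_line d; by rewrite scale0r addr0.
Qed.

Lemma Cinf_slice (g : 'cV[R]_m.+1 -> R) (s : R) : Cinf setT g ->
  Cinf setT (fun z => g (vcons s z)).
Proof.
move=> Cg; apply: (Cinf_comp _ _ _ _ Cg) => // i; case: (unliftP ord0 i) => [j|] ->.
  by apply: Cinf_ext (Cinf_coord _ j) => // x _; rewrite vconsS.
by apply: Cinf_ext (Cinf_cst _ s) => // x _; rewrite vcons0.
Qed.

Lemma Cinf_vtail (g : 'cV[R]_m -> R) : Cinf setT g ->
  Cinf setT (fun z : 'cV[R]_m.+1 => g (vtail z)).
Proof.
move=> Cg; apply: (Cinf_comp _ _ _ _ Cg) => // i.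
by apply: Cinf_ext (Cinf_coord _ (lift ord0 i)) => // x _; rewrite mxE.
Qed.

Lemma smooth_vtail : smooth_map (@vtail R m).
Proof. by move=> i; exact: (Cinf_vtail (Cinf_coord _ i)). Qed.

Lemma partial_vtailS (g : 'cV[R]_m -> R) k z : Cinf setT g ->
  partial (lift ord0 k) (fun z : 'cV[R]_m.+1 => g (vtail z)) z = partial k g (vtail z).
Proof.
move=> Cg; have [_] := is_derive_slice (z ord0 0) (vtail z) k (Cinf_vtail Cg).
rewrite vcons_tail => <-; congr ('D_ _ _ _).
by apply/funext => y; rewrite vtail_cons.
Qed.

Lemma partial_vtail0 (g : 'cV[R]_m -> R) z :
  partial ord0 (fun z : 'cV[R]_m.+1 => g (vtail z)) z = 0.
Proof.
have F (h : R) : g (vtail (z + h *: e_ ord0)) = g (vtail z).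
  by congr g; apply/colP => j; rewrite !mxE /= mulr0 addr0.
have H : is_derive z (e_ ord0 : 'cV[R]_m.+1) (fun z : 'cV[R]_m.+1 => g (vtail z)) 0.
  by apply: is_derive_of_line; rewrite (funext F); exact: is_derive_cst.
by have [_] := H.
Qed.

End Slices.

(** * The generator of Moser's isotopy *)

Section Moser.
Variables (R : realType) (m : nat) (W : 'cV[R]_m -> 'M[R]_m.+1) (d0 : R).
Hypothesis CW : forall a b, Cinf setT (fun x => W x a b).
Hypothesis WT : forall x a b, W x a b = - W x b a.
Hypothesis W0 : W 0 \in unitmx.
Hypothesis d0_gt0 : 0 < d0.
Hypothesis closedW : forall x, `|x| <= d0 -> closed_form_at W x.

Let D x := W x - W 0.
Let al b := potential D b.
(** The segment from the constant form [W 0] to [W]. Coordinate 0 of [z] is the time here; the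
    invariant coordinate is absent because [W] does not depend on it. *)
Let Th (z : 'cV[R]_m.+1) : 'M[R]_m.+1 := W 0 + z ord0 0 *: D (vtail z).

Let CD a b : Cinf setT (fun x => D x a b).
Proof.
apply: (@Cinf_ext _ _ _ (fun x => W x a b - W 0 a b)) => //.
  by move=> x _; rewrite /D !mxE.
by apply: Cinf_subr => //; exact: Cinf_cst.
Qed.

Let DT x a b : D x a b = - D x b a.
Proof. by rewrite /D !mxE (WT x) (WT 0) -!opprD. Qed.

Let pdD a b c x : pd a (fun y => D y b c) x = pd a (fun y => W y b c) x.
Proof.
case: (unliftP ord0 a) => [k|] ->; rewrite ?pd0 ?pdS //.
have -> : (fun y => D y b c) = (fun y => W y b c + - W 0 b c).
  by apply/funext => y; rewrite /D !mxE.
have [_] := is_derive_addf (derivableP (Cinf_derivable (i := k) (x := x) (CW b c) I))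
  (is_derive_cst (- W 0 b c) x (e_ k)).
by rewrite addr0.
Qed.

Let closedD x : `|x| <= d0 -> closed_form_at D x.
Proof. by move=> xd a b c; rewrite !pdD; exact: closedW. Qed.

Let CTh a b : Cinf setT (fun z => Th z a b).
Proof.
apply: (@Cinf_ext _ _ _ (fun z => W 0 a b + z ord0 0 * D (vtail z) a b)) => //.
  by move=> x _; rewrite /Th !mxE.
apply: Cinf_add => //; first exact: Cinf_cst.
by apply: Cinf_mul => //; [exact: Cinf_coord|exact: (Cinf_vtail (CD a b))].
Qed.

(** At x = 0 the segment is constantly [W 0], so it stays invertible for small x, uniformly in time.
    The time interval exceeds [0, 1] to leave room for a cutoff in time. *)
Let Th_unit : exists2 r : R, 0 < r & forall t x, - 2^-1 <= t <= 3 / 2 -> `|x| < r ->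
  Th (vcons t x) \in unitmx.
Proof.
(* The substitution t = 2w - 1/2 maps [0, 1], the range of [near_slice], onto [-1/2, 3/2]. *)
pose f (w : 'cV[R]_m.+1) := \det (Th (vcons (2 * w ord0 0 - 2^-1) (vtail w))).
have Cf : Cinf setT f.
  apply: (Cinf_comp _ _ _ _ (Cinf_det (@cV_openT R _) CTh)) => // i.
  case: (unliftP ord0 i) => [j|] ->.
    by apply: Cinf_ext (Cinf_coord _ (lift ord0 j)) => // x _; rewrite vconsS mxE.
  apply: (@Cinf_ext _ _ _ (fun w : 'cV[R]_m.+1 => 2 * w ord0 0 - 2^-1)) => //.
    by move=> x _; rewrite vcons0.
  apply: Cinf_subr => //; last exact: Cinf_cst.
  by apply: Cinf_mul => //; [exact: Cinf_cst|exact: Cinf_coord].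
have cf : continuous f by move=> z; exact: Cinf_continuous Cf _.
have dn : `|\det (W 0)| / 2 > 0.
  by rewrite divr_gt0 // normr_gt0 -unitfE -unitmxE.
have /cV_nbhsP[r r0 Hr] := near_slice 0 cf dn.
exists r => // t x t01 xr; rewrite unitmxE unitfE.
have := Hr x; rewrite subr0 => /(_ xr ((t + 2^-1) / 2)).
have -> : 0 <= (t + 2^-1) / 2 <= 1 by apply/andP; split; lra.
move=> /(_ isT); rewrite /f !vcons0 !vtail_cons.
have -> : 2 * ((t + 2^-1) / 2) - 2^-1 = t by lra.
have -> : Th (vcons t 0) = W 0 by rewrite /Th vtail_cons /D subrr scaler0 addr0.
move=> H; apply/negP => /eqP E; move: H; rewrite E sub0r normrN.
by move: dn; lra.
Qed.

(** Moser's equation, contraction of the segment with X equal to minus the potential, is solved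
    where the segment is invertible, then cut off in time and space so that X is smooth everywhere
    and bounded. X vanishes at x = 0 because the potential does. *)
Lemma moser_field : exists X : 'cV[R]_m.+1 -> 'cV[R]_m.+1, exists B r : R,
  [/\ smooth_map X, forall z, `|X z| <= B, forall t, X (vcons t 0) = 0,
      0 < r <= d0 &
      forall t x, 0 <= t <= 1 -> `|x| < r ->
        forall b, \sum_a X (vcons t x) a 0 * Th (vcons t x) a b = - al b x].
Proof.
have [r r0 Hr] := Th_unit.
pose d := Num.min (r / 3) d0.
have d_gt0 : 0 < d by rewrite lt_min d0_gt0 divr_gt0.
have d3 : 3 * d <= r by rewrite mulrC -ler_pdivlMr // ge_min lexx.
(* The time factor is 1 when (2t - 1)^2 <= 1, that is for t in [0, 1], and 0 when (2t - 1)^2 >= 2,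
   which happens before t leaves [-1/2, 3/2]. *)
pose c (z : 'cV[R]_m.+1) := step ((2 * z ord0 0 - 1) ^+ 2) * bump 0 d (vtail z).
(* The segment is antisymmetric, so contracting with this X from the left gives the minus sign of
   Moser's equation. Where [Th z] is singular, the factor [c z] is 0. *)
pose X z := c z *: (invmx (Th z) *m \col_b al b (vtail z)).
pose U := [set z | \det (Th z) != 0].
have Cdet : Cinf setT (fun z => \det (Th z)) by apply: Cinf_det.
have oU : open U.
  have -> : U = (fun z => \det (Th z)) @^-1` [set x | x != 0] by [].
  by apply: open_comp; [move=> z _; exact: Cinf_continuous Cdet _|exact: open_neq].
pose V1 := [set z : 'cV[R]_m.+1 | 2 < (2 * z ord0 0 - 1) ^+ 2].
have Csq : Cinf setT (fun z : 'cV[R]_m.+1 => (2 * z ord0 0 - 1) ^+ 2).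
  have C1 : Cinf setT (fun z : 'cV[R]_m.+1 => 2 * z ord0 0 - 1).
    apply: Cinf_subr => //; last exact: Cinf_cst.
    by apply: Cinf_mul => //; [exact: Cinf_cst|exact: Cinf_coord].
  by apply: Cinf_ext (Cinf_mul (@cV_openT _ _) C1 C1) => // x _; rewrite expr2.
have oV1 : open V1.
  have -> : V1 = (fun z : 'cV[R]_m.+1 => (2 * z ord0 0 - 1) ^+ 2) @^-1` [set x | 2 < x] by [].
  by apply: open_comp; [move=> z _; exact: Cinf_continuous Csq _|exact: open_gt].
pose V2 := [set z : 'cV[R]_m.+1 | 2 * d < `|vtail z|].
have oV2 : open V2.
  have -> : V2 = @vtail R m @^-1` [set x | 2 * d < `|x - 0|].
    by apply/seteqP; split=> z; rewrite /V2 /= subr0.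
  by apply: open_comp; [move=> z _; exact: (smooth_map_continuous (@smooth_vtail R m))|exact: open_far].
(* X is smooth on [U] by Cramer's rule and vanishes on the open sets [V1] and [V2]; together they
   cover the space. *)
have cover z : [\/ U z, V1 z | V2 z].
  case: (ltP 2 ((2 * z ord0 0 - 1) ^+ 2)) => z1; first by apply: Or32.
  case: (ltP (2 * d) `|vtail z|) => z2; first by apply: Or33.
  apply: Or31; rewrite /U /= -unitfE -unitmxE -(vcons_tail z); apply: Hr; last first.
    by rewrite (le_lt_trans z2) // (lt_le_trans _ d3) // ltr_pM2r // ltr_nat.
  by apply/andP; split; nra.
have c1 z : V1 z -> X z = 0.
  by move=> /ltW z1; rewrite /X /c step_eq0 // mul0r scale0r.
have c2 z : V2 z -> X z = 0.
  by move=> z2; rewrite /X /c bump_eq0 ?subr0 // mulr0 scale0r.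
have CX : smooth_map X.
  move=> i; apply: Cinf_local => z _; case: (cover z) => Hz.
  - exists U; split=> //.
    apply: (@Cinf_ext _ _ _ (fun z => c z * (invmx (Th z) *m \col_b al b (vtail z)) i 0)) => //.
      by move=> y _; rewrite [RHS]mxE.
    apply: Cinf_mul => //.
      apply: Cinf_mul => //; last exact: Cinf_sub (Cinf_vtail (Cinf_bump 0 d (@cV_openT _ _))).
      have C2y : Cinf setT (fun z : 'cV[R]_m.+1 => 2 - (2 * z ord0 0 - 1) ^+ 2).
        by apply: Cinf_subr => //; exact: Cinf_cst.
      have Cy1 : Cinf setT (fun z : 'cV[R]_m.+1 => (2 * z ord0 0 - 1) ^+ 2 - 1).
        by apply: Cinf_subr => //; exact: Cinf_cst.
      apply: (@Cinf_sub _ _ setT) => //; apply: Cinf_mul => //; first exact: Cinf_flat.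
      apply: Cinf_inv => //; first by move=> y _; rewrite gt_eqF // step_den_gt0.
      by apply: Cinf_add => //; exact: Cinf_flat.
    apply: Cinf_mulmx => // [k l|k l].
      apply: Cinf_invmx => // [y|k' l']; first by rewrite unitmxE unitfE.
      exact: Cinf_sub (CTh _ _).
    apply: (@Cinf_ext _ _ _ (fun z => al k (vtail z))) => //.
      by move=> y _; rewrite mxE.
    exact: Cinf_sub (Cinf_vtail (Cinf_potential CD k)).
  - exists V1; split=> //; apply: Cinf_ext (Cinf_cst _ 0) => // y /c1 ->.
    by rewrite mxE.
  - exists V2; split=> //; apply: Cinf_ext (Cinf_cst _ 0) => // y /c2 ->.
    by rewrite mxE.
(* The cutoff confines the support to |t| <= 2 and |x| <= 2d, a compact region. *)
have [B [B0 HB]] : exists B, 0 <= B /\ forall i z, `|z| <= Num.max 2 (2 * d) -> `|X z i 0| <= B.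
  have [|i|B B0 HB] := @finite_upper_bound R _ (fun i B => forall z, `|z| <= Num.max 2 (2 * d) ->
    `|X z i 0| <= B).
  - by move=> i a b Ha ab x /Ha; move/le_trans; exact.
  - have [|B _ HB] := @continuous_bounded R _ (fun z => X z i 0) (Num.max 2 (2 * d)).
      by move=> z; exact: Cinf_continuous (CX i) _.
    by exists B.
  by exists B.
exists X, B, d; split=> //.
- move=> z; case: (ltP 2 ((2 * z ord0 0 - 1) ^+ 2)) => z1; first by rewrite c1 ?normr0.
  case: (ltP (2 * d) `|vtail z|) => z2; first by rewrite c2 ?normr0.
  apply: cV_norm_le => // i; apply: HB; apply: cV_norm_le => [|j].
    by rewrite le_max ler0n.
  case: (unliftP ord0 j) => [k|] ->; rewrite le_max.
    by have := le_trans (cV_norm_ge (vtail z) k) z2; rewrite mxE => ->; rewrite orbT.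
  by rewrite ler_norml; apply/orP; left; apply/andP; split; nra.
- move=> t; rewrite /X (_ : \col_b _ = 0) ?mulmx0 ?scaler0 //.
  by apply/colP => b; rewrite !mxE vtail_cons /al potential_at0.
- by rewrite d_gt0 ge_min lexx orbT.
move=> t x /andP[t0 t1] xd b.
have uT : Th (vcons t x) \in unitmx.
  apply: Hr; first by apply/andP; split; lra.
  by rewrite (lt_le_trans xd) // (le_trans _ d3) // ler_peMl ?ler1n // ltW.
have -> : X (vcons t x) = invmx (Th (vcons t x)) *m \col_b al b x.
  rewrite /X /c vcons0 vtail_cons step_eq1; last by nra.
  by rewrite bump_eq1 ?subr0 ?(ltW xd) // mulr1 scale1r.
set T := Th _; set v := \col_b _.
have TT : T^T = - T.
  apply/matrixP => i j; rewrite mxE [RHS]mxE /T /Th.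
  rewrite mxE [X in _ + X]mxE [in RHS]mxE [X in - (_ + X)]mxE.
  rewrite vcons0 vtail_cons (WT 0 j i) (DT x j i); ring.
have -> : \sum_a (invmx T *m v) a 0 * T a b = (T^T *m (invmx T *m v)) b 0.
  by rewrite [RHS]mxE; apply: eq_bigr => a _; rewrite [T^T _ _]mxE mulrC.
by rewrite TT mulNmx mulKVmx // !mxE.
Qed.

End Moser.

Lemma moser_cancel (R : realFieldType) (S1 S2 S3 S4 S5 p q d t : R) :
  S1 + t * S2 = - p -> S3 + t * S4 = - q -> p - q = d -> S5 - S2 + S4 = 0 ->
  S1 + (d + t * S5) - S3 = 0.
Proof.
move=> K1 K2 K3 K4; have -> : S5 = S2 - S4 by lra.
lra.
Qed.

(** * Moser's isotopy and the pullback of the form *)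

Section LocalDarboux.
Variables (R : realType) (m : nat) (W : 'cV[R]_m -> 'M[R]_m.+1) (d0 : R).
Hypothesis CW : forall a b, Cinf setT (fun x => W x a b).
Hypothesis WT : forall x a b, W x a b = - W x b a.
Hypothesis W0 : W 0 \in unitmx.
Hypothesis d0_gt0 : 0 < d0.
Hypothesis closedW : forall x, `|x| <= d0 -> closed_form_at W x.

Let D x := W x - W 0.
Let al b := potential D b.
Let Th (z : 'cV[R]_m.+1) : 'M[R]_m.+1 := W 0 + z ord0 0 *: D (vtail z).

Let CD a b : Cinf setT (fun x => D x a b).
Proof.
apply: (@Cinf_ext _ _ _ (fun x => W x a b - W 0 a b)) => //.
  by move=> x _; rewrite /D !mxE.
by apply: Cinf_subr => //; exact: Cinf_cst.
Qed.

Let DT x a b : D x a b = - D x b a.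
Proof. by rewrite /D !mxE (WT x) (WT 0) -!opprD. Qed.

Let pdD a b c x : pd a (fun y => D y b c) x = pd a (fun y => W y b c) x.
Proof.
case: (unliftP ord0 a) => [k|] ->; rewrite ?pd0 ?pdS //.
have -> : (fun y => D y b c) = (fun y => W y b c + - W 0 b c).
  by apply/funext => y; rewrite /D !mxE.
have [_] := is_derive_addf (derivableP (Cinf_derivable (i := k) (x := x) (CW b c) I))
  (is_derive_cst (- W 0 b c) x (e_ k)).
by rewrite addr0.
Qed.

Let closedD x : `|x| <= d0 -> closed_form_at D x.
Proof. by move=> xd a b c; rewrite !pdD; exact: closedW. Qed.

Variables (X : 'cV[R]_m.+1 -> 'cV[R]_m.+1) (B r : R).
Hypothesis CX : smooth_map X.
Hypothesis XB : forall z, `|X z| <= B.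
Hypothesis X0 : forall t, X (vcons t 0) = 0.
Hypothesis r_gt0 : 0 < r <= d0.
Hypothesis Xeq : forall t x, 0 <= t <= 1 -> `|x| < r ->
  forall b, \sum_a X (vcons t x) a 0 * Th (vcons t x) a b = - al b x.

(* the suspension of X: the first coordinate is time *)
Let Y (w : 'cV[R]_m.+2) : 'cV[R]_m.+2 := vcons 1 (X (vcons (w ord0 0) (vtail (vtail w)))).

Let CXY a : Cinf setT (fun w : 'cV[R]_m.+2 => X (vcons (w ord0 0) (vtail (vtail w))) a 0).
Proof.
apply: (Cinf_comp _ _ _ _ (CX a)) => // i; case: (unliftP ord0 i) => [j|] ->.
  apply: Cinf_ext (Cinf_coord _ (lift ord0 (lift ord0 j))) => // x _.
  by rewrite vconsS !mxE.
by apply: Cinf_ext (Cinf_coord _ ord0) => // x _; rewrite vcons0.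
Qed.

Let CY : smooth_map Y.
Proof.
move=> i; case: (unliftP ord0 i) => [j|] ->.
  by apply: Cinf_ext (CXY j) => // x _; rewrite vconsS.
by apply: Cinf_ext (Cinf_cst _ 1) => // x _; rewrite vcons0.
Qed.

Let YB w : `|Y w| <= Num.max 1 B.
Proof.
apply: cV_norm_le => [|i]; first by rewrite le_max ler01.
rewrite le_max; case: (unliftP ord0 i) => [j|] ->.
  by rewrite vconsS (le_trans (cV_norm_ge _ _) (XB _)) orbT.
by rewrite vcons0 normr1 lexx.
Qed.

Let BY : picard_bounded Y.
Proof. by apply: bounded_picard => //; exists (Num.max 1 B). Qed.

Let CF := smooth_flow CY BY.

Let flow_time s w : flow Y (vcons s w) ord0 0 = w ord0 0 + s.
Proof.
have H (t : R) : is_derive t 1 (fun t => flow Y (vcons t w) ord0 0 - t) 0.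
  have := is_deriveB (flow_integral_curve w CY BY ord0 t) (is_derive_id t 1).
  by rewrite vcons0 subrr.
have E (a b : R) : flow Y (vcons a w) ord0 0 - a = flow Y (vcons b w) ord0 0 - b.
  by case: (leP a b) => [ab|/ltW ab]; [apply/esym|]; apply: (constant_derive0 ab) => t _; exact: H.
by have := E s 0; rewrite (flow_at0 CY BY) subr0 => <-; rewrite subrK.
Qed.

Definition moser_map (t : R) (z : 'cV[R]_m.+1) : 'cV[R]_m.+1 :=
  vtail (flow Y (vcons t (vcons 0 z))).

(** The suspension is autonomous and its clock runs at unit speed, so the time-one map is undone by
    flowing backwards for time 1 from clock value 1. *)
Definition moser_inverse (z : 'cV[R]_m.+1) : 'cV[R]_m.+1 :=
  vtail (flow Y (vcons (-1) (vcons 1 z))).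

Lemma smooth_moser_map t : smooth_map (moser_map t).
Proof.
move=> i; apply: (@Cinf_ext _ _ _ (fun z => flow Y (vcons t (vcons 0 z)) (lift ord0 i) 0)) => //.
  by move=> z _; rewrite /moser_map /moser_inverse [RHS]mxE.
exact: (Cinf_slice 0 (Cinf_slice t (CF (lift ord0 i)))).
Qed.

Lemma smooth_moser_inverse : smooth_map moser_inverse.
Proof.
move=> i; apply: (@Cinf_ext _ _ _ (fun z => flow Y (vcons (-1) (vcons 1 z)) (lift ord0 i) 0)) => //.
  by move=> z _; rewrite /moser_map /moser_inverse [RHS]mxE.
exact: (Cinf_slice 1 (Cinf_slice (-1) (CF (lift ord0 i)))).
Qed.

Lemma moser_mapK : cancel (moser_map 1) moser_inverse.
Proof.
move=> z; rewrite /moser_inverse /moser_map.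
have -> : vcons 1 (vtail (flow Y (vcons 1 (vcons 0 z)))) = flow Y (vcons 1 (vcons 0 z)).
  by rewrite -[RHS]vcons_tail flow_time vcons0 add0r.
by rewrite (flow_add _ _ _ CY YB) addNr (flow_at0 CY BY) vtail_cons.
Qed.

Lemma moser_inverseK : cancel moser_inverse (moser_map 1).
Proof.
move=> z; rewrite /moser_inverse /moser_map.
have -> : vcons 0 (vtail (flow Y (vcons (-1) (vcons 1 z)))) = flow Y (vcons (-1) (vcons 1 z)).
  by rewrite -[RHS]vcons_tail flow_time vcons0 addrN.
by rewrite (flow_add _ _ _ CY YB) addrN (flow_at0 CY BY) vtail_cons.
Qed.

(** The suspension does not involve the coordinate that is shifted, so a translated integral curve
    is an integral curve, and uniqueness applies. This is the equivariance of the Darboux chart. *)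
Lemma moser_map_shift t (c : R) z :
  moser_map t (z + c *: e_ ord0) = moser_map t z + c *: e_ ord0.
Proof.
have H1 := flow_integral_curve (vcons 0 (z + c *: e_ ord0)) CY BY.
pose sh := vcons 0 (c *: e_ ord0 : 'cV[R]_m.+1).
have Ysh w : Y (w + sh) = Y w.
  rewrite /Y; congr (vcons 1 (X (vcons _ _))).
    by rewrite mxE vcons0 addr0.
  apply/colP => i; rewrite mxE [LHS]mxE [LHS]mxE [RHS]mxE [RHS]mxE /sh vconsS.
  by rewrite !mxE /= mulr0 addr0.
have H2 : integral_curve Y (fun t => flow Y (vcons t (vcons 0 z)) + sh).
  move=> i s; rewrite Ysh.
  have := is_derive_addf (flow_integral_curve (vcons 0 z) CY BY i s) (is_derive_cst (sh i 0) s 1).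
  rewrite addr0; congr is_derive.
  by apply/funext => u; rewrite [RHS]mxE.
have := integral_curve_unique CY YB H1 H2; rewrite !(flow_at0 CY BY) vcons_add addr0.
move=> /(_ erefl t) E; rewrite /moser_map E.
apply/colP => i; rewrite mxE [LHS]mxE /sh vconsS [RHS]mxE.
by congr (_ + _); rewrite [RHS]mxE.
Qed.

Lemma moser_map0 t : moser_map t 0 = 0.
Proof.
have H1 := flow_integral_curve (vcons 0 0) CY BY.
have H2 : integral_curve Y (fun t => vcons t 0).
  move=> i s; rewrite /Y vcons0 vtail_cons.
  have -> : vtail (0 : 'cV[R]_m.+1) = 0 by apply/colP => j; rewrite !mxE.
  rewrite X0; case: (unliftP ord0 i) => [j|] ->.
    rewrite vconsS mxE (_ : (fun _ => _) = cst 0); first exact: is_derive_cst.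
    by apply/funext => u; rewrite vconsS mxE.
  rewrite vcons0 (_ : (fun _ => _) = id); first exact: is_derive_id.
  by apply/funext => u; rewrite vcons0.
have := integral_curve_unique CY YB H1 H2; rewrite (flow_at0 CY BY) => /(_ erefl t) E.
by rewrite /moser_map E vtail_cons.
Qed.

Let is_derive_moser z a (t : R) : is_derive t 1 (fun t => moser_map t z a 0)
  (X (vcons t (vtail (moser_map t z))) a 0).
Proof.
have := flow_integral_curve (vcons 0 z) CY BY (lift ord0 a) t.
rewrite vconsS flow_time vcons0 add0r; congr is_derive.
by apply/funext => u; rewrite /moser_map [RHS]mxE.
Qed.

(** The Jacobian of X(t, .) as a field on R^(m+1); [pd] makes the column of the invariant coordinate
    zero. *)
Let PX t x : 'M[R]_m.+1 := \matrix_(a, e) pd e (fun x => X (vcons t x) a 0) x.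

Let jac_moserE t z a b : jac (moser_map t) z a b =
  partial (lift ord0 (lift ord0 b)) (fun q => flow Y q (lift ord0 a) 0) (vcons t (vcons 0 z)).
Proof.
rewrite mxE.
have -> : (fun y => moser_map t y a 0) = (fun y => flow Y (vcons t (vcons 0 y)) (lift ord0 a) 0).
  by apply/funext => y; rewrite /moser_map [LHS]mxE.
have [_] := is_derive_slice 0 z b (Cinf_slice t (CF (lift ord0 a))).
rewrite /partial => ->.
by have [_] := is_derive_slice t (vcons 0 z) (lift ord0 b) (CF (lift ord0 a)).
Qed.

(** The variational equation of the suspension with its clock component removed; that component does
    not depend on the initial position, so its derivative vanishes. *)
Let jac_moser_derive z (t : R) : mx_derive (fun t => jac (moser_map t) z) t
  (PX t (vtail (moser_map t z)) *m jac (moser_map t) z).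
Proof.
move=> a b; rewrite (funext (fun t => jac_moserE t z a b)).
have := variational_equation (vcons 0 z) t (lift ord0 a) (lift ord0 b) CY BY.
congr is_derive; apply: etrans (big_ord_recl _ _) _.
have Z : partial (lift ord0 (lift ord0 b)) (fun q => flow Y q ord0 0) (vcons t (vcons 0 z)) = 0.
  have [_ <-] := is_derive_slice t (vcons 0 z) (lift ord0 b) (CF ord0).
  have -> : (fun w => flow Y (vcons t w) ord0 0) = (fun w => w ord0 0 + t).
    by apply/funext => w; rewrite flow_time.
  have [_ ->] := is_derive_addf (is_derive_coord (vcons 0 z) (e_ (lift ord0 b)) ord0)
     (is_derive_cst t (vcons 0 z) (e_ (lift ord0 b))).
  by rewrite mxE addr0.
have mul_add0 (u v w : R) : v = 0 -> u * v + w = w by move=> ->; rewrite mulr0 add0r.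
apply: etrans (mul_add0 _ _ _ Z) _; rewrite [RHS]mulmx_entry; set q := flow Y _.
have EY : (fun y => Y y (lift ord0 a) 0) = (fun w => X (vcons (w ord0 0) (vtail (vtail w))) a 0).
  by apply/funext => w; rewrite /Y vconsS.
have Eq : q = vcons t (moser_map t z).
  by rewrite -[LHS]vcons_tail /q flow_time vcons0 add0r.
have EP e : partial (lift ord0 e) (fun y => Y y (lift ord0 a) 0) q =
    PX t (vtail (moser_map t z)) a e.
  rewrite EY Eq [RHS]mxE.
  have CXt := Cinf_slice t (CX a).
  have E1 : (fun y => X (vcons (vcons t y ord0 0) (vtail (vtail (vcons t y)))) a 0) =
      (fun y : 'cV[R]_m.+1 => X (vcons t (vtail y)) a 0).
    by apply/funext => y; rewrite vcons0 vtail_cons.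
  have := is_derive_slice t (moser_map t z) e (CXY a); rewrite E1 => -[_ E2].
  apply: etrans (esym E2) _.
  case: (unliftP ord0 e) => [k|] ->.
    rewrite pdS; exact: (partial_vtailS k (moser_map t z) CXt).
  rewrite pd0; exact: (partial_vtail0 (fun x => X (vcons t x) a 0) (moser_map t z)).
by apply: eq_bigr => e _; rewrite EP (jac_moserE t z e b).
Qed.

Let Th_derive z (t : R) : mx_derive (fun t => Th (vcons t (vtail (moser_map t z)))) t
  (D (vtail (moser_map t z)) + t *: \matrix_(a, b)
     \sum_e X (vcons t (vtail (moser_map t z))) e 0 * pd e (fun y => D y a b) (vtail (moser_map t z))).
Proof.
move=> a b; set x := vtail (moser_map t z).
have -> : (fun t => Th (vcons t (vtail (moser_map t z))) a b) =
  (fun t => W 0 a b + t * D (vtail (moser_map t z)) a b).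
  by apply/funext => s; rewrite /Th addscale_entry vcons0 vtail_cons.
have dx k : is_derive t 1 (fun t => vtail (moser_map t z) k 0) (X (vcons t x) (lift ord0 k) 0).
  rewrite (_ : (fun _ => _) = (fun t => moser_map t z (lift ord0 k) 0)).
    exact: is_derive_moser.
  by apply/funext => s; rewrite mxE.
have dx' k : derivable (fun t => vtail (moser_map t z) k 0) t 1 by have [] := dx k.
have := is_derive_chain (W := R^o) (f := fun x => D x a b) (g := fun t => vtail (moser_map t z))
   (@cV_openT R m) (I : setT (vtail (moser_map t z)))
  (fun y i _ => Cinf_derivable (i := i) (x := y) (CD a b) I)
  (fun i => Cinf_continuous (Cinf_partial i (CD a b)) I) dx'.
move=> dD.
have := is_derive_addf (is_derive_cst (W 0 a b) t 1) (is_derive_mulf (is_derive_id t 1) dD).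
rewrite add0r mul1r; congr is_derive; rewrite addscale_entry; congr (_ + _ * _).
rewrite [RHS]mxE.
rewrite big_ord_recl pd0 mulr0 add0r; apply: eq_bigr => k _.
by have [_ ->] := dx k; rewrite pdS mulrC.
Qed.

(** In matrix form: the Lie derivative of Th along X plus its time derivative is 0. By Cartan's
    formula and closedness the Lie derivative is the differential of the contraction, i.e. of minus
    the potential, which is - D, while the time derivative is D. *)
Let moser_identity (t : R) x : 0 <= t <= 1 -> `|x| < r ->
  (PX t x)^T *m Th (vcons t x) +
  (D x + t *: \matrix_(a, b) \sum_e X (vcons t x) e 0 * pd e (fun y => D y a b) x) +
  Th (vcons t x) *m PX t x = 0.
Proof.
move=> t01 xr; apply/matrixP => a a'.
have ThT b c y : Th (vcons t y) b c = - Th (vcons t y) c b.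
  by rewrite /Th !addscale_entry vcons0 vtail_cons (WT 0 b c) (DT y b c); ring.
pose XX e y := X (vcons t y) e 0.
have CXX e : Cinf setT (XX e) by exact: (Cinf_slice t (CX e)).
(* Moser's equation holds on a neighbourhood of [x], hence may be differentiated at [x]. *)
have K c b : \sum_e (pd c (XX e) x * Th (vcons t x) e b + XX e x * (t * pd c (fun y => D y e b) x)) =
    - pd c (al b) x.
  case: (unliftP ord0 c) => [k|] ->; last first.
    by rewrite big1 ?pd0 ?oppr0 // => e _; rewrite !pd0 mul0r !mulr0 addr0.
  have dT e : is_derive x (e_ k : 'cV[R]_m) (fun y => Th (vcons t y) e b)
      (t * partial k (fun y => D y e b) x).
    have -> : (fun y => Th (vcons t y) e b) = (fun y => W 0 e b + t * D y e b).
      by apply/funext => y; rewrite /Th addscale_entry vcons0 vtail_cons.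
    have := is_derive_addf (is_derive_cst (W 0 e b) x (e_ k)) (is_derive_mulf 
      (is_derive_cst t x (e_ k)) (derivableP (Cinf_derivable (i := k) (x := x) (CD e b) I))).
    by rewrite add0r mul0r add0r.
  have dS := is_derive_sumf (index_enum 'I_m.+1) (fun e => is_derive_mulf
     (derivableP (Cinf_derivable (i := k) (x := x) (CXX e) I)) (dT e)).
  have Ca := Cinf_potential CD b.
  have dN : is_derive x (e_ k : 'cV[R]_m) (fun y => - al b y) (- partial k (al b) x).
    exact: is_deriveN (derivableP (Cinf_derivable (i := k) (x := x) Ca I)).
  have nE : \forall y \near x, \sum_e XX e y * Th (vcons t y) e b = - al b y.
    apply/cV_nbhsP; exists (r - `|x|); first by rewrite subr_gt0.
    move=> y yx; apply: Xeq => //; rewrite -(subrK x y) (le_lt_trans (ler_normD _ _)) //.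
    by rewrite -ltrBrDr.
  have nE' : \forall y \near x, - al b y = \sum_e XX e y * Th (vcons t y) e b.
    by apply: filterS nE => y; exact: esym.
  have [_ E1] := near_eq_is_derive nE' dN; have [_ E2] := dS.
  rewrite pdS -E1; apply: etrans (esym E2); apply: eq_bigr => e _.
  by rewrite !pdS.
have xd : `|x| <= d0 by move: r_gt0 => /andP[_]; apply: le_trans; exact: ltW.
have K1 := K a a'; have K2 := K a' a.
have K3 := potential_primitive CD DT (ltW d0_gt0) xd closedD a a'.
have K4 : \sum_e XX e x * (pd e (fun y => D y a a') x + pd a (fun y => D y a' e) x +
    pd a' (fun y => D y e a) x) = 0.
  by rewrite big1 // => e _; rewrite closedD ?mulr0.
have pdN c b e : pd c (fun y => D y b e) x = - pd c (fun y => D y e b) x.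
  case: (unliftP ord0 c) => [k|] ->; rewrite ?pd0 ?oppr0 // !pdS -partial_opp //.
  have -> // : (fun y => D y b e) = (fun y => - D y e b).
  by apply/funext => y; rewrite DT.
set S1 := \sum_e pd a (XX e) x * Th (vcons t x) e a'.
set S3 := \sum_e pd a' (XX e) x * Th (vcons t x) e a.
set S2 := \sum_e XX e x * pd a (fun y => D y e a') x.
set S4 := \sum_e XX e x * pd a' (fun y => D y e a) x.
set S5 := \sum_e XX e x * pd e (fun y => D y a a') x.
have {}K1 : S1 + t * S2 = - pd a (al a') x.
  rewrite -K1 big_split mulr_sumr; congr (_ + _); apply: eq_bigr => e _; ring.
have {}K2 : S3 + t * S4 = - pd a' (al a) x.
  rewrite -K2 big_split mulr_sumr; congr (_ + _); apply: eq_bigr => e _; ring.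
have {}K4 : S5 - S2 + S4 = 0.
  rewrite -K4 /S5 /S2 /S4 -sumrB -big_split; apply: eq_bigr => e _ /=.
  rewrite (pdN a a' e); ring.
have E1 : ((PX t x)^T *m Th (vcons t x)) a a' = S1.
  by rewrite mxE; apply: eq_bigr => e _; rewrite !mxE.
have E3 : (Th (vcons t x) *m PX t x) a a' = - S3.
  rewrite mxE -sumrN; apply: eq_bigr => e _; rewrite (ThT a e) [PX _ _ _ _]mxE; ring.
have -> : ((PX t x)^T *m Th (vcons t x) +
  (D x + t *: \matrix_(a, b) \sum_e X (vcons t x) e 0 * pd e (fun y => D y a b) x) +
  Th (vcons t x) *m PX t x) a a' = S1 + (D x a a' + t * S5) - S3.
  rewrite mxE E3 [X in X - _]mxE E1 addscale_entry; congr (_ + (_ + _ * _) - _).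
  by rewrite mxE.
rewrite [RHS]mxE; exact: moser_cancel K1 K2 K3 K4.
Qed.

(** The pulled-back segment has derivative 0 for t in [0, 1] by [moser_identity]; it is [W 0] at t =
    0 and the pullback of [W] at t = 1. *)
Lemma moser_map_pullback : exists2 d : R, 0 < d & forall z, `|z| < d ->
  (jac (moser_map 1) z)^T *m W (vtail (moser_map 1 z)) *m jac (moser_map 1) z = W 0.
Proof.
have [r0 rd] := andP r_gt0.
have r2 : 0 < r / 2 by rewrite divr_gt0.
(* The origin is fixed by the isotopy, so points close to it remain, for all times in [0, 1], in the
   region where Moser's equation holds. *)
have near_k : forall k : 'I_m, \forall z \near (0 : 'cV[R]_m.+1), forall t, 0 <= t <= 1 ->
    `|moser_map t z (lift ord0 k) 0| <= r / 2.
  move=> k; pose g (w : 'cV[R]_m.+2) := flow Y (vcons (w ord0 0) (vcons 0 (vtail w))) (lift ord0 (lift ord0 k)) 0.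
  have Cg : Cinf setT g.
    apply: (Cinf_comp _ _ _ _ (CF _)) => // i; case: (unliftP ord0 i) => [j|] ->.
      case: (unliftP ord0 j) => [l|] ->.
        apply: Cinf_ext (Cinf_coord _ (lift ord0 l)) => // x _.
        by rewrite !vconsS mxE.
      by apply: Cinf_ext (Cinf_cst _ 0) => // x _; rewrite vconsS vcons0.
    by apply: Cinf_ext (Cinf_coord _ ord0) => // x _; rewrite vcons0.
  have cg : continuous g by move=> z; exact: Cinf_continuous Cg _.
  apply: filterS (near_slice 0 cg r2) => z Hz t /Hz.
  have gE y : g (vcons t y) = moser_map t y (lift ord0 k) 0.
    by rewrite /g vcons0 vtail_cons /moser_map [RHS]mxE.
  have m0 : moser_map t 0 (lift ord0 k) 0 = 0 by rewrite moser_map0 mxE.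
  by rewrite !gE m0 subr0.
have /cV_nbhsP[d d_gt0 Hd] : \forall z \near (0 : 'cV[R]_m.+1), forall k t, 0 <= t <= 1 ->
    `|moser_map t z (lift ord0 k) 0| <= r / 2.
  have := @filter_forall _ 'I_m (fun k (z : 'cV[R]_m.+1) => forall t, 0 <= t <= 1 ->
    `|moser_map t z (lift ord0 k) 0| <= r / 2) (nbhs (0 : 'cV[R]_m.+1)) _.
  by apply.
exists d => // z zd.
have small t : 0 <= t <= 1 -> `|vtail (moser_map t z)| < r.
  move=> t01; apply: (@le_lt_trans _ _ (r / 2)); last by rewrite ltr_pdivrMr // ltr_pMr // ltr1n.
  by apply: cV_norm_le => [|k]; [exact: ltW|rewrite mxE; apply: Hd; rewrite ?subr0].
pose M t := (jac (moser_map t) z)^T *m Th (vcons t (vtail (moser_map t z))) *m jac (moser_map t) z.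
have dM (t : R) : 0 <= t <= 1 -> mx_derive M t 0.
  move=> t01; have H1 := jac_moser_derive z t; have H2 := Th_derive z t.
  have := mx_derive_mul (mx_derive_mul (mx_derive_tr H1) H2) H1.
  set x := vtail (moser_map t z); set J := jac (moser_map t) z.
  have H := moser_identity t01 (small t t01); rewrite -/x in H.
  have E0 : ((PX t x *m J)^T *m Th (vcons t x) + J^T *m (D x + t *: \matrix_(a, b)
     \sum_e X (vcons t x) e 0 * pd e (fun y => D y a b) x)) *m J +
     J^T *m Th (vcons t x) *m (PX t x *m J) = 0.
    have -> : 0 = J^T *m 0 *m J by rewrite mulmx0 mul0mx.
    rewrite -H; move: (D x + _) (Th _) (PX t x) => B0 T0 P0.
    by rewrite !mulmxDr !mulmxDl trmx_mul !mulmxA.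
  by rewrite E0.
have E : M 1 = M 0.
  by apply/matrixP => a b; apply: (@constant_derive0 R (fun t => M t a b)) => // t /dM/(_ a b); rewrite mxE.
have M0 : M 0 = W 0.
  rewrite /M.
  have E0 : moser_map 0 = id by apply/funext => y; rewrite /moser_map (flow_at0 CY BY) vtail_cons.
  have -> : jac (moser_map 0) z = 1%:M by rewrite E0 jac_id.
  by rewrite trmx1 mul1mx mulmx1 /Th vcons0 scale0r addr0.
rewrite -M0 -E /M; congr (_ *m _ *m _).
by rewrite /Th vcons0 vtail_cons scale1r /D addrC subrK.
Qed.

End LocalDarboux.

(* Darboux' theorem for closed forms that do not depend on the first coordinate:
   the chart can be chosen equivariant under translations of that coordinate *)
Theorem equivariant_darboux (R : realType) (m : nat) (W : 'cV[R]_m -> 'M[R]_m.+1) (d0 : R) :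
  (forall a b, Cinf setT (fun x => W x a b)) ->
  (forall x a b, W x a b = - W x b a) -> W 0 \in unitmx -> 0 < d0 ->
  (forall x, `|x| <= d0 -> closed_form_at W x) ->
  exists Phi Psi : 'cV[R]_m.+1 -> 'cV[R]_m.+1,
  [/\ smooth_map Phi /\ smooth_map Psi, cancel Phi Psi /\ cancel Psi Phi, Phi 0 = 0,
      forall c z, Phi (z + c *: e_ ord0) = Phi z + c *: e_ ord0 &
      exists2 d : R, 0 < d & forall z, `|z| < d ->
        (jac Phi z)^T *m W (vtail (Phi z)) *m jac Phi z = W 0].
Proof.
move=> CW WT W0 d0_gt0 closedW.
have [X [B [r [CX XB X0 r0 Xeq]]]] := moser_field CW WT W0 d0_gt0.
exists (moser_map X 1), (moser_inverse X); split.
- by split; [exact: (smooth_moser_map CX XB)|exact: (smooth_moser_inverse CX XB)].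
- by split; [exact: (moser_mapK CX XB)|exact: (moser_inverseK CX XB)].
- exact: (moser_map0 CX XB).
- by move=> c z; exact: (moser_map_shift CX XB).
- exact: (moser_map_pullback CW WT d0_gt0 closedW CX XB X0 r0).
Qed.

(** * Smooth functions and frames on manifolds *)

Section Manifolds.
Variables (R : realType) (m : nat) (X : topologicalType).
Implicit Types (c : chart R m X) (f g : X -> R) (U V : set X).

Lemma in_coordsE c f x : chart_ok c -> dom c x -> in_coords c f (c x) = f x.
Proof.
move=> [_ ci _ _] cx; rewrite /in_coords.
have : (f @` (dom c `&` c @^-1` [set c x])) (xget 0 (f @` (dom c `&` c @^-1` [set c x]))).
  by apply: xgetPex; exists (f x); exists x.
move=> [y [cy cyx] <-]; congr f; apply: ci => //; exact: mem_set.
Qed.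

Lemma chart_image_open c U : chart_ok c -> open U -> open (c @` (dom c `&` U)).
Proof.
move=> [oc _ _ cU] oU; apply: cU; first exact: openI.
by move=> x [].
Qed.

Lemma chart_continuous c x : chart_ok c -> dom c x -> {for x, continuous c}.
Proof. by move=> [_ _ H _]; exact: H. Qed.

Lemma chart_dom_open c : chart_ok c -> open (dom c).
Proof. by case. Qed.

Lemma chart_preimage_open c (O : set 'cV[R]_m) : chart_ok c -> open O ->
  open (dom c `&` c @^-1` O).
Proof.
move=> ok oO; rewrite openE => x [cx Ox]; apply: filterI.
  by apply: open_nbhs_nbhs; split=> //; exact: chart_dom_open.
by apply: (chart_continuous ok cx); exact: open_nbhs_nbhs.
Qed.

Definition transition c c' (y : 'cV[R]_m) : 'cV[R]_m :=
  \col_i in_coords c (fun x => c' x i 0) y.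

Lemma transitionE c c' x : chart_ok c -> dom c x -> transition c c' (c x) = c' x.
Proof. by move=> ok cx; apply/colP => i; rewrite mxE in_coordsE. Qed.

Lemma Cinf_change_chart c c' f U : chart_ok c -> chart_ok c' -> smooth_transition c c' ->
  open U -> Cinf (c' @` (dom c' `&` U)) (in_coords c' f) ->
  Cinf (c @` (dom c `&` (dom c' `&` U))) (in_coords c f).
Proof.
move=> ok ok' tr oU Cf; have oc' := chart_dom_open ok'.
have oI : open (c @` (dom c `&` (dom c' `&` U))) by apply: chart_image_open => //; exact: openI.
apply: (@Cinf_ext _ _ _ (fun y => in_coords c' f (transition c c' y))) => //.
  by move=> _ [x [cx [c'x Ux]] <-]; rewrite transitionE // !in_coordsE.
apply: Cinf_comp Cf => //; first exact: chart_image_open.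
  by move=> _ [x [cx [c'x Ux]] <-]; rewrite transitionE //; exists x.
move=> i; apply: (@Cinf_ext _ _ _ (in_coords c (fun x => c' x i 0))) => //.
  by move=> y _; rewrite mxE.
by apply: Cinf_sub (tr i) => _ [x [cx [c'x _]] <-]; exists x.
Qed.

Variable A : set (chart R m X).
Hypothesis hA : is_atlas A.

Lemma atlas_chart c : A c -> is_chart A c.
Proof.
by case: hA => ok _ tr Ac; split; [exact: ok|move=> c' Ac'; split; exact: tr].
Qed.

Lemma atlas_ok c : A c -> chart_ok c.
Proof. by case: hA => ok _ _; exact: ok. Qed.

Lemma smooth_on_chart c U f : is_chart A c -> open U -> smooth_on A U f ->
  Cinf (c @` (dom c `&` U)) (in_coords c f).
Proof.
move=> [ok tr] oU Sf; apply: Cinf_local => _ [x [cx Ux] <-].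
have [_ cov _] := hA; have [c' Ac' c'x] := cov x.
exists (c @` (dom c `&` (dom c' `&` U))); split.
- by apply: chart_image_open => //; apply: openI => //; exact: chart_dom_open (atlas_ok Ac').
- by exists x.
- apply: Cinf_change_chart => //; [exact: atlas_ok|by case: (tr _ Ac')|exact: Sf].
Qed.

Lemma smooth_onP U f : open U ->
  smooth_on A U f <-> (forall x, U x -> exists c V,
    [/\ is_chart A c, open V, V x, dom c x & Cinf (c @` (dom c `&` V)) (in_coords c f)]).
Proof.
move=> oU; split=> [Sf x Ux|H c Ac].
  have [_ cov _] := hA; have [c Ac cx] := cov x.
  by exists c, U; split=> //; [exact: atlas_chart|exact: Sf].
apply: Cinf_local => _ [x [cx Ux] <-]; have [c' [V [[ok' tr] oV Vx c'x Cf]]] := H x Ux.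
exists (c @` (dom c `&` (dom c' `&` V))); split.
- by apply: chart_image_open; [exact: atlas_ok|apply: openI => //; exact: chart_dom_open].
- by exists x.
- apply: Cinf_change_chart => //; [exact: atlas_ok|by case: (tr _ Ac)].
Qed.

Lemma smooth_on_sub U V f : V `<=` U -> smooth_on A U f -> smooth_on A V f.
Proof.
move=> VU Sf c Ac; apply: Cinf_sub (Sf c Ac) => _ [x [cx Vx] <-].
by exists x => //; split=> //; exact: VU.
Qed.

Lemma smooth_on_local U f : open U ->
  (forall x, U x -> exists V, [/\ open V, V x & smooth_on A V f]) -> smooth_on A U f.
Proof.
move=> oU H; apply/smooth_onP => // x /H[V [oV Vx Sf]].
have [_ cov _] := hA; have [c Ac cx] := cov x.
by exists c, V; split=> //; [exact: atlas_chart|exact: Sf].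
Qed.

Let image_ext c U f g : chart_ok c -> (forall x, U x -> f x = g x) ->
  forall y, (c @` (dom c `&` U)) y -> in_coords c f y = in_coords c g y.
Proof. by move=> ok fg _ [x [cx Ux] <-]; rewrite !in_coordsE // fg. Qed.

Lemma smooth_on_ext U f g : open U -> (forall x, U x -> f x = g x) ->
  smooth_on A U f -> smooth_on A U g.
Proof.
move=> oU fg Sf c Ac; have ok := atlas_ok Ac.
apply: Cinf_ext (Sf c Ac); first exact: chart_image_open.
exact: image_ext.
Qed.

Lemma smooth_on_cst U (a : R) : open U -> smooth_on A U (fun=> a).
Proof.
move=> oU c Ac; have ok := atlas_ok Ac.
apply: Cinf_ext (Cinf_cst _ a); first exact: chart_image_open.
by move=> _ [x [cx _] <-]; rewrite in_coordsE.
Qed.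

Lemma smooth_on_add U f g : open U -> smooth_on A U f -> smooth_on A U g ->
  smooth_on A U (fun x => f x + g x).
Proof.
move=> oU Sf Sg c Ac; have ok := atlas_ok Ac; have oI := chart_image_open ok oU.
apply: Cinf_ext (Cinf_add oI (Sf c Ac) (Sg c Ac)) => // _ [x [cx _] <-].
by rewrite !in_coordsE.
Qed.

Lemma smooth_on_mul U f g : open U -> smooth_on A U f -> smooth_on A U g ->
  smooth_on A U (fun x => f x * g x).
Proof.
move=> oU Sf Sg c Ac; have ok := atlas_ok Ac; have oI := chart_image_open ok oU.
apply: Cinf_ext (Cinf_mul oI (Sf c Ac) (Sg c Ac)) => // _ [x [cx _] <-].
by rewrite !in_coordsE.
Qed.

Lemma smooth_on_inv U f : open U -> (forall x, U x -> f x != 0) -> smooth_on A U f ->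
  smooth_on A U (fun x => (f x)^-1).
Proof.
move=> oU f0 Sf c Ac; have ok := atlas_ok Ac; have oI := chart_image_open ok oU.
apply: Cinf_ext (Cinf_inv oI _ (Sf c Ac)) => // _ [x [cx Ux] <-].
  by rewrite !in_coordsE.
by rewrite !in_coordsE // f0.
Qed.

Lemma smooth_on_sum U (I : Type) (r : seq I) (P : pred I) (F : I -> X -> R) : open U ->
  (forall i, P i -> smooth_on A U (F i)) -> smooth_on A U (fun x => \sum_(i <- r | P i) F i x).
Proof.
move=> oU SF; elim: r => [|i r IH].
  by apply: smooth_on_ext (smooth_on_cst 0 oU) => // x _; rewrite big_nil.
case Pi: (P i).
  by apply: smooth_on_ext (smooth_on_add oU (SF _ Pi) IH) => // x _; rewrite big_cons Pi.
by apply: smooth_on_ext IH => // x _; rewrite big_cons Pi.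
Qed.

Lemma smooth_on_prod U (I : Type) (r : seq I) (P : pred I) (F : I -> X -> R) : open U ->
  (forall i, P i -> smooth_on A U (F i)) -> smooth_on A U (fun x => \prod_(i <- r | P i) F i x).
Proof.
move=> oU SF; elim: r => [|i r IH].
  by apply: smooth_on_ext (smooth_on_cst 1 oU) => // x _; rewrite big_nil.
case Pi: (P i).
  by apply: smooth_on_ext (smooth_on_mul oU (SF _ Pi) IH) => // x _; rewrite big_cons Pi.
by apply: smooth_on_ext IH => // x _; rewrite big_cons Pi.
Qed.

Lemma smooth_on_opp U f : open U -> smooth_on A U f -> smooth_on A U (fun x => - f x).
Proof.
move=> oU Sf; apply: smooth_on_ext (smooth_on_mul oU (smooth_on_cst (-1) oU) Sf) => // x _.
by rewrite mulN1r.
Qed.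

Lemma smooth_on_continuous U f x : open U -> U x -> smooth_on A U f -> {for x, continuous f}.
Proof.
move=> oU Ux Sf; have [_ cov _] := hA; have [c Ac cx] := cov x.
have ok := atlas_ok Ac.
have C := Cinf_continuous (Sf c Ac) (ex_intro2 _ _ x (conj cx Ux) erefl).
have H : {for x, continuous (in_coords c f \o c)}.
  by apply: continuous_comp => //; exact: chart_continuous.
rewrite /prop_for /continuous_at in H *.
rewrite -(in_coordsE f ok cx); apply: cvg_trans H; apply: near_eq_cvg.
have : nbhs x (dom c) by apply: open_nbhs_nbhs; split=> //; exact: chart_dom_open.
by apply: filterS => y cy /=; rewrite in_coordsE.
Qed.

Lemma smooth_on_coord_fun c (O : set 'cV[R]_m) (F : 'cV[R]_m -> R) :
  is_chart A c -> open O -> Cinf O F -> smooth_on A (dom c `&` c @^-1` O) (fun x => F (c x)).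
Proof.
move=> hc oO CF; have ok := hc.1; have oU := chart_preimage_open ok oO.
apply/smooth_onP => // x [cx Ox]; exists c, (dom c `&` c @^-1` O); split=> //.
apply: (@Cinf_ext _ _ _ F).
- exact: chart_image_open.
- by move=> _ [y [cy _] <-]; rewrite in_coordsE.
- by apply: Cinf_sub CF => _ [y [_ [_ Oy]] <-].
Qed.

Hypothesis hX : hausdorff_space X.

(** A bump in a chart, extended by 0. The set [K] carrying it is compact, hence closed as X is
    Hausdorff, and this makes the extension smooth off the chart domain. *)
Lemma smooth_bump x U : open U -> U x -> exists rho V K,
  [/\ smooth A rho, open V, V x & forall y, V y -> rho y = 1] /\
  [/\ closed K, K `<=` U, V `<=` U & forall y, ~ K y -> rho y = 0].
Proof.
move=> oU Ux; have [_ cov _] := hA; have [c Ac cx] := cov x.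
have ok := atlas_ok Ac; have oI := chart_image_open ok oU.
have /cV_nbhsP[r r0 Hr] : nbhs (c x) (c @` (dom c `&` U)).
  by apply: open_nbhs_nbhs; split=> //; exists x.
pose d := r / 3; have d0 : 0 < d by rewrite divr_gt0.
pose rho y := if y \in dom c then bump (c x) d (c y) else 0.
pose B := [set z : 'cV[R]_m | `|z - c x| <= 2 * d].
pose K := (dom c `&` U) `&` c @^-1` B.
have Br z : B z -> (c @` (dom c `&` U)) z.
  move=> zB; apply: Hr; apply: le_lt_trans zB _.
  by rewrite /d mulrA ltr_pdivrMr // mulrC ltr_pM2l // ltr_nat.
(* [K] is the image of a closed ball under the inverse of the chart, whose continuity comes from
   openness of the chart map. *)
have cK : compact K.
  have cB : compact B by exact: compact_closed_ball.
  have H z : exists y, (c @` (dom c `&` U)) z -> [/\ dom c y, U y & c y = z].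
    case: (pselect ((c @` (dom c `&` U)) z)) => [[y [cy Uy] <-]|zO]; last by exists x.
    by exists y.
  have [s Hs] := choice H.
  have sc y : dom c y -> U y -> s (c y) = y.
    move=> cy Uy; have [|cs _ E] := Hs (c y); first by exists y.
    by case: ok => _ ci _ _; apply: ci => //; exact: mem_set.
  have -> : K = s @` B.
    apply/seteqP; split=> [y [[cy Uy] yB]|_ [z zB <-]].
      by exists (c y) => //; exact: sc.
    by have [cs Us E] := Hs _ (Br _ zB); split=> //; rewrite /preimage /= E.
  apply: continuous_compact cB; apply: continuous_in_subspaceT => z.
  rewrite inE => zB N; have [cs Us E] := Hs _ (Br _ zB).
  rewrite nbhsE /= => -[N' [oN' N's] N'N].
  have : nbhs z (c @` (dom c `&` (U `&` N'))).
    apply: open_nbhs_nbhs; split; first by apply: chart_image_open => //; exact: openI.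
    by exists (s z).
  by apply: filterS => _ [y [cy [Uy N'y]] <-]; apply: N'N; rewrite sc.
have clK : closed K by exact: compact_closed.
have rho0 y : ~ K y -> rho y = 0.
  rewrite /rho; case: ifP => // /set_mem cy Ky; apply: bump_eq0 => //.
  rewrite ltNge; apply/negP => yB; apply: Ky.
  have [y' [cy' Uy'] E] := Br _ yB; split=> //; split=> //.
  have -> // : y = y'.
  by case: ok => _ ci _ _; apply: ci => //; exact: mem_set.
pose V := dom c `&` c @^-1` [set z | `|z - c x| < d] `&` U.
have oV : open V.
  by apply: openI => //; apply: chart_preimage_open => //; exact: open_near.
exists rho, V, K; split; split=> //.
- apply: smooth_on_local; first exact: openT.
  move=> y _; case: (pselect (dom c y)) => cy.
    exists (dom c); split=> //; first exact: chart_dom_open.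
    have := smooth_on_coord_fun (atlas_chart Ac) (@cV_openT R m) (Cinf_bump (c x) d (@cV_openT R m)).
    rewrite preimage_setT setIT; apply: smooth_on_ext; first exact: chart_dom_open.
    by move=> y' cy'; rewrite /rho mem_set.
  exists (~` K); split; [exact: closed_openC|by move=> [[]]|].
  apply: smooth_on_ext (smooth_on_cst 0 _); try exact: closed_openC.
  by move=> y' /rho0 ->.
- by split=> //; split=> //=; rewrite subrr normr0.
- by move=> y [[cy yd] _]; rewrite /rho mem_set // bump_eq1 // ltW.
- by move=> y [[]].
- by move=> y [_].
Qed.

Lemma smooth_bump_mul rho K U f : smooth A rho -> closed K -> K `<=` U -> open U ->
  (forall y, ~ K y -> rho y = 0) -> smooth_on A U f -> smooth A (fun x => rho x * f x).
Proof.
move=> Sr cK KU oU r0 Sf; apply: smooth_on_local; first exact: openT.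
move=> x _; case: (pselect (U x)) => Ux.
  exists U; split=> //; apply: smooth_on_mul => //.
  by apply: smooth_on_sub Sr => y.
exists (~` K); split; [exact: closed_openC|by move=> /KU|].
apply: smooth_on_ext (smooth_on_cst 0 _); try exact: closed_openC.
by move=> y /r0 ->; rewrite mul0r.
Qed.

Lemma smooth_extend U f x : open U -> U x -> smooth_on A U f ->
  exists g V, [/\ smooth A g, open V, V x, V `<=` U & forall y, V y -> g y = f y].
Proof.
move=> oU Ux Sf; have [rho [V [K [[Sr oV Vx r1] [cK KU VU r0]]]]] := smooth_bump oU Ux.
exists (fun y => rho y * f y), V; split=> //; first exact: smooth_bump_mul Sr cK KU oU r0 Sf.
by move=> y /r1 ->; rewrite mul1r.
Qed.

Lemma smooth_family_extend (I : finType) U (F : I -> X -> R) x : open U -> U x ->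
  (forall i, smooth_on A U (F i)) -> exists (G : I -> X -> R) (V : set X),
  [/\ forall i, smooth A (G i), open V, V x, V `<=` U & forall i y, V y -> G i y = F i y].
Proof.
move=> oU Ux SF; have [rho [V [K [[Sr oV Vx r1] [cK KU VU r0]]]]] := smooth_bump oU Ux.
exists (fun i y => rho y * F i y), V; split=> // [i|i y /r1 ->]; last by rewrite mul1r.
exact: smooth_bump_mul Sr cK KU oU r0 (SF i).
Qed.

(** * Tangent vectors in coordinates *)

Section Tangent.
Variables (x : X) (v : (X -> R) -> R).
Hypothesis tv : tangent A x v.

Lemma tangent_add f g : smooth A f -> smooth A g -> v (fun y => f y + g y) = v f + v g.
Proof.
move=> Sf Sg; have [lin _ _] := tv; rewrite -[v f]mul1r -lin //; congr v.
by apply/funext => y; rewrite mul1r.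
Qed.

Lemma tangent_scale a f : smooth A f -> v (fun y => a * f y) = a * v f.
Proof.
move=> Sf; have [lin _ _] := tv.
have v0 : v (fun=> 0) = 0.
  have := lin 1 _ _ (smooth_on_cst 0 openT) (smooth_on_cst 0 openT).
  rewrite (_ : (fun y => _) = (fun=> 0)); last by apply/funext => y; rewrite mulr0 addr0.
  rewrite mul1r => H; lra.
rewrite -[RHS]addr0 -v0 -lin //; last exact: smooth_on_cst _ openT.
by congr v; apply/funext => y; rewrite addr0.
Qed.

Lemma tangent_sum (I : Type) (r : seq I) (F : I -> X -> R) : (forall i, smooth A (F i)) ->
  v (fun y => \sum_(i <- r) F i y) = \sum_(i <- r) v (F i).
Proof.
move=> SF; elim: r => [|i r IH].
  rewrite big_nil -[RHS](mul0r (v (fun=> 0))) -tangent_scale; last exact: smooth_on_cst _ openT.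
  by congr v; apply/funext => y; rewrite big_nil mul0r.
rewrite big_cons -IH -tangent_add //; last exact: smooth_on_sum openT (fun i _ => SF i).
by congr v; apply/funext => y; rewrite big_cons.
Qed.

Lemma tangent_mul f g : smooth A f -> smooth A g ->
  v (fun y => f y * g y) = f x * v g + g x * v f.
Proof. by case: tv => _ H _; exact: H. Qed.

Lemma tangent_cst a : v (fun=> a) = 0.
Proof.
have S1 : smooth A (fun=> 1) by exact: smooth_on_cst _ openT.
have := tangent_mul S1 S1; rewrite (_ : (fun y => _) = (fun=> 1)); last first.
  by apply/funext => y; rewrite mulr1.
rewrite mul1r => E; have v1 : v (fun=> 1) = 0 by lra.
rewrite -[RHS](mulr0 a) -v1 -tangent_scale //.
by congr v; apply/funext => y; rewrite mulr1.
Qed.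

(** If rho is a bump at [x] supported in [V], then [rho f = rho g] everywhere, and the Leibniz rule
    expresses [v h] through [v (rho h)], [h x] and [v rho]. *)
Lemma tangent_local f g V : smooth A f -> smooth A g -> open V -> V x ->
  (forall y, V y -> f y = g y) -> v f = v g.
Proof.
move=> Sf Sg oV Vx fg.
have [rho [V' [K [[Sr oV' V'x r1] [_ KV _ r0]]]]] := smooth_bump oV Vx.
have E h : smooth A h -> v h = v (fun y => rho y * h y) - h x * v rho.
  by move=> Sh; rewrite tangent_mul // r1 // mul1r addrK.
rewrite (E f) // (E g) // (fg x Vx); congr (v _ - _); apply/funext => y.
case: (pselect (V y)) => Vy; first by rewrite fg.
by rewrite r0 ?mul0r // => /KV.
Qed.

(* Hadamard's lemma: f = f x + sum_i (y_i - y_i x) g_i near x, where g_i x is the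
   i-th partial derivative *)
Lemma tangent_coordinates c (y : 'I_m -> X -> R) V f : is_chart A c -> dom c x ->
  (forall i, smooth A (y i)) -> open V -> V x ->
  (forall i z, V z -> dom c z /\ y i z = c z i 0) -> smooth A f ->
  v f = \sum_i v (y i) * partial i (in_coords c f) (c x).
Proof.
move=> hc cx Sy oV Vx yc Sf; have ok := hc.1.
have oI : open (c @` (dom c `&` setT)) by apply: chart_image_open => //; exact: openT.
have Cf := smooth_on_chart hc openT Sf.
have [F [d d0 [CF HF]]] := Cinf_extend oI (ex_intro2 _ _ x (conj cx I) erefl) Cf.
pose z0 := c x.
(* Hadamard's factors: the i-th partial derivative averaged over the segment from the centre to [z].
   [F] is a global extension of [f] in coordinates, so the whole segment is available. *)
pose G i (z : 'cV[R]_m) := J (fun w : 'cV[R]_m.+1 => partial i F (z0 + w ord0 0 *: (vtail w - z0))) z.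
have CG i : Cinf setT (G i).
  apply: Cinf_J; apply: (Cinf_comp _ _ _ _ (Cinf_partial i CF)) => // k.
  apply: (@Cinf_ext _ _ _ (fun w : 'cV[R]_m.+1 => z0 k 0 + w ord0 0 * (w (lift ord0 k) 0 - z0 k 0))) => //.
    by move=> w _; rewrite !mxE.
  apply: Cinf_add => //; first exact: Cinf_cst.
  apply: Cinf_mul => //; first exact: Cinf_coord.
  by apply: Cinf_subr => //; [exact: Cinf_coord|exact: Cinf_cst].
have HG z : F z = F z0 + \sum_i (z i 0 - z0 i 0) * G i z.
  have cpf i : continuous (fun s : R => partial i F (z0 + s *: (z - z0))).
    move=> s; have cs : {for s, continuous (fun s : R => z0 + s *: (z - z0))}.
      have c1 : {for s, continuous (fun s : R => s *: (z - z0))} by exact: scalel_continuous.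
      by apply: (@cvgD _ _ _ (nbhs s) _ (fun=> z0)) => //; exact: cvg_cst.
    by apply: (continuous_comp cs); exact: Cinf_continuous (Cinf_partial i CF) _.
  have cpm i : continuous (fun s : R => partial i F (z0 + s *: (z - z0)) * (z - z0) i 0).
    move=> s; have := continuous_mul_fun (g := fun=> (z - z0) i 0) (t := s) (cpf i s).
    by apply; exact: cst_continuous.
  have E : I01 (fun s => \sum_i partial i F (z0 + s *: (z - z0)) * (z - z0) i 0) =
      F (z0 + 1 *: (z - z0)) - F (z0 + 0 *: (z - z0)).
    apply: (@I01_derive R (fun s => F (z0 + s *: (z - z0)))).
      by move=> s; apply: cvg_sumr => i _; exact: cpm.
    move=> s; have := @is_derive_partials R m setT F (z0 + s *: (z - z0)) (z - z0)
      (@cV_openT _ _) I (CF 1%N).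
    by move=> [dF <-]; exact: is_derive_line.
  rewrite scale1r scale0r addr0 [z0 + _]addrC subrK in E.
  rewrite -[LHS](subrK (F z0)) addrC -E.
  rewrite I01_sum //; congr (_ + _); apply: eq_bigr => i _; rewrite /G /J.
  rewrite -I01_scale; last first.
    apply: (continuous_slice (f := fun w : 'cV[R]_m.+1 => partial i F (z0 + w ord0 0 *: (vtail w - z0)))).
    move=> w; have := Cinf_continuous (x := w) (U := setT) _ I; apply.
    apply: (Cinf_comp _ _ _ _ (Cinf_partial i CF)) => // k.
    apply: (@Cinf_ext _ _ _ (fun w : 'cV[R]_m.+1 => z0 k 0 + w ord0 0 * (w (lift ord0 k) 0 - z0 k 0))) => //.
      by move=> w' _; rewrite !mxE.
    apply: Cinf_add => //; first exact: Cinf_cst.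
    apply: Cinf_mul => //; first exact: Cinf_coord.
    by apply: Cinf_subr => //; [exact: Cinf_coord|exact: Cinf_cst].
  by congr I01; apply/funext => s; rewrite vcons0 vtail_cons mulrC !mxE.
have G0 i : G i z0 = partial i (in_coords c f) (c x).
  transitivity (partial i F z0).
    rewrite -[RHS]I01_cst /G /J; congr I01; apply/funext => s.
    by rewrite vcons0 vtail_cons subrr scaler0 addr0.
  apply: near_eq_derive; apply/cV_nbhsP; exists d => // z /ltW zd.
  by have [] := HF z zd.
pose N := V `&` (dom c `&` c @^-1` [set z | `|z - z0| < d]).
have oN : open N by apply: openI => //; apply: chart_preimage_open => //; exact: open_near.
have Nx : N x by split=> //; split=> //=; rewrite subrr normr0.
have [g [N' [Sg oN' N'x N'N gE]]] := smooth_family_extend oN Nx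
  (F := fun i z => G i (c z)) (fun i => smooth_on_sub (fun z (Nz : N z) => conj (Nz.2.1) I : 
    (dom c `&` c @^-1` setT) z) (smooth_on_coord_fun hc (@cV_openT _ _) (CG i))).
have Sy' i : smooth A (fun z => y i z + - z0 i 0).
  exact: smooth_on_add openT (Sy i) (smooth_on_cst _ openT).
have Syg i : smooth A (fun z => (y i z + - z0 i 0) * g i z).
  exact: smooth_on_mul openT (Sy' i) (Sg i).
have yx i : y i x = z0 i 0 by have [_ ->] := yc i x Vx.
(* Each product has a first factor vanishing at [x], so the Leibniz rule keeps only the value of the
   second factor there. *)
transitivity (v (fun z => f x + \sum_i (y i z + - z0 i 0) * g i z)).
  apply: (tangent_local (V := N')) => //.
    apply: smooth_on_add openT (smooth_on_cst _ openT) _.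
    exact: smooth_on_sum openT (fun i _ => Syg i).
  move=> z /[dup] N'z /N'N [Vz [cz /ltW zd]].
  rewrite -(in_coordsE f ok cz); have [_ <-] := HF _ zd; rewrite HG; congr (_ + _).
    have := HF z0; rewrite subrr normr0 => /(_ (ltW d0))[_ ->].
    by rewrite in_coordsE.
  by apply: eq_bigr => i _; rewrite gE //; have [_ ->] := yc i z Vz.
rewrite tangent_add; first last.
- exact: smooth_on_sum openT (fun i _ => Syg i).
- exact: smooth_on_cst _ openT.
rewrite tangent_cst add0r tangent_sum //; apply: eq_bigr => i _.
rewrite tangent_mul // yx subrr mul0r add0r gE // -/z0 G0 mulrC; congr (_ * _).
rewrite tangent_add //; last exact: smooth_on_cst _ openT.
by rewrite tangent_cst addr0.
Qed.

End Tangent.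

End Manifolds.

(** * Coordinate frames and changes of chart *)

Section CoordinateFrames.
Variables (R : realType) (m : nat) (X : topologicalType) (A : set (chart R m X)).
Hypotheses (hA : is_atlas A) (hX : hausdorff_space X).
Implicit Types (c : chart R m X) (f g : X -> R) (U V : set X).

(** Tangent vectors act on globally smooth functions only, so the coordinates of a chart are
    replaced by global functions that agree with them near [x]. *)
Lemma chart_coordinates_extend c x : is_chart A c -> dom c x ->
  exists (y : 'I_m -> X -> R) (V : set X),
  [/\ forall i, smooth A (y i), open V, V x & forall i z, V z -> dom c z /\ y i z = c z i 0].
Proof.
move=> hc cx; have oc := chart_dom_open hc.1.
have S i : smooth_on A (dom c) (fun z => c z i 0).
  have := smooth_on_coord_fun hA hc (@cV_openT R m) (Cinf_coord setT i).
  by rewrite preimage_setT setIT.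
have [G [V [SG oV Vx VU GE]]] := smooth_family_extend hA hX oc cx S.
by exists G, V; split=> // i z Vz; split; [exact: VU|exact: GE].
Qed.

Section OneChart.
Variable c : chart R m X.
Hypothesis hc : is_chart A c.

Let ok : chart_ok c := hc.1.

Let oim : open (c @` dom c).
Proof. by case: ok => oc _ _; apply. Qed.

Lemma Cinf_in_coords f : smooth A f -> Cinf (c @` dom c) (in_coords c f).
Proof.
by move=> Sf; have := smooth_on_chart hA hc openT Sf; rewrite setIT.
Qed.

Lemma coord_frameE x w f : dom c x -> smooth A f ->
  coord_frame A c x w f = \sum_i partial i (in_coords c f) (c x) * w i 0.
Proof.
move=> cx Sf; rewrite /coord_frame asboolT //.
have [_ ->] := is_derive_partials w oim (ex_intro2 _ _ x cx erefl) (Cinf_in_coords Sf 1%N).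
by [].
Qed.

Lemma coord_frame_nonsmooth x w f : ~ smooth A f -> coord_frame A c x w f = 0.
Proof. by move=> Sf; rewrite /coord_frame asboolF. Qed.

Lemma coord_frame_lin x a w w' : dom c x ->
  coord_frame A c x (a *: w + w') = (fun f => a * coord_frame A c x w f + coord_frame A c x w' f).
Proof.
move=> cx; apply/funext => f; case: (pselect (smooth A f)) => Sf; last first.
  by rewrite !coord_frame_nonsmooth // mulr0 addr0.
rewrite !coord_frameE // mulr_sumr -big_split; apply: eq_bigr => i _ /=.
by rewrite !mxE mulrDr mulrCA.
Qed.

Lemma tangent_coord_frame x w : dom c x -> tangent A x (coord_frame A c x w).
Proof.
move=> cx; have nx : nbhs (c x) (c @` dom c) by apply: open_nbhs_nbhs; split=> //; exists x.
have D h i : smooth A h -> is_derive (c x) (e_ i : 'cV[R]_m) (in_coords c h) (partial i (in_coords c h) (c x)).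
  move=> Sh; apply: derivableP; apply: Cinf_derivable (Cinf_in_coords Sh) _.
  by exists x.
split=> [a f g Sf Sg|f g Sf Sg|f]; last exact: coord_frame_nonsmooth.
- have Sfg : smooth A (fun y => a * f y + g y).
    exact: (smooth_on_add hA openT (smooth_on_mul hA openT (smooth_on_cst hA a openT) Sf) Sg).
  rewrite !coord_frameE // mulr_sumr -big_split; apply: eq_bigr => i _ /=.
  rewrite mulrA -mulrDl; congr (_ * _).
  have H := is_derive_addf (is_derive_mulf (is_derive_cst a (c x) (e_ i)) (D f i Sf)) (D g i Sg).
  rewrite mul0r add0r in H.
  have N : \forall y \near c x, a * in_coords c f y + in_coords c g y =
      in_coords c (fun y => a * f y + g y) y.
    by apply: filterS nx => _ [z cz <-]; rewrite !in_coordsE.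
  by have [_ E] := near_eq_is_derive N H.
- have Sfg : smooth A (fun y => f y * g y) by exact: (smooth_on_mul hA openT Sf Sg).
  rewrite !coord_frameE // !mulr_sumr -big_split; apply: eq_bigr => i _ /=.
  rewrite !mulrA -mulrDl; congr (_ * _).
  have H := is_derive_mulf (D f i Sf) (D g i Sg).
  have N : \forall y \near c x, in_coords c f y * in_coords c g y =
      in_coords c (fun y => f y * g y) y.
    by apply: filterS nx => _ [z cz <-]; rewrite !in_coordsE.
  have [_ E] := near_eq_is_derive N H.
  rewrite /partial E !in_coordsE // addrC; congr (_ + _).
  by rewrite mulrC.
Qed.

Lemma coord_frame_coordinate x w (y : X -> R) V i : smooth A y -> open V -> V x ->
  (forall z, V z -> dom c z /\ y z = c z i 0) -> coord_frame A c x w y = w i 0.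
Proof.
move=> Sy oV Vx yc; have [cx _] := yc x Vx.
rewrite /coord_frame asboolT //.
have N : nbhs (c x) [set z : 'cV[R]_m | z i 0 = in_coords c y z].
  have : nbhs (c x) (c @` (dom c `&` V)).
    by apply: open_nbhs_nbhs; split; [exact: chart_image_open|exists x].
  by apply: filterS => _ [z [cz Vz] <-]; rewrite /= in_coordsE //; have [_ ->] := yc z Vz.
have N' : {near c x, (fun z : 'cV[R]_m => z i 0) =1 in_coords c y} by [].
by have [_] := near_eq_is_derive N' (is_derive_coord (c x) w i).
Qed.

Lemma tangent_coord_frameE x (y : 'I_m -> X -> R) V v : (forall i, smooth A (y i)) ->
  open V -> V x -> (forall i z, V z -> dom c z /\ y i z = c z i 0) -> tangent A x v -> dom c x ->
  v = coord_frame A c x (\col_i v (y i)).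
Proof.
move=> Sy oV Vx yc tv cx; apply/funext => f; case: (pselect (smooth A f)) => Sf; last first.
  by rewrite coord_frame_nonsmooth //; case: tv => _ _; exact.
rewrite (tangent_coordinates hA hX tv hc cx Sy oV Vx yc Sf) coord_frameE //.
by apply: eq_bigr => i _; rewrite mxE mulrC.
Qed.

Lemma coord_frame_surj x v : dom c x -> tangent A x v -> exists w, v = coord_frame A c x w.
Proof.
move=> cx tv; have [y [V [Sy oV Vx yc]]] := chart_coordinates_extend hc cx.
by exists (\col_i v (y i)); exact: tangent_coord_frameE Sy oV Vx yc tv cx.
Qed.

Lemma coord_frame_inj x : dom c x -> injective (coord_frame A c x).
Proof.
move=> cx w w' E; have [y [V [Sy oV Vx yc]]] := chart_coordinates_extend hc cx.
apply/colP => i.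
have := congr1 (fun v => v (y i)) E.
by rewrite !(coord_frame_coordinate _ (Sy i) oV Vx (yc i)).
Qed.

Lemma is_frame_coord_frame x B : dom c x -> B \in unitmx ->
  is_frame A x (frame_comp (coord_frame A c x) B).
Proof.
move=> cx uB; split.
- by move=> a w w' f; rewrite /frame_comp mulmxDr -scalemxAr coord_frame_lin.
- by move=> w; exact: tangent_coord_frame.
- move=> w w' /(coord_frame_inj cx) E.
  by rewrite -(mulKmx uB w) E mulKmx.
- move=> v /(coord_frame_surj cx)[w ->]; exists (invmx B *m w).
  by rewrite /frame_comp mulKVmx.
Qed.

Lemma frame_linear x psi : is_frame A x psi ->
  forall a w w', psi (a *: w + w') = (fun f => a * psi w f + psi w' f).
Proof. by move=> [lin _ _ _] a w w'; apply/funext => f; exact: lin. Qed.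

(** The columns of [B] are the coordinates of the frame vectors; a kernel vector of [B] would
    contradict injectivity of [psi]. *)
Lemma frame_matrix x psi : dom c x -> is_frame A x psi ->
  exists2 B, B \in unitmx & psi = frame_comp (coord_frame A c x) B.
Proof.
move=> cx fpsi; have [lin tan inj sur] := fpsi.
have lin0 f : psi 0 f = 0.
  have := lin 1 0 0 f; rewrite scaler0 addr0 mul1r => H; lra.
have linS (I : Type) (r : seq I) (F : I -> 'cV[R]_m) f :
    psi (\sum_(i <- r) F i) f = \sum_(i <- r) psi (F i) f.
  elim: r => [|i r IH]; first by rewrite !big_nil lin0.
  by rewrite !big_cons -{1}[F i]scale1r lin IH mul1r.
have linZ a w f : psi (a *: w) f = a * psi w f.
  by rewrite -[a *: w]addr0 lin lin0 addr0.
have [b Hb] := choice (fun i => coord_frame_surj cx (tan (e_ i))).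
pose B : 'M[R]_m := \matrix_(i, j) b j i 0.
have E : psi = frame_comp (coord_frame A c x) B.
  apply/funext => w; apply/funext => f; rewrite /frame_comp.
  case: (pselect (smooth A f)) => Sf; last first.
    by rewrite coord_frame_nonsmooth //; case: (tan w) => _ _; exact.
  rewrite coord_frameE // {1}(cV_sum_delta w) linS.
  transitivity (\sum_j w j 0 * \sum_i partial i (in_coords c f) (c x) * b j i 0).
    by apply: eq_bigr => j _; rewrite linZ Hb coord_frameE.
  under eq_bigr => j _ do rewrite mulr_sumr.
  rewrite exchange_big; apply: eq_bigr => i _ /=; rewrite mulmx_entry mulr_sumr.
  by apply: eq_bigr => j _; rewrite mxE mulrCA mulrA mulrAC -mulrA.
exists B => //; rewrite -unitmx_tr -row_free_unit -kermx_eq0.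
apply/eqP/row_matrixP => i; rewrite row0.
set u := row i _.
have uB : u *m B^T = 0.
  by rewrite /u -row_mul mulmx_ker row0.
have : psi u^T = psi 0.
  by rewrite E /frame_comp -[B in LHS]trmxK -trmx_mul uB trmx0 mulmx0.
by move=> /inj /(congr1 trmx); rewrite trmxK trmx0.
Qed.

Lemma smooth_coord_frame V (w : X -> 'cV[R]_m) f : open V -> V `<=` dom c ->
  (forall i, smooth_on A V (fun x => w x i 0)) -> smooth A f ->
  smooth_on A V (fun x => coord_frame A c x (w x) f).
Proof.
move=> oV Vc Sw Sf.
apply: (smooth_on_ext hA oV (f := fun x => \sum_i partial i (in_coords c f) (c x) * w x i 0)).
  by move=> x /Vc cx; rewrite coord_frameE.
apply: smooth_on_sum => // i _; apply: smooth_on_mul => //.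
have := smooth_on_coord_fun hA hc oim (Cinf_partial i (Cinf_in_coords Sf)).
apply: smooth_on_sub => x /Vc cx; split=> //; by exists x.
Qed.

Lemma local_frame_matrix V sigma (B : X -> 'M[R]_m) : V `<=` dom c ->
  local_frame A V sigma -> (forall x, V x -> sigma x = frame_comp (coord_frame A c x) (B x)) ->
  forall i j, smooth_on A V (fun x => B x i j).
Proof.
move=> Vc [oV fr Ss] sB i j; apply: smooth_on_local => // x Vx.
have [y [N [Sy oN Nx yc]]] := chart_coordinates_extend hc (Vc x Vx).
exists (V `&` N); split=> //; first exact: openI.
have := Ss (e_ j) (y i) (Sy i).
move=> /(smooth_on_sub (V := V `&` N) (fun x h => h.1)).
apply: smooth_on_ext => //; first exact: openI.
move=> z [Vz Nz]; rewrite sB // /frame_comp.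
rewrite (coord_frame_coordinate _ (Sy i) oN Nz (yc i)) mulmx_entry (bigD1 j) //= big1.
  by rewrite mxE !eqxx mulr1 addr0.
by move=> k kj; rewrite mxE (negbTE kj) mulr0.
Qed.

(** Change of coordinates by a diffeomorphism of [O]; with [th] the identity it shrinks the domain
    of a chart. *)
Definition chart_compose (O : set 'cV[R]_m) (th : 'cV[R]_m -> 'cV[R]_m) : chart R m X :=
  Chart (dom c `&` c @^-1` O) (th \o c).

Section Compose.
Variables (O O' : set 'cV[R]_m) (th th' : 'cV[R]_m -> 'cV[R]_m).
Hypotheses (oO : open O) (oO' : open O').
Hypotheses (Cth : forall i, Cinf O (fun y => th y i 0)) (Cth' : forall i, Cinf O' (fun y => th' y i 0)).
Hypothesis thK : forall y, O y -> O' (th y) /\ th' (th y) = y.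
Hypothesis th'K : forall z, O' z -> O (th' z) /\ th (th' z) = z.

Local Notation c1 := (chart_compose O th).

Let cth' z : O' z -> {for z, continuous th'}.
Proof. by move=> Oz; apply: cV_continuous => i; exact: Cinf_continuous (Cth' i) Oz. Qed.

Lemma chart_compose_ok : chart_ok c1.
Proof.
split.
- exact: chart_preimage_open.
- move=> x y /set_mem[cx Ox] /set_mem[cy Oy] /= E.
  case: ok => _ ci _ _; apply: ci; [exact: mem_set..|].
  by have [_ <-] := thK Ox; have [_ <-] := thK Oy; rewrite E.
- move=> x [cx Ox]; apply: continuous_comp; first exact: chart_continuous.
  by apply: cV_continuous => i; exact: Cinf_continuous (Cth i) Ox.
- move=> U oU Uc.
  have -> : c1 @` U = O' `&` th' @^-1` (c @` (dom c `&` U)).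
    apply/seteqP; split=> [_ [x Ux <-]|z [Oz [x [cx Ux] E]]].
      have [cx Ox] := Uc x Ux; have [h1 E] := thK Ox.
      by split=> //=; rewrite /preimage /= E; exists x.
    by exists x => //=; rewrite E; have [_] := th'K Oz.
  rewrite openE => z [Oz Hz]; apply: filterI; first exact: open_nbhs_nbhs.
  by apply: (cth' Oz); apply: open_nbhs_nbhs; split=> //; exact: chart_image_open.
Qed.

Lemma in_coords_compose f z : (c1 @` dom c1) z -> in_coords c1 f z = in_coords c f (th' z).
Proof.
move=> [x /[dup] c1x [cx Ox] <-]; rewrite (in_coordsE f chart_compose_ok c1x) /=.
by have [_ ->] := thK Ox; rewrite in_coordsE.
Qed.

Lemma is_chart_compose : is_chart A c1.
Proof.
split; first exact: chart_compose_ok.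
move=> c' Ac'; have ok' := atlas_ok hA Ac'; have [tr tr'] := hc.2 _ Ac'; split=> i.
- have o1 : open (c1 @` (dom c1 `&` dom c')).
    by apply: chart_image_open; [exact: chart_compose_ok|exact: chart_dom_open].
  apply: (@Cinf_ext _ _ _ (fun z => in_coords c (fun x => c' x i 0) (th' z))) => //.
    by move=> z [x [c1x c'x] <-]; rewrite in_coords_compose //; exists x.
  apply: (Cinf_comp (W := c @` (dom c `&` dom c'))) => //.
  + by apply: chart_image_open => //; exact: chart_dom_open.
  + move=> _ [x [[cx Ox] c'x] <-] /=; have [_ ->] := thK Ox; by exists x.
  + move=> j; apply: Cinf_sub (Cth' j) => _ [x [[cx Ox] c'x] <-] /=.
    by have [] := thK Ox.
- have o1 : open (c' @` (dom c' `&` dom c1)).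
    by apply: chart_image_open => //; exact: chart_dom_open chart_compose_ok.
  apply: (@Cinf_ext _ _ _ (fun z => th (transition c' c z) i 0)) => //.
    move=> _ [x [c'x [cx Ox]] <-].
    by rewrite transitionE // in_coordsE.
  apply: (Cinf_comp (W := O) (f := fun y => th y i 0)) => //.
  + by move=> _ [x [c'x [cx Ox]] <-]; rewrite transitionE.
  + move=> j; apply: (@Cinf_ext _ _ _ (in_coords c' (fun x => c x j 0))) => //.
      by move=> y _; rewrite mxE.
    apply: Cinf_sub (tr' j) => _ [x [c'x [cx _]] <-]; by exists x.
Qed.

(** The chain rule brings in the Jacobian of the inverse change of coordinates, taken at the new
    coordinates of [x]. *)
Lemma coord_frame_compose x w : dom c1 x ->
  coord_frame A c1 x w = coord_frame A c x (jac th' (th (c x)) *m w).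
Proof.
move=> c1x; have [cx Ox] := c1x; have [h1 E] := thK Ox.
apply/funext => f; case: (pselect (smooth A f)) => Sf; last first.
  by rewrite /coord_frame !asboolF.
rewrite coord_frameE // /coord_frame asboolT //=.
have C1 := Cinf_in_coords Sf 1%N.
have oi : open (c @` dom c) := oim.
have Ux : (c @` dom c) (th' (th (c x))) by rewrite E; exists x.
have dth i : is_derive (th (c x)) w (fun z => th' z i 0)
    (\sum_k partial k (fun z => th' z i 0) (th (c x)) * w k 0).
  exact: is_derive_partials oO' h1 (Cth' i 1%N).
have dth' i : derivable (fun z => th' z i 0) (th (c x)) w by have [] := dth i.
have H := is_derive_comp oi Ux C1 dth'.
have N : \forall z \near th (c x), (in_coords c f \o th') z = in_coords c1 f z.
  have : nbhs (th (c x)) (c1 @` dom c1).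
    apply: open_nbhs_nbhs; split; last by exists x.
    by have [h2 _ _] := chart_compose_ok; apply.
  by apply: filterS => z Hz; rewrite in_coords_compose.
have [_ ->] := near_eq_is_derive N H; rewrite E; apply: eq_bigr => i _; congr (_ * _).
have [_ ->] := dth i; rewrite mulmx_entry.
by apply: eq_bigr => k _; rewrite mxE.
Qed.

End Compose.
End OneChart.
End CoordinateFrames.

(** * The slit dual as a manifold *)

Section SlitDualManifold.
Variables (R : realType) (n : nat) (M : manifold R n) (L : line_bundle M).
Local Notation Mt := (slit_dual L).
Local Notation At := (slit_dual_atlas L).
Implicit Types (t : local_triv (fib L)) (c : chart R n M) (e : Mt) (x : M).

Let hA : is_atlas (atlas M) := atlasP M.

Definition unit_vec t x : fib L x := xget 0 [set u : fib L x | tmap t u = 1].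

Lemma tmap0 t x : trivs L t -> tdom t x -> tmap t (0 : fib L x) = 0.
Proof.
move=> Tt tx; have := trivs_linear Tt tx 1 0 0.
rewrite scaler0 addr0 mul1r => H; lra.
Qed.

Lemma tmapZ t x a (u : fib L x) : trivs L t -> tdom t x -> tmap t (a *: u) = a * tmap t u.
Proof.
by move=> Tt tx; have := trivs_linear Tt tx a u 0; rewrite !addr0 tmap0 // addr0.
Qed.

Lemma tmap_inj t x : trivs L t -> tdom t x -> injective (@tmap _ _ _ t x).
Proof. by move=> Tt tx; exact: bij_inj (trivs_bij Tt tx). Qed.

Lemma tmap_unit t x : trivs L t -> tdom t x -> tmap t (unit_vec t x) = 1.
Proof.
move=> Tt tx; have [g _ gK] := trivs_bij Tt tx.
suff : [set u : fib L x | tmap t u = 1] (unit_vec t x) by [].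
by apply: xgetPex; exists (g 1); exact: gK.
Qed.

Lemma fib_unit t x (u : fib L x) : trivs L t -> tdom t x -> u = tmap t u *: unit_vec t x.
Proof.
by move=> Tt tx; apply: (tmap_inj Tt tx); rewrite tmapZ // tmap_unit // mulr1.
Qed.

Definition sfun t e : R := cov (unit_vec t (proj e)).

Lemma cov0 e : cov (0 : fib L (proj e)) = 0.
Proof. by have := cov_linear 1 (0 : fib L (proj e)) 0; rewrite scaler0 addr0 mul1r => H; lra. Qed.

Lemma covZ e a (u : fib L (proj e)) : cov (a *: u) = a * cov u.
Proof. by have := cov_linear a u 0; rewrite !addr0 cov0 addr0. Qed.

Lemma cov_sfun t e (u : fib L (proj e)) : trivs L t -> tdom t (proj e) ->
  cov u = tmap t u * sfun t e.
Proof. by move=> Tt te; rewrite {1}(fib_unit u Tt te) covZ. Qed.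

Lemma sfun_neq0 t e : trivs L t -> tdom t (proj e) -> sfun t e != 0.
Proof.
move=> Tt te; have [u] := cov_neq0 e; rewrite (cov_sfun _ Tt te).
by rewrite mulf_eq0 negb_or => /andP[].
Qed.

Lemma sfun_scale r (r0 : r != 0) t e : sfun t (scale r0 e) = r * sfun t e.
Proof. by []. Qed.

(** The covector of a point has a type depending on its projection, so base points are identified
    before covectors are compared; a covector is determined by its value on one frame of L. *)
Lemma slit_dual_eq e e' (E : proj e = proj e') :
  (forall t, trivs L t -> tdom t (proj e) -> sfun t e = sfun t e') -> e = e'.
Proof.
case: e e' E => [x u ul u0] [x' u' ul' u0'] /= E; case: _ / E u' ul' u0' => u' ul' u0' H.
have [t Tt tx] := trivs_cover L x.
have E : u = u'.
  apply/funext => v.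
  have E1 := @cov_sfun t (SlitDual ul u0) v Tt tx.
  have E2 := @cov_sfun t (SlitDual ul' u0') v Tt tx.
  by rewrite /= in E1 E2; rewrite E1 E2 H.
move: ul' u0'; rewrite -E => ul' u0'.
by rewrite (Prop_irrelevance ul ul') (Prop_irrelevance u0 u0').
Qed.

Lemma mk_linear t x (Tt : trivs L t) (tx : tdom t x) (s : R) a (u v : fib L x) :
  s * tmap t (a *: u + v) = a * (s * tmap t u) + s * tmap t v.
Proof. by rewrite (trivs_linear Tt tx) mulrDr mulrCA. Qed.

Lemma mk_neq0 t x (Tt : trivs L t) (tx : tdom t x) (s : R) (s0 : s != 0) :
  exists v : fib L x, s * tmap t v != 0.
Proof. by exists (unit_vec t x); rewrite tmap_unit // mulr1. Qed.

Definition mkpt t x (Tt : trivs L t) (tx : tdom t x) (s : R) (s0 : s != 0) : Mt :=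
  SlitDual (mk_linear Tt tx s) (mk_neq0 Tt tx s0).

Lemma sfun_mkpt t x (Tt : trivs L t) (tx : tdom t x) (s : R) (s0 : s != 0) :
  sfun t (mkpt Tt tx s0) = s.
Proof. by rewrite /sfun /= tmap_unit // mulr1. Qed.

Local Notation Ct c t := (Chart (@slit_dual_dom R n M L c t) (@slit_dual_coord R n M L c t)).

Lemma slit_coordE c t e : slit_dual_coord c t e = vcons (sfun t e) (c (proj e)).
Proof. by []. Qed.

Section Subbase.
Import finmap.

Lemma slit_subbase_open (B : set Mt) : slit_dual_subbase B -> open B.
Proof.
move=> sB; rewrite openE => e Be; exists B; split=> //.
exists [set B]; last by rewrite bigcup_set1.
move=> _ ->; exists [fset B]%fset.
  by move=> B'; rewrite inE => /eqP ->; exact/mem_set.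
by rewrite set_fset1 bigcap_set1.
Qed.

(** An open set is a union of finite intersections of subbasic sets, and filters are closed under
    finite intersections. *)
Lemma nbhs_slit_subbase (T : Type) (F : set_system T) (f : T -> Mt) e : Filter F ->
  (forall B, slit_dual_subbase B -> B e -> F (f @^-1` B)) -> f @ F --> nbhs e.
Proof.
move=> FF H U; rewrite nbhsE => -[V [oV Ve] VU].
apply: filterS (_ : F (f @^-1` V)); first by move=> y; exact: VU.
case: oV => D' D'fin VE; move: Ve; rewrite -VE => -[W D'W We].
have [D0 D0s WE] := D'fin _ D'W.
apply: (@filterS _ F _ (f @^-1` W)); first by move=> y Wy; exists W.
rewrite -WE.
rewrite preimage_bigcap.
apply: filter_bigI => B BD; apply: H; first exact: (set_mem (D0s _ BD)).
by move: We; rewrite -WE; apply.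
Qed.

End Subbase.

Lemma slit_dom_open c t : atlas M c -> trivs L t -> open (@slit_dual_dom R n M L c t).
Proof.
move=> Ac Tt; apply: slit_subbase_open; exists c, t, setT; first by split=> //; exact: openT.
by rewrite preimage_setT setIT.
Qed.

Lemma slit_coord_open c t (O : set 'cV[R]_n.+1) : atlas M c -> trivs L t -> open O ->
  open (@slit_dual_dom R n M L c t `&` slit_dual_coord c t @^-1` O).
Proof. by move=> Ac Tt oO; apply: slit_subbase_open; exists c, t, O. Qed.

Lemma slit_cover e : exists c t, [/\ atlas M c, trivs L t & slit_dual_dom c t e].
Proof.
have [_ cov _] := hA; have [c Ac cx] := cov (proj e).
by have [t Tt tx] := trivs_cover L (proj e); exists c, t.
Qed.

Lemma vtail_preimage_open (O : set 'cV[R]_n) : open O -> open (@vtail R n @^-1` O).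
Proof.
by move=> oO; apply: open_comp => // z _; exact: (smooth_map_continuous (@smooth_vtail R n)).
Qed.

Lemma proj_preimage_open (U : set M) : open U -> open (@proj R n M L @^-1` U).
Proof.
move=> oU; rewrite openE => e Ue; have [c [t [Ac Tt [ce te]]]] := slit_cover e.
have ok := atlas_ok hA Ac.
have oV := slit_coord_open Ac Tt (vtail_preimage_open (chart_image_open ok oU)).
suff : nbhs e (@slit_dual_dom R n M L c t `&` slit_dual_coord c t @^-1` (@vtail R n @^-1` (c @` (dom c `&` U)))).
  apply: filterS => e' [[ce' te']]; rewrite /preimage /= slit_coordE vtail_cons => -[x [cx Ux] E].
  have <- // : x = proj e'.
  by case: ok => _ ci _ _; apply: ci => //; exact: mem_set.
apply: open_nbhs_nbhs; split=> //; split=> //; rewrite /preimage /= slit_coordE vtail_cons.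
by exists (proj e).
Qed.

Lemma slit_coord_continuous c t e : atlas M c -> trivs L t -> slit_dual_dom c t e ->
  {for e, continuous (slit_dual_coord c t : Mt -> _)}.
Proof.
move=> Ac Tt de N; rewrite nbhsE => -[N' [oN' N'e] N'N].
have : nbhs e (@slit_dual_dom R n M L c t `&` slit_dual_coord c t @^-1` N').
  by apply: open_nbhs_nbhs; split=> //; exact: slit_coord_open.
by apply: filterS => e' [_ He']; exact: N'N.
Qed.

Lemma slit_coord_inj c t : atlas M c -> trivs L t ->
  set_inj (@slit_dual_dom R n M L c t) (slit_dual_coord c t).
Proof.
move=> Ac Tt e e' /set_mem[ce te] /set_mem[ce' te']; rewrite !slit_coordE => E.
have ok := atlas_ok hA Ac.
have Es : sfun t e = sfun t e' by rewrite -(vcons0 (sfun t e) (c (proj e))) E vcons0.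
have Ex : proj e = proj e'.
  case: ok => _ ci _ _; apply: ci; [exact: mem_set..|].
  by rewrite -(vtail_cons (sfun t e) (c (proj e))) E vtail_cons.
apply: (slit_dual_eq Ex) => t' Tt' t'e; have t'e' : tdom t' (proj e') by rewrite -Ex.
have Eu : tmap t (unit_vec t' (proj e)) = tmap t (unit_vec t' (proj e')) by rewrite Ex.
by rewrite /sfun (cov_sfun _ Tt te) (cov_sfun _ Tt te') Es Eu.
Qed.

Definition slit_image c t : set 'cV[R]_n.+1 :=
  [set z : 'cV[R]_n.+1 | z ord0 0 != 0 /\ (c @` (dom c `&` tdom t)) (vtail z)].

Lemma slit_image_open c t : atlas M c -> trivs L t -> open (slit_image c t).
Proof.
move=> Ac Tt; have ok := atlas_ok hA Ac.
apply: openI; last first.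
  by apply: vtail_preimage_open; apply: chart_image_open => //; exact: trivs_open.
apply: (@open_comp _ _ (fun z : 'cV[R]_n.+1 => z ord0 0) [set s | s != 0]).
  by move=> z _; exact: coord_continuous.
exact: open_neq.
Qed.

Lemma slit_coord_image c t e : trivs L t -> slit_dual_dom c t e -> slit_image c t (slit_dual_coord c t e).
Proof.
move=> Tt [ce te]; split; first by rewrite slit_coordE vcons0 sfun_neq0.
by rewrite slit_coordE vtail_cons; exists (proj e).
Qed.

Lemma slit_image_coord c t z : trivs L t -> slit_image c t z ->
  exists2 e, slit_dual_dom c t e & slit_dual_coord c t e = z.
Proof.
move=> Tt [z0 [x [cx tx] E]]; exists (mkpt Tt tx z0); first by [].
by rewrite slit_coordE sfun_mkpt /= E vcons_tail.
Qed.

Lemma sfun_change t t' : trivs L t -> trivs L t' -> exists2 g : M -> R,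
  smooth_on (atlas M) (tdom t `&` tdom t') g /\ (forall x, tdom t x -> tdom t' x -> g x != 0) &
  forall e, tdom t (proj e) -> tdom t' (proj e) -> sfun t' e = sfun t e * g (proj e).
Proof.
move=> Tt Tt'; have [g Sg gE] := trivs_smooth Tt' Tt.
exists g; last first.
  move=> e te t'e; rewrite {1}/sfun (cov_sfun _ Tt te) gE // tmap_unit //.
  by rewrite mulr1 mulrC.
split; first by rewrite setIC.
move=> x tx t'x; apply/negP => /eqP g0.
have := gE x t'x tx (unit_vec t x); rewrite tmap_unit // g0 mul0r => /eqP.
by rewrite oner_eq0.
Qed.

(* continuity of the inverse of the coordinates, tested on the subbase *)
Let slit_section_nbhs c t e U : atlas M c -> trivs L t -> slit_dual_dom c t e -> open U -> U e ->
  nbhs (slit_dual_coord c t e) (slit_dual_coord c t @` (slit_dual_dom c t `&` U)).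
Proof.
move=> Ac Tt de oU Ue; have ok := atlas_ok hA Ac; have [ce te] := de.
have [s Hs] : exists s : 'cV[R]_n.+1 -> Mt, forall z, slit_image c t z ->
    slit_dual_dom c t (s z) /\ slit_dual_coord c t (s z) = z.
  have H z : exists e', slit_image c t z -> slit_dual_dom c t e' /\ slit_dual_coord c t e' = z.
    case: (pselect (slit_image c t z)) => [Hz|nz]; last by exists e.
    by have [e' d' E] := slit_image_coord Tt Hz; exists e'.
  by have [s Hs] := boolp.choice H; exists s.
have ie := slit_coord_image Tt de.
have se : s (slit_dual_coord c t e) = e.
  by have [ds E] := Hs _ ie; apply: (slit_coord_inj Ac Tt) => //; exact: mem_set.
have ni : nbhs (slit_dual_coord c t e) (slit_image c t).
  by apply: open_nbhs_nbhs; split=> //; exact: slit_image_open.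
suff sc : s @ nbhs (slit_dual_coord c t e) --> nbhs e.
  have : nbhs (slit_dual_coord c t e) (s @^-1` U).
    by apply: sc; exact: open_nbhs_nbhs.
  move=> nU; apply: filterS (filterI nU ni) => z [Uz /Hs[dz E]].
  by exists (s z).
apply: nbhs_slit_subbase => B [c' [t' [B' [Ac' Tt' oO] ->]]] [[c'e t'e] Oe].
have ok' := atlas_ok hA Ac'.
have [g [Sg g0] gE] := sfun_change Tt Tt'.
pose I0 := c @` (dom c `&` (dom c' `&` (tdom t `&` tdom t'))).
have oI : open I0.
  by apply: chart_image_open => //; apply: openI; [exact: chart_dom_open|
    by apply: openI; exact: trivs_open].
(* The change of coordinates on the slit dual: the fibre coordinate is multiplied by the transition
   function of L and the base coordinates follow the transition map of M. *)
pose tau (z : 'cV[R]_n.+1) : 'cV[R]_n.+1 :=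
  vcons (z ord0 0 * in_coords c g (vtail z)) (transition c c' (vtail z)).
have I0e : I0 (vtail (slit_dual_coord c t e)) by rewrite slit_coordE vtail_cons; exists (proj e).
have ct : {for slit_dual_coord c t e, continuous tau}.
  apply: cV_continuous => i; case: (unliftP ord0 i) => [j|] ->.
    have -> : (fun z => tau z (lift ord0 j) 0) = in_coords c (fun x => c' x j 0) \o @vtail R n.
      by apply/funext => z; rewrite /tau vconsS /= mxE.
    apply: continuous_comp; first exact: (smooth_map_continuous (@smooth_vtail R n)).
    rewrite slit_coordE vtail_cons.
    have [_ _ tr] := hA.
    apply: (Cinf_continuous (tr c c' Ac Ac' j)); by exists (proj e).
  have -> : (fun z => tau z ord0 0) = (fun z => z ord0 0 * in_coords c g (vtail z)).
    by apply/funext => z; rewrite /tau vcons0.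
  apply: continuous_mul_fun; first exact: coord_continuous.
  have cg : {for vtail (slit_dual_coord c t e), continuous (in_coords c g)}.
    rewrite slit_coordE vtail_cons.
    apply: (Cinf_continuous (Sg c Ac)); by exists (proj e).
  have cv : {for slit_dual_coord c t e, continuous (@vtail R n)}.
    exact: (smooth_map_continuous (@smooth_vtail R n)).
  exact: (continuous_comp cv cg).
have tauE e' : slit_dual_dom c t e' -> dom c' (proj e') -> tdom t' (proj e') ->
    tau (slit_dual_coord c t e') = slit_dual_coord c' t' e'.
  move=> [ce' te'] c'e' t'e'; rewrite /tau !slit_coordE vtail_cons vcons0.
  by rewrite in_coordsE // transitionE // gE.
have nO : nbhs (slit_dual_coord c t e) (tau @^-1` B').
  by apply: ct; rewrite tauE //; exact: open_nbhs_nbhs.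
have nI : nbhs (slit_dual_coord c t e) (@vtail R n @^-1` I0).
  by apply: open_nbhs_nbhs; split=> //; exact: vtail_preimage_open.
apply: filterS (filterI (filterI nO nI) ni) => z [[Oz Iz] /Hs[dz E]].
have [x [cx [c'x [tx t'x]]] Ex] := Iz.
have pz : proj (s z) = x.
  case: ok => _ ci _ _; apply: ci; [exact: mem_set dz.1|exact: mem_set|].
  by rewrite Ex -[in RHS]E slit_coordE vtail_cons.
have c'z : dom c' (proj (s z)) by rewrite pz.
have t'z : tdom t' (proj (s z)) by rewrite pz.
split; first by [].
by rewrite /preimage /= -tauE // E.
Qed.

Lemma slit_chart_ok c t : atlas M c -> trivs L t -> chart_ok (Ct c t).
Proof.
move=> Ac Tt; split=> /=.
- exact: slit_dom_open.
- exact: slit_coord_inj.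
- by move=> e de; exact: slit_coord_continuous.
move=> U oU Uc; rewrite openE => _ [e Ue <-].
have := slit_section_nbhs Ac Tt (Uc e Ue) oU Ue.
by apply: filterS => z [e' [_ Ue'] <-]; exists e'.
Qed.

Lemma slit_transition c t c' t' : atlas M c -> trivs L t -> atlas M c' -> trivs L t' ->
  smooth_transition (Ct c t) (Ct c' t').
Proof.
move=> Ac Tt Ac' Tt' i.
have ok := atlas_ok hA Ac; have okt := slit_chart_ok Ac Tt.
have okt' := slit_chart_ok Ac' Tt'; have odt' := chart_dom_open okt'.
have oI := chart_image_open okt odt'.
have [g [Sg g0] gE] := sfun_change Tt Tt'.
case: (unliftP ord0 i) => [j|] ->.
  apply: (@Cinf_ext _ _ _ (fun z => in_coords c (fun x => c' x j 0) (vtail z))) => //.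
    move=> _ [e [[ce te] [c'e t'e]] <-].
    by rewrite (in_coordsE _ okt) //= !slit_coordE vtail_cons vconsS in_coordsE.
  apply: (Cinf_comp (W := c @` (dom c `&` dom c'))) => //.
  - by apply: chart_image_open => //; exact: chart_dom_open (atlas_ok hA Ac').
  - move=> _ [e [[ce te] [c'e t'e]] <-]; rewrite /= slit_coordE vtail_cons.
    by exists (proj e).
  - by move=> k; apply: Cinf_sub (@smooth_vtail R n k).
  - by case: hA => _ _ tr; exact: tr.
apply: (@Cinf_ext _ _ _ (fun z => z ord0 0 * in_coords c g (vtail z))) => //.
  move=> _ [e [[ce te] [c'e t'e]] <-].
  by rewrite (in_coordsE _ okt) //= !slit_coordE vtail_cons !vcons0 in_coordsE // gE.
apply: Cinf_mul => //; first exact: Cinf_coord.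
apply: (Cinf_comp (W := c @` (dom c `&` (tdom t `&` tdom t')))) => //.
- by apply: chart_image_open => //; apply: openI; exact: trivs_open.
- move=> _ [e [[ce te] [c'e t'e]] <-]; rewrite /= slit_coordE vtail_cons.
  by exists (proj e).
- by move=> k; apply: Cinf_sub (@smooth_vtail R n k).
- exact: Sg.
Qed.

Theorem slit_dual_is_atlas : is_atlas At.
Proof.
split.
- by move=> _ [c [t [Ac Tt ->]]]; exact: slit_chart_ok.
- move=> e; have [c [t [Ac Tt de]]] := slit_cover e.
  by exists (Ct c t) => //; exists c, t.
- by move=> _ _ [c [t [Ac Tt ->]]] [c' [t' [Ac' Tt' ->]]]; exact: slit_transition.
Qed.

(** Points over distinct base points are separated on M. Points over the same base point lie in one
    chart domain, where they are separated by their coordinates. *)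
Theorem slit_dual_hausdorff : hausdorff_space Mt.
Proof.
move=> e e' cl; have E : proj e = proj e'.
  apply: (manifold_hausdorff (m := M)) => A B nA nB.
  move: nA nB; rewrite !nbhsE => -[A' [oA' A'e] A'A] [B' [oB' B'e] B'B].
  have [||e1 [Ae1 Be1]] := cl (@proj R n M L @^-1` A') (@proj R n M L @^-1` B').
  - by apply: open_nbhs_nbhs; split=> //; exact: proj_preimage_open.
  - by apply: open_nbhs_nbhs; split=> //; exact: proj_preimage_open.
  by exists (proj e1); split; [exact: A'A|exact: B'B].
have [c [t [Ac Tt de]]] := slit_cover e.
have de' : slit_dual_dom c t e' by rewrite /slit_dual_dom /preimage /= -E.
apply: (slit_coord_inj Ac Tt); [exact: mem_set..|].
apply: (@norm_hausdorff _ 'cV[R]_n.+1) => A B nA nB.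
move: nA nB; rewrite !nbhsE => -[A' [oA' A'e] A'A] [B' [oB' B'e] B'B].
have [||e1 [[_ Ae1] [_ Be1]]] := cl (slit_dual_dom c t `&` slit_dual_coord c t @^-1` A')
   (slit_dual_dom c t `&` slit_dual_coord c t @^-1` B').
- by apply: open_nbhs_nbhs; split=> //; exact: slit_coord_open.
- by apply: open_nbhs_nbhs; split=> //; exact: slit_coord_open.
by exists (slit_dual_coord c t e1); split; [exact: A'A|exact: B'B].
Qed.

End SlitDualManifold.

(** * Lifting functions, sections and derivations *)

(** Compares functions related by a translation or a linear scaling of the argument, without any
    differentiability hypothesis. *)
Lemma derive_increment_ext (R : realType) m (f g : 'cV[R]_m -> R) a b v w :
  (forall h : R, g (h *: v + a) - g a = f (h *: w + b) - f b) -> 'D_v g a = 'D_w f b.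
Proof.
move=> H; rewrite /derive.
rewrite (_ : (fun h : R => h^-1 *: ((g \o shift a) (h *: v) - g a)) =
  (fun h : R => h^-1 *: ((f \o shift b) (h *: w) - f b))) //.
by apply/funext => h /=; rewrite H.
Qed.

Section LiftedFunctions.
Variables (R : realType) (n : nat) (M : manifold R n) (L : line_bundle M).
Local Notation Mt := (slit_dual L).
Local Notation At := (slit_dual_atlas L).
Local Notation Am := (atlas M).
Local Notation Ct c t := (Chart (@slit_dual_dom R n M L c t) (@slit_dual_coord R n M L c t)).
Implicit Types (t : local_triv (fib L)) (c : chart R n M) (e : Mt) (x : M).

Let hA : is_atlas Am := atlasP M.
Let hX : hausdorff_space M := @manifold_hausdorff _ _ M.
Let hAt : is_atlas At := slit_dual_is_atlas L.
Let hXt : hausdorff_space Mt := @slit_dual_hausdorff R n M L.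

Lemma slit_is_chart c t : Am c -> trivs L t -> is_chart At (Ct c t).
Proof. by move=> Ac Tt; apply: (atlas_chart hAt); exists c, t. Qed.

Lemma smooth_on_proj U f : open U -> smooth_on Am U f ->
  smooth_on At (@proj R n M L @^-1` U) (f \o @proj R n M L).
Proof.
move=> oU Sf; have opU := proj_preimage_open L oU.
apply/(smooth_onP hAt) => // e Ue; have [c [t [Ac Tt de]]] := slit_cover e.
have okt := slit_chart_ok Ac Tt.
exists (Ct c t), (@proj R n M L @^-1` U); split=> //; first exact: slit_is_chart.
apply: (@Cinf_ext _ _ _ (fun z => in_coords c f (vtail z))).
- exact: chart_image_open.
- move=> _ [e' [de' Ue'] <-]; rewrite (in_coordsE _ okt) //= slit_coordE vtail_cons.
  by rewrite in_coordsE //; [exact: (atlas_ok hA)|exact: de'.1].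
apply: (Cinf_comp (W := c @` (dom c `&` U))).
- exact: chart_image_open.
- by apply: chart_image_open => //; exact: (atlas_ok hA).
- move=> _ [e' [de' Ue'] <-]; rewrite /= slit_coordE vtail_cons.
  by exists (proj e') => //; split=> //; exact: de'.1.
- by move=> k; apply: Cinf_sub (@smooth_vtail R n k).
- exact: Sf.
Qed.

(** Pullback along the local section of the slit dual given by fibre coordinate 1. It lets
    smoothness descend to M, both for functions and for matrices of frames. *)
Lemma smooth_on_unit_section c t U f : Am c -> trivs L t -> open U ->
  U `<=` dom c `&` tdom t -> smooth_on At (@proj R n M L @^-1` U) f ->
  smooth_on Am U (fun x => in_coords (Ct c t) f (vcons 1 (c x))).
Proof.
move=> Ac Tt oU UU Sf; have oW := proj_preimage_open L oU.
have ok := atlas_ok hA Ac; have okt := slit_chart_ok Ac Tt.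
apply/(smooth_onP hA) => // x Ux; have [cx tx] := UU _ Ux.
exists c, U; split=> //; first exact: (atlas_chart hA).
apply: (@Cinf_ext _ _ _ (fun y => in_coords (Ct c t) f (vcons 1 y))).
- exact: chart_image_open.
- by move=> _ [y [cy Uy] <-]; rewrite in_coordsE.
apply: (Cinf_comp (W := Ct c t @` (dom (Ct c t) `&` @proj R n M L @^-1` U))).
- exact: chart_image_open.
- exact: chart_image_open.
- move=> _ [y [cy Uy] <-]; have [_ ty] := UU _ Uy.
  exists (mkpt Tt ty (oner_neq0 R)); first by split.
  by rewrite /= slit_coordE sfun_mkpt.
- move=> i; case: (unliftP ord0 i) => [j|] ->.
    apply: (@Cinf_ext _ _ _ (fun y => y j 0)); first exact: chart_image_open.
      by move=> y _; rewrite vconsS.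
    by apply: Cinf_coord; exact: chart_image_open.
  apply: (@Cinf_ext _ _ _ (fun y => 1)); first exact: chart_image_open.
    by move=> y _; rewrite vcons0.
  by apply: Cinf_cst.
- exact: Sf (ex_intro _ c (ex_intro _ t (And3 Ac Tt erefl))).
Qed.

Lemma smooth_on_base U f : open U ->
  smooth_on At (@proj R n M L @^-1` U) (f \o @proj R n M L) -> smooth_on Am U f.
Proof.
move=> oU Sf; apply: (smooth_on_local hA) => // x Ux.
have [_ cov _] := hA; have [c Ac cx] := cov x; have [t Tt tx] := trivs_cover L x.
have okt := slit_chart_ok Ac Tt; pose V := U `&` (dom c `&` tdom t).
have oV : open V.
  by apply: openI => //; apply: openI; [exact: chart_dom_open (atlas_ok hA Ac)|exact: trivs_open].
have VU : V `<=` dom c `&` tdom t by move=> y [].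
exists V; split=> //.
have Sf' : smooth_on At (@proj R n M L @^-1` V) (f \o @proj R n M L).
  by apply: smooth_on_sub Sf => e [].
apply: (smooth_on_ext hA oV _ (smooth_on_unit_section Ac Tt oV VU Sf')) => y [_ [cy ty]].
have -> : vcons 1 (c y) = slit_dual_coord c t (mkpt Tt ty (oner_neq0 R)).
  by rewrite slit_coordE sfun_mkpt.
by rewrite (in_coordsE _ okt).
Qed.

Lemma smooth_sfun t : trivs L t -> smooth_on At (@proj R n M L @^-1` tdom t) (sfun t).
Proof.
move=> Tt; have ot := proj_preimage_open L (trivs_open Tt).
apply: (smooth_on_local hAt) => // e te.
have [_ cov _] := hA; have [c Ac ce] := cov (proj e).
exists (dom (Ct c t)); split=> //; first exact: slit_dom_open.
have := smooth_on_coord_fun hAt (slit_is_chart Ac Tt) (@cV_openT R n.+1) (Cinf_coord setT ord0).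
rewrite preimage_setT setIT; apply: (smooth_on_ext hAt); first exact: slit_dom_open.
by move=> e' _; rewrite /= slit_coordE vcons0.
Qed.

Lemma smooth_fun_of_section (lam : presection L) :
  smooth_section lam -> smooth At (fun_of_section lam).
Proof.
move=> Sl; apply: (smooth_on_local hAt) => [|e _]; first exact: openT.
have [t Tt te] := trivs_cover L (proj e); have ot := trivs_open Tt.
have opt := proj_preimage_open L ot.
exists (@proj R n M L @^-1` tdom t); split=> //.
have := smooth_on_mul hAt opt (smooth_on_proj ot (Sl t Tt)) (smooth_sfun Tt).
by apply: (smooth_on_ext hAt) => // e' te'; rewrite /fun_of_section (cov_sfun _ Tt te').
Qed.

Lemma smooth_section_of_fun (lam : presection L) :
  smooth At (fun_of_section lam) -> smooth_section lam.
Proof.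
move=> Sl t Tt; have ot := trivs_open Tt; have opt := proj_preimage_open L ot.
apply: smooth_on_base => //.
have Ss : smooth_on At (@proj R n M L @^-1` tdom t) (fun e => (sfun t e)^-1).
  apply: (smooth_on_inv hAt) => //; last exact: smooth_sfun.
  by move=> e te; exact: sfun_neq0.
have Sl' : smooth_on At (@proj R n M L @^-1` tdom t) (fun_of_section lam) by apply: smooth_on_sub Sl.
apply: (smooth_on_ext hAt opt) (smooth_on_mul hAt opt Sl' Ss).
by move=> e te; rewrite /fun_of_section (cov_sfun _ Tt te) mulfK //; exact: sfun_neq0.
Qed.

Lemma scaleK r (r0 : r != 0) (r0' : r^-1 != 0) e : scale r0 (scale r0' e) = e.
Proof.
by apply: (@slit_dual_eq _ _ _ _ (scale r0 (scale r0' e)) e erefl) => t _ _; rewrite !sfun_scale mulrA divff // mul1r.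
Qed.

Lemma scaleVK r (r0 : r != 0) (r0' : r^-1 != 0) e : scale r0' (scale r0 e) = e.
Proof.
by apply: (@slit_dual_eq _ _ _ _ (scale r0' (scale r0 e)) e erefl) => t _ _; rewrite !sfun_scale mulrA mulVf // mul1r.
Qed.

(** The matrix diag(s, 1, .., 1). It expresses the action of [s] in coordinates, and also turns d/ds
    into s d/ds. *)
Definition scmx (s : R) : 'M[R]_n.+1 :=
  \matrix_(i, j) ((i == j)%:R * (if i == ord0 then s else 1)).

Lemma scmxE s (w : 'cV[R]_n.+1) : scmx s *m w = vcons (s * w ord0 0) (vtail w).
Proof.
apply/colP => i; rewrite mulmx_entry (bigD1 i) //= big1 => [|j ji]; last first.
  by rewrite mxE eq_sym (negbTE ji) !mul0r.
rewrite mxE eqxx mul1r addr0; case: (unliftP ord0 i) => [j|] ->.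
  by rewrite vconsS mxE /= mul1r.
by rewrite vcons0 eqxx.
Qed.

Lemma scmxM a b : scmx a *m scmx b = scmx (a * b).
Proof.
apply/matrixP => i j; rewrite mulmx_entry (bigD1 i) //= big1 => [|k ki]; last first.
  by rewrite mxE eq_sym (negbTE ki) !mul0r.
rewrite addr0 /scmx !mxE eqxx mul1r; case: ifP => _; first by rewrite mulrCA.
by rewrite mul1r.
Qed.

Lemma scmx1 : scmx 1 = 1%:M.
Proof. by apply/matrixP => i j; rewrite !mxE; case: ifP => _; rewrite mulr1. Qed.

Lemma scmxV s : s != 0 -> scmx s^-1 *m scmx s = 1%:M.
Proof. by move=> s0; rewrite scmxM mulVf // scmx1. Qed.

Lemma scmx_unit s : s != 0 -> scmx s \in unitmx.
Proof. by move=> /scmxV /mulmx1_unit[]. Qed.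

Lemma slit_coord_scale c t r (r0 : r != 0) e :
  slit_dual_coord c t (scale r0 e) = scmx r *m slit_dual_coord c t e.
Proof. by rewrite scmxE !slit_coordE vcons0 vtail_cons. Qed.

(** No condition on [z] is required: the chart domain is saturated and the action invertible, so
    both sides take the default value together. *)
Lemma in_coords_scale c t f r (r0 : r != 0) (z : 'cV[R]_n.+1) :
  in_coords (Ct c t) (f \o scale r0) z = in_coords (Ct c t) f (scmx r *m z).
Proof.
rewrite /in_coords; congr (xget 0 _); apply/seteqP; split=> [_ [e [de E] <-]|_ [e [de E] <-]].
  by exists (scale r0 e) => //; split=> //; rewrite -E /= slit_coord_scale.
have r0' : r^-1 != 0 by rewrite invr_eq0.
have {E} E : slit_dual_coord c t e = scmx r *m z by [].
exists (scale r0' e); last by rewrite /= scaleK.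
by split=> //; rewrite /preimage /= slit_coord_scale E mulmxA scmxV // mul1mx.
Qed.

Lemma smooth_on_scale U f r (r0 : r != 0) : open U -> smooth_on At (@proj R n M L @^-1` U) f ->
  smooth_on At (@proj R n M L @^-1` U) (f \o scale r0).
Proof.
move=> oU Sf _ [c [t [Ac Tt ->]]]; have okt := slit_chart_ok Ac Tt.
have opU := proj_preimage_open L oU.
have oI := chart_image_open okt opU.
apply: (@Cinf_ext _ _ _ (fun z => in_coords (Ct c t) f (scmx r *m z))) => //.
  by move=> z _; rewrite in_coords_scale.
apply: (Cinf_comp (W := Ct c t @` (dom (Ct c t) `&` @proj R n M L @^-1` U))) => //.
- move=> _ [e' [de' Ue'] <-]; exists (scale r0 e') => //.
  by rewrite /= slit_coord_scale.
- move=> i; apply: (@Cinf_ext _ _ _ (fun z => \sum_j scmx r i j * z j 0)) => //.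
    by move=> z _; rewrite mulmx_entry.
  apply: Cinf_sum => // j _; apply: Cinf_mul => //; first exact: Cinf_cst.
  exact: Cinf_coord.
- by apply: Sf; exists c, t.
Qed.

Lemma smooth_scale f r (r0 : r != 0) : smooth At f -> smooth At (f \o scale r0).
Proof. by move=> Sf; have := @smooth_on_scale setT f r r0 openT; apply. Qed.

Lemma smooth_scaleP f r (r0 : r != 0) : smooth At (f \o scale r0) -> smooth At f.
Proof.
move=> Sf; have r0' : r^-1 != 0 by rewrite invr_eq0.
have := smooth_scale r0' Sf; congr (smooth _ _).
by apply/funext => e; rewrite /= scaleK.
Qed.

Lemma tangent_push e v r (r0 : r != 0) : tangent At e v ->
  tangent At (scale r0 e) (fun f => v (f \o scale r0)).
Proof.
move=> [lin lei non]; split.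
- by move=> a f g Sf Sg; exact: (lin a _ _ (smooth_scale r0 Sf) (smooth_scale r0 Sg)).
- by move=> f g Sf Sg; exact: (lei _ _ (smooth_scale r0 Sf) (smooth_scale r0 Sg)).
- by move=> f nf; apply: non => /smooth_scaleP.
Qed.

(* the frame (s d/ds, d/dx_1, .., d/dx_n) of the coordinates (s, x) of a
   trivialisation, which is invariant under the action *)
Definition lin_frame c t e : preframe R n.+1 Mt :=
  frame_comp (coord_frame At (Ct c t) e) (scmx (sfun t e)).

Lemma is_frame_lin_frame c t e : Am c -> trivs L t -> slit_dual_dom c t e ->
  is_frame At e (lin_frame c t e).
Proof.
move=> Ac Tt de; apply: (is_frame_coord_frame hAt hXt (slit_is_chart Ac Tt)) => //.
by apply: scmx_unit; apply: sfun_neq0 => //; exact: de.2.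
Qed.

(** The action multiplies the fibre coordinate and the field s d/ds by the same factor; this is the
    invariance that d/ds lacks. *)
Lemma lin_frame_push c t e r (r0 : r != 0) :
  push r0 (lin_frame c t e) = lin_frame c t (scale r0 e).
Proof.
apply/funext => w; apply/funext => f; rewrite /push /lin_frame /frame_comp /coord_frame.
case: (pselect (smooth At f)) => Sf; last first.
  by rewrite !asboolF // => /smooth_scaleP.
rewrite !asboolT //; last exact: smooth_scale.
rewrite sfun_scale /= slit_coord_scale.
have -> : scmx (r * sfun t e) *m w = scmx r *m (scmx (sfun t e) *m w).
  by rewrite !scmxE vcons0 vtail_cons mulrA.
apply: derive_increment_ext => h.
by rewrite !in_coords_scale mulmxDr -scalemxAr.
Qed.

Lemma lin_frame_sfun c t e w f V : Am c -> trivs L t -> smooth At f -> open V -> V e ->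
  (forall e', V e' -> slit_dual_dom c t e' /\ f e' = sfun t e') ->
  lin_frame c t e w f = sfun t e * w ord0 0.
Proof.
move=> Ac Tt Sf oV Ve H.
rewrite /lin_frame /frame_comp.
have -> := coord_frame_coordinate (slit_is_chart Ac Tt) _ Sf oV Ve (i := ord0).
  by rewrite scmxE vcons0.
by move=> e' /H[de' ->]; split=> //; rewrite /= slit_coordE vcons0.
Qed.

Lemma lin_frame_coord c t e w f V j : Am c -> trivs L t -> smooth At f -> open V -> V e ->
  (forall e', V e' -> slit_dual_dom c t e' /\ f e' = c (proj e') j 0) ->
  lin_frame c t e w f = w (lift ord0 j) 0.
Proof.
move=> Ac Tt Sf oV Ve H.
rewrite /lin_frame /frame_comp.
have -> := coord_frame_coordinate (slit_is_chart Ac Tt) _ Sf oV Ve (i := lift ord0 j).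
  by rewrite scmxE vconsS mxE.
by move=> e' /H[de' ->]; split=> //; rewrite /= slit_coordE vconsS.
Qed.

Lemma local_section t x f U : trivs L t -> open U -> U x -> U `<=` tdom t ->
  smooth_on Am U f -> exists (lam : presection L) V, [/\ smooth_section lam, open V, V x, V `<=` U &
    forall y, V y -> lam y = f y *: unit_vec t y].
Proof.
move=> Tt oU Ux Ut Sf.
have [rho [V [K [[Sr oV Vx r1] [cK KU VU r0]]]]] := smooth_bump hA hX oU Ux.
exists (fun y => (rho y * f y) *: unit_vec t y), V; split=> //; last first.
  by move=> y /r1 ->; rewrite mul1r.
move=> t' Tt'; have ot' := trivs_open Tt'.
apply: (smooth_on_local hA) => // y t'y; case: (pselect (U y)) => Uy; last first.
  exists (tdom t' `&` ~` K); split.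
  - by apply: openI => //; exact: closed_openC.
  - by split=> // /KU.
  apply: (@smooth_on_ext _ _ _ _ hA _ (fun=> 0)).
  - by apply: openI => //; exact: closed_openC.
  - by move=> z [t'z /r0 ->]; rewrite mul0r scale0r tmap0.
  by apply: (smooth_on_cst hA); apply: openI => //; exact: closed_openC.
have [g Sg gE] := trivs_smooth Tt Tt'.
have oW : open (tdom t' `&` U) by exact: openI.
exists (tdom t' `&` U); split=> //.
apply: (@smooth_on_ext _ _ _ _ hA _ (fun z => (rho z * f z) * g z)) => //.
  move=> z [t'z Uz]; have tz := Ut _ Uz.
  by rewrite gE // tmapZ // tmap_unit // mulr1 mulrC.
apply: (smooth_on_mul hA) => //; last first.
  by apply: smooth_on_sub Sg => z [t'z /Ut].
apply: (smooth_on_mul hA) => //; first by apply: smooth_on_sub Sr => z.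
by apply: smooth_on_sub Sf => z [].
Qed.

Lemma smooth_section_lin f (lam mu : presection L) : smooth Am f -> smooth_section lam ->
  smooth_section mu -> smooth_section (fun x => f x *: lam x + mu x).
Proof.
move=> Sf Sl Sm t Tt; have ot := trivs_open Tt.
apply: (@smooth_on_ext _ _ _ _ hA _ (fun x => f x * tmap t (lam x) + tmap t (mu x))) => //.
  by move=> x tx; rewrite (trivs_linear Tt tx).
apply: (smooth_on_add hA) => //; last exact: Sm.
by apply: (smooth_on_mul hA) => //; [apply: smooth_on_sub Sf => z|exact: Sl].
Qed.

Lemma smooth_section0 : smooth_section (fun x => 0 : fib L x).
Proof.
move=> t Tt; have ot := trivs_open Tt.
apply: (@smooth_on_ext _ _ _ _ hA _ (fun=> 0)) => //; last exact: (smooth_on_cst hA).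
by move=> x tx; rewrite tmap0.
Qed.

Lemma smooth_section_mul f (lam : presection L) : smooth Am f -> smooth_section lam ->
  smooth_section (fun x => f x *: lam x).
Proof.
move=> Sf Sl; have := smooth_section_lin Sf Sl smooth_section0.
by congr (smooth_section _); apply: boolp.functional_extensionality_dep => x; rewrite addr0.
Qed.

Lemma fun_of_section_mul f (lam : presection L) e :
  fun_of_section (fun x => f x *: lam x) e = f (proj e) * fun_of_section lam e.
Proof. by rewrite /fun_of_section covZ. Qed.

End LiftedFunctions.

(** * Derivations of L as invariant vector fields *)

Section Derivations.
Variables (R : realType) (n : nat) (M : manifold R n) (L : line_bundle M).
Local Notation Mt := (slit_dual L).
Local Notation At := (slit_dual_atlas L).
Local Notation Am := (atlas M).
Local Notation pr := (@proj R n M L).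
Local Notation Ct c t := (Chart (@slit_dual_dom R n M L c t) (@slit_dual_coord R n M L c t)).
Implicit Types (t : local_triv (fib L)) (c : chart R n M) (e : Mt) (x : M) (lam mu : presection L).
Implicit Types (D : presection L -> presection L) (X : M -> (M -> R) -> R) (Z : Mt -> (Mt -> R) -> R).

Let hA : is_atlas Am := atlasP M.
Let hX : hausdorff_space M := @manifold_hausdorff _ _ M.
Let hAt : is_atlas At := slit_dual_is_atlas L.
Let hXt : hausdorff_space Mt := @slit_dual_hausdorff R n M L.

Lemma smooth_proj f : smooth Am f <-> smooth At (f \o pr).
Proof.
split=> Sf; first by have := smooth_on_proj (L := L) openT Sf.
by apply: (smooth_on_base (L := L)) => //; exact: openT.
Qed.

Lemma tangent_proj e v : tangent At e v -> tangent Am (proj e) (fun f => v (f \o pr)).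
Proof.
move=> [lin lei non]; split.
- by move=> a f g /smooth_proj Sf /smooth_proj Sg; exact: (lin a _ _ Sf Sg).
- by move=> f g /smooth_proj Sf /smooth_proj Sg; exact: (lei _ _ Sf Sg).
- by move=> f nf; apply: non => /smooth_proj.
Qed.

(** Global objects that near [x] agree with the frame of L and the coordinates of M. On the slit
    dual, the function of [lam] is then the fibre coordinate and the pulled-back [y j] are the base
    coordinates. *)
Lemma lin_coordinates c t x : Am c -> trivs L t -> dom c x -> tdom t x ->
  exists (lam : presection L) (y : 'I_n -> M -> R) (V : set M),
  [/\ smooth_section lam, forall j, smooth Am (y j), open V, V x & forall x', V x' ->
     [/\ dom c x', tdom t x', lam x' = unit_vec t x' & forall j, y j x' = c x' j 0]].
Proof.
move=> Ac Tt cx tx.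
have [y [V1 [Sy oV1 V1x yc]]] := chart_coordinates_extend hA hX (atlas_chart hA Ac) cx.
have oU : open (dom c `&` tdom t).
  by apply: openI; [exact: chart_dom_open (atlas_ok hA Ac)|exact: trivs_open].
have Ut : dom c `&` tdom t `<=` tdom t by move=> z [].
have [lam [V [Sl oV Vx VU lamE]]] :=
  local_section Tt oU (conj cx tx) Ut (smooth_on_cst hA 1 oU).
exists lam, y, (V `&` V1); split=> //; first exact: openI.
move=> x' [Vx' V1x']; have [cx' tx'] := VU _ Vx'; split=> //.
  by rewrite lamE // scale1r.
by move=> j; have [] := yc j _ V1x'.
Qed.

Lemma tangent_lin_coordinates c t e v v' lam (y : 'I_n -> M -> R) V : tangent At e v ->
  tangent At e v' -> Am c -> trivs L t -> smooth_section lam -> (forall j, smooth Am (y j)) ->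
  open V -> V (proj e) ->
  (forall x', V x' -> [/\ dom c x', tdom t x', lam x' = unit_vec t x' & forall j, y j x' = c x' j 0]) ->
  v (fun_of_section lam) = v' (fun_of_section lam) ->
  (forall j, v (y j \o pr) = v' (y j \o pr)) -> v = v'.
Proof.
move=> tv tv' Ac Tt Sl Sy oV Ve HV H0 HS; have oW := proj_preimage_open L oV.
have de : dom (Ct c t) e by have [ce te _ _] := HV _ Ve.
pose Y (i : 'I_n.+1) := if unlift ord0 i is Some j then y j \o pr else fun_of_section lam.
have SY i : smooth At (Y i).
  rewrite /Y; case: (unlift _ _) => [j|]; last exact: smooth_fun_of_section.
  by apply/smooth_proj.
have Yc i e' : (pr @^-1` V) e' -> dom (Ct c t) e' /\ Y i e' = Ct c t e' i 0.
  move=> /HV[ce' te' le ye]; split=> //; rewrite /Y /= slit_coordE.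
  case: (unliftP ord0 i) => [j|] -> /=; first by rewrite vconsS ye.
  by rewrite vcons0 /fun_of_section le.
have hc := slit_is_chart Ac Tt.
rewrite (tangent_coord_frameE hAt hXt hc SY oW Ve Yc tv de).
rewrite (tangent_coord_frameE hAt hXt hc SY oW Ve Yc tv' de).
congr (coord_frame _ _ _ _); apply/colP => i; rewrite !mxE /Y.
by case: (unlift ord0 i) => [j|]; [exact: HS|exact: H0].
Qed.

(** For a section [lam] not vanishing at the base point, the Leibniz rule on the functions of [lam]
    and of [y j *: lam] recovers the value of a tangent vector on each coordinate. *)
Lemma tangent_determined e v v' : tangent At e v -> tangent At e v' ->
  (forall lam, smooth_section lam -> v (fun_of_section lam) = v' (fun_of_section lam)) ->
  v = v'.
Proof.
move=> tv tv' H; have [c [t [Ac Tt [ce te]]]] := slit_cover e.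
have [lam [y [V [Sl Sy oV Ve HV]]]] := lin_coordinates Ac Tt ce te.
apply: (tangent_lin_coordinates tv tv' Ac Tt Sl Sy oV Ve HV (H _ Sl)) => j.
have l0 : fun_of_section lam e != 0.
  by rewrite /fun_of_section; have [_ _ -> _] := HV _ Ve; exact: sfun_neq0.
have Sl' := smooth_fun_of_section Sl; have /smooth_proj Sy' := Sy j.
have E u : tangent At e u -> u (fun_of_section (fun x => y j x *: lam x)) =
    y j (proj e) * u (fun_of_section lam) + fun_of_section lam e * u (y j \o pr).
  move=> tu; rewrite -(tangent_mul tu) //; congr u; apply/funext => e'.
  exact: fun_of_section_mul.
have := H _ (smooth_section_mul (Sy j) Sl).
by rewrite (E v) // (E v') // (H _ Sl) => /addrI /(mulfI l0).
Qed.

Section OneDerivation.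
Variables (D : presection L -> presection L) (X : M -> (M -> R) -> R).
Hypothesis dD : derivation D X.

(** The bump argument of [tangent_local], with the symbol in the Leibniz rule. *)
Lemma derivation_local lam mu V x : smooth_section lam -> smooth_section mu -> open V -> V x ->
  (forall x', V x' -> lam x' = mu x') -> D lam x = D mu x.
Proof.
move=> Sl Sm oV Vx E; have [_ _ _ lei _] := dD.
have [rho [V' [K [[Sr oV' V'x r1] [_ KV _ r0]]]]] := smooth_bump hA hX oV Vx.
have H nu : smooth_section nu -> D nu x = D (fun x => rho x *: nu x) x - X x rho *: nu x.
  by move=> Sn; rewrite lei // r1 // scale1r addrK.
rewrite (H lam) // (H mu) // (E x Vx); congr (D _ x - _).
apply: boolp.functional_extensionality_dep => x'.
case: (pselect (V x')) => Vx'; first by rewrite E.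
by rewrite r0 ?scale0r // => /KV.
Qed.

Lemma derivation0 : D (fun x => 0) = (fun x => 0).
Proof.
have [_ lin _ _ _] := dD; have := lin (-1) _ _ (@smooth_section0 _ _ _ L) (@smooth_section0 _ _ _ L).
have -> : (fun x => -1 *: (0 : fib L x) + 0) = (fun x => 0).
  by apply: boolp.functional_extensionality_dep => x; rewrite scaler0 addr0.
by move=> ->; apply: boolp.functional_extensionality_dep => x; rewrite scaleN1r addNr.
Qed.

End OneDerivation.

(* v is the tangent vector at e corresponding to the element d of the fibre of DL *)
Definition lift_at e (d : presection L -> fib L (proj e)) (v : (Mt -> R) -> R) : Prop :=
  tangent At e v /\ forall lam, smooth_section lam -> v (fun_of_section lam) = cov (d lam).

Lemma lift_at_unique e (d : presection L -> fib L (proj e)) v v' :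
  lift_at d v -> lift_at d v' -> v = v'.
Proof.
by move=> [tv Hv] [tv' Hv']; apply: (tangent_determined tv tv') => lam Sl; rewrite Hv // Hv'.
Qed.

Lemma lift_at_inj e (d d' : presection L -> fib L (proj e)) v :
  lift_at d v -> lift_at d' v -> forall lam, smooth_section lam -> d lam = d' lam.
Proof.
move=> [tv Hv] [tv' Hv'] lam Sl; have [t Tt te] := trivs_cover L (proj e).
apply: (tmap_inj Tt te); have := Hv lam Sl; rewrite Hv' //.
rewrite !(cov_sfun _ Tt te) => /mulIf ->//; exact: sfun_neq0.
Qed.

Lemma lift_at_lin e (d d' : presection L -> fib L (proj e)) v v' (a : R) :
  lift_at d v -> lift_at d' v' ->
  lift_at (fun lam => a *: d lam + d' lam) (fun f => a * v f + v' f).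
Proof.
move=> [[lin lei non] Hv] [[lin' lei' non'] Hv']; split; last first.
  by move=> lam Sl; rewrite Hv // Hv' // cov_linear.
split=> [b f g Sf Sg|f g Sf Sg|f nf].
- by rewrite lin // lin' //; ring.
- by rewrite lei // lei' //; ring.
- by rewrite non // non' // mulr0 addr0.
Qed.

Lemma lift_at_scale e (d : presection L -> fib L (proj e)) v r (r0 : r != 0) :
  lift_at d v -> @lift_at (scale r0 e) d (fun f => v (f \o scale r0)).
Proof.
move=> [tv Hv]; split; first exact: tangent_push.
move=> lam Sl; rewrite /= -Hv // -(tangent_scale hAt tv) //.
exact: smooth_fun_of_section.
Qed.

Lemma smooth_lin_frame c t (V : set Mt) (w : Mt -> 'cV[R]_n.+1) f : Am c -> trivs L t ->
  open V -> V `<=` slit_dual_dom c t -> (forall i, smooth_on At V (fun e => w e i 0)) ->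
  smooth At f -> smooth_on At V (fun e => lin_frame c t e (w e) f).
Proof.
move=> Ac Tt oV Vd Sw Sf.
apply: (smooth_coord_frame hAt (slit_is_chart Ac Tt) (w := fun e => scmx n (sfun t e) *m w e)) => //.
move=> i; case: (unliftP ord0 i) => [j|] ->.
  by apply: (@smooth_on_ext _ _ _ _ hAt _ _ _ oV _ (Sw (lift ord0 j))) => e _; rewrite scmxE vconsS mxE.
apply: (@smooth_on_ext _ _ _ _ hAt _ (fun e => sfun t e * w e ord0 0)) => //.
  by move=> e _; rewrite scmxE vcons0.
apply: (smooth_on_mul hAt) => //.
by apply: smooth_on_sub (smooth_sfun Tt) => e /Vd[].
Qed.

(** In the invariant frame, a derivation has as component along s d/ds its effect on the local frame
    of L, and as components along d/dx_j its symbol on the coordinates. *)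
Lemma derivation_lift D X c t e lam (y : 'I_n -> M -> R) V : derivation D X ->
  Am c -> trivs L t -> smooth_section lam -> (forall j, smooth Am (y j)) -> open V -> V (proj e) ->
  (forall x', V x' -> [/\ dom c x', tdom t x', lam x' = unit_vec t x' & forall j, y j x' = c x' j 0]) ->
  lift_at (at_point D (proj e))
    (lin_frame c t e (vcons (tmap t (D lam (proj e))) (\col_j X (proj e) (y j)))).
Proof.
move=> dD Ac Tt Sl Sy oV Ve HV; set w := vcons _ _.
have [ce te le ye] := HV _ Ve; have de : slit_dual_dom c t e by [].
have [_ tv _ _] := is_frame_lin_frame Ac Tt de; split=> [|mu Sm]; first exact: tv.
have {tv} tv := tv w; set v := lin_frame c t e w in tv *.
have [DS Dlin [tX _] Dlei Dnon] := dD.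
have Vt : V `<=` tdom t by move=> x' /HV[].
(* Near the base point every section is a function times [lam], so only the Leibniz rule for [f] and
   [lam] is to be checked. *)
have [f [V' [Sf oV' V'e V'V fE]]] := smooth_extend hA hX oV Ve (smooth_on_sub Vt (Sm t Tt)).
have muE x' : V' x' -> mu x' = f x' *: lam x'.
  move=> V'x'; have [_ tx' -> _] := HV _ (V'V _ V'x'); rewrite fE //.
  exact: fib_unit.
have oW := proj_preimage_open L oV; have oW' := proj_preimage_open L oV'.
have Sf' : smooth At (f \o pr) by apply/smooth_proj.
have Sl' := smooth_fun_of_section Sl.
have -> : v (fun_of_section mu) = v (fun e' => (f \o pr) e' * fun_of_section lam e').
  apply: (tangent_local hAt hXt tv (V := pr @^-1` V')) => //.
  - exact: smooth_fun_of_section.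
  - exact: (smooth_on_mul hAt openT).
  - by move=> e' V'e'; rewrite /fun_of_section muE // covZ.
rewrite (tangent_mul tv) //.
have vl : v (fun_of_section lam) = sfun t e * tmap t (D lam (proj e)).
  rewrite /v (lin_frame_sfun w Ac Tt Sl' oW Ve) ?vcons0 // => e' /HV[ce' te' le' _].
  by split=> //; rewrite /fun_of_section le'.
have vf : v (f \o pr) = X (proj e) f.
  have hc := atlas_chart hA Ac.
  have yV i z : V z -> dom c z /\ y i z = c z i 0 by move=> /HV[].
  have E1 := tangent_coord_frameE hA hX hc Sy oV Ve yV (tangent_proj tv) ce.
  have E2 := tangent_coord_frameE hA hX hc Sy oV Ve yV (tX (proj e)) ce.
  have /= -> := congr1 (fun u : (M -> R) -> R => u f) E1.
  rewrite [in RHS]E2; congr (coord_frame _ _ _ _ f); apply/colP => j; rewrite !mxE.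
  have Sy' : smooth At (y j \o pr) by apply/smooth_proj.
  rewrite /v (lin_frame_coord w (j := j) Ac Tt Sy' oW Ve).
    by rewrite vconsS mxE.
  by move=> e' /HV[ce' te' _ ye']; split=> //=; exact: ye'.
rewrite vl vf /at_point.
rewrite (derivation_local dD Sm (smooth_section_mul Sf Sl) oV' V'e muE).
rewrite Dlei // cov_linear !(cov_sfun _ Tt te) mulrC /fun_of_section le.
by rewrite (cov_sfun _ Tt te) tmapZ // tmap_unit //=; ring.
Qed.

Lemma DL_fibre_lift e d : DL_fibre d -> exists v, lift_at (e := e) d v.
Proof.
move=> [D [X [dD ->]]]; have [c [t [Ac Tt [ce te]]]] := slit_cover e.
have [lam [y [V [Sl Sy oV Ve HV]]]] := lin_coordinates Ac Tt ce te.
by eexists; exact: (derivation_lift dD Ac Tt Sl Sy oV Ve HV).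
Qed.

Lemma DL_fibre_nonsmooth x (d : presection L -> fib L x) lam :
  DL_fibre d -> ~ smooth_section lam -> d lam = 0.
Proof. by move=> [D [X [[_ _ _ _ non] ->]]] nl; rewrite /at_point non. Qed.

Lemma lifts_at D X Z e : derivation D X -> lifts D Z -> lift_at (at_point D (proj e)) (Z e).
Proof. by move=> dD [[tZ _] HZ]; split=> // lam Sl; rewrite HZ. Qed.

Lemma lifts_exist D X : derivation D X -> exists Z, lifts D Z.
Proof.
move=> dD.
have H e : exists v, lift_at (at_point D (proj e)) v.
  by apply: DL_fibre_lift; exists D, X.
have [Z HZ] := boolp.choice H; exists Z; split; last by move=> lam Sl e; have [_ ->] := HZ e.
split=> [e|f Sf]; first by have [] := HZ e.
apply: (smooth_on_local hAt) => [|e _]; first exact: openT.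
have [c [t [Ac Tt [ce te]]]] := slit_cover e.
have [lam [y [V [Sl Sy oV Ve HV]]]] := lin_coordinates Ac Tt ce te.
have [DS _ [_ SX] _ _] := dD; have oW := proj_preimage_open L oV.
exists (pr @^-1` V); split=> //.
apply: (@smooth_on_ext _ _ _ _ hAt _ (fun e => lin_frame c t e
  (vcons (tmap t (D lam (proj e))) (\col_j X (proj e) (y j))) f)) => //.
  move=> e' Ve'; congr (_ f); apply: lift_at_unique (HZ e').
  exact: (derivation_lift dD Ac Tt Sl Sy oV Ve' HV).
apply: smooth_lin_frame => //; first by move=> e' /HV[].
move=> i; case: (unliftP ord0 i) => [j|] ->.
  apply: (@smooth_on_ext _ _ _ _ hAt _ ((fun x => X x (y j)) \o pr)) => //.
    by move=> e' _; rewrite vconsS mxE.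
  by apply: smooth_on_proj => //; apply: smooth_on_sub (SX _ (Sy j)).
apply: (@smooth_on_ext _ _ _ _ hAt _ ((fun x => tmap t (D lam x)) \o pr)) => //.
  by move=> e' _; rewrite vcons0.
apply: smooth_on_proj => //; apply: smooth_on_sub (DS _ Sl t Tt) => z.
by move=> /HV[].
Qed.

Lemma base_triv x : {t | trivs L t /\ tdom t x}.
Proof. by apply: boolp.cid; have [t Tt tx] := trivs_cover L x; exists t. Qed.

(** A chosen point over each [x], with no continuity in [x]. Every point of the slit dual is a
    multiple of one of these, so equivariant statements are checked here only. *)
Definition bpt x : Mt :=
  mkpt (proj1 (proj2_sig (base_triv x))) (proj2 (proj2_sig (base_triv x))) (oner_neq0 R).

Lemma bpt_ind (P : Mt -> Prop) : (forall x r (r0 : r != 0), P (scale r0 (bpt x))) -> forall e, P e.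
Proof.
move=> H e; set t0 := proj1_sig (base_triv (proj e)).
have [T0 t0e] : trivs L t0 /\ tdom t0 (proj e) := proj2_sig (base_triv (proj e)).
have r0 := sfun_neq0 T0 t0e.
suff -> : e = scale r0 (bpt (proj e)) by exact: H.
have E : proj e = proj (scale r0 (bpt (proj e))) by [].
apply: (slit_dual_eq E) => t Tt te.
rewrite sfun_scale {1}/sfun (cov_sfun _ T0 t0e) mulrC; congr (_ * _).
by rewrite /sfun /= mul1r.
Qed.

Definition invariant_field (Z : Mt -> (Mt -> R) -> R) : Prop :=
  forall r (r0 : r != 0) e f, Z (scale r0 e) f = Z e (f \o scale r0).

(** The derivation is read off at the chosen points. Invariance makes [Z] preserve functions of
    degree 1, so the reading is valid on the whole fibre, and smoothness descends from the slit dual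
    although the chosen points vary arbitrarily. *)
Lemma invariant_field_derivation Z : vector_field At Z -> invariant_field Z ->
  exists D X, [/\ derivation D X, lifts D Z & forall e f, Z e (f \o pr) = X (proj e) f].
Proof.
move=> vZ iZ; have [tZ SZ] := vZ.
pose D lam x : fib L x := Z (bpt x) (fun_of_section lam) *: unit_vec (proj1_sig (base_triv x)) x.
pose X x f := Z (bpt x) (f \o pr).
have XE e f : Z e (f \o pr) = X (proj e) f.
  by move: e; apply: bpt_ind => x r r0; rewrite iZ.
have DE lam e : smooth_section lam -> fun_of_section (D lam) e = Z e (fun_of_section lam).
  move=> Sl; move: e; apply: bpt_ind => x r r0; rewrite iZ.
  have -> : fun_of_section lam \o scale r0 = (fun e => r * fun_of_section lam e) by [].
  rewrite (tangent_scale hAt (tZ _)); last exact: smooth_fun_of_section.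
  have [T0 t0x] := proj2_sig (base_triv x).
  by rewrite /fun_of_section /= /D tmapZ // tmap_unit // mul1r mulr1.
have DE' lam : smooth_section lam -> fun_of_section (D lam) = (fun e => Z e (fun_of_section lam)).
  by move=> Sl; apply/funext => e; exact: DE.
have tX e : tangent Am (proj e) (X (proj e)).
  by have := tangent_proj (tZ e); congr (tangent _ _ _); apply/funext => f; exact: XE.
have SX f : smooth Am f -> smooth Am (fun x => X x f).
  move=> /smooth_proj Sf; apply/smooth_proj; have := SZ _ Sf; congr (smooth _ _).
  by apply/funext => e; exact: XE.
exists D, X; split=> //; last by split=> // lam Sl e; rewrite DE.
split.
- move=> lam Sl; apply: smooth_section_of_fun; rewrite DE' //; apply: SZ.
  exact: smooth_fun_of_section.
- move=> a lam mu Sl Sm; apply: boolp.functional_extensionality_dep => x.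
  rewrite /D scalerA -scalerDl; congr (_ *: _).
  have [lin _ _] := tZ (bpt x); rewrite -lin; try exact: smooth_fun_of_section.
  by congr (Z _ _); apply/funext => e; exact: cov_linear.
- by split=> // x; exact: (tX (bpt x)).
- move=> f lam Sf Sl; apply: boolp.functional_extensionality_dep => x.
  have Sf' : smooth At (f \o pr) by apply/smooth_proj.
  have [T0 t0x] := proj2_sig (base_triv x).
  rewrite /D /X.
  have -> : fun_of_section (fun x => f x *: lam x) = (fun e => (f \o pr) e * fun_of_section lam e).
    by apply/funext => e; exact: fun_of_section_mul.
  rewrite (tangent_mul (tZ _)) //; last exact: smooth_fun_of_section.
  rewrite scalerDl scalerA [lam x in RHS](fib_unit _ T0 t0x) scalerA; congr (_ + _ *: _).
  by rewrite mulrC /fun_of_section /= mul1r.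
- move=> lam nl; apply: boolp.functional_extensionality_dep => x.
  have [_ _ non] := tZ (bpt x); rewrite /D non ?scale0r // => Sl.
  by apply: nl; exact: smooth_section_of_fun.
Qed.

(** A constant combination of the invariant frame, cut off by a bump function of the base point,
    remains invariant and therefore comes from a globally defined derivation. *)
Lemma lin_derivations c t x : Am c -> trivs L t -> dom c x -> tdom t x ->
  exists V, [/\ open V, V x, V `<=` dom c `&` tdom t & forall w, exists D X Z,
    [/\ derivation D X, lifts D Z, forall e f, Z e (f \o pr) = X (proj e) f &
        forall e, V (proj e) -> Z e = lin_frame c t e w]].
Proof.
move=> Ac Tt cx tx.
have oU : open (dom c `&` tdom t).
  by apply: openI; [exact: chart_dom_open (atlas_ok hA Ac)|exact: trivs_open].
have [rho [V [K [[Sr oV Vx r1] [cK KU VU r0]]]]] := smooth_bump hA hX oU (conj cx tx).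
exists V; split=> // w.
pose Z e f := rho (proj e) * lin_frame c t e w f.
have [D [X [dD lD XD]]] : exists D X,
    [/\ derivation D X, lifts D Z & forall e f, Z e (f \o pr) = X (proj e) f].
  apply: invariant_field_derivation.
    split=> [e|f Sf].
      case: (pselect (K (proj e))) => Ke; last first.
        by rewrite /Z r0 //; split=> [a f g _ _|f g _ _|f _]; rewrite !mul0r ?mulr0 ?addr0.
      have [_ tv _ _] := is_frame_lin_frame Ac Tt (KU _ Ke : slit_dual_dom c t e).
      have [lin lei non] := tv w; split=> [a f g Sf Sg|f g Sf Sg|f nf]; rewrite /Z.
      - by rewrite lin //; ring.
      - by rewrite lei //; ring.
      - by rewrite non // mulr0.
    have oU' := proj_preimage_open L oU.
    apply: (smooth_bump_mul hAt (K := pr @^-1` K) (U := pr @^-1` (dom c `&` tdom t)) (rho := rho \o pr)) => //.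
    - by apply/smooth_proj.
    - have := proj_preimage_open L (closed_openC cK).
      by rewrite -preimage_setC => /open_closedC; rewrite setCK.
    - by move=> e /KU.
    - by move=> e /r0.
    by apply: smooth_lin_frame => // i; exact: (smooth_on_cst hAt).
  by move=> r rn0 e f; rewrite /Z -lin_frame_push.
exists D, X, Z; split=> // e Ve; apply/funext => f.
by rewrite /Z r1 // mul1r.
Qed.

(** Every tangent vector is the value of an invariant field, so [d] agrees with a derivation on
    smooth sections; the second hypothesis is the normalisation on the remaining ones. *)
Lemma lift_DL_fibre e (d : presection L -> fib L (proj e)) v : lift_at d v ->
  (forall lam, ~ smooth_section lam -> d lam = 0) -> DL_fibre d.
Proof.
move=> lv non; have [c [t [Ac Tt de]]] := slit_cover e; have [ce te] := de.
have [V [oV Ve VU H]] := lin_derivations Ac Tt ce te.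
have [_ _ _ sur] := is_frame_lin_frame Ac Tt de.
have [w vE] := sur v lv.1.
have [D [X [Z [dD lD _ ZE]]]] := H w; exists D, X; split=> //.
have := lifts_at e dD lD; rewrite ZE // vE => lv'.
apply/funext => lam; case: (pselect (smooth_section lam)) => Sl.
  exact: (lift_at_inj lv lv').
by rewrite non //; have [_ _ _ _ non'] := dD; rewrite /at_point non'.
Qed.

Lemma tangent_DL_fibre e v : tangent At e v -> exists2 d, DL_fibre d & lift_at (e := e) d v.
Proof.
move=> tv; have [c [t [Ac Tt de]]] := slit_cover e; have [ce te] := de.
have [V [oV Ve VU H]] := lin_derivations Ac Tt ce te.
have [_ _ _ sur] := is_frame_lin_frame Ac Tt de.
have [w vE] := sur v tv; have [D [X [Z [dD lD _ ZE]]]] := H w.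
exists (at_point D (proj e)); first by exists D, X.
by have := lifts_at e dD lD; rewrite ZE // vE.
Qed.

Lemma DL_fibre_eq e (d d' : presection L -> fib L (proj e)) v : DL_fibre d -> DL_fibre d' ->
  lift_at d v -> lift_at d' v -> d = d'.
Proof.
move=> Dd Dd' lv lv'; apply/funext => lam; case: (pselect (smooth_section lam)) => Sl.
  exact: (lift_at_inj lv lv').
by rewrite !DL_fibre_nonsmooth.
Qed.

Definition field_bracket (Z Z' : Mt -> (Mt -> R) -> R) e f : R :=
  Z e (fun e' => Z' e' f) - Z' e (fun e' => Z e' f).

Lemma tangent_bracket Z Z' e : vector_field At Z -> vector_field At Z' ->
  tangent At e (field_bracket Z Z' e).
Proof.
move=> [tZ SZ] [tZ' SZ']; have [lin lei non] := tZ e; have [lin' lei' non'] := tZ' e.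
split=> [a f g Sf Sg|f g Sf Sg|f nf]; rewrite /field_bracket.
- have -> : (fun e' => Z' e' (fun y => a * f y + g y)) = (fun e' => a * Z' e' f + Z' e' g).
    by apply/funext => e'; have [-> //] := tZ' e'.
  have -> : (fun e' => Z e' (fun y => a * f y + g y)) = (fun e' => a * Z e' f + Z e' g).
    by apply/funext => e'; have [-> //] := tZ e'.
  by rewrite lin ?lin'; try (by auto); ring.
- have -> : (fun e' => Z' e' (fun y => f y * g y)) = (fun e' => f e' * Z' e' g + g e' * Z' e' f).
    by apply/funext => e'; have [_ -> //] := tZ' e'.
  have -> : (fun e' => Z e' (fun y => f y * g y)) = (fun e' => f e' * Z e' g + g e' * Z e' f).
    by apply/funext => e'; have [_ -> //] := tZ e'.
  have mulS h h' : smooth At h -> smooth At h' -> smooth At (fun y => h y * h' y).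
    exact: (smooth_on_mul hAt openT).
  rewrite (tangent_add (tZ e)); try (by auto).
  rewrite (tangent_add (tZ' e)); try (by auto).
  by rewrite !lei ?lei'; try (by auto); ring.
- have -> : (fun e' => Z' e' f) = (fun=> 0) by apply/funext => e'; have [_ _ ->] := tZ' e'.
  have -> : (fun e' => Z e' f) = (fun=> 0) by apply/funext => e'; have [_ _ ->] := tZ e'.
  by rewrite (tangent_cst hAt (tZ e)) (tangent_cst hAt (tZ' e)) subrr.
Qed.

Lemma covB e (u v : fib L (proj e)) : cov (u - v) = cov u - cov v.
Proof. by rewrite addrC -scaleN1r cov_linear mulN1r addrC. Qed.

Lemma lift_bracket D X D' X' Z Z' e : derivation D X -> derivation D' X' -> lifts D Z ->
  lifts D' Z' -> lift_at (at_point (bracket D D') (proj e)) (field_bracket Z Z' e).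
Proof.
move=> [SD _ _ _ _] [SD' _ _ _ _] [vZ HZ] [vZ' HZ']; split; first exact: tangent_bracket.
move=> lam Sl; rewrite /field_bracket.
have -> : (fun e' => Z' e' (fun_of_section lam)) = fun_of_section (D' lam).
  by apply/funext => e'; exact: HZ'.
have -> : (fun e' => Z e' (fun_of_section lam)) = fun_of_section (D lam).
  by apply/funext => e'; exact: HZ.
by rewrite HZ ?HZ' ?covB //; auto.
Qed.

Lemma DL_fibre_bracket D X D' X' e : derivation D X -> derivation D' X' ->
  DL_fibre (at_point (bracket D D') (proj e)).
Proof.
move=> dD dD'; have [Z lD] := lifts_exist dD; have [Z' lD'] := lifts_exist dD'.
apply: (lift_DL_fibre (lift_bracket e dD dD' lD lD')) => lam nl.
have [_ _ _ _ non] := dD; have [_ _ _ _ non'] := dD'.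
by rewrite /at_point /bracket (non lam nl) (non' lam nl) (derivation0 dD) (derivation0 dD') subrr.
Qed.

(** The Leibniz rules of [Z] and of [D] are compared on [f] times a section that does not vanish at
    the base point. On non-smooth [f] both sides are 0 by normalisation. *)
Lemma lifts_symbol D X Z e f : derivation D X -> lifts D Z -> Z e (f \o pr) = X (proj e) f.
Proof.
move=> dD lD; have [c [t [Ac Tt [ce te]]]] := slit_cover e.
have [lam [y [V [Sl Sy oV Ve HV]]]] := lin_coordinates Ac Tt ce te.
have [tZ _] := lD.1; have [_ _ [tX _] lei _] := dD.
case: (pselect (smooth Am f)) => Sf; last first.
  have [_ _ ->] := tX (proj e); last by [].
  by have [_ _ ->] := tZ e; last by move=> /smooth_proj.
have Sf' : smooth At (f \o pr) by apply/smooth_proj.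
have := lD.2 _ (smooth_section_mul Sf Sl) e.
have -> : fun_of_section (fun x => f x *: lam x) = (fun e => (f \o pr) e * fun_of_section lam e).
  by apply/funext => e'; exact: fun_of_section_mul.
rewrite (tangent_mul (tZ e)) //; last exact: smooth_fun_of_section.
rewrite lD.2 // lei // /fun_of_section cov_linear covZ /= => /addrI.
rewrite mulrC => /mulIf; apply.
by have [_ _ -> _] := HV _ Ve; exact: sfun_neq0.
Qed.

End Derivations.

(** * Symplectic bases depending smoothly on a parameter *)

Section SmoothMatrices.
Variables (R : realType) (m : nat) (X : topologicalType) (A : set (chart R m X)).
Hypothesis hA : is_atlas A.
Implicit Types (U : set X).

Definition smooth_mx U p q (P : X -> 'M[R]_(p, q)) : Prop :=
  forall i j, smooth_on A U (fun x => P x i j).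

Lemma smooth_mx_sub U V p q (P : X -> 'M[R]_(p, q)) : V `<=` U -> smooth_mx U P -> smooth_mx V P.
Proof. by move=> VU SP i j; exact: smooth_on_sub (SP i j). Qed.

Lemma smooth_mx_cst U p q (P : 'M[R]_(p, q)) : open U -> smooth_mx U (fun=> P).
Proof. by move=> oU i j; exact: (smooth_on_cst hA). Qed.

Lemma smooth_mx_mul U p q r (P : X -> 'M[R]_(p, q)) (Q : X -> 'M[R]_(q, r)) : open U ->
  smooth_mx U P -> smooth_mx U Q -> smooth_mx U (fun x => P x *m Q x).
Proof.
move=> oU SP SQ i j.
apply: (@smooth_on_ext _ _ _ _ hA _ (fun x => \sum_k P x i k * Q x k j)) => //.
  by move=> x _; rewrite mxE.
by apply: (smooth_on_sum hA) => // k _; exact: (smooth_on_mul hA).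
Qed.

Lemma smooth_mx_tr U p q (P : X -> 'M[R]_(p, q)) : open U ->
  smooth_mx U P -> smooth_mx U (fun x => (P x)^T).
Proof.
by move=> oU SP i j; apply: (smooth_on_ext hA oU) (SP j i) => x _; rewrite mxE.
Qed.

Lemma smooth_on_det U p (P : X -> 'M[R]_p) : open U -> smooth_mx U P ->
  smooth_on A U (fun x => \det (P x)).
Proof.
move=> oU SP; apply: (smooth_on_sum hA) => // s _; apply: (smooth_on_mul hA) => //.
  exact: (smooth_on_cst hA).
by apply: (smooth_on_prod hA) => // i _; exact: SP.
Qed.

Lemma smooth_mx_inv U p (P : X -> 'M[R]_p) : open U -> (forall x, U x -> P x \in unitmx) ->
  smooth_mx U P -> smooth_mx U (fun x => invmx (P x)).
Proof.
move=> oU uP SP i j.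
apply: (@smooth_on_ext _ _ _ _ hA _ (fun x => (\det (P x))^-1 *
   ((-1) ^+ (j + i) * \det (row' j (col' i (P x)))))) => //.
  by move=> x Ux; rewrite /invmx uP // !mxE.
apply: (smooth_on_mul hA) => //.
  apply: (smooth_on_inv hA) => //; last exact: smooth_on_det.
  by move=> x /uP; rewrite unitmxE unitfE.
apply: (smooth_on_mul hA) => //; first exact: (smooth_on_cst hA).
apply: smooth_on_det => // a b.
by apply: (smooth_on_ext hA oU) (SP (lift j a) (lift i b)) => x _; rewrite !mxE.
Qed.

Lemma smooth_on_neq0_open U f x : open U -> U x -> smooth_on A U f -> f x != 0 ->
  exists V, [/\ open V, V x, V `<=` U & forall y, V y -> f y != 0].
Proof.
move=> oU Ux Sf f0; exists (U `&` [set y | f y != 0])^°; split.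
- exact: open_interior.
- apply: filterI; first exact: open_nbhs_nbhs.
  have cf := smooth_on_continuous hA oU Ux Sf.
  by apply: (cf [set z | z != 0]); apply: open_nbhs_nbhs; split=> //; exact: open_neq.
- by move=> y /interior_subset[].
- by move=> y /interior_subset[].
Qed.

End SmoothMatrices.

Lemma mx_inj_unit (F : fieldType) m (P : 'M[F]_m) : (forall v : 'cV_m, P *m v = 0 -> v = 0) ->
  P \in unitmx.
Proof.
move=> inj; rewrite -unitmx_tr -row_free_unit -kermx_eq0.
apply/eqP/row_matrixP => i; rewrite row0; set u := row i _.
have uP : u *m P^T = 0 by rewrite /u -row_mul mulmx_ker row0.
have := inj u^T; rewrite -[P in P *m _]trmxK -trmx_mul uP trmx0 => /(_ erefl).
by move=> /(congr1 trmx); rewrite trmxK trmx0.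
Qed.

(** * The symplectic matrix and the elimination of one pair *)

Section Symplectic.
Variables (R : realType) (m k : nat).
Hypothesis hm : m = (k + k)%N.
Local Notation Jm := (symplectic_J R k m).

Let partner_lt (a : 'I_m) : ((if (a < k)%N then k + a else a - k) < m)%N.
Proof. by case: ifP; have := ltn_ord a; lia. Qed.

(** The conjugate index, exchanging i and k + i: the only column where row [a] of J is nonzero, with
    entry [psign a]. *)
Definition partner a : 'I_m := Ordinal (partner_lt a).
Definition psign (a : 'I_m) : R := if (a < k)%N then 1 else -1.

Lemma partnerK a : partner (partner a) = a.
Proof. by apply: val_inj => /=; have := ltn_ord a; case: ifP; case: ifP; lia. Qed.

Lemma psign_partner a : psign (partner a) = - psign a.
Proof.
rewrite /psign /=; have := ltn_ord a; case: (ltnP a k) => ak am.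
  by rewrite (_ : (k + a < k)%N = false) //; lia.
by rewrite (_ : (a - k < k)%N = true) ?opprK //; lia.
Qed.

Lemma JE a b : Jm a b = psign a * (b == partner a)%:R.
Proof.
rewrite mxE /psign -val_eqE /=; have := ltn_ord a; have := ltn_ord b.
case: (ltnP a k) => ak bm am.
  case: eqP => _; first by rewrite mulr1.
  by rewrite mulr0; case: eqP => // E; exfalso; lia.
case: eqP => [E|_]; first by exfalso; lia.
case: eqP => [->|E]; first by rewrite addKn eqxx mulr1.
by case: eqP => [E'|_]; [exfalso; lia|rewrite mulr0].
Qed.

Lemma J_antisym a b : Jm a b = - Jm b a.
Proof.
rewrite !JE; have [->|ba] := eqVneq b (partner a).
  by rewrite partnerK eqxx psign_partner mulNr opprK.
rewrite mulr0; have [E|_] := eqVneq a (partner b); last by rewrite mulr0 oppr0.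
by move: ba; rewrite E partnerK eqxx.
Qed.

Lemma mul_J p (K : 'M[R]_(m, p)) a b : (Jm *m K) a b = psign a * K (partner a) b.
Proof.
rewrite mulmx_entry (bigD1 (partner a)) //= big1 => [|c ca].
  by rewrite JE eqxx mulr1 addr0.
by rewrite JE (negbTE ca) mulr0 mul0r.
Qed.

Lemma J_unit : Jm \in unitmx.
Proof.
apply: mx_inj_unit => v /colP E; apply/colP => a.
have := E (partner a); rewrite mul_J partnerK mxE => /eqP.
rewrite mulf_eq0 mxE => /orP[|/eqP //]; rewrite /psign; case: ifP => _.
  by rewrite oner_eq0.
by rewrite oppr_eq0 oner_eq0.
Qed.

Lemma Sp1 : Sp R k m 1%:M.
Proof. by split; [exact: unitmx1|rewrite trmx1 mul1mx mulmx1]. Qed.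

Lemma SpM B B' : Sp R k m B -> Sp R k m B' -> Sp R k m (B *m B').
Proof.
move=> [uB BJ] [uB' BJ']; split; first by rewrite unitmx_mul uB.
by rewrite trmx_mul !mulmxA -(mulmxA _ B^T) -(mulmxA _ (B^T *m _)) BJ.
Qed.

Lemma SpV B : Sp R k m B -> Sp R k m (invmx B).
Proof.
move=> [uB BJ]; split; first by rewrite unitmx_inv.
rewrite -{1}BJ !mulmxA -trmx_mul mulmxV // trmx1 mul1mx -mulmxA mulmxV //.
by rewrite mulmx1.
Qed.

Section Pivot.
Variables (N : 'M[R]_m) (p q : 'I_m).
Hypotheses (antiN : forall a b, N a b = - N b a) (pq : p != q) (Npq : N p q != 0).

(** One step of symplectic Gram-Schmidt: e_p is kept, e_q is divided by N p q, and every other e_b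
    is corrected by multiples of e_p and e_q that make it N-orthogonal to both. *)
Definition pivot_mx : 'M[R]_m :=
  \matrix_(a, b) ((a == b)%:R * (if b == q then (N p q)^-1 else 1)
    + (a == p)%:R * (if (b == p) || (b == q) then 0 else - (N b q / N p q))
    + (a == q)%:R * (if (b == p) || (b == q) then 0 else N b p / N p q)).

Let sum_delta (f : 'I_m -> R) b : \sum_a f a * (a == b)%:R = f b.
Proof.
rewrite (bigD1 b) //= big1 => [|a /negbTE ->]; last by rewrite mulr0.
by rewrite eqxx mulr1 addr0.
Qed.

Let comb (f : 'I_m -> R) b : \sum_a f a * pivot_mx a b =
  f b * (if b == q then (N p q)^-1 else 1)
  + f p * (if (b == p) || (b == q) then 0 else - (N b q / N p q))
  + f q * (if (b == p) || (b == q) then 0 else N b p / N p q).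
Proof.
rewrite -(sum_delta f b) -(sum_delta f p) -(sum_delta f q) !mulr_suml -!big_split /=.
by apply: eq_bigr => a _; rewrite mxE !mulrDr !mulrA.
Qed.

Let N0 a : N a a = 0. Proof. by have := antiN a a => E; lra. Qed.

Let N' := pivot_mx^T *m N *m pivot_mx.

Let N'E a b : N' a b =
  (if a == q then (N p q)^-1 else 1) * (N *m pivot_mx) a b
  + (if (a == p) || (a == q) then 0 else - (N a q / N p q)) * (N *m pivot_mx) p b
  + (if (a == p) || (a == q) then 0 else N a p / N p q) * (N *m pivot_mx) q b.
Proof.
rewrite /N' -mulmxA mulmx_entry.
under eq_bigr => c _ do rewrite [pivot_mx^T _ _]mxE mulrC.
by rewrite (comb (fun c => (N *m pivot_mx) c b)); congr (_ + _ + _); exact: mulrC.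
Qed.

Let NTE a b : (N *m pivot_mx) a b =
  N a b * (if b == q then (N p q)^-1 else 1)
  + N a p * (if (b == p) || (b == q) then 0 else - (N b q / N p q))
  + N a q * (if (b == p) || (b == q) then 0 else N b p / N p q).
Proof. by rewrite mulmx_entry comb. Qed.

Lemma pivot_p b : N' p b = (b == q)%:R.
Proof.
rewrite N'E (negbTE pq) eqxx /= !mul0r mul1r !addr0 NTE N0 mul0r addr0.
have [->|bq] := eqVneq b q; first by rewrite orbT mulr0 addr0 mulfV.
rewrite orbF mulr1; have [->|bp] := eqVneq b p; first by rewrite N0 mulr0 addr0.
by rewrite mulrCA mulfV // mulr1 (antiN p b) addNr.
Qed.

Lemma pivot_q b : N' q b = - (b == p)%:R.
Proof.
rewrite N'E eqxx orbT !mul0r !addr0 NTE N0 mul0r addr0.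
have [->|bq] := eqVneq b q.
  by rewrite orbT N0 mul0r mulr0 addr0 mulr0 eq_sym (negbTE pq) oppr0.
rewrite orbF; have E := antiN q p; have [->|bp] := eqVneq b p.
  by rewrite mulr0 addr0 mulr1 E mulrN mulVf.
have -> : N q b * 1 + N q p * - (N b q / N p q) = 0.
  by rewrite E (antiN q b); field.
by rewrite mulr0 oppr0.
Qed.

(** Rows normalised by earlier steps are orthogonal to the new pair and survive the step. *)
Lemma pivot_done a b : a != p -> a != q -> N a p = 0 -> N a q = 0 -> N' a b = N a b.
Proof.
move=> ap aq Eap Eaq.
rewrite N'E (negbTE ap) (negbTE aq) /= Eap Eaq !mul0r oppr0 !mul0r mul1r !addr0 NTE Eap Eaq.
rewrite !mul0r !addr0; have [->|_] := eqVneq b q; last by rewrite mulr1.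
by rewrite Eaq mul0r.
Qed.

Lemma pivot_unit : pivot_mx \in unitmx.
Proof.
rewrite -unitmx_tr; apply: mx_inj_unit => v E.
have H b : v b 0 * (if b == q then (N p q)^-1 else 1)
  + v p 0 * (if (b == p) || (b == q) then 0 else - (N b q / N p q))
  + v q 0 * (if (b == p) || (b == q) then 0 else N b p / N p q) = 0.
  rewrite -(comb (fun c => v c 0)); have := congr1 (fun w : 'cV_m => w b 0) E.
  rewrite mulmx_entry mxE => E'; rewrite -[RHS]E'; apply: eq_bigr => c _.
  by rewrite [pivot_mx^T _ _]mxE mulrC.
have vp : v p 0 = 0.
  by have := H p; rewrite eqxx (negbTE pq) /= !mulr0 !addr0 mulr1.
have vq : v q 0 = 0.
  have := H q; rewrite eqxx orbT !mulr0 !addr0 => /eqP.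
  by rewrite mulf_eq0 invr_eq0 (negbTE Npq) orbF => /eqP.
apply/colP => b; rewrite [RHS]mxE; have := H b; rewrite vp vq !mul0r !addr0.
have [-> _ //|_] := eqVneq b q; by rewrite mulr1.
Qed.

End Pivot.

End Symplectic.

(** * Gram-Schmidt with parameters *)

Section GramSchmidt.
Variables (R : realType) (mX : nat) (X : topologicalType) (A : set (chart R mX X)).
Hypothesis hA : is_atlas A.
Variables (m k : nat).
Hypothesis hm : m = (k + k)%N.
Local Notation Jm := (symplectic_J R k m).
Variables (U : set X) (x0 : X) (Om : X -> 'M[R]_m).
Hypotheses (oU : open U) (Ux0 : U x0) (SOm : smooth_mx A U Om).
Hypotheses (antiOm : forall x, U x -> forall a b, Om x a b = - Om x b a) (uOm : Om x0 \in unitmx).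

(** The indices treated after [i] steps: the first [i] pairs (a, k + a). *)
Let dn i (a : 'I_m) := (a < i)%N || ((k <= a) && (a < k + i))%N.

Let J_dn i a b : (i <= k)%N -> dn i a -> ~~ dn i b -> Jm a b = 0.
Proof.
move=> ik da nb; rewrite (JE R hm); have [E|_] := eqVneq b (partner hm a); last by rewrite mulr0.
exfalso; move: da nb; rewrite E /dn /=; have := ltn_ord a.
by case: ifP; lia.
Qed.

Let tr_anti (N P : 'M[R]_m) : (forall a b, N a b = - N b a) ->
  forall a b, (P^T *m N *m P) a b = - (P^T *m N *m P) b a.
Proof.
move=> aN a b; have NE : N^T = - N by apply/matrixP => i j; rewrite !mxE aN.
have H : (P^T *m N *m P)^T = - (P^T *m N *m P).
  by rewrite !trmx_mul trmxK NE mulNmx mulmxN mulmxA.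
by have := congr1 (fun K : 'M[R]_m => K b a) H; rewrite [LHS]mxE [RHS]mxE.
Qed.

(** The choice of pivot is made at [x0] only. The permutation is therefore constant, and the
    neighbourhood shrinks at each of the [k] steps so that the pivot stays nonzero; the entries are
    then rational functions of smooth ones. *)
Lemma smooth_gram_schmidt : exists V (P : X -> 'M[R]_m),
  [/\ open V, V x0, V `<=` U, smooth_mx A V P &
      forall x, V x -> P x \in unitmx /\ (P x)^T *m Om x *m P x = Jm].
Proof.
have step i : (i <= k)%N -> exists V (P : X -> 'M[R]_m),
  [/\ open V, V x0, V `<=` U, smooth_mx A V P &
      forall x, V x -> P x \in unitmx /\
        forall a b, dn i a -> ((P x)^T *m Om x *m P x) a b = Jm a b].
  elim: i => [_|i IH ik].
    exists U, (fun=> 1%:M); split=> //; first exact: (smooth_mx_cst hA).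
    by move=> x Ux; split; [exact: unitmx1|move=> a b; rewrite /dn; lia].
  have [V [P [oV Vx0 VU SP HP]]] := IH (ltnW ik).
  have im : (i < m)%N by lia.
  have kim : (k + i < m)%N by lia.
  pose p := Ordinal im; pose q := Ordinal kim.
  have nk : (k + i < k)%N = false by lia.
  have pq : p != q by rewrite -val_eqE /=; lia.
  have dnS a : dn i.+1 a -> a != p -> a != q -> dn i a.
    by rewrite /dn -!val_eqE /=; lia.
  have ndp : ~~ dn i p by rewrite /dn /=; lia.
  have ndq : ~~ dn i q by rewrite /dn /=; lia.
  pose N x := (P x)^T *m Om x *m P x.
  have aN x : V x -> forall a b, N x a b = - N x b a.
    by move=> Vx; apply: tr_anti; apply: antiOm; exact: VU.
  have SN : smooth_mx A V N.
    apply: (smooth_mx_mul hA) => //; apply: (smooth_mx_mul hA) => //.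
      exact: (smooth_mx_tr hA).
    exact: smooth_mx_sub SOm.
  have [uP0 _] := HP _ Vx0.
  have uN0 : N x0 \in unitmx by rewrite /N !unitmx_mul unitmx_tr uP0 uOm.
  (* A row of an invertible matrix is nonzero. The column [j] is untreated, since treated rows agree
     with those of J and so vanish in column p. *)
  have [j Nj] : exists j, N x0 p j != 0.
    apply: boolp.contrapT => H; have : row p (N x0) = 0.
      apply/rowP => j; rewrite [LHS]mxE [RHS]mxE; apply/eqP/negPn/negP => nj; apply: H; by exists j.
    rewrite rowE => /(congr1 (mulmx^~ (invmx (N x0)))); rewrite mulmxK // mul0mx.
    by move=> /rowP/(_ p); rewrite !mxE !eqxx => /eqP; rewrite oner_eq0.
  have jp : j != p.
    apply/negP => /eqP E; move: Nj; rewrite E; have := aN _ Vx0 p p => H.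
    by rewrite (_ : N x0 p p = 0) ?eqxx //; lra.
  have ndj : ~~ dn i j.
    apply/negP => dj; move: Nj; rewrite aN // (HP _ Vx0).2 // (J_dn (ltnW ik) dj ndp).
    by rewrite oppr0 eqxx.
  (* The pivot column is moved to place k + i, the partner of i; treated indices are fixed by the
     transposition. *)
  pose s := tperm j q; pose S := perm_mx s : 'M[R]_m.
  have sd a : dn i a -> s a = a.
    by move=> da; rewrite /s tpermD //; apply/eqP => E; move: ndj ndq; rewrite E da.
  have sp : s p = p by rewrite /s tpermD // eq_sym.
  pose N1 x := (P x *m S)^T *m Om x *m (P x *m S).
  have N1E x a b : N1 x a b = N x (s a) (s b).
    have -> : N1 x = row_perm s (col_perm s (N x)).
      by rewrite row_permE col_permE /N1 trmx_mul tr_perm_mx /S /s !tpermV !mulmxA.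
    by rewrite [LHS]mxE [LHS]mxE.
  have aN1 x : V x -> forall a b, N1 x a b = - N1 x b a.
    by move=> Vx a b; rewrite !N1E aN.
  have SPS : smooth_mx A V (fun x => P x *m S).
    by apply: (smooth_mx_mul hA) => //; exact: (smooth_mx_cst hA).
  have SN1 : smooth_mx A V N1.
    apply: (smooth_mx_mul hA) => //; apply: (smooth_mx_mul hA) => //.
      exact: (smooth_mx_tr hA).
    exact: smooth_mx_sub SOm.
  have N1d x a b : V x -> dn i a -> N1 x a b = Jm a b.
    move=> Vx da; rewrite N1E sd // (HP _ Vx).2 //; case: (boolP (dn i b)) => db; first by rewrite sd.
    rewrite (J_dn (ltnW ik) da db) (J_dn (ltnW ik) da) //.
    rewrite /s; case: tpermP => // _; by [].
  have N1pq : N1 x0 p q != 0 by rewrite N1E sp /s tpermR.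
  have [V' [oV' V'x0 V'V N1nz]] := smooth_on_neq0_open hA oV Vx0 (SN1 p q) N1pq.
  pose T x := pivot_mx (N1 x) p q.
  exists V', (fun x => P x *m S *m T x); split=> //.
  - by move=> x /V'V /VU.
  - have oc c : smooth_on A V' (fun=> c) by exact: (smooth_on_cst hA).
    have SN1' a b : smooth_on A V' (fun x => N1 x a b) by apply: smooth_on_sub (SN1 a b).
    have Siv : smooth_on A V' (fun x => (N1 x p q)^-1) by apply: (smooth_on_inv hA).
    apply: (smooth_mx_mul hA) => //; first exact: smooth_mx_sub SPS.
    move=> a b; apply: (@smooth_on_ext _ _ _ _ hA _ (fun x =>
      ((a == b)%:R * (if b == q then (N1 x p q)^-1 else 1)
    + (a == p)%:R * (if (b == p) || (b == q) then 0 else - (N1 x b q / N1 x p q))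
    + (a == q)%:R * (if (b == p) || (b == q) then 0 else N1 x b p / N1 x p q)))) => //.
      by move=> x _; rewrite [RHS]mxE.
    apply: (smooth_on_add hA) => //; first apply: (smooth_on_add hA) => //.
    + by apply: (smooth_on_mul hA) => //; case: (b == q).
    + apply: (smooth_on_mul hA) => //; case: (_ || _) => //.
      by apply: (smooth_on_opp hA) => //; exact: (smooth_on_mul hA).
    + apply: (smooth_on_mul hA) => //; case: (_ || _) => //.
      exact: (smooth_on_mul hA).
  move=> x V'x; have Vx := V'V _ V'x; have N1x := N1nz _ V'x.
  split.
    rewrite !unitmx_mul unitmx_perm (HP _ Vx).1 /=.
    exact: (pivot_unit pq N1x).
  move=> a b da.
  have -> : (P x *m S *m T x)^T *m Om x *m (P x *m S *m T x) = (T x)^T *m N1 x *m T x.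
    by rewrite /N1 trmx_mul !mulmxA.
  have [->|ap] := eqVneq a p.
    rewrite (pivot_p (aN1 x Vx) pq N1x) (JE R hm) /psign /= ik mul1r; congr (_%:R); congr nat_of_bool.
    by rewrite -!val_eqE /= ik.
  have [->|aq] := eqVneq a q.
    rewrite (pivot_q (aN1 x Vx) pq N1x) (JE R hm) /psign /= nk mulN1r; congr (- _%:R).
    by congr nat_of_bool; rewrite -!val_eqE /= nk addKn.
  have da' : dn i a by exact: dnS da ap aq.
  rewrite pivot_done ?N1d //.
  - by rewrite (J_dn (ltnW ik) da' ndp).
  - by rewrite (J_dn (ltnW ik) da' ndq).
have [V [P [oV Vx0 VU SP HP]]] := step k (leqnn k).
exists V, P; split=> // x /HP[uP E]; split=> //; apply/matrixP => a b.
by apply: E; rewrite /dn; have := ltn_ord a; lia.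
Qed.

End GramSchmidt.

Lemma sum_halves (R : realType) (F : nat -> R) k m : m = (k + k)%N ->
  \sum_(0 <= a < m) F a = \sum_(i < k) (F i + F (k + i)%N).
Proof.
move=> ->; rewrite (big_cat_nat (n := k)) //=; last by lia.
rewrite -{2}[k]add0n big_addn addnK !big_mkord big_split /=; congr (_ + _).
by apply: eq_bigr => i _; rewrite addnC.
Qed.

(* the form of a symplectic coframe, [sum_i xi^i /\ eta_i] *)
Lemma J_form_sum (R : realType) n k (w w' : 'cV[R]_n.+1) : n.+1 = (k + k)%N ->
  (w^T *m symplectic_J R k n.+1 *m w') 0 0 =
  \sum_(i < k) (w (inord i) 0 * w' (inord (k + i)) 0 - w (inord (k + i)) 0 * w' (inord i) 0).
Proof.
move=> hm; rewrite -mulmxA mulmx_entry.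
under eq_bigr => a _ do rewrite mxE mul_J.
pose F (a : nat) : R := w (inord a) 0 * (psign R k (inord a : 'I_n.+1) * w' (partner hm (inord a)) 0).
transitivity (\sum_(0 <= a < n.+1) F a).
  by rewrite big_mkord; apply: eq_bigr => a _; rewrite /F inord_val.
rewrite (sum_halves F hm); apply: eq_bigr => i _; rewrite /F.
have ik := ltn_ord i.
have vi : nat_of_ord (inord i : 'I_n.+1) = i by rewrite inordK //; lia.
have vki : nat_of_ord (inord (k + i) : 'I_n.+1) = (k + i)%N by rewrite inordK //; lia.
have nk : (k + i < k)%N = false by lia.
have -> : partner hm (inord i) = inord (k + i).
  by apply: ord_inj; rewrite vki /= vi ik.
have -> : partner hm (inord (k + i)) = inord i.
  by apply: ord_inj; rewrite vi /= vki nk addKn.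
by rewrite /psign vi vki ik nk mul1r mulN1r mulrN.
Qed.

(** * Structures and forms *)

Section FrameChange.
Variables (R : realType) (m : nat) (X : topologicalType) (A : set (chart R m X)).
Hypotheses (hA : is_atlas A) (hX : hausdorff_space X).

Lemma frame_comp_mul (psi : preframe R m X) B B' :
  frame_comp (frame_comp psi B) B' = frame_comp psi (B *m B').
Proof. by apply/funext => w; rewrite /frame_comp mulmxA. Qed.

Lemma frame_comp1 (psi : preframe R m X) : frame_comp psi 1%:M = psi.
Proof. by apply/funext => w; rewrite /frame_comp mul1mx. Qed.

Lemma is_frame_comp x psi B : is_frame A x psi -> B \in unitmx -> is_frame A x (frame_comp psi B).
Proof.
move=> [lin tan inj sur] uB; split.
- by move=> a w w' f; rewrite /frame_comp mulmxDr -scalemxAr lin.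
- by move=> w; exact: tan.
- by move=> w w' /inj E; rewrite -(mulKmx uB w) E mulKmx.
- move=> v /sur[w <-]; exists (invmx B *m w).
  by rewrite /frame_comp mulKVmx.
Qed.

Lemma frame_change x psi psi' : is_frame A x psi -> is_frame A x psi' ->
  exists2 B, B \in unitmx & psi' = frame_comp psi B.
Proof.
move=> fr fr'; have [_ cov _] := hA; have [c Ac cx] := cov x.
have hc := atlas_chart hA Ac.
have [B uB E] := frame_matrix hA hX hc cx fr; have [B' uB' E'] := frame_matrix hA hX hc cx fr'.
exists (invmx B *m B'); first by rewrite unitmx_mul unitmx_inv uB.
have E0 : B *m (invmx B *m B') = B' by rewrite mulmxA mulmxV // mul1mx.
apply: etrans E' _; rewrite -[in LHS]E0 -frame_comp_mul; congr frame_comp.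
exact: esym.
Qed.

Lemma frame_comp_inj x psi B B' : is_frame A x psi -> frame_comp psi B = frame_comp psi B' -> B = B'.
Proof.
move=> [_ _ inj _] E; apply/matrixP => i j.
have /inj/colP/(_ i) : psi (B *m e_ j) = psi (B' *m e_ j) by exact: (congr1 (fun f => f (e_ j)) E).
by rewrite -!colE !mxE.
Qed.

End FrameChange.

(** * Invariant sections of a structure *)

Section Correspondence.
Variables (R : realType) (n : nat) (n_odd : odd n) (M : manifold R n) (L : line_bundle M).
Local Notation Mt := (slit_dual L).
Local Notation At := (slit_dual_atlas L).
Local Notation Am := (atlas M).
Local Notation pr := (@proj R n M L).
Local Notation Ct c t := (Chart (@slit_dual_dom R n M L c t) (@slit_dual_coord R n M L c t)).
Local Notation k := ((n.+1)./2).
Local Notation G := (Sp R k n.+1).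
Local Notation Jm := (symplectic_J R k n.+1).
Local Notation frame := (preframe R n.+1 Mt).
Implicit Types (t : local_triv (fib L)) (c : chart R n M) (e : Mt) (x : M) (lam mu : presection L).
Implicit Types (D : presection L -> presection L) (X : M -> (M -> R) -> R) (Z : Mt -> (Mt -> R) -> R).
Implicit Types (S : Mt -> set frame) (psi : frame) (omega : DL_preform L).

Let hA : is_atlas Am := atlasP M.
Let hX : hausdorff_space M := @manifold_hausdorff _ _ M.
Let hAt : is_atlas At := slit_dual_is_atlas L.
Let hXt : hausdorff_space Mt := @slit_dual_hausdorff R n M L.

Lemma half_dim : n.+1 = (k + k)%N.
Proof. by rewrite addnn -[LHS]odd_double_half /= n_odd. Qed.

Let hm := half_dim.

Definition J_form (w w' : 'cV[R]_n.+1) : R := (w^T *m Jm *m w') 0 0.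

Lemma J_form_Sp B w w' : G B -> J_form (B *m w) (B *m w') = J_form w w'.
Proof.
move=> [_ BJ]; rewrite /J_form trmx_mul !mulmxA -(mulmxA _ B^T) -(mulmxA _ (B^T *m _)).
by rewrite BJ.
Qed.

Lemma J_form_antisym w w' : J_form w w' = - J_form w' w.
Proof.
have JT : Jm^T = - Jm by apply/matrixP => i j; rewrite [LHS]mxE [RHS]mxE (J_antisym R hm).
have H : (w'^T *m Jm *m w)^T = - (w^T *m Jm *m w').
  by rewrite !trmx_mul trmxK JT mulNmx mulmxN mulmxA.
have := congr1 (fun K : 'M[R]_1 => K 0 0) H.
by rewrite [LHS]mxE [RHS]mxE /J_form => ->; rewrite opprK.
Qed.

Lemma J_form_lin a w1 w2 w : J_form (a *: w1 + w2) w = a * J_form w1 w + J_form w2 w.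
Proof.
rewrite /J_form linearD linearZ /= !mulmxDl -!scalemxAl.
by rewrite [LHS]mxE [X in X + _]mxE.
Qed.

Lemma J_form_nondegenerate w : (forall w', J_form w w' = 0) -> w = 0.
Proof.
move=> H; have E : w^T *m Jm = 0.
  by apply/rowP => i; have := H (e_ i); rewrite /J_form -colE mxE => ->; rewrite mxE.
have := mulmxK (J_unit R hm) w^T; rewrite E mul0mx => /(congr1 trmx).
by rewrite trmxK trmx0.
Qed.

Lemma is_frame_push e psi r (r0 : r != 0) : is_frame At e psi ->
  is_frame At (scale r0 e) (push r0 psi).
Proof.
have r0' : r^-1 != 0 by rewrite invr_eq0.
have K f : (f \o scale r0') \o scale r0 = f.
  by apply/funext => e'; rewrite /= scaleVK.
have K' f : (f \o scale r0) \o scale r0' = f.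
  by apply/funext => e'; rewrite /= scaleK.
move=> [lin tan inj sur]; split.
- by move=> a w w' f; rewrite /push lin.
- by move=> w; exact: (tangent_push r0 (tan w)).
- move=> w w' E; apply: inj; apply/funext => f.
  by have := congr1 (fun u : (Mt -> R) -> R => u (f \o scale r0')) E; rewrite /push K.
- move=> v tv; have := tangent_push r0' tv; rewrite scaleVK => /sur[w wE].
  by exists w; apply/funext => f; rewrite /push wE K'.
Qed.

(** [lin_frame] is invariant and [P] depends on the base point alone, so the product is invariant,
    i.e. homogeneous with A = 1. *)
Lemma homogeneous_frame_lin c t (U : set M) (P : M -> 'M[R]_n.+1) : Am c -> trivs L t -> open U ->
  U `<=` dom c `&` tdom t -> smooth_mx Am U P -> (forall x, U x -> P x \in unitmx) ->
  homogeneous_frame U (fun e => frame_comp (lin_frame c t e) (P (proj e))) (fun=> 1%:M).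
Proof.
move=> Ac Tt oU UU SP uP; have oW := proj_preimage_open L oU.
split; [exact: oU| |by move=> r _; exact: unitmx1|].
- split; [exact: oW|move=> e Ue|move=> w f Sf].
    by apply: is_frame_comp (uP _ Ue); apply: is_frame_lin_frame => //; exact: UU.
  apply: smooth_lin_frame => //; first by move=> e /UU.
  move=> i; apply: (@smooth_on_ext _ _ _ _ hAt _ ((fun x => (P x *m w) i 0) \o pr)) => //.
  apply: smooth_on_proj => //.
  by apply: (smooth_mx_mul hA) => //; exact: (smooth_mx_cst hA).
- move=> r r0 e Ue; rewrite invmx1 frame_comp1 -lin_frame_push.
  by apply/funext => w; apply/funext => f.
Qed.

Section FromStructure.
Variable S : Mt -> set frame.
Hypothesis hS : homogeneous_G_structure G (trivial_degree G) S.

Let Sfr e psi : S e psi -> is_frame At e psi.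
Proof. by have [[H _ _] _ _] := hS; exact: H. Qed.

Lemma structure_orbit e psi psi' : S e psi -> (S e psi' <-> exists2 B, G B & psi' = frame_comp psi B).
Proof. by move=> Se; have [[_ H _] _ _] := hS; exact: H. Qed.

Lemma structure_neq0 e : exists psi, S e psi.
Proof. by have [[_ _ H] _ _] := hS; have [V [s [Ve _ Ss]]] := H e; exists (s e); exact: Ss. Qed.

Lemma adapted_degree (U : set M) sigma a r : U !=set0 -> adapted_section S U sigma a -> r != 0 -> G (a r).
Proof.
move=> U0 ad r0; have [_ _ deg] := hS; rewrite /has_degree /trivial_degree in deg.
rewrite -(deg U sigma a U0 ad r r0); exists 1%:M; first exact: Sp1.
by rewrite mulmx1.
Qed.

(** An adapted section gives invariance of [S] under the push-forward twisted by [a r]. The degree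
    is trivial, so [a r] lies in G and the twist is undone inside the orbit. *)
Lemma structure_push e psi r (r0 : r != 0) : S e psi -> S (scale r0 e) (push r0 psi).
Proof.
move=> Se; have [_ hom _] := hS; have [U [sigma [a [Ue ad]]]] := hom e.
have Ga : G (a r) by apply: adapted_degree ad r0; exists (proj e).
have H := structure_orbit (push r0 psi) (ad.2 r r0 e psi Ue Se).
apply/H; exists (a r) => //.
by rewrite frame_comp_mul mulVmx ?frame_comp1 //; case: Ga.
Qed.

(* on the slice of sfun t = 1 the section has a matrix depending on the base point only;
   moving it by the action gives an invariant section *)
Lemma invariant_section e : exists c t (U : set M) (P : M -> 'M[R]_n.+1),
  [/\ [/\ Am c, trivs L t & open U], U (proj e), U `<=` dom c `&` tdom t, smooth_mx Am U P &
   forall e', U (proj e') -> P (proj e') \in unitmx /\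
     S e' (frame_comp (lin_frame c t e') (P (proj e')))].
Proof.
have [_ hom _] := hS; have [U0 [sigma [a [Ue ad]]]] := hom e.
have [[[oU0 lf ua sigE] Ss] _] := ad.
have [c [t [Ac Tt [ce te]]]] := slit_cover e.
pose U := U0 `&` (dom c `&` tdom t).
have oU : open U.
  by apply: openI => //; apply: openI; [exact: chart_dom_open (atlas_ok hA Ac)|exact: trivs_open].
have oW := proj_preimage_open L oU; have UU : U `<=` dom c `&` tdom t by move=> x [].
have hc := slit_is_chart Ac Tt; have okt := slit_chart_ok Ac Tt.
have [B HB] : exists B : Mt -> 'M[R]_n.+1, forall e', U (proj e') ->
    B e' \in unitmx /\ sigma e' = frame_comp (coord_frame At (Ct c t) e') (B e').
  suff H e' : exists B, U (proj e') ->
      B \in unitmx /\ sigma e' = frame_comp (coord_frame At (Ct c t) e') B.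
    by have [B HB] := boolp.choice H; exists B.
  case: (pselect (U (proj e'))) => Ue'; last by exists 0.
  have [_ fr _] := lf; have de' : dom (Ct c t) e' by exact: UU.
  have [B uB E] := frame_matrix hAt hXt hc de' (fr e' Ue'.1).
  by exists B.
have lfW : local_frame At (pr @^-1` U) sigma.
  have [_ fr Sf] := lf; split=> // [e' [U0e' _]|w f sf]; first exact: fr.
  by apply: smooth_on_sub (Sf w f sf) => e' [].
have SB : smooth_mx At (pr @^-1` U) B.
  move=> i j; apply: (local_frame_matrix hAt hXt hc _ lfW) => [e' /UU //|e' Ue'].
  exact: (HB e' Ue').2.
(* The matrix of [sigma] at the point with fibre coordinate 1, where the coordinate frame and
   [lin_frame] coincide. *)
pose P x : 'M[R]_n.+1 := \matrix_(i, j) in_coords (Ct c t) (fun e' => B e' i j) (vcons 1 (c x)).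
have SP : smooth_mx Am U P.
  move=> i j; apply: (smooth_on_ext hA oU) (smooth_on_unit_section Ac Tt oU UU (SB i j)).
  by move=> x _; rewrite mxE.
exists c, t, U, P; split=> //.
move=> e' Ue'; have [ce' te'] := UU _ Ue'.
have s0 := sfun_neq0 Tt te'; set s := sfun t e' in s0.
have s0' : s^-1 != 0 by rewrite invr_eq0.
pose e1 := scale s0' e'.
have e1E : scale s0 e1 = e' by exact: scaleK.
have se1 : sfun t e1 = 1 by rewrite sfun_scale mulVf.
have PB : P (proj e') = B e1.
  apply/matrixP => i j; rewrite mxE.
  have -> : vcons 1 (c (proj e')) = Ct c t e1 by rewrite /= slit_coordE se1.
  by rewrite (in_coordsE _ okt).
have Ue1 : U (proj e1) by [].
have [uB sB] := HB _ Ue1.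
have sE : sigma e1 = frame_comp (lin_frame c t e1) (B e1).
  by rewrite sB /lin_frame se1 scmx1 frame_comp1.
split; first by rewrite PB.
have -> : frame_comp (lin_frame c t e') (P (proj e')) = push s0 (sigma e1).
  rewrite sE PB -[in lin_frame c t e']e1E -lin_frame_push.
  by apply/funext => w; apply/funext => f.
have H := structure_push s0 (Ss e1 Ue1.1); rewrite e1E in H; exact: H.
Qed.

Lemma invariant_homogeneous_section e : exists U sigma,
  U (proj e) /\ homogeneous_section S U sigma (fun=> 1%:M).
Proof.
have [c [t [U [P [[Ac Tt oU] Ue UU SP HP]]]]] := invariant_section e.
exists U, (fun e => frame_comp (lin_frame c t e) (P (proj e))); split=> //; split.
  apply: homogeneous_frame_lin => // x Ux.
  by have [] := HP (bpt L x) Ux.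
by move=> e' /HP[].
Qed.

(** The formula prescribed on homogeneous sections extends to every frame of [S]: such a frame
    differs from an invariant section by a symplectic matrix, which preserves J. *)
Lemma assoc_form_frame W e psi w w' : assoc_form S W -> S e psi ->
  W e (psi w) (psi w') = J_form w w'.
Proof.
move=> aW Se; have [U [sigma [Ue hs]]] := invariant_homogeneous_section e.
have Ss := hs.2 e Ue; have [B GB E] := (structure_orbit psi Ss).1 Se.
have [_ tan inj sur] := Sfr Ss.
pose theta v : 'cV[R]_n.+1 := xget 0 [set w | sigma e w = v].
have thE v : theta (sigma e v) = v.
  apply: inj; suff : [set w | sigma e w = sigma e v] (theta (sigma e v)) by [].
  by apply: xgetPex; exists v.
rewrite (aW U sigma hs e Ue theta thE); last by rewrite E; exact: tan.
  rewrite -J_form_sum ?E; last exact: hm.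
  by rewrite /frame_comp !thE -/(J_form _ _) J_form_Sp.
by rewrite E; exact: tan.
Qed.

Lemma corresponds_value omega e psi d d' w w' : corresponds S omega -> S e psi ->
  DL_fibre d -> DL_fibre d' -> lift_at (e := e) d (psi w) -> lift_at (e := e) d' (psi w') ->
  omega (proj e) d d' = J_form w w'.
Proof.
move=> [W aW WE] Se [D [X [dD ->]]] [D' [X' [dD' ->]]] lv lv'.
have [Z lD] := lifts_exist dD; have [Z' lD'] := lifts_exist dD'.
rewrite -(assoc_form_frame w w' aW Se).
rewrite (lift_at_unique lv (lifts_at e dD lD)) (lift_at_unique lv' (lifts_at e dD' lD')).
by rewrite (WE _ _ _ _ _ _ dD dD' lD lD').
Qed.

End FromStructure.
End Correspondence.

Lemma linear_sum_delta (R : realType) m (f : 'cV[R]_m -> R) (w : 'cV[R]_m) :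
  (forall a u v, f (a *: u + v) = a * f u + f v) -> f w = \sum_i w i 0 * f (e_ i).
Proof.
move=> lin; have f0 : f 0 = 0.
  by have := lin 1 0 0; rewrite scaler0 addr0 mul1r => H; lra.
have fS (r : seq 'I_m) : f (\sum_(i <- r) w i 0 *: e_ i) = \sum_(i <- r) w i 0 * f (e_ i).
  by elim: r => [|i r IH]; rewrite ?big_nil // !big_cons lin IH.
by rewrite {1}(cV_sum_delta w) fS.
Qed.

Lemma bilinear_matrix (R : realType) m (f : 'cV[R]_m -> 'cV[R]_m -> R) :
  (forall a u v w, f (a *: u + v) w = a * f u w + f v w) -> (forall u v, f u v = - f v u) ->
  forall w w', f w w' = (w^T *m (\matrix_(i, j) f (e_ i) (e_ j)) *m w') 0 0.
Proof.
move=> lin anti w w'; rewrite -mulmxA mulmx_entry.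
rewrite (linear_sum_delta (f := f^~ w')); last by move=> *; exact: lin.
apply: eq_bigr => i _; rewrite [w^T _ _]mxE mulmx_entry; congr (_ * _).
rewrite anti (linear_sum_delta (f := f^~ (e_ i))); last by move=> *; exact: lin.
rewrite -sumrN; apply: eq_bigr => j _; rewrite [(\matrix_(_, _) _) _ _]mxE.
by rewrite anti mulrN opprK mulrC.
Qed.

(** * The form of a structure *)

Section FormsAndStructures.
Variables (R : realType) (n : nat) (n_odd : odd n) (M : manifold R n) (L : line_bundle M).
Local Notation Mt := (slit_dual L).
Local Notation At := (slit_dual_atlas L).
Local Notation Am := (atlas M).
Local Notation pr := (@proj R n M L).
Local Notation Ct c t := (Chart (@slit_dual_dom R n M L c t) (@slit_dual_coord R n M L c t)).
Local Notation k := ((n.+1)./2).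
Local Notation G := (Sp R k n.+1).
Local Notation Jm := (symplectic_J R k n.+1).
Local Notation frame := (preframe R n.+1 Mt).
Local Notation J_form := (@J_form R n).
Implicit Types (t : local_triv (fib L)) (c : chart R n M) (e : Mt) (x : M) (lam mu : presection L).
Implicit Types (D : presection L -> presection L) (X : M -> (M -> R) -> R) (Z : Mt -> (Mt -> R) -> R).
Implicit Types (S : Mt -> set frame) (psi : frame) (omega : DL_preform L).

Let hA : is_atlas Am := atlasP M.
Let hX : hausdorff_space M := @manifold_hausdorff _ _ M.
Let hAt : is_atlas At := slit_dual_is_atlas L.
Let hXt : hausdorff_space Mt := @slit_dual_hausdorff R n M L.
Let hm : n.+1 = (k + k)%N := half_dim n_odd.

Lemma DL_fibre_lin e (d d' : presection L -> fib L (proj e)) (a : R) :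
  DL_fibre d -> DL_fibre d' -> DL_fibre (fun lam => a *: d lam + d' lam).
Proof.
move=> Dd Dd'; have [v lv] := DL_fibre_lift Dd; have [v' lv'] := DL_fibre_lift Dd'.
apply: (lift_DL_fibre (lift_at_lin a lv lv')) => lam nl.
by rewrite !DL_fibre_nonsmooth // scaler0 addr0.
Qed.

Lemma frame_coefficient e psi (d : presection L -> fib L (proj e)) : is_frame At e psi ->
  DL_fibre d -> exists w, lift_at d (psi w).
Proof.
by move=> [_ _ _ sur] /DL_fibre_lift[v lv]; have [w E] := sur v lv.1; exists w; rewrite E.
Qed.

Lemma lift_frame_lin e psi (d d' : presection L -> fib L (proj e)) a w w' : is_frame At e psi ->
  lift_at d (psi w) -> lift_at d' (psi w') ->
  lift_at (fun lam => a *: d lam + d' lam) (psi (a *: w + w')).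
Proof.
move=> fr lw lw'; rewrite (frame_linear fr); exact: lift_at_lin.
Qed.

Lemma derivation_coefficients D X c t x : derivation D X -> Am c -> trivs L t ->
  dom c x -> tdom t x -> exists V (z : M -> 'cV[R]_n.+1),
  [/\ open V, V x, smooth_mx Am V z & forall e, V (proj e) ->
     lift_at (at_point D (proj e)) (lin_frame c t e (z (proj e)))].
Proof.
move=> dD Ac Tt cx tx; have [lam [y [V [Sl Sy oV Vx HV]]]] := lin_coordinates Ac Tt cx tx.
have [SD _ [_ SX] _ _] := dD.
exists V, (fun x => vcons (tmap t (D lam x)) (\col_j X x (y j))); split=> //; last first.
  by move=> e Ve; exact: (derivation_lift dD Ac Tt Sl Sy oV Ve HV).
move=> i j; rewrite ord1; case: (unliftP ord0 i) => [l|] ->.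
  apply: (@smooth_on_ext _ _ _ _ hA _ (fun x => X x (y l))) => //.
    by move=> x' _; rewrite vconsS mxE.
  by apply: smooth_on_sub (SX _ (Sy l)).
apply: (@smooth_on_ext _ _ _ _ hA _ (fun x => tmap t (D lam x))) => //.
  by move=> x' _; rewrite vcons0.
by apply: smooth_on_sub (SD _ Sl t Tt) => x' /HV[].
Qed.

(** The correspondence with the intermediate form W eliminated: in every frame of [S] the form has
    Gram matrix J. *)
Definition structure_value S omega : Prop := forall e psi, S e psi ->
  forall (d d' : presection L -> fib L (proj e)) w w', DL_fibre d -> DL_fibre d' ->
  lift_at d (psi w) -> lift_at d' (psi w') -> omega (proj e) d d' = J_form w w'.

Lemma corresponds_structure_value S omega : homogeneous_G_structure G (trivial_degree G) S ->
  corresponds S omega -> structure_value S omega.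
Proof. by move=> hS cS e psi Se d d' w w'; exact: (corresponds_value n_odd hS cS Se). Qed.

Lemma structure_value_corresponds S omega : homogeneous_G_structure G (trivial_degree G) S ->
  structure_value S omega -> corresponds S omega.
Proof.
move=> hS sv; have Sfr e psi : S e psi -> is_frame At e psi by have [[H _ _] _ _] := hS; exact: H.
(* W is built from an arbitrary choice of a frame of [S] at each point. The choice need not be
   smooth, as symplectic invariance of J removes the dependence on it. *)
pose psi0 e : frame := xget (fun=> fun=> 0) (S e).
have S0 e : S e (psi0 e) by have [psi Se] := structure_neq0 hS e; apply: (@xgetI _ _ _ psi).
pose cf e v : 'cV[R]_n.+1 := xget 0 [set w | psi0 e w = v].
have cfE e v : tangent At e v -> psi0 e (cf e v) = v.
  move=> tv; have [_ _ _ sur] := Sfr _ _ (S0 e); have [w E] := sur v tv.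
  by have := @xgetI _ 0 [set w | psi0 e w = v] w E.
exists (fun e v v' => J_form (cf e v) (cf e v')).
  move=> U sigma hs e Ue theta thE v v' tv tv'.
  have Ss := hs.2 e Ue; have [B GB E] := (structure_orbit hS (psi0 e) Ss).1 (S0 e).
  have thB v0 : tangent At e v0 -> theta v0 = B *m cf e v0.
    by move=> tv0; rewrite -[v0 in LHS](cfE _ _ tv0) E /frame_comp thE.
  by rewrite !thB // -J_form_sum // -/(J_form _ _) (J_form_Sp _ _ GB).
move=> D X D' X' Z Z' dD dD' lD lD' e; rewrite /pairing.
have lv := lifts_at e dD lD; have lv' := lifts_at e dD' lD'.
rewrite -(sv e _ (S0 e) (at_point D (proj e)) (at_point D' (proj e)) (cf e (Z e)) (cf e (Z' e))) //.
- by exists D, X.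
- by exists D', X'.
- by rewrite cfE //; exact: lv.1.
- by rewrite cfE //; exact: lv'.1.
Qed.

Section FormOfStructure.
Variable S : Mt -> set frame.
Hypothesis hS : homogeneous_G_structure G (trivial_degree G) S.

Let Sfr e psi : S e psi -> is_frame At e psi.
Proof. by have [[H _ _] _ _] := hS; exact: H. Qed.

(** The value at [x] is computed at the chosen point over [x] in a chosen frame of [S]; the default
    0 off the fibres is the normalisation in [DL_form]. *)
Definition form_of : DL_preform L := fun x d d' =>
  let psi := xget (fun=> fun=> 0) (S (bpt L x)) in
  let cf (d : presection L -> fib L x) := xget 0 [set w | @lift_at _ _ _ _ (bpt L x) d (psi w)] in
  if `[< DL_fibre d /\ DL_fibre d' >] then J_form (cf d) (cf d') else 0.

(** Independence of the choices: a point is a multiple of the chosen one, lifts of an element of DL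
    are related by push-forward, push-forward preserves [S], and J is invariant under change of
    frame in an orbit. *)
Lemma form_of_value : structure_value S form_of.
Proof.
apply: bpt_ind => x r r0 psi Spsi d d' w w' Dd Dd' lw lw'.
rewrite /form_of /= asboolT //; set psi0 := xget (fun=> fun=> 0) (S (bpt L x)).
have S0 : S (bpt L x) psi0 by have [p Sp] := structure_neq0 hS (bpt L x); apply: (@xgetI _ _ _ p).
have Sp := structure_push hS r0 S0.
have [B GB E] := (structure_orbit hS psi Sp).1 Spsi.
have [_ _ inj _] := Sfr Sp.
have H (d0 : presection L -> fib L x) w0 : DL_fibre d0 -> @lift_at _ _ _ _ (scale r0 (bpt L x)) d0 (psi w0) ->
    xget 0 [set w | @lift_at _ _ _ _ (bpt L x) d0 (psi0 w)] = B *m w0.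
  move=> Dd0 lw0; have [w1 lw1] := @frame_coefficient (bpt L x) psi0 d0 (Sfr S0) Dd0.
  have := @xgetI _ 0 [set w | @lift_at _ _ _ _ (bpt L x) d0 (psi0 w)] w1 lw1.
  set w2 := xget _ _ => /= lw2; apply: inj.
  apply: (lift_at_unique (lift_at_scale r0 lw2)).
  by move: lw0; rewrite E.
by rewrite (H d w) // (H d' w') // J_form_Sp.
Qed.

Lemma DL_form_of : DL_form form_of.
Proof.
have val x (d d' : presection L -> fib L x) psi w w' : S (bpt L x) psi -> DL_fibre d -> DL_fibre d' ->
    @lift_at _ _ _ _ (bpt L x) d (psi w) -> @lift_at _ _ _ _ (bpt L x) d' (psi w') ->
    form_of d d' = J_form w w'.
  by move=> Sx; exact: (@form_of_value (bpt L x) psi Sx d d' w w').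
split.
- move=> x a d1 d2 d D1 D2 Dd; have [psi Sx] := structure_neq0 hS (bpt L x).
  have fr := Sfr Sx.
  have [w1 l1] := @frame_coefficient (bpt L x) psi d1 fr D1.
  have [w2 l2] := @frame_coefficient (bpt L x) psi d2 fr D2.
  have [w l] := @frame_coefficient (bpt L x) psi d fr Dd.
  rewrite (val x _ d psi (a *: w1 + w2) w) //.
  + by rewrite (val x d1 d psi w1 w) // (val x d2 d psi w2 w) // J_form_lin.
  + exact: (@DL_fibre_lin (bpt L x)).
  + exact: (@lift_frame_lin (bpt L x)).
- move=> x d d' Dd Dd'; have [psi Sx] := structure_neq0 hS (bpt L x).
  have [w l] := @frame_coefficient (bpt L x) psi d (Sfr Sx) Dd.
  have [w' l'] := @frame_coefficient (bpt L x) psi d' (Sfr Sx) Dd'.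
  by rewrite (val x d d' psi w w') // (val x d' d psi w' w) // J_form_antisym.
- move=> D X D' X' dD dD'; apply: (smooth_on_local hA) => [|x _]; first exact: openT.
  (* Smoothness cannot be seen from the pointwise choices. Near [x] an invariant section provides
     frames with smooth matrix [P], in which the value is J evaluated on smooth coefficients. *)
  have [c [t [U [P [[Ac Tt oU] Ux UU SP HP]]]]] := invariant_section hS (bpt L x).
  have [cx tx] := UU _ Ux.
  have [V [z [oV Vx Sz Hz]]] := derivation_coefficients dD Ac Tt cx tx.
  have [V' [z' [oV' V'x Sz' Hz']]] := derivation_coefficients dD' Ac Tt cx tx.
  pose W := U `&` (V `&` V').
  have oW : open W by apply: openI => //; exact: openI.
  exists W; split=> //.
  have SI : smooth_mx Am W (fun x => invmx (P x)).
    apply: (smooth_mx_inv hA) => //; last by apply: smooth_mx_sub SP => y [].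
    by move=> y [Uy _]; have [] := HP (bpt L y) Uy.
  have Sw : smooth_mx Am W (fun x => invmx (P x) *m z x).
    by apply: (smooth_mx_mul hA) => //; apply: smooth_mx_sub Sz => y [_ []].
  have Sw' : smooth_mx Am W (fun x => invmx (P x) *m z' x).
    by apply: (smooth_mx_mul hA) => //; apply: smooth_mx_sub Sz' => y [_ []].
  have SJ : smooth_on Am W (fun y => J_form (invmx (P y) *m z y) (invmx (P y) *m z' y)).
    rewrite /J_form; apply: (smooth_mx_mul hA oW _ Sw'); apply: (smooth_mx_mul hA) => //.
      exact: (smooth_mx_tr hA).
    exact: (smooth_mx_cst hA).
  apply: (smooth_on_ext hA oW _ SJ) => y [Uy [Vy V'y]].
  have [uP Sy] := HP (bpt L y) Uy.
  rewrite (val y _ _ _ (invmx (P y) *m z y) (invmx (P y) *m z' y) Sy) //.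
  + by exists D, X.
  + by exists D', X'.
  + by rewrite /frame_comp mulKVmx //; exact: (Hz (bpt L y) Vy).
  + by rewrite /frame_comp mulKVmx //; exact: (Hz' (bpt L y) V'y).
- by move=> x d d' nd; rewrite /form_of asboolF.
Qed.

Lemma form_of_nondegenerate : DL_nondegenerate form_of.
Proof.
move=> x d Dd H; have [psi Sx] := structure_neq0 hS (bpt L x); have fr := Sfr Sx.
have [w l] := @frame_coefficient (bpt L x) psi d fr Dd.
have w0 : w = 0.
  apply: (J_form_nondegenerate n_odd) => w'; have [_ tan _ _] := fr.
  have [d' Dd' l'] := @tangent_DL_fibre _ _ _ _ (bpt L x) _ (tan w').
  by rewrite -(@form_of_value (bpt L x) psi Sx d d' w w' Dd Dd' l l') H.
have p0 f : psi 0 f = 0.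
  by have [lin _ _ _] := fr; have := lin 1 0 0 f; rewrite scaler0 addr0 mul1r => E; lra.
have l0 : @lift_at _ _ _ _ (bpt L x) (fun=> 0) (psi w).
  by split; [exact: l.1|move=> lam _; rewrite w0 p0 cov0].
apply/funext => lam; case: (pselect (smooth_section lam)) => Sl.
  exact: (lift_at_inj l l0).
exact: (@DL_fibre_nonsmooth _ _ _ _ x).
Qed.

Lemma form_of_unique omega : DL_form omega -> corresponds S omega -> omega = form_of.
Proof.
move=> [_ _ _ out] cS; have sv := corresponds_structure_value hS cS.
apply: boolp.functional_extensionality_dep => x; apply/funext => d; apply/funext => d'.
case: (pselect (DL_fibre d /\ DL_fibre d')) => [[Dd Dd']|nd]; last first.
  by rewrite out // /form_of asboolF.
have [psi Sx] := structure_neq0 hS (bpt L x).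
have [w l] := @frame_coefficient (bpt L x) psi d (Sfr Sx) Dd.
have [w' l'] := @frame_coefficient (bpt L x) psi d' (Sfr Sx) Dd'.
rewrite (@form_of_value (bpt L x) psi Sx d d' w w' Dd Dd' l l').
exact: (sv (bpt L x) psi Sx d d' w w').
Qed.

End FormOfStructure.
End FormsAndStructures.

Lemma form_delta (R : realType) m (K : 'M[R]_m) i j :
  ((e_ i : 'cV[R]_m)^T *m K *m (e_ j : 'cV[R]_m)) 0 0 = K i j.
Proof.
rewrite -mulmxA -colE mulmx_entry (bigD1 i) //= big1 => [|l li].
  by rewrite !mxE !eqxx mul1r addr0.
by rewrite !mxE (negbTE li) mul0r.
Qed.

(** * The structure of a form *)

Section StructureOfForm.
Variables (R : realType) (n : nat) (n_odd : odd n) (M : manifold R n) (L : line_bundle M).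
Local Notation Mt := (slit_dual L).
Local Notation At := (slit_dual_atlas L).
Local Notation Am := (atlas M).
Local Notation pr := (@proj R n M L).
Local Notation k := ((n.+1)./2).
Local Notation G := (Sp R k n.+1).
Local Notation Jm := (symplectic_J R k n.+1).
Local Notation frame := (preframe R n.+1 Mt).
Local Notation J_form := (@J_form R n).
Implicit Types (t : local_triv (fib L)) (c : chart R n M) (e : Mt) (x : M) (lam mu : presection L).
Implicit Types (D : presection L -> presection L) (X : M -> (M -> R) -> R) (Z : Mt -> (Mt -> R) -> R).
Implicit Types (S : Mt -> set frame) (psi : frame).

Let hA : is_atlas Am := atlasP M.
Let hX : hausdorff_space M := @manifold_hausdorff _ _ M.
Let hAt : is_atlas At := slit_dual_is_atlas L.
Let hXt : hausdorff_space Mt := @slit_dual_hausdorff R n M L.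
Let hm : n.+1 = (k + k)%N := half_dim n_odd.

Variable omega : DL_preform L.
Hypotheses (form : DL_form omega) (nondeg : DL_nondegenerate omega).

Definition gram_matrix e psi (N : 'M[R]_n.+1) : Prop :=
  forall (d d' : presection L -> fib L (proj e)) w w', DL_fibre d -> DL_fibre d' ->
  lift_at d (psi w) -> lift_at d' (psi w') -> omega d d' = (w^T *m N *m w') 0 0.

(** Each tangent vector at [e] comes from exactly one element of the fibre of DL, so the form
    becomes bilinear on R^(n+1); a kernel vector of its matrix would violate non-degeneracy. *)
Lemma form_gram_matrix e psi : is_frame At e psi -> exists N : 'M[R]_n.+1,
  [/\ gram_matrix e psi N, forall i j, N i j = - N j i & N \in unitmx].
Proof.
move=> fr; have [lin tan inj sur] := fr; have [omlin omanti _ _] := form.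
have [dl Hdl] : exists dl : 'cV[R]_n.+1 -> (presection L -> fib L (proj e)),
    forall w, DL_fibre (dl w) /\ lift_at (dl w) (psi w).
  have H w : exists d : presection L -> fib L (proj e), DL_fibre d /\ lift_at d (psi w).
    by have [d Dd ld] := tangent_DL_fibre (tan w); exists d.
  by have [dl Hdl] := boolp.choice H; exists dl.
have dlE d w : DL_fibre d -> lift_at d (psi w) -> d = dl w.
  by move=> Dd lw; have [Dd' lw'] := Hdl w; exact: DL_fibre_eq lw lw'.
have dlin a u v : dl (a *: u + v) = (fun lam => a *: dl u lam + dl v lam).
  apply: esym; have [Du lu] := Hdl u; have [Dv lv] := Hdl v.
  by apply: dlE; [exact: DL_fibre_lin|exact: lift_frame_lin].
pose f u v := omega (dl u) (dl v).
have flin a u v w : f (a *: u + v) w = a * f u w + f v w.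
  by rewrite /f dlin; apply: omlin; exact: (Hdl _).1.
have fanti u v : f u v = - f v u by apply: omanti; exact: (Hdl _).1.
pose N : 'M[R]_n.+1 := \matrix_(i, j) f (e_ i) (e_ j).
have fN w w' : f w w' = (w^T *m N *m w') 0 0 by exact: bilinear_matrix.
exists N; split.
- move=> d d' w w' Dd Dd' lw lw'.
  by rewrite -fN /f -(dlE d w) // -(dlE d' w').
- by move=> i j; rewrite [LHS]mxE [in RHS]mxE fanti.
apply: mx_inj_unit => v Nv.
have dv : dl v = (fun=> 0).
  apply: nondeg; first exact: (Hdl _).1.
  move=> d' Dd'; have [w' lw'] := frame_coefficient fr Dd'.
  have -> : omega (dl v) d' = f v w' by rewrite (dlE d' w').
  by rewrite fanti fN -mulmxA Nv mulmx0 mxE oppr0.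
have p0 f0 : psi 0 f0 = 0.
  by have := lin 1 0 0 f0; rewrite scaler0 addr0 mul1r => E; lra.
apply: inj; apply: tangent_determined => [||lam Sl]; [exact: tan|exact: tan|].
by rewrite p0; have [_ [_ ->]] := Hdl v; rewrite // dv cov0.
Qed.

Lemma gram_matrix_comp e psi N P : gram_matrix e psi N ->
  gram_matrix e (frame_comp psi P) (P^T *m N *m P).
Proof.
move=> H d d' w w' Dd Dd' lw lw'; rewrite (H d d' (P *m w) (P *m w')) //.
by rewrite trmx_mul !mulmxA.
Qed.

Lemma gram_matrix_unique e psi N N' : is_frame At e psi -> gram_matrix e psi N ->
  gram_matrix e psi N' -> N = N'.
Proof.
move=> [_ tan _ _] H H'; apply/matrixP => i j.
have [d Dd ld] := tangent_DL_fibre (tan (e_ i)); have [d' Dd' ld'] := tangent_DL_fibre (tan (e_ j)).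
have E K := form_delta K i j.
by rewrite -E -(H d d') // (H' d d' (e_ i) (e_ j)) // E.
Qed.

(** Push-forward carries the lift of an element of DL at [e] to its lift at the scaled point, so the
    coefficients are unchanged. This is invariance of the lifted form. *)
Lemma gram_matrix_push e psi N r (r0 : r != 0) : is_frame At e psi -> gram_matrix e psi N ->
  gram_matrix (scale r0 e) (push r0 psi) N.
Proof.
move=> fr H d d' w w' Dd Dd' lw lw'.
have [_ _ inj _] := is_frame_push r0 fr.
have L0 (d0 : presection L -> fib L (proj e)) w0 : DL_fibre d0 ->
    @lift_at _ _ _ _ (scale r0 e) d0 (push r0 psi w0) -> lift_at d0 (psi w0).
  move=> Dd0 lw0; have [w1 lw1] := frame_coefficient fr Dd0.
  suff -> : w0 = w1 by [].
  apply: inj; exact: (lift_at_unique lw0 (lift_at_scale r0 lw1)).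
exact: (H d d' w w' Dd Dd' (L0 d w Dd lw) (L0 d' w' Dd' lw')).
Qed.

Definition structure_of e : set frame := [set psi | is_frame At e psi /\ gram_matrix e psi Jm].

(** The Gram matrix in the invariant frame is read off from derivations whose lifts form that frame.
    Hence it is smooth and a function of the base point alone. *)
Lemma local_gram_matrix c t x : Am c -> trivs L t -> dom c x -> tdom t x -> exists V
  (Ds : 'I_n.+1 -> presection L -> presection L) (Xs : 'I_n.+1 -> M -> (M -> R) -> R)
  (Zs : 'I_n.+1 -> Mt -> (Mt -> R) -> R),
  let Om x : 'M[R]_n.+1 := \matrix_(i, j) pairing omega (Ds i) (Ds j) x in
  [/\ [/\ open V, V x & V `<=` dom c `&` tdom t],
      forall i, [/\ derivation (Ds i) (Xs i), lifts (Ds i) (Zs i) &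
        forall e, V (proj e) -> Zs i e = lin_frame c t e (e_ i)],
      smooth_mx Am V Om &
      forall e, V (proj e) -> [/\ gram_matrix e (lin_frame c t e) (Om (proj e)),
        forall i j, Om (proj e) i j = - Om (proj e) j i & Om (proj e) \in unitmx]].
Proof.
move=> Ac Tt cx tx; have [V [oV Vx VU H]] := lin_derivations Ac Tt cx tx.
have [D HD] := boolp.choice (fun i : 'I_n.+1 => H (e_ i)).
have [X HX] := boolp.choice HD; have [Z HZ] := boolp.choice HX.
have {}HZ i : [/\ derivation (D i) (X i), lifts (D i) (Z i) &
        forall e, V (proj e) -> Z i e = lin_frame c t e (e_ i)] by have [? ? _ ?] := HZ i.
exists V, D, X, Z; split=> //.
  move=> i j; have [dDi _ _] := HZ i; have [dDj _ _] := HZ j; have [_ _ Sm _] := form.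
  apply: (@smooth_on_ext _ _ _ _ hA _ (pairing omega (D i) (D j))) => //.
    by move=> y _; rewrite [RHS]mxE.
  exact: smooth_on_sub (Sm _ _ _ _ dDi dDj).
move=> e Ve; have fr := is_frame_lin_frame Ac Tt (VU _ Ve : slit_dual_dom c t e).
have [N [HN aN uN]] := form_gram_matrix fr.
suff -> : \matrix_(i, j) pairing omega (D i) (D j) (proj e) = N by [].
apply/matrixP => i j; rewrite [LHS]mxE.
have [dDi lDi ZDi] := HZ i; have [dDj lDj ZDj] := HZ j.
rewrite /pairing (HN (at_point (D i) (proj e)) (at_point (D j) (proj e)) (e_ i) (e_ j)).
- exact: form_delta.
- by exists (D i), (X i).
- by exists (D j), (X j).
- by rewrite -ZDi //; exact: lifts_at dDi lDi.
- by rewrite -ZDj //; exact: lifts_at dDj lDj.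
Qed.

Lemma structure_of_section e : exists (U : set M) (sigma : Mt -> frame),
  [/\ U (proj e), homogeneous_frame U sigma (fun=> 1%:M) &
      forall e', U (proj e') -> structure_of e' (sigma e')].
Proof.
have [c [t [Ac Tt [ce te]]]] := slit_cover e.
have [V [D [X [Z /=]]]] := local_gram_matrix Ac Tt ce te.
set Om := (fun x => \matrix_(i, j) _) => -[[oV Ve VU] _ SOm HOm].
have aOm x : V x -> forall i j, Om x i j = - Om x j i.
  by move=> Vx; have [_ H _] := HOm (bpt L x) Vx.
have [_ _ uOm] := HOm e Ve.
have [U [P [oU Ue UV SP HP]]] := smooth_gram_schmidt hA hm oV Ve SOm aOm uOm.
exists U, (fun e => frame_comp (lin_frame c t e) (P (proj e))); split; [exact: Ue| |].
  apply: homogeneous_frame_lin => //; first by move=> x /UV /VU.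
  by move=> x /HP[].
move=> e' Ue'; have [uP PE] := HP _ Ue'; have de' : slit_dual_dom c t e' := VU _ (UV _ Ue').
split; first exact: is_frame_comp (is_frame_lin_frame Ac Tt de') uP.
by rewrite -PE; apply: gram_matrix_comp; have [] := HOm e' (UV _ Ue').
Qed.

Lemma structure_of_orbit e psi psi' : structure_of e psi ->
  (structure_of e psi' <-> exists2 B, G B & psi' = frame_comp psi B).
Proof.
move=> [fr gm]; split=> [[fr' gm']|[B GB ->]]; last first.
  split; first by apply: is_frame_comp => //; case: GB.
  by have := gram_matrix_comp (P := B) gm; have [_ ->] := GB.
have [B uB E] := frame_change hAt hXt fr fr'; exists B => //; split=> //.
by apply: (gram_matrix_unique fr') gm'; rewrite E; exact: gram_matrix_comp.
Qed.

Lemma structure_of_push e psi r (r0 : r != 0) : structure_of e psi ->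
  structure_of (scale r0 e) (push r0 psi).
Proof. by move=> [fr gm]; split; [exact: is_frame_push|exact: gram_matrix_push]. Qed.

Lemma structure_of_homogeneous : homogeneous_G_structure G (trivial_degree G) structure_of.
Proof.
split.
- split=> [e psi []//|e psi Se psi'|e]; first exact: structure_of_orbit.
  have [U [sigma [Ue [oU lf _ _] Ss]]] := structure_of_section e.
  by exists (pr @^-1` U), sigma.
- move=> e; have [U [sigma [Ue hs Ss]]] := structure_of_section e.
  exists U, sigma, (fun=> 1%:M); split=> //; split=> //.
  move=> r r0 e' psi Ue' Se'; rewrite invmx1 frame_comp1; exact: structure_of_push.
(* The degree is computed from an arbitrary adapted section: [sigma] at the scaled point and the
   push-forward of [sigma] are both symplectic frames there, so the matrix relating them, the
   inverse of [a r], lies in G. *)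
- move=> U sigma a [x Ux] [[[oU lf ua sE] Ss] _] r r0.
  have Ue : U (proj (bpt L x)) by [].
  have S1 := structure_of_push r0 (Ss _ Ue).
  have S2 : structure_of (scale r0 (bpt L x)) (sigma (scale r0 (bpt L x))) by exact: Ss.
  have [B GB E] := (structure_of_orbit _ S1).1 S2.
  have Ga : G (invmx (a r)).
    suff -> : invmx (a r) = B by [].
    by apply: (frame_comp_inj S1.1); rewrite -E sE.
  have {}Ga : G (a r) by rewrite -[a r]invmxK; exact: SpV.
  apply/seteqP; split=> [_ [B' GB' <-]|B' GB']; first exact: SpM.
  exists (invmx (a r) *m B'); first by apply: SpM => //; exact: SpV.
  by rewrite mulmxA mulmxV ?mul1mx //; case: Ga.
Qed.

Lemma structure_of_value : structure_value structure_of omega.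
Proof. by move=> e psi [_ gm] d d' w w'; exact: gm. Qed.

(** The frames of [S] have Gram matrix J and so belong to [structure_of]; over each point both sets
    are single G-orbits, so the inclusion is an equality. *)
Lemma structure_of_unique S : homogeneous_G_structure G (trivial_degree G) S ->
  corresponds S omega -> structure_of = S.
Proof.
move=> hS cS; have sv := corresponds_structure_value n_odd hS cS.
have sub e psi : S e psi -> structure_of e psi.
  move=> Se; have [[Sfr _ _] _ _] := hS; split; first exact: Sfr.
  by move=> d d' w w'; exact: sv.
apply/funext => e; apply/seteqP; split=> [psi Spsi|psi]; last exact: sub.
have [psi0 S0] := structure_neq0 hS e.
have [B GB E] := (structure_of_orbit psi (sub _ _ S0)).1 Spsi.
by apply/(structure_orbit hS psi S0); exists B.
Qed.

End StructureOfForm.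

(** * Integrability *)

Section IntegrableCocycle.
Variables (R : realType) (n : nat) (n_odd : odd n) (M : manifold R n) (L : line_bundle M).
Local Notation Mt := (slit_dual L).
Local Notation At := (slit_dual_atlas L).
Local Notation Am := (atlas M).
Local Notation pr := (@proj R n M L).
Local Notation k := ((n.+1)./2).
Local Notation G := (Sp R k n.+1).
Local Notation Jm := (symplectic_J R k n.+1).
Local Notation frame := (preframe R n.+1 Mt).
Local Notation J_form := (@J_form R n).
Implicit Types (t : local_triv (fib L)) (c : chart R n M) (e : Mt) (x : M) (lam mu : presection L).
Implicit Types (D : presection L -> presection L) (X : M -> (M -> R) -> R) (Z : Mt -> (Mt -> R) -> R).
Implicit Types (S : Mt -> set frame) (psi : frame).

Let hA : is_atlas Am := atlasP M.
Let hX : hausdorff_space M := @manifold_hausdorff _ _ M.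
Let hAt : is_atlas At := slit_dual_is_atlas L.
Let hXt : hausdorff_space Mt := @slit_dual_hausdorff R n M L.
Let hm : n.+1 = (k + k)%N := half_dim n_odd.

Lemma J_formE w w' : J_form w w' = \sum_a w a 0 * (psign R k a * w' (partner hm a) 0).
Proof.
rewrite /J_form -mulmxA mulmx_entry; apply: eq_bigr => a _.
by rewrite mxE (mul_J hm).
Qed.

Lemma tangent_J_form e v (u u' : 'I_n.+1 -> Mt -> R) : tangent At e v ->
  (forall i, smooth At (u i)) -> (forall i, smooth At (u' i)) ->
  v (fun e' => J_form (\col_i u i e') (\col_i u' i e')) =
  J_form (\col_i v (u i)) (\col_i u' i e) + J_form (\col_i u i e) (\col_i v (u' i)).
Proof.
move=> tv Su Su'; rewrite !J_formE -big_split /=.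
pose F a e' := u a e' * (psign R k a * u' (partner hm a) e').
have Sp a : smooth At (fun e' => psign R k a * u' (partner hm a) e').
  by apply: (smooth_on_mul hAt openT); [exact: (smooth_on_cst hAt _ openT)|exact: Su'].
have SF a : smooth At (F a) by apply: (smooth_on_mul hAt openT); [exact: Su|exact: Sp].
transitivity (v (fun e' => \sum_a F a e')).
  by congr v; apply/funext => e'; rewrite J_formE; apply: eq_bigr => a _; rewrite !mxE.
rewrite (tangent_sum hAt tv) //; apply: eq_bigr => a _.
rewrite /F (tangent_mul tv) // (tangent_scale hAt tv) // !mxE addrC; congr (_ + _).
exact: mulrC.
Qed.

(** The differential is tested on the slit dual, where lifted derivations have coefficient vectors
    in the chart and the pairing is the constant form J of these. The terms from differentiating the
    coefficients cancel against those of the brackets. No homogeneity of the chart is used. *)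
Lemma integrable_cocycle S (omega : DL_preform L) :
  homogeneous_G_structure G (trivial_degree G) S -> DL_form omega -> corresponds S omega ->
  G_integrable At S -> cocycle omega.
Proof.
move=> hS form cS int; have sv := corresponds_structure_value n_odd hS cS.
have [_ _ Sform _] := form.
move=> D1 X1 D2 X2 D3 X3 d1 d2 d3 x; pose e := bpt L x.
have [c [hc ce Sc]] := int e.
have [y [V [Sy oV Ve yc]]] := chart_coordinates_extend hAt hXt hc ce.
have [Z1 l1] := lifts_exist d1; have [Z2 l2] := lifts_exist d2; have [Z3 l3] := lifts_exist d3.
(* The i-th coefficient of the field in the chart, as a global smooth function; the coefficients of
   a bracket are then Z (a Z') - Z' (a Z). *)
pose a Z i e' := Z e' (y i).
have Sa Z i : vector_field At Z -> smooth At (a Z i) by move=> [_ SZ]; exact: SZ.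
have vE e' v : V e' -> tangent At e' v -> v = coord_frame At c e' (\col_i v (y i)).
  move=> Ve' tv; have [ce' _] := yc ord0 _ Ve'.
  exact: (tangent_coord_frameE hAt hXt hc Sy oV Ve' yc tv ce').
have val e' (dl dl' : presection L -> fib L (proj e')) v v' : V e' -> DL_fibre dl -> DL_fibre dl' ->
    lift_at dl v -> lift_at dl' v' ->
    omega (proj e') dl dl' = J_form (\col_i v (y i)) (\col_i v' (y i)).
  move=> Ve' Dl Dl' lv lv'; have [ce' _] := yc ord0 _ Ve'.
  apply: (sv e' _ (Sc _ ce')) => //; first by rewrite -vE //; exact: lv.1.
  by rewrite -vE //; exact: lv'.1.
have pairE D X Z D' X' Z' e' : derivation D X -> lifts D Z -> derivation D' X' -> lifts D' Z' ->
    V e' -> pairing omega D D' (proj e') = J_form (\col_i a Z i e') (\col_i a Z' i e').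
  move=> dD lD dD' lD' Ve'; apply: val => //.
  - by exists D, X.
  - by exists D', X'.
  - exact: lifts_at dD lD.
  - exact: lifts_at dD' lD'.
have derE D X Z D' X' Z' D'' X'' Z'' : derivation D X -> lifts D Z -> derivation D' X' ->
    lifts D' Z' -> derivation D'' X'' -> lifts D'' Z'' ->
    X x (pairing omega D' D'') =
    J_form (\col_i Z e (a Z' i)) (\col_i a Z'' i e) + J_form (\col_i a Z' i e) (\col_i Z e (a Z'' i)).
  move=> dD lD dD' lD' dD'' lD''.
  have tZ := lD.1.1 e; have S' i := Sa Z' i lD'.1; have S'' i := Sa Z'' i lD''.1.
  (* The symbol acting on a function of M is the lift acting on its pullback. That pullback equals J
     of the coefficients only near [e], so locality of tangent vectors is needed. *)
  rewrite -(lifts_symbol e _ dD lD) -(tangent_J_form tZ S' S'').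
  apply: (tangent_local hAt hXt tZ) oV Ve _.
  - by apply/smooth_proj; exact: Sform dD' dD''.
  - pose F b e' := a Z' b e' * (psign R k b * a Z'' (partner hm b) e').
    have SF b : smooth At (F b).
      apply: (smooth_on_mul hAt openT); first exact: S'.
      by apply: (smooth_on_mul hAt openT); [exact: (smooth_on_cst hAt _ openT)|exact: S''].
    have : smooth At (fun e' => \sum_b F b e').
      by apply: (@smooth_on_sum _ _ _ _ hAt setT _ (index_enum _) xpredT F openT) => b _; exact: SF.
    congr (smooth_on _ _ _); apply/funext => e'; rewrite J_formE.
    by apply: eq_bigr => b _; rewrite !mxE.
  - by move=> e' Ve'; exact: (pairE _ _ _ _ _ _ _ dD' lD' dD'' lD'' Ve').
have brE D X Z D' X' Z' D'' X'' Z'' : derivation D X -> lifts D Z -> derivation D' X' ->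
    lifts D' Z' -> derivation D'' X'' -> lifts D'' Z'' ->
    pairing omega (bracket D D') D'' x =
    J_form (\col_i (Z e (a Z' i) - Z' e (a Z i))) (\col_i a Z'' i e).
  move=> dD lD dD' lD' dD'' lD''.
  apply: (val e _ _ (field_bracket Z Z' e) (Z'' e) Ve).
  - exact: (@DL_fibre_bracket _ _ _ _ _ _ _ _ e dD dD').
  - by exists D'', X''.
  - exact: (@lift_bracket _ _ _ _ _ _ _ _ _ _ e dD dD').
  - exact: (lifts_at e dD'' lD'').
have JB u v w : J_form (u - v) w = J_form u w - J_form v w.
  by rewrite addrC -scaleN1r J_form_lin mulN1r addrC.
have colB (u v : 'I_n.+1 -> R) : \col_i (u i - v i) = \col_i u i - \col_i v i :> 'cV[R]_n.+1.
  by apply/colP => i; rewrite !mxE.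
rewrite /DL_differential (derE _ _ _ _ _ _ _ _ _ d1 l1 d2 l2 d3 l3).
rewrite (derE _ _ _ _ _ _ _ _ _ d2 l2 d1 l1 d3 l3) (derE _ _ _ _ _ _ _ _ _ d3 l3 d1 l1 d2 l2).
rewrite (brE _ _ _ _ _ _ _ _ _ d1 l1 d2 l2 d3 l3) (brE _ _ _ _ _ _ _ _ _ d1 l1 d3 l3 d2 l2).
rewrite (brE _ _ _ _ _ _ _ _ _ d2 l2 d3 l3 d1 l1) !colB !JB.
set A1 := \col_i a Z1 i e; set A2 := \col_i a Z2 i e; set A3 := \col_i a Z3 i e.
rewrite (J_form_antisym n_odd A2) (J_form_antisym n_odd A1 (\col_i Z2 e _)).
rewrite (J_form_antisym n_odd A1 (\col_i Z3 e _)).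
ring.
Qed.

End IntegrableCocycle.

(** * Logarithmic fibre coordinate *)

Section LogarithmicCoordinates.
Variables (R : realType) (m : nat) (s0 : R) (x0 : 'cV[R]_m).
Hypothesis s00 : s0 != 0.

(** Dividing by [s0] selects the values of s with the sign of [s0], so that the logarithm is
    defined, and places the base point (s0, x0) at the origin. *)
Definition log_chart (y : 'cV[R]_m.+1) : 'cV[R]_m.+1 := vcons (ln (y ord0 0 / s0)) (vtail y - x0).
Definition exp_chart (u : 'cV[R]_m.+1) : 'cV[R]_m.+1 :=
  vcons (s0 * expR (u ord0 0)) (x0 + vtail u).
Definition log_dom : set 'cV[R]_m.+1 := [set y | 0 < y ord0 0 / s0].

Lemma log_chartK y : log_dom y -> exp_chart (log_chart y) = y.
Proof.
move=> y0; rewrite /exp_chart /log_chart vcons0 vtail_cons lnK // mulrCA mulfV // mulr1.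
by rewrite addrC subrK vcons_tail.
Qed.

Lemma exp_chartK u : log_chart (exp_chart u) = u.
Proof.
rewrite /exp_chart /log_chart vcons0 vtail_cons mulrAC mulfV // mul1r expRK.
by rewrite addrC addKr vcons_tail.
Qed.

Lemma exp_chart_dom u : log_dom (exp_chart u).
Proof. by rewrite /log_dom /= /exp_chart vcons0 mulrAC mulfV // mul1r expR_gt0. Qed.

Lemma log_dom_open : open log_dom.
Proof.
apply: (@open_comp _ _ (fun y : 'cV[R]_m.+1 => y ord0 0 / s0) [set s | 0 < s]).
  move=> y _.
  have C : Cinf setT (fun y : 'cV[R]_m.+1 => y ord0 0 / s0).
    by apply: Cinf_mul => //; [exact: Cinf_coord|exact: Cinf_cst].
  exact: (Cinf_continuous C).
exact: open_gt.
Qed.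

Lemma Cinf_log_chart i : Cinf log_dom (fun y => log_chart y i 0).
Proof.
have od := log_dom_open.
case: (unliftP ord0 i) => [j|] ->.
  apply: (@Cinf_ext _ _ _ (fun y => y (lift ord0 j) 0 + - x0 j 0)) => //.
    by move=> y _; rewrite /log_chart vconsS !mxE.
  by apply: Cinf_add => //; [exact: Cinf_coord|exact: Cinf_cst].
apply: (@Cinf_ext _ _ _ (fun y => ln (y ord0 0 / s0))) => //.
  by move=> y _; rewrite /log_chart vcons0.
apply: Cinf_ln => //; apply: Cinf_mul => //; [exact: Cinf_coord|exact: Cinf_cst].
Qed.

Lemma smooth_exp_chart : smooth_map exp_chart.
Proof.
move=> i; case: (unliftP ord0 i) => [j|] ->.
  apply: (@Cinf_ext _ _ _ (fun u => x0 j 0 + u (lift ord0 j) 0)) => //.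
    by move=> y _; rewrite /exp_chart vconsS !mxE.
  by apply: Cinf_add => //; [exact: Cinf_cst|exact: Cinf_coord].
apply: (@Cinf_ext _ _ _ (fun u => s0 * expR (u ord0 0))) => //.
  by move=> y _; rewrite /exp_chart vcons0.
by apply: Cinf_mul => //; [exact: Cinf_cst|apply: Cinf_expR => //; exact: Cinf_coord].
Qed.

(** The diagonal entry is s itself: the coordinate frame of (ln s, x) is the invariant frame (s
    d/ds, d/dx_1, .., d/dx_n). *)
Lemma jac_exp_chart u : jac exp_chart u = scmx m (s0 * expR (u ord0 0)).
Proof.
apply/matrixP => i j; rewrite [LHS]mxE [RHS]mxE /partial.
case: (unliftP ord0 i) => [l|] ->.
  transitivity ('D_(e_ j) (fun u : 'cV[R]_m.+1 => u (lift ord0 l) 0) u).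
    apply: derive_increment_ext => h; rewrite /exp_chart !vconsS !mxE; ring.
  have [_ ->] := is_derive_coord u (e_ j) (lift ord0 l).
  by rewrite mxE andbT mulr1.
have -> : (fun u => exp_chart u ord0 0) = (s0 \*: expR) \o (fun u : 'cV[R]_m.+1 => u ord0 0).
  by apply/funext => v; rewrite /exp_chart vcons0.
have D := is_derive_coord u (e_ j) ord0.
have [du E] := D.
have H : is_derive ((u ord0 0) : R) 1 (s0 \*: (expR : R -> R)) (s0 *: expR (u ord0 0)).
  exact: is_deriveZ.
have [_ E'] := is_derive_comp1 du H.
by apply: etrans E' _; rewrite E eqxx mxE andbT mulrC.
Qed.

End LogarithmicCoordinates.

(** * Maps commuting with translations *)

Section EquivariantMaps.
Variables (R : realType) (m : nat) (Phi Psi : 'cV[R]_m.+1 -> 'cV[R]_m.+1).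
Hypotheses (SPhi : smooth_map Phi) (SPsi : smooth_map Psi).
Hypotheses (PhiK : cancel Phi Psi) (PsiK : cancel Psi Phi).
Hypothesis equi : forall c z, Phi (z + c *: e_ ord0) = Phi z + c *: e_ ord0.

Lemma equivariant_inverse c z : Psi (z + c *: e_ ord0) = Psi z + c *: e_ ord0.
Proof. by apply: (can_inj PhiK); rewrite equi !PsiK. Qed.

Lemma jac_equivariant c z : jac Phi (z + c *: e_ ord0) = jac Phi z.
Proof.
apply/matrixP => i j; rewrite [LHS]mxE [RHS]mxE /partial.
apply: derive_increment_ext => h; rewrite addrA !equi.
by rewrite !addscale_entry; ring.
Qed.

Lemma jac_unit z : jac Phi z \in unitmx.
Proof.
have E := jac_comp (x := Phi z) openT I SPhi I SPsi.
rewrite PhiK in E; have F : Phi \o Psi = id by apply/funext => y /=; exact: PsiK.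
rewrite F jac_id in E.
by have [] := mulmx1_unit (esym E).
Qed.

End EquivariantMaps.

(** * The cocycle condition in a trivialisation *)

Section ClosedGramMatrix.
Variables (R : realType) (n : nat) (M : manifold R n) (L : line_bundle M).
Local Notation Mt := (slit_dual L).
Local Notation At := (slit_dual_atlas L).
Local Notation Am := (atlas M).
Local Notation pr := (@proj R n M L).
Implicit Types (t : local_triv (fib L)) (c : chart R n M) (e : Mt) (x : M) (lam mu : presection L).
Implicit Types (D : presection L -> presection L) (X : M -> (M -> R) -> R) (Z : Mt -> (Mt -> R) -> R).

Let hA : is_atlas Am := atlasP M.
Let hX : hausdorff_space M := @manifold_hausdorff _ _ M.
Let hAt : is_atlas At := slit_dual_is_atlas L.
Let hXt : hausdorff_space Mt := @slit_dual_hausdorff R n M L.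

(** The field s d/ds is vertical, so its symbol is 0; this is the convention of [pd] at index 0. *)
Lemma symbol_pd c t D X Z a e f : Am c -> trivs L t -> slit_dual_dom c t e ->
  derivation D X -> lifts D Z -> Z e = lin_frame c t e (e_ a) -> smooth Am f ->
  X (proj e) f = pd a (in_coords c f) (c (proj e)).
Proof.
move=> Ac Tt [ce te] dD lD ZE Sf; have hc := atlas_chart hA Ac.
have [lam [y [V [Sl Sy oV Ve HV]]]] := lin_coordinates Ac Tt ce te.
have [_ _ [tX _] _ _] := dD; have oW := proj_preimage_open L oV.
have yV i z : V z -> dom c z /\ y i z = c z i 0 by move=> /HV[].
rewrite (tangent_coordinates hA hX (tX _) hc ce Sy oV Ve yV Sf).
have Xy i : X (proj e) (y i) = (e_ a : 'cV[R]_n.+1) (lift ord0 i) 0.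
  have Sy' : smooth At (y i \o pr) by apply/smooth_proj.
  rewrite -(lifts_symbol e _ dD lD) ZE.
  by apply: (lin_frame_coord _ Ac Tt Sy' oW Ve) => e' /HV[ce' te' _ ye]; split=> //; exact: ye.
case: (unliftP ord0 a) => [j|] aE; rewrite aE.
  rewrite pdS (bigD1 j) //= big1 => [|i ij].
    by rewrite Xy aE mxE !eqxx mul1r addr0.
  by rewrite Xy aE mxE (inj_eq (@lift_inj _ ord0)) (negbTE ij) mul0r.
rewrite pd0 big1 // => i _; rewrite Xy aE mxE eq_sym.
by rewrite (negbTE (neq_lift _ _)) mul0r.
Qed.

(** The fields s d/ds and d/dx_j commute, as is checked on the fibre coordinate and on the base
    coordinates. The zero vector is written in the frame so that it can be fed to a Gram matrix. *)
Lemma lin_frame_bracket c t Z Z' a b e V : Am c -> trivs L t -> vector_field At Z ->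
  vector_field At Z' -> open V -> V (proj e) -> V `<=` dom c `&` tdom t ->
  (forall e', V (proj e') -> Z e' = lin_frame c t e' (e_ a)) ->
  (forall e', V (proj e') -> Z' e' = lin_frame c t e' (e_ b)) ->
  field_bracket Z Z' e = lin_frame c t e 0.
Proof.
move=> Ac Tt vZ vZ' oV Ve VU ZE ZE'; have [ce te] := VU _ Ve.
have de : slit_dual_dom c t e by [].
have [lam [y [V1 [Sl Sy oV1 V1e HV]]]] := lin_coordinates Ac Tt ce te.
have [lin tan _ _] := is_frame_lin_frame Ac Tt de.
have lin0 f : lin_frame c t e 0 f = 0.
  by have := lin 1 0 0 f; rewrite scaler0 addr0 mul1r => H; lra.
have oW : open (V `&` V1) by exact: openI.
have opW := proj_preimage_open L oW; have Sl' := smooth_fun_of_section Sl.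
have HV' x' : (V `&` V1) x' ->
    [/\ dom c x', tdom t x', lam x' = unit_vec t x' & forall j, y j x' = c x' j 0].
  by move=> [_ /HV].
have lE u e' : (V `&` V1) (proj e') ->
    lin_frame c t e' u (fun_of_section lam) = u ord0 0 * fun_of_section lam e'.
  move=> We'; rewrite (lin_frame_sfun u Ac Tt Sl' opW We') => [|e'' /HV'[ce'' te'' le _]].
    by have [_ _ le _] := HV' _ We'; rewrite /fun_of_section le mulrC.
  by split=> //; rewrite /fun_of_section le.
have yE u e' j : (V `&` V1) (proj e') -> lin_frame c t e' u (y j \o pr) = u (lift ord0 j) 0.
  move=> We'; have Sy' : smooth At (y j \o pr) by apply/smooth_proj.
  apply: (lin_frame_coord _ Ac Tt Sy' opW We') => e'' /HV'[ce'' te'' _ ye];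
      split=> //; exact: ye.
have Sc u : smooth At (fun=> u) by exact: (smooth_on_cst hAt u openT).
have We : (V `&` V1) (proj e) by [].
have br Z1 Z2 a1 b1 : vector_field At Z1 -> vector_field At Z2 ->
    (forall e', V (proj e') -> Z1 e' = lin_frame c t e' (e_ a1)) ->
    (forall e', V (proj e') -> Z2 e' = lin_frame c t e' (e_ b1)) ->
    (Z1 e (fun e' => Z2 e' (fun_of_section lam)) =
       (e_ b1 : 'cV[R]_n.+1) ord0 0 * ((e_ a1 : 'cV[R]_n.+1) ord0 0 * fun_of_section lam e)) /\
    forall j, Z1 e (fun e' => Z2 e' (y j \o pr)) = 0.
  move=> [tZ1 SZ1] [tZ2 SZ2] E1 E2; split=> [|j].
    have -> : Z1 e (fun e' => Z2 e' (fun_of_section lam)) =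
        Z1 e (fun e' => (e_ b1 : 'cV[R]_n.+1) ord0 0 * fun_of_section lam e').
      apply: (tangent_local hAt hXt (tZ1 e) _ _ opW We).
      - exact: SZ2.
      - exact: (smooth_on_mul hAt openT (Sc _) Sl').
      - by move=> e' We'; rewrite E2; [exact: lE|exact: We'.1].
    rewrite (tangent_scale hAt (tZ1 e)) //; congr (_ * _).
    by rewrite E1; [exact: lE|exact: Ve].
  have -> : Z1 e (fun e' => Z2 e' (y j \o pr)) = Z1 e (fun=> (e_ b1 : 'cV[R]_n.+1) (lift ord0 j) 0).
    apply: (tangent_local hAt hXt (tZ1 e) _ _ opW We).
    - by apply: SZ2; apply/smooth_proj.
    - exact: Sc.
    - by move=> e' We'; rewrite E2; [exact: yE|exact: We'.1].
  exact: (tangent_cst hAt (tZ1 e)).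
have [l1 y1] := br Z Z' a b vZ vZ' ZE ZE'; have [l2 y2] := br Z' Z b a vZ' vZ ZE' ZE.
apply: (tangent_lin_coordinates _ _ Ac Tt Sl Sy oW We HV').
- exact: tangent_bracket.
- exact: tan.
- by rewrite lin0 /field_bracket l1 l2 mulrCA subrr.
- by move=> j; rewrite lin0 /field_bracket y1 y2 subrr.
Qed.

Variable omega : DL_preform L.
Hypotheses (form : DL_form omega) (nondeg : DL_nondegenerate omega).

(** The bracket terms of the differential vanish, and the symbol terms are the cyclic sum of
    derivatives of the coefficients. *)
Lemma cocycle_closed c t V (Ds : 'I_n.+1 -> presection L -> presection L)
    (Xs : 'I_n.+1 -> M -> (M -> R) -> R) (Zs : 'I_n.+1 -> Mt -> (Mt -> R) -> R) a b d e :
  Am c -> trivs L t -> open V -> V `<=` dom c `&` tdom t ->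
  (forall i, [/\ derivation (Ds i) (Xs i), lifts (Ds i) (Zs i) &
     forall e, V (proj e) -> Zs i e = lin_frame c t e (e_ i)]) ->
  cocycle omega -> V (proj e) ->
  let p i j := in_coords c (pairing omega (Ds i) (Ds j)) in
  pd a (p b d) (c (proj e)) + pd b (p d a) (c (proj e)) + pd d (p a b) (c (proj e)) = 0.
Proof.
move=> Ac Tt oV VU HZ coc Ve /=; have de : slit_dual_dom c t e := VU _ Ve.
have [_ omanti omsmooth _] := form.
have Sp i j : smooth Am (pairing omega (Ds i) (Ds j)).
  by have [di _ _] := HZ i; have [dj _ _] := HZ j; exact: omsmooth di dj.
have XE i j l : Xs i (proj e) (pairing omega (Ds j) (Ds l)) =
    pd i (in_coords c (pairing omega (Ds j) (Ds l))) (c (proj e)).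
  have [di li Zi] := HZ i.
  exact: (symbol_pd Ac Tt de di li (Zi e Ve) (Sp j l)).
have anti i j : pairing omega (Ds j) (Ds i) = (fun x => -1 * pairing omega (Ds i) (Ds j) x).
  apply/funext => x; have [di _ _] := HZ i; have [dj _ _] := HZ j.
  by rewrite mulN1r; apply: omanti; [exists (Ds j), (Xs j)|exists (Ds i), (Xs i)].
have br i j l : pairing omega (bracket (Ds i) (Ds j)) (Ds l) (proj e) = 0.
  have [di li Zi] := HZ i; have [dj lj Zj] := HZ j; have [dl ll Zl] := HZ l.
  have fr := is_frame_lin_frame Ac Tt de.
  have [N [HN _ _]] := form_gram_matrix form nondeg fr.
  rewrite /pairing (HN (at_point (bracket (Ds i) (Ds j)) (proj e)) (at_point (Ds l) (proj e)) 0 (e_ l)).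
  - by rewrite trmx0 !mul0mx mxE.
  - exact: DL_fibre_bracket di dj.
  - by exists (Ds l), (Xs l).
  - have <- := lin_frame_bracket Ac Tt li.1 lj.1 oV Ve VU Zi Zj.
    exact: lift_bracket di dj li lj.
  - by rewrite -Zl //; exact: lifts_at dl ll.
have [da _ _] := HZ a; have [db lb _] := HZ b; have [dd _ _] := HZ d.
have := coc _ _ _ _ _ _ da db dd (proj e); rewrite /DL_differential !br !XE.
have -> : pd b (in_coords c (pairing omega (Ds a) (Ds d))) (c (proj e)) =
    - pd b (in_coords c (pairing omega (Ds d) (Ds a))) (c (proj e)).
  rewrite -!XE (anti d a); have [_ _ [tX _] _ _] := db.
  by rewrite (tangent_scale hA (tX _)) // mulN1r.
by move=> E; lra.
Qed.

End ClosedGramMatrix.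

Lemma smooth_map_mulmx (R : realType) m p (B : 'M[R]_(p, m)) : smooth_map (mulmx B : 'cV[R]_m -> 'cV[R]_p).
Proof.
move=> i; apply: (@Cinf_ext _ _ _ (fun z => \sum_j B i j * z j 0)) => //.
  by move=> z _; rewrite mulmx_entry.
by apply: Cinf_sum => // j _; apply: Cinf_mul => //; [exact: Cinf_cst|exact: Cinf_coord].
Qed.

Lemma jac_mulmx (R : realType) m p (B : 'M[R]_(p, m)) (x : 'cV[R]_m) : jac (mulmx B) x = B.
Proof.
apply/matrixP => i j; rewrite [LHS]mxE.
have L : is_derive x (e_ j) (fun z : 'cV[R]_m => (B *m z) i 0) (B i j).
  have -> : (fun z : 'cV[R]_m => (B *m z) i 0) = (fun z => \sum_l B i l * z l 0).
    by apply/funext => z; rewrite mulmx_entry.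
  have -> : B i j = \sum_l B i l * (e_ j : 'cV[R]_m) l 0.
    rewrite (bigD1 j) //= big1 => [|l lj]; first by rewrite mxE !eqxx mulr1 addr0.
    by rewrite mxE (negbTE lj) mulr0.
  apply: is_derive_sumf => l.
  have := is_derive_mulf (is_derive_cst (B i l) x (e_ j)) (is_derive_coord x (e_ j) l).
  by rewrite mul0r add0r.
by have [_ E] := L.
Qed.

(** * Homogeneous Darboux charts *)

Section CocycleIntegrable.
Variables (R : realType) (n : nat) (n_odd : odd n) (M : manifold R n) (L : line_bundle M).
Local Notation Mt := (slit_dual L).
Local Notation At := (slit_dual_atlas L).
Local Notation Am := (atlas M).
Local Notation pr := (@proj R n M L).
Local Notation Ct c t := (Chart (@slit_dual_dom R n M L c t) (@slit_dual_coord R n M L c t)).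
Local Notation k := ((n.+1)./2).
Local Notation G := (Sp R k n.+1).
Local Notation Jm := (symplectic_J R k n.+1).
Implicit Types (t : local_triv (fib L)) (c : chart R n M) (e : Mt) (x : M).

Let hA : is_atlas Am := atlasP M.
Let hX : hausdorff_space M := @manifold_hausdorff _ _ M.
Let hAt : is_atlas At := slit_dual_is_atlas L.
Let hXt : hausdorff_space Mt := @slit_dual_hausdorff R n M L.
Let hm : n.+1 = (k + k)%N := half_dim n_odd.

Variable omega : DL_preform L.
Hypotheses (form : DL_form omega) (nondeg : DL_nondegenerate omega) (coc : cocycle omega).

(** The Gram matrix depends on the base point alone, so [z] and [e] are tied only through the base
    coordinates; coordinate 0 of [Phi z] need not be the logarithmic fibre coordinate of [e]. *)
Lemma darboux_frame e0 : exists c t (V : set M) (Phi Psi : 'cV[R]_n.+1 -> 'cV[R]_n.+1)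
    (Q : 'M[R]_n.+1) (d : R),
  [/\ [/\ Am c, trivs L t, open V, V (proj e0) & V `<=` dom c `&` tdom t],
      [/\ smooth_map Phi, smooth_map Psi, cancel Phi Psi & cancel Psi Phi],
      [/\ Phi 0 = 0, Q \in unitmx &
          forall a z, Phi (z + a *: e_ ord0) = Phi z + a *: e_ ord0],
      0 < d &
      forall z e, `|z| < d -> slit_dual_dom c t e -> vtail (Phi z) = c (proj e) - c (proj e0) ->
        V (proj e) /\ gram_matrix omega e (frame_comp (lin_frame c t e) (jac Phi z *m Q)) Jm].
Proof.
have [c [t [Ac Tt [ce te]]]] := slit_cover e0.
have [V [Ds [Xs [Zs /=]]]] := local_gram_matrix form nondeg Ac Tt ce te.
set Om := (fun x => \matrix_(i, j) _) => -[[oV Ve VU] HZ SOm HOm].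
have hc := atlas_chart hA Ac; have ok := hc.1.
set x0 := c (proj e0).
have oI := chart_image_open ok oV.
have /cV_nbhsP[r r0 Hr] : nbhs x0 (c @` (dom c `&` V)).
  by apply: open_nbhs_nbhs; split=> //; exists (proj e0).
(* The cutoff needs the coefficients on a ball of radius 3d, which must fit into the image of
   [V]. *)
pose d := r / 4; have d0 : 0 < d by rewrite divr_gt0.
have dr : 3 * d < r by rewrite /d; lra.
have Hin y : `|y - x0| < 3 * d -> exists2 x, V x /\ dom c x & c x = y.
  by move=> yd; have [x [cx Vx] E] := Hr y (lt_trans yd dr); exists x.
pose p i j := in_coords c (pairing omega (Ds i) (Ds j)).
have pE i j x : dom c x -> p i j (c x) = Om x i j.
  by move=> cx; rewrite /p in_coordsE // /Om [RHS]mxE.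
have Cp i j : Cinf (c @` (dom c `&` V)) (p i j).
  have [di _ _] := HZ i; have [dj _ _] := HZ j; have [_ _ Sm _] := form.
  by apply: (smooth_on_chart hA hc oV); apply: smooth_on_sub (Sm _ _ _ _ di dj).
(* Antisymmetrising makes [W] antisymmetric by a formal identity at every point, in or out of the
   image of the chart, and changes nothing on the image of [V]. *)
pose F i j y := (p i j y + - p j i y) * 2^-1.
have CF i j : Cinf (c @` (dom c `&` V)) (F i j).
  apply: Cinf_mul => //; last exact: Cinf_cst.
  by apply: Cinf_add => //; apply: Cinf_opp.
pose W (z : 'cV[R]_n) : 'M[R]_n.+1 := \matrix_(i, j) (bump x0 d (x0 + z) * F i j (x0 + z)).
have CW a b : Cinf setT (fun z => W z a b).
  apply: (@Cinf_ext _ _ _ (fun z => bump x0 d (x0 + z) * F a b (x0 + z))) => //.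
    by move=> z _; rewrite [RHS]mxE.
  apply: (Cinf_comp (W := setT) (f := fun y => bump x0 d y * F a b y)) => //.
    move=> i; apply: (@Cinf_ext _ _ _ (fun z => x0 i 0 + z i 0)) => //.
      by move=> z _; rewrite mxE.
    by apply: Cinf_add => //; [exact: Cinf_cst|exact: Cinf_coord].
  apply: Cinf_cutoff d0 _ (CF a b) => y yd.
  by have [x [Vx cx] <-] := Hin y yd; exists x.
have antiW z a b : W z a b = - W z b a by rewrite !mxE /F; ring.
have WOm x : V x -> dom c x -> `|c x - x0| <= d -> W (c x - x0) = Om x.
  move=> Vx cx xd; apply/matrixP => i j; have [_ aO _] := HOm (bpt L x) Vx.
  have E : x0 + (c x - x0) = c x by rewrite addrC subrK.
  rewrite [LHS]mxE E bump_eq1 // mul1r /F !pE // (aO j i) opprK.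
  by field.
have W0 : W 0 = Om (proj e0).
  by rewrite -(WOm _ Ve ce) ?subrr // normr0 ltW.
have [_ _ uOm] := HOm e0 Ve.
have uW0 : W 0 \in unitmx by rewrite W0.
(* [W] agrees with the Gram matrix on the ball of radius d; halving the radius leaves a
   neighbourhood on which to compare derivatives. *)
have pdW a b b' z : `|z| <= d / 2 -> pd a (fun y => W y b b') z = pd a (p b b') (x0 + z).
  move=> zd; case: (unliftP ord0 a) => [l|] ->; last by rewrite !pd0.
  rewrite !pdS /partial.
  transitivity ('D_(e_ l) (fun z => p b b' (x0 + z)) z); last first.
    by apply: derive_increment_ext => h; rewrite addrCA.
  apply: near_eq_derive; apply/cV_nbhsP; exists (d / 2); first by rewrite divr_gt0.
  move=> y yz; have yd : `|y| <= d.
    rewrite -(subrK z y) (le_trans (ler_normD _ _)) //.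
    by rewrite [leRHS]splitr lerD // ltW.
  have [x [Vx cx] E] : exists2 x, V x /\ dom c x & c x = x0 + y.
    apply: Hin; rewrite addrC addKr; apply: le_lt_trans yd _; lra.
  have yE : y = c x - x0 by rewrite E addrC addKr.
  by rewrite {1}yE WOm // -?yE // -E pE.
have clW z : `|z| <= d / 2 -> closed_form_at W z.
  move=> zd a b b'; rewrite !pdW //.
  have [x [Vx cx] E] : exists2 x, V x /\ dom c x & c x = x0 + z.
    apply: Hin; rewrite addrC addKr; apply: le_lt_trans zd _; lra.
  rewrite -E.
  exact: (@cocycle_closed _ _ _ _ _ form nondeg c t V Ds Xs Zs a b b' (bpt L x) Ac Tt oV VU HZ coc Vx).
have d20 : 0 < d / 2 by rewrite divr_gt0.
have [Phi [Psi [[SPhi SPsi] [PhiK PsiK] Phi0 equi [d1 d10 Hd1]]]] :=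
  equivariant_darboux CW antiW uW0 d20 clW.
(* Darboux' theorem only makes the form constant, equal to [W 0]. A symplectic frame at [e0]
   supplies the matrix [Q] that takes [W 0] to J. *)
have [psi [frpsi gmpsi]] := structure_neq0 (structure_of_homogeneous n_odd form nondeg) e0.
have de0 : slit_dual_dom c t e0 by [].
have fr0 := is_frame_lin_frame Ac Tt de0.
have [Q uQ psiE] := frame_change hAt hXt fr0 frpsi.
have [gm0 _ _] := HOm e0 Ve.
have QE : Q^T *m W 0 *m Q = Jm.
  rewrite W0; apply: (gram_matrix_unique frpsi _ gmpsi).
  by rewrite psiE; exact: gram_matrix_comp.
have /cV_nbhsP[d2 d20' Hd2] : nbhs (0 : 'cV[R]_n.+1) (Phi @^-1` [set u | `|u - 0| < d]).
  apply: (smooth_map_continuous SPhi); apply: open_nbhs_nbhs; split; first exact: open_near.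
  by rewrite /= Phi0 subrr normr0.
exists c, t, V, Phi, Psi, Q, (Num.min d1 d2); split=> //; first by rewrite lt_min d10.
move=> z e; rewrite lt_min => /andP[zd1 zd2] [ce' te'] zE.
have Pd : `|Phi z| < d by have := Hd2 z; rewrite /= !subr0; apply.
have xd : `|c (proj e) - x0| < d.
  rewrite -zE; apply: le_lt_trans Pd; apply: cV_norm_le => // i.
  by rewrite mxE; exact: cV_norm_ge.
have Vx : V (proj e).
  have [|x [Vx cx] E] := Hin (c (proj e)); first by apply: lt_trans xd _; lra.
  suff <- : x = proj e by [].
  by case: ok => _ ci _ _; apply: ci => //; exact: mem_set.
split=> //; have [gm _ _] := HOm e Vx.
have := gram_matrix_comp (P := jac Phi z *m Q) gm.
suff -> : (jac Phi z *m Q)^T *m Om (proj e) *m (jac Phi z *m Q) = Jm by [].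
rewrite -QE -(Hd1 z zd1) zE (WOm _ Vx ce' (ltW xd)).
by rewrite trmx_mul !mulmxA.
Qed.

(** The Darboux map commutes with translations of ln s, so its Jacobian is constant along the
    fibres. The coordinate frame is then the invariant frame times a matrix depending on the base
    point alone. *)
Theorem cocycle_homogeneous_integrable : homogeneous_integrable (structure_of omega).
Proof.
move=> e0; have [c [t [V [Phi [Psi [Q [d [[Ac Tt oV Ve VU] [SPhi SPsi PhiK PsiK]
  [Phi0 uQ equi] d0 H]]]]]]]] := darboux_frame e0.
have hc := atlas_chart hA Ac; have hct := slit_is_chart Ac Tt.
have [ce te] := VU _ Ve; set x0 := c (proj e0) in H; set s0 := sfun t e0.
have s00 : s0 != 0 by exact: sfun_neq0.
(* Logarithmic coordinates centred at [e0], straightened by the inverse of the Darboux map, followed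
   by the linear normalisation. *)
pose th y := invmx Q *m Psi (log_chart s0 x0 y).
pose th' (z : 'cV[R]_n.+1) := exp_chart s0 x0 (Phi (Q *m z)).
have oL := @log_dom_open R n s0.
have Sexp := @smooth_exp_chart R n s0 x0.
have Cth i : Cinf (@log_dom R n s0) (fun y => th y i 0).
  apply: (Cinf_comp (W := setT) (f := fun u => (invmx Q *m Psi u) i 0)) => //.
    by move=> j; exact: Cinf_log_chart.
  exact: (smooth_map_comp (smooth_map_mulmx (invmx Q)) SPsi).
have Sth' : smooth_map th'.
  exact: (smooth_map_comp Sexp (smooth_map_comp SPhi (smooth_map_mulmx Q))).
have thK y : log_dom s0 y -> [set: 'cV[R]_n.+1] (th y) /\ th' (th y) = y.
  by move=> y0; split=> //; rewrite /th' /th mulKVmx // PsiK log_chartK.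
have th'K z : [set: 'cV[R]_n.+1] z -> log_dom s0 (th' z) /\ th (th' z) = z.
  move=> _; split; first exact: exp_chart_dom.
  by rewrite /th' /th exp_chartK // PhiK mulKmx.
pose c1 := chart_compose (Ct c t) (log_dom s0) th.
have hc1 : is_chart At c1 := is_chart_compose hAt hct oL openT Cth Sth' thK th'K.
(* The pullback identity holds only near the origin, so the chart is restricted, by a composition
   with the identity. *)
pose B : set 'cV[R]_n.+1 := [set z | `|Q *m z| < d].
have oB : open B.
  have -> : B = (mulmx Q) @^-1` [set u | `|u - 0| < d].
    by apply/seteqP; split=> z; rewrite /B /= subr0.
  apply: open_comp; last exact: open_near.
  by move=> z _; exact: (smooth_map_continuous (smooth_map_mulmx Q)).
have Cid i : Cinf B (fun y : 'cV[R]_n.+1 => id y i 0) by exact: Cinf_coord.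
have idK z : B z -> B (id z) /\ id (id z) = z by [].
pose c2 := chart_compose c1 B id.
have hc2 : is_chart At c2 := is_chart_compose hAt hc1 oB oB Cid Cid idK idK.
(* The Jacobian is taken on the slice ln s = ln s0, i.e. at logarithmic coordinate 0; translation
   invariance identifies it with the Jacobian at every point of the fibre in the chart. *)
pose P x := jac Phi (Psi (vcons 0 (c x - x0))) *m Q.
have SP : smooth_mx Am V P.
  apply: (smooth_mx_mul hA oV); last exact: (smooth_mx_cst hA).
  move=> i j.
  have Sg : smooth_map (fun y : 'cV[R]_n => vcons 0 (y - x0)).
    move=> l; case: (unliftP ord0 l) => [l'|] ->.
      apply: (@Cinf_ext _ _ _ (fun y => y l' 0 + - x0 l' 0)) => //.
        by move=> y _; rewrite vconsS !mxE.
      by apply: Cinf_add => //; [exact: Cinf_coord|exact: Cinf_cst].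
    apply: (@Cinf_ext _ _ _ (fun=> 0)) => //; last exact: Cinf_cst.
    by move=> y _; rewrite vcons0.
  have CP : Cinf setT (fun y : 'cV[R]_n => partial j (fun z => Phi z i 0) (Psi (vcons 0 (y - x0)))).
    apply: (Cinf_comp (W := setT) (f := partial j (fun z => Phi z i 0))) => //.
      exact: (smooth_map_comp SPsi Sg).
    by apply: Cinf_partial.
  have := smooth_on_coord_fun hA hc (@cV_openT R n) CP; rewrite preimage_setT setIT.
  move=> /(smooth_on_sub (V := V) (fun x Vx => (VU x Vx).1)).
  by apply: (smooth_on_ext hA oV) => x _; rewrite [RHS]mxE.
have uP x : V x -> P x \in unitmx.
  by move=> _; rewrite unitmx_mul uQ andbT; exact: jac_unit SPhi SPsi PhiK PsiK _.
have main e : dom c2 e -> [/\ V (proj e), coord_frame At c2 e = frame_comp (lin_frame c t e) (P (proj e)) &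
    structure_of omega e (coord_frame At c2 e)].
  move=> de2; have [[de /= Oe] Be] := de2.
  set z := Q *m th (slit_dual_coord c t e).
  have zE : z = Psi (log_chart s0 x0 (slit_dual_coord c t e)) by rewrite /z /th mulKVmx.
  have Pz : Phi z = log_chart s0 x0 (slit_dual_coord c t e) by rewrite zE PsiK.
  have vz : vtail (Phi z) = c (proj e) - x0.
    by rewrite Pz /log_chart slit_coordE !vtail_cons.
  have [Vx gm] := H z e Be de vz.
  have PE : P (proj e) = jac Phi z *m Q.
    rewrite /P zE /log_chart slit_coordE vcons0 vtail_cons; congr (_ *m Q).
    set a := ln _; have -> : vcons a (c (proj e) - x0) = vcons 0 (c (proj e) - x0) + a *: e_ ord0.
      by rewrite -vcons_delta0 vcons_scale vcons_add add0r mulr1 scaler0 addr0.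
    by rewrite (equivariant_inverse PhiK PsiK equi) (jac_equivariant equi).
  have CE : coord_frame At c2 e = frame_comp (lin_frame c t e) (P (proj e)).
    apply/funext => w.
    rewrite (coord_frame_compose hAt hc1 oB oB Cid Cid idK idK w de2) jac_id mul1mx.
    have de1 : dom c1 e by [].
    rewrite (coord_frame_compose hAt hct oL openT Cth Sth' thK th'K w de1).
    rewrite /lin_frame !frame_comp_mul /frame_comp PE; congr (coord_frame _ _ _ (_ *m w)).
    have -> : th' = exp_chart s0 x0 \o (Phi \o mulmx Q) by [].
    rewrite (jac_comp openT I Sexp I (smooth_map_comp SPhi (smooth_map_mulmx Q))).
    rewrite (jac_comp openT I SPhi I (smooth_map_mulmx Q)) jac_mulmx jac_exp_chart.
    rewrite /= -/z Pz /log_chart slit_coordE !vcons0; congr (scmx _ _ *m _).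
    have s1 : 0 < sfun t e / s0.
      by move: Oe; rewrite /log_dom /preimage /= slit_coordE vcons0.
    by rewrite lnK // mulrCA mulfV // mulr1.
  split; [exact: Vx|exact: CE|rewrite CE; split; last by rewrite PE].
  exact: is_frame_comp (is_frame_lin_frame Ac Tt de) (uP _ Vx).
exists c2; split; last by move=> e /main[].
- split=> // e de2; have [Ve' _ _] := main e de2.
  (* The homogeneous frame lives on all of the saturated set over [V], although the chart domain is
     not saturated. *)
  exists setT, V, (fun e => frame_comp (lin_frame c t e) (P (proj e))), (fun=> 1%:M).
  split; [exact: openT|by []|exact: homogeneous_frame_lin|].
  by move=> e' _ de2'; have [] := main e' de2'.
- have E0 : log_chart s0 x0 (slit_dual_coord c t e0) = 0.
    rewrite /log_chart slit_coordE vcons0 vtail_cons -/s0 -/x0 subrr mulfV // ln1.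
    by apply/colP => i; case: (unliftP ord0 i) => [j|] ->; rewrite ?vconsS ?vcons0 !mxE.
  split; last first.
    rewrite /preimage /= /B /= /th mulKVmx // E0 -[X in Psi X]Phi0 PhiK normr0.
    by [].
  split=> //; rewrite /preimage /= /log_dom /= slit_coordE vcons0 mulfV //.
Qed.

End CocycleIntegrable.

(** * The correspondence and the integrability criteria *)

Theorem theorem6p1 (R : realType) (n : nat) (n_odd : odd n)
    (M : manifold R n) (L : line_bundle M) :
  let k := (n.+1)./2 in
  let G := Sp R k n.+1 in
  let Sp_structure_1 : set (slit_dual L -> set (preframe R n.+1 (slit_dual L))) :=
    homogeneous_G_structure G (trivial_degree G) in
  [/\ forall S, Sp_structure_1 S ->
        exists omega : DL_preform L,
          [/\ DL_form omega, DL_nondegenerate omega, corresponds S omega &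
              forall omega', DL_form omega' -> corresponds S omega' ->
                omega' = omega],
      forall omega : DL_preform L, DL_form omega -> DL_nondegenerate omega ->
        exists! S, Sp_structure_1 S /\ corresponds S omega &
      forall S (omega : DL_preform L), Sp_structure_1 S ->
        DL_form omega -> corresponds S omega ->
        (homogeneous_integrable S <-> G_integrable (slit_dual_atlas L) S) /\
        (G_integrable (slit_dual_atlas L) S <-> cocycle omega)].
Proof.
move=> k G Sp_structure_1; split.
- move=> S hS; exists (form_of S); split.
  + by apply: DL_form_of.
  + by apply: form_of_nondegenerate.
  + by apply: structure_value_corresponds => //; apply: form_of_value.
  + by move=> omega' form' cS'; apply: form_of_unique.
- move=> omega form nondeg; exists (structure_of omega); split.
    have hS := structure_of_homogeneous n_odd form nondeg.
    by split; [exact: hS|apply: structure_value_corresponds => //; exact: structure_of_value].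
  by move=> S [hS cS]; apply: structure_of_unique.
- move=> S omega hS form cS.
  have H1 : homogeneous_integrable S -> G_integrable (slit_dual_atlas L) S.
    by move=> H e; have [c [[hc _] ce Sc]] := H e; exists c.
  have H2 := integrable_cocycle n_odd hS form cS.
  have H3 : cocycle omega -> homogeneous_integrable S.
    (* Non-degeneracy is not among the hypotheses of this part; it follows because the form
       corresponding to [S] is unique and [form_of S] is non-degenerate. *)
    have nondeg : DL_nondegenerate omega.
      by rewrite (form_of_unique n_odd hS form cS); exact: form_of_nondegenerate.
    by rewrite -(structure_of_unique n_odd hS cS); apply: cocycle_homogeneous_integrable.
  by split; split=> //; auto.
Qed.
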